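(* Let $n\ge2$, $s\in(1/2,1)$, $\mu\in\mathcal M(\mathbb R^n)$, $g\in W^{s,2}_{\rm loc}(\mathbb R^n)\cap L^1_{2s}(\mathbb R^n)$, suppose that $\Phi$ satisfies the structure assumption for some $\Lambda\ge1$, and let $u$ be a SOLA of $\mathcal L u=\mu$ in $\Omega$, $u=g$ a.e. in $\mathbb R^n\setminus\Omega$, in a bounded domain $\Omega\subset\mathbb R^n$. Define $$\Sigma_u=\Big\{x\in\Omega:\ \liminf_{\rho\to0}E_{\rm loc}(\nabla u;B_\rho(x))>0\ \text{ or }\ \limsup_{\rho\to0}|(\nabla u)_{B_\rho(x)}|=\infty\Big\}.$$ Then the Hausdorff dimension of $\Sigma_u$ satisfies $\dim(\Sigma_u)\le n-2s+1$.
   Context: $\mathcal M(\mathbb R^n)$ is the class of signed Radon measures on $\mathbb R^n$ with finite total mass; $|\mu|$ is the variation of $\mu$. Structure assumption on $\Phi$: $\Phi:\mathbb R\to\mathbb R$ is odd and, for all $t,t'\in\mathbb R$, $|\Phi(t)-\Phi(t')|\le\Lambda|t-t'|$ and $(\Phi(t)-\Phi(t'))(t-t')\ge\Lambda^{-1}|t-t'|^2$. The operator is formally $\mathcal L u(x)=(1-s)\,\mathrm{P.V.}\int_{\mathbb R^n}\Phi\big(\frac{u(x)-u(y)}{|x-y|^s}\big)\frac{dy}{|x-y|^{n+s}}$. $L^1_{2s}(\mathbb R^n)=\{u\in L^1_{\rm loc}(\mathbb R^n):\int_{\mathbb R^n}|u(y)|(1+|y|)^{-n-2s}\,dy<\infty\}$.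 Weak formulation (W) of $\mathcal L u=\mu$ in $\Omega$: $$(1-s)\int_{\mathbb R^n}\int_{\mathbb R^n}\Phi\Big(\frac{u(x)-u(y)}{|x-y|^s}\Big)\frac{\psi(x)-\psi(y)}{|x-y|^s}\frac{dx\,dy}{|x-y|^n}=\int_\Omega\psi\,d\mu\quad\text{for all }\psi\in C_c^\infty(\Omega).$$ A weak solution is a $u\in W^{s,2}_{\rm loc}(\Omega)\cap L^1_{2s}(\mathbb R^n)$ satisfying (W). SOLA: a function $u$ is a SOLA of $\mathcal L u=\mu$ in $\Omega$, $u=g$ a.e. in $\mathbb R^n\setminus\Omega$, if (1) $u\in W^{h,q}(\Omega)$ for any $h\in(0,s)$ and $q\in[1,\frac n{n-s})$; (2) $u$ is a distributional solution of $\mathcal Lu=\mu$ in $\Omega$, i.e. (W) holds; (3) $u=g$ a.e. in $\mathbb R^n\setminus\Omega$; (4) there are sequences $\{u_j\}\subset W^{s,2}(\mathbb R^n)$, $\{\mu_j\}\subset C_0^\infty(\mathbb R^n)$, $\{g_j\}\subset C_0^\infty(\mathbb R^n)$ such that each $u_j$ is a weak solution of $\mathcal L u_j=\mu_j$ in $\Omega$ with $u_j=g_j$ a.e. in $\mathbb R^n\setminus\Omega$; (5) $u_j\to u$ a.e. in $\mathbb R^n$ and locally in $L^q(\mathbb R^n)$ (with $q$ in the range of (1)); (6) $\mu_j\to\mu$ weakly in the sense of measures in $\Omega$ and $\limsup_{j\to\infty}|\mu_j|(B)\le|\mu|(\overline B)$ for any ball $B$; (7) for any $z\in\mathbb R^n$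 and $r>0$, $g_j\to g$ in $W^{s,2}(B_r(z))$ and $\lim_{j\to\infty}\int_{\mathbb R^n\setminus B_r(z)}\frac{|g_j(y)-g(y)|}{|z-y|^{n+2s}}\,dy=0$. Under these hypotheses $u\in W^{1,1}_{\rm loc}(\Omega)$ (it is in fact in $W^{1+\sigma,1}_{\rm loc}(\Omega)$ for every $\sigma\in(0,2s-1)$), so $\nabla u$ and its averages make sense. $(G)_B$ is the average of $G$ over $B$ and $E_{\rm loc}(G;B)=\frac1{|B|}\int_B|G-(G)_B|\,dx$. *)

(* Defs.v *)
From HB Require Import structures.
From mathcomp Require Import all_boot all_order all_algebra.
From mathcomp Require Import all_classical all_reals all_analysis.

Set Implicit Arguments.
Unset Strict Implicit.
Unset Printing Implicit Defensive.
Import Order.TTheory GRing.Theory Num.Theory.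
Import numFieldNormedType.Exports.
Local Open Scope classical_set_scope.
Local Open Scope ring_scope.

Definition rV_display : measure_display.
Proof. exact: default_measure_display. Qed.

Section measurable_rV.
Variables (R : realType) (n : nat).

Let coor : 'I_n -> 'rV[R]_n -> R := fun i x => x ord0 i.

Let rV_set0 : g_sigma_preimage coor set0.
Proof. exact: sigma_algebra0. Qed.

Let rV_setC A : g_sigma_preimage coor A -> g_sigma_preimage coor (~` A).
Proof. exact: sigma_algebraC. Qed.

Let rV_bigcup (F : _^nat) : (forall i, g_sigma_preimage coor (F i)) ->
  g_sigma_preimage coor (\bigcup_i (F i)).
Proof. exact: sigma_algebra_bigcup. Qed.

(* The product sigma-algebra generated by the coordinates, which is the Borel
   sigma-algebra of R^n. *)
HB.instance Definition _ := @isMeasurable.Build rV_display 'rV[R]_n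
  (g_sigma_preimage coor) rV_set0 rV_setC rV_bigcup.

Lemma measurable_coor i : measurable_fun [set: 'rV[R]_n] (coor i).
Proof.
move=> _ Y mY; rewrite setTI; apply: sub_sigma_algebra => /=.
rewrite -bigcup_seq/=; exists i => /=; first by rewrite mem_index_enum.
by exists Y => //; rewrite setTI.
Qed.

Lemma measurable_rVP d (T : measurableType d) (f : T -> 'rV[R]_n) :
  (forall i, measurable_fun [set: T] (fun x => f x ord0 i)) ->
  measurable_fun [set: T] f.
Proof.
move=> mf.
suff : g_sigma_preimage (fun i => coor i \o f) `<=` measurable.
  rewrite g_sigma_preimage_comp => fS _ A mA.
  by apply: fS; exists A.
apply: smallest_sub; first exact: sigma_algebra_measurable.
move=> A; rewrite -bigcup_seq/= => -[i _] [B mB <-].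
exact: mf.
Qed.

End measurable_rV.

Section lebesgue_measure_rV.
Variable R : realType.
Local Open Scope ereal_scope.

Definition rV_cons n (p : measurableTypeR R * 'rV[R]_n) : 'rV[R]_n.+1 :=
  \row_i oapp (fun j => p.2 ord0 j) p.1 (unlift ord0 i).

Definition rV_uncons n (x : 'rV[R]_n.+1) : measurableTypeR R * 'rV[R]_n :=
  (x ord0 ord0, \row_j x ord0 (lift ord0 j)).

Lemma rV_consK n : cancel (@rV_cons n) (@rV_uncons n).
Proof.
move=> [a v]; rewrite /rV_uncons /rV_cons/= mxE unlift_none/=; congr pair.
by apply/rowP => j; rewrite !mxE liftK.
Qed.

Lemma measurable_rV_cons n : measurable_fun setT (@rV_cons n).
Proof.
apply: measurable_rVP => i.
under eq_fun do rewrite mxE.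
case: unliftP => [j _|_] /=; last exact: measurable_fst.
exact: (measurableT_comp (measurable_coor j) measurable_snd).
Qed.

Lemma measurable_rV_uncons n : measurable_fun setT (@rV_uncons n).
Proof.
apply/measurable_fun_pair; first exact: measurable_coor.
apply: measurable_rVP => j; under eq_fun do rewrite mxE.
exact: measurable_coor.
Qed.

Section step.
Variables (n : nat) (m : {sigma_finite_measure set 'rV[R]_n -> \bar R}).

Definition rV_step : set 'rV[R]_n.+1 -> \bar R :=
  pushforward (lebesgue_measure \x m) (@rV_cons n).

Let mpre A : measurable A -> measurable (@rV_cons n @^-1` A).
Proof. by move=> mA; rewrite -[X in measurable X]setTI; exact: measurable_rV_cons. Qed.

Let rV_step0 : rV_step set0 = 0.
Proof. by rewrite /rV_step /pushforward preimage_set0 measure0. Qed.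

Let rV_step_ge0 A : 0 <= rV_step A.
Proof. by rewrite /rV_step /pushforward. Qed.

Let rV_step_sigma_additive : semi_sigma_additive rV_step.
Proof.
move=> F mF tF mUF; rewrite /rV_step /pushforward preimage_bigcup.
apply: measure_semi_sigma_additive.
- by move=> k; exact: mpre.
- apply/trivIsetP => /= i j _ _ ij; rewrite -preimage_setI.
  by move/trivIsetP : tF => /(_ _ _ _ _ ij) ->//; rewrite preimage_set0.
- by rewrite -preimage_bigcup; exact: mpre.
Qed.

HB.instance Definition _ := isMeasure.Build _ _ _ rV_step
  rV_step0 rV_step_ge0 rV_step_sigma_additive.

Let rV_step_sigma_finite : sigma_finite setT rV_step.
Proof.
have /sigma_finiteP[F [TF ndF Foo]] := sigma_finiteT (@lebesgue_measure R).
have /sigma_finiteP[G [TG ndG Goo]] := sigma_finiteT m.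
exists (fun k => @rV_uncons n @^-1` (F k `*` G k)).
  apply/esym; rewrite -subTset => x _.
  have [k _ Fk] : (\bigcup_k F k) (rV_uncons x).1 by rewrite -TF.
  have [l _ Gl] : (\bigcup_k G k) (rV_uncons x).2 by rewrite -TG.
  exists (maxn k l) => //; split.
  - by move: Fk; exact/subsetPset/ndF/leq_maxl.
  - by move: Gl; exact/subsetPset/ndG/leq_maxr.
move=> k; have [mF Fk] := Foo k; have [mG Gk] := Goo k; split.
  rewrite -[X in measurable X]setTI; apply: measurable_rV_uncons => //.
  exact: measurableX.
rewrite /rV_step /pushforward (_ : _ @^-1` _ = F k `*` G k).
  by rewrite product_measure1E// lte_mul_pinfty// ge0_fin_numE.
by rewrite -comp_preimage (_ : _ \o _ = id)//; apply/funext; exact: rV_consK.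
Qed.

HB.instance Definition _ := Measure_isSigmaFinite.Build _ _ _ rV_step
  rV_step_sigma_finite.

End step.

Fixpoint lebesgue_rV n : {sigma_finite_measure set 'rV[R]_n -> \bar R} :=
  match n with
  | 0 => @dirac _ 'rV[R]_0 0%R R
  | n'.+1 => @rV_step n' (lebesgue_rV n')
  end.

End lebesgue_measure_rV.

Section signed_measures.
Context d (T : measurableType d) (R : realType).
Variable nu : {charge set T -> \bar R}.
Local Open Scope ereal_scope.

Let P := projT1 (cid (Hahn_decomposition nu)).
Let N := projT1 (cid (projT2 (cid (Hahn_decomposition nu)))).

(* The notions below do not depend on the chosen Hahn decomposition. *)
Definition hahn_chosen : hahn_decomposition nu P N :=
  projT2 (cid (projT2 (cid (Hahn_decomposition nu)))).

Definition abs_charge : set T -> \bar R := charge_variation hahn_chosen.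

Definition charge_integral (D : set T) (f : T -> R) : \bar R :=
  \int[jordan_pos hahn_chosen]_(x in D) (f x)%:E -
  \int[jordan_neg hahn_chosen]_(x in D) (f x)%:E.

End signed_measures.

Section euclidean.
Context {R : realType} {n : nat}.
Notation Rn := 'rV[R]_n.

(* The library norm on 'rV[R]_n is the sup norm; it induces the same open,
   compact and bounded sets. *)
Definition enorm (x : Rn) : R := Num.sqrt (\sum_i x ord0 i ^+ 2).

Definition eball (x : Rn) (r : R) : set Rn := [set y | enorm (y - x) < r].

Definition ei (i : 'I_n) : Rn := delta_mx ord0 i.

Definition iter_partial (l : seq 'I_n) (f : Rn -> R) : Rn -> R :=
  foldr (fun i (h : Rn -> R) x => 'D_(ei i) h x) f l.

Definition smooth (f : Rn -> R) : Prop :=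
  forall l : seq 'I_n, continuous (iter_partial l f) /\
    forall (i : 'I_n) (x : Rn), derivable (iter_partial l f) x (ei i).

Definition supp (f : Rn -> R) : set Rn := closure [set x | f x != 0].

Definition Cc (Omega : set Rn) (f : Rn -> R) : Prop :=
  [/\ continuous f, compact (supp f) & supp f `<=` Omega].

Definition Ccoo (Omega : set Rn) (f : Rn -> R) : Prop :=
  [/\ smooth f, compact (supp f) & supp f `<=` Omega].

Definition bounded_domain (Omega : set Rn) : Prop :=
  [/\ Omega !=set0, open Omega, connected Omega & bounded_set Omega].

End euclidean.

Section function_spaces.
Context {R : realType} {n : nat}.
Notation Rn := 'rV[R]_n.
Notation leb := (@lebesgue_rV R n).
Local Open Scope ereal_scope.

Definition L1loc (Omega : set Rn) (f : Rn -> R) : Prop :=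
  measurable_fun Omega f /\
  forall K, compact K -> K `<=` Omega -> \int[leb]_(x in K) `|f x|%:E < +oo.

Definition Lq_int (q : R) (D : set Rn) (f : Rn -> R) : \bar R :=
  \int[leb]_(x in D) (`|f x| `^ q)%:E.

(* At z.1 = z.2 the quotient is 0; the diagonal is a null set. *)
Definition gagliardo (h q : R) (D : set Rn) (f : Rn -> R) : \bar R :=
  \int[leb \x leb]_(z in D `*` D)
    (`|f z.1 - f z.2| `^ q / enorm (z.1 - z.2) `^ (n%:R + h * q))%:E.

Definition Whq (h q : R) (D : set Rn) (f : Rn -> R) : Prop :=
  [/\ measurable_fun D f, Lq_int q D f < +oo & gagliardo h q D f < +oo].

Definition Whq_loc (h q : R) (Omega : set Rn) (f : Rn -> R) : Prop :=
  forall D : set Rn, open D -> compact (closure D) -> closure D `<=` Omega ->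
    Whq h q D f.

Definition L1_2s (s : R) (f : Rn -> R) : Prop :=
  L1loc setT f /\
  \int[leb]_y (`|f y| / (1 + enorm y) `^ (n%:R + 2 * s))%:E < +oo.

End function_spaces.

Section SOLA.
Context {R : realType} {n : nat}.
Notation Rn := 'rV[R]_n.
Notation leb := (@lebesgue_rV R n).

Definition structure_assumption (Lambda : R) (Phi : R -> R) : Prop :=
  [/\ forall t, Phi (- t) = - Phi t,
      forall t t', `|Phi t - Phi t'| <= Lambda * `|t - t'| &
      forall t t',
        (Phi t - Phi t') * (t - t') >= Lambda^-1 * `|t - t'| ^+ 2].

Local Open Scope ereal_scope.

Definition energy_form (s : R) (Phi : R -> R) (u psi : Rn -> R) : \bar R :=
  (1 - s)%:E * \int[leb \x leb]_z
    (Phi ((u z.1 - u z.2) / enorm (z.1 - z.2) `^ s) *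
     ((psi z.1 - psi z.2) / enorm (z.1 - z.2) `^ s) /
     enorm (z.1 - z.2) ^+ n)%:E.

(* The right-hand side is passed as the functional psi |-> \int_Omega psi dmu.
   Its values on test functions are finite, so the equality in \bar R forces
   the double integral to be finite. *)
Definition weak_formulation (s : R) (Phi : R -> R) (Omega : set Rn)
    (u : Rn -> R) (rhs : (Rn -> R) -> \bar R) : Prop :=
  forall psi, Ccoo Omega psi -> energy_form s Phi u psi = rhs psi.

Definition density_integral (Omega : set Rn) (f psi : Rn -> R) : \bar R :=
  \int[leb]_(x in Omega) (psi x * f x)%:E.

Definition weak_solution (s : R) (Phi : R -> R) (Omega : set Rn)
    (f u : Rn -> R) : Prop :=
  [/\ Whq_loc s 2 Omega u, L1_2s s u &
      weak_formulation s Phi Omega u (density_integral Omega f)].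

Definition q_range (s q : R) : Prop := (1 <= q < n%:R / (n%:R - s))%R.

Definition ae_eq_outside (Omega : set Rn) (u g : Rn -> R) : Prop :=
  {ae leb, forall x, ~ Omega x -> u x = g x}.

Definition sola_approximation (s : R) (Phi : R -> R) (Omega : set Rn)
    (mu : {charge set Rn -> \bar R}) (g u : Rn -> R)
    (u_ mu_ g_ : nat -> Rn -> R) : Prop :=
  [/\ forall j, [/\ Whq s 2 setT (u_ j), Ccoo setT (mu_ j), Ccoo setT (g_ j),
        weak_solution s Phi Omega (mu_ j) (u_ j) &
        ae_eq_outside Omega (u_ j) (g_ j)],
      {ae leb, forall x, u_ j x @[j --> \oo] --> u x} /\
      forall q, q_range s q -> forall K : set Rn, compact K ->
        Lq_int q K (u_ j \- u)%R @[j --> \oo] --> 0,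
      (forall phi, Cc Omega phi ->
        density_integral Omega (mu_ j) phi @[j --> \oo] -->
          charge_integral mu Omega phi) /\
      forall (z : Rn) (r : R), (0 < r)%R ->
        limn_esup (fun j => \int[leb]_(x in eball z r) `|mu_ j x|%:E) <=
          abs_charge mu (closure (eball z r)) &
      forall (z : Rn) (r : R), (0 < r)%R ->
        [/\ Lq_int 2 (eball z r) (g_ j \- g)%R @[j --> \oo] --> 0,
            gagliardo s 2 (eball z r) (g_ j \- g)%R @[j --> \oo] --> 0 &
            \int[leb]_(y in ~` eball z r)
              (`|g_ j y - g y| / enorm (z - y) `^ (n%:R + 2 * s))%:E
              @[j --> \oo] --> 0]].

Definition SOLA (s : R) (Phi : R -> R) (Omega : set Rn)
    (mu : {charge set Rn -> \bar R}) (g u : Rn -> R) : Prop :=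
  [/\ forall h q, (0 < h < s)%R -> q_range s q -> Whq h q Omega u,
      weak_formulation s Phi Omega u (charge_integral mu Omega),
      ae_eq_outside Omega u g &
      exists u_ mu_ g_ : nat -> Rn -> R,
        sola_approximation s Phi Omega mu g u u_ mu_ g_].

End SOLA.

Section singular_set.
Context {R : realType} {n : nat}.
Notation Rn := 'rV[R]_n.
Notation leb := (@lebesgue_rV R n).
Local Open Scope ereal_scope.

(* u \in W^{1,1}_loc(Omega) with weak gradient Du *)
Definition weak_gradient (Omega : set Rn) (u : Rn -> R) (Du : Rn -> Rn)
    : Prop :=
  L1loc Omega u /\ forall i : 'I_n,
    L1loc Omega (fun x => Du x ord0 i) /\
    forall psi, Ccoo Omega psi ->
      \int[leb]_(x in Omega) (u x * 'D_(ei i) psi x)%:E =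
      - \int[leb]_(x in Omega) (Du x ord0 i * psi x)%:E.

Definition average (G : Rn -> Rn) (B : set Rn) : Rn :=
  \row_i ((fine (leb B))^-1 * \int[leb]_(x in B) G x ord0 i)%R.

Definition Eloc (G : Rn -> Rn) (B : set Rn) : \bar R :=
  (fine (leb B))^-1%:E * \int[leb]_(x in B) (enorm (G x - average G B))%:E.

Definition singular_point (Du : Rn -> Rn) (x : Rn) : Prop :=
  0 < limf_einf (fun rho : R => Eloc Du (eball x rho)) 0%R^'+ \/
  limf_esup (fun rho : R => (enorm (average Du (eball x rho)))%:E) 0%R^'+
    = +oo.

(* Being a singular point depends only on the a.e. class of Du, and weak
   gradients are a.e. unique, so for u \in W^{1,1}_loc(Omega) the quantifier
   merely names the gradient of u. A function without a weak gradient would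
   have Sigma_set Omega u = Omega. *)
Definition Sigma_set (Omega : set Rn) (u : Rn -> R) : set Rn :=
  [set x | Omega x /\
    forall Du, weak_gradient Omega u Du -> singular_point Du x].

End singular_set.

Section hausdorff_dimension.
Context {R : realType} {n : nat}.
Notation Rn := 'rV[R]_n.
Local Open Scope ereal_scope.

Definition diam (U : set Rn) : \bar R :=
  ereal_sup [set (enorm (x - y))%:E | x in U & y in U].

Definition diam_pow (d : R) (U : set Rn) : \bar R :=
  if U == set0 then 0 else diam U `^ d.

Definition hausdorff_premeasure (d delta : R) (A : set Rn) : \bar R :=
  ereal_inf [set \sum_(i <oo) diam_pow d (U i) | U in
    [set U : nat -> set Rn | A `<=` \bigcup_i U i /\
                             forall i, diam (U i) <= delta%:E]].

(* Without the usual normalizing constant, which does not affect the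
   dimension. *)
Definition hausdorff_measure (d : R) (A : set Rn) : \bar R :=
  ereal_sup [set hausdorff_premeasure d delta A | delta in
    [set delta : R | (0 < delta)%R]].

Definition hausdorff_dim (A : set Rn) : \bar R :=
  ereal_inf [set d%:E | d in
    [set d : R | (0 <= d)%R /\ hausdorff_measure d A = 0]].

End hausdorff_dimension.

(* Main.v *)
Require Import Defs.
From HB Require Import structures.
From mathcomp Require Import all_boot all_order all_algebra.
From mathcomp Require Import all_classical all_reals all_analysis.
From mathcomp Require Import measurable_realfun.
From mathcomp Require Import ring lra.
Set Implicit Arguments.
Unset Strict Implicit.
Unset Printing Implicit Defensive.
Import Order.TTheory GRing.Theory Num.Theory.
Import Num.Def numFieldNormedType.Exports.
Local Open Scope classical_set_scope.
Local Open Scope ring_scope.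

(* The singular set is controlled without any comparison estimate.  Subtract the
   equation of the smooth approximation [u_j] from its translate by [h], and test
   with a cut-off of a bounded, increasing function of the difference [tau_h u_j]:
   boundedness makes the datum enter only through its total mass, and the energy
   that is left controls the second differences [tau_k tau_h u_j] in [L^1].  The
   resulting inequality survives [j -> oo].  It can be iterated: if second
   differences of steps at most [rho] are [O(rho^(1+g))], then the choice
   [r = rho^(1/(2s-g))] of the cut-off radius improves the exponent [1+g] to almost
   [s + s/(2s-g)], which is larger as long as [g < 2s-1].  Hence
   [int |tau_e tau_h u| <= C |h| |e|^g] for all such [g] and [|h| <= |e|], so that
   the difference quotients converge to a gradient [G] with
   [int |tau_e G| <= C |e|^g].
   If the mean oscillation of [G] on the balls [B_rho(x)] were at most [rho^eps] for
   all small dyadic [rho], its averages would converge and [x] would be regular.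
   So at a singular point it exceeds [rho^eps] infinitely often; covering such
   points by a grid of mesh [rho] and adding up the oscillations over the cells
   bounds the [t]-dimensional premeasure by [C rho^(t-n-eps+g)], which is summable
   over dyadic [rho] when [t > n-2s+1]. *)

(** The datum is only a measure, so [u] need not have finite energy and its differences are
    integrable only to powers slightly above 1. The truncation has derivative [(kap + t)^(-1-del)]:
    it is bounded by [kap^(-del)/del], and removing the weight costs a moment of order [1 + del],
    interpolated between L^1 and an L^q with [q > 1]. For [kap = rho^4] the total loss is
    [rho^(-lam*del)], an arbitrarily small power. The truncation is centred at the value of
    [tau_h u] at the centre [x0] of the cut-off, and the inequality is integrated over [x0]. The
    moments on the right are then those of [tau_p tau_h u] with [|p| < 3r], so the quantity being
    estimated reappears there and can be improved; the first differences follow from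
    [2 tau_h = tau_(2h) - tau_h tau_h]. The bound [2s-1] is the fixed point of the improvement: for
    [g = 2s-1] the exponent [s + s/(2s-g)] equals [1+g]. It gives the dimension [n - (2s-1)]. The
    regularity of [u_j] is used only qualitatively, to make energies finite and the test function
    admissible; the constants see the mass of the datum and the exterior values. *)

Section integral_monotonicity.
Context d (T : measurableType d) (R : realType).
Variable mu : {measure set T -> \bar R}.
Local Open Scope ereal_scope.

(* [ge0_le_integral] without measurability: the integral of a nonnegative
   function is a supremum over simple functions below it. *)
Lemma le_integral_ge0 (A B : set T) (f g : T -> \bar R) :
  A `<=` B -> (forall x, A x -> 0 <= f x) -> (forall x, B x -> 0 <= g x) ->
  (forall x, A x -> f x <= g x) ->
  \int[mu]_(x in A) f x <= \int[mu]_(x in B) g x.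
Proof.
move=> AB f0 g0 fg; rewrite integral_mkcond [leRHS]integral_mkcond.
have f0' x : 0 <= (f \_ A) x by apply: erestrict_ge0.
have g0' x : 0 <= (g \_ B) x by apply: erestrict_ge0.
rewrite !ge0_integralTE//; apply: ge_ereal_sup => _ [h hf <-].
apply: ereal_sup_ubound; exists h => //= x; apply: le_trans (hf x) _.
rewrite !patchE; case: ifPn => [/set_mem Ax|_].
  by rewrite mem_set ?fg//; exact: AB.
by case: ifPn => // /set_mem; exact: g0.
Qed.

End integral_monotonicity.

(** * Coordinates, the two norms and the Borel sets of R^n *)

Section euclidean_space.
Context {R : realType}.
Implicit Types n : nat.

Lemma rV_norm_ltP n (x : 'rV[R]_n) r : 0 < r ->
  reflect (forall i, `|x ord0 i| < r) (`|x| < r).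
Proof.
move=> r0; rewrite {2}/normr/= mx_normrE; apply: (iffP (bigmax_ltP _ _ _ _)).
  by move=> [_ xr] i; exact: (xr (ord0, i)).
by move=> xr; split => // -[i j] _/=; rewrite ord1.
Qed.

Lemma rV_norm_coor n (x : 'rV[R]_n) i : `|x ord0 i| <= `|x|.
Proof.
rewrite [leRHS]/normr/= mx_normrE.
exact: (le_bigmax _ (fun ij : 'I_1 * 'I_n => `|x ij.1 ij.2|) (ord0, i)).
Qed.

Lemma measurable_rV_ball n (x : 'rV[R]_n) r : measurable (ball x r).
Proof.
have [r0|r0] := ltP 0 r; last first.
  rewrite (_ : ball x r = set0) //; apply/seteqP; split => // y.
  by rewrite -ball_normE /ball_/= => /(le_lt_trans (normr_ge0 _)); rewrite ltNge r0.
rewrite (_ : ball x r = \bigcap_(i in [set: 'I_n])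
    [set y : 'rV[R]_n | ball (x ord0 i) r (y ord0 i)]); last first.
  apply/seteqP; split => [y|y yx].
    by rewrite -ball_normE => /rV_norm_ltP-/(_ r0) yx i _; have := yx i; rewrite !mxE.
  by rewrite -ball_normE; apply/rV_norm_ltP => // i; have := yx i Logic.I; rewrite !mxE.
apply: fin_bigcap_measurable => // i _.
rewrite -[X in measurable X]setTI; apply: (measurable_coor i) => //.
exact: measurable_ball.
Qed.

(** An open set is the union of the sup-norm balls with rational centres and radii [1/(k+1)] that it
    contains. Such balls are finite intersections of coordinate preimages, hence belong to the
    sigma-algebra generated by the coordinates. *)
Lemma rV_open_measurable n (A : set 'rV[R]_n) : open A -> measurable A.
Proof.
move=> oA.
pose B (p : 'rV[rat]_n * nat) : set 'rV[R]_n :=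
  let b := ball (map_mx ratr p.1 : 'rV[R]_n) (p.2.+1%:R^-1) in
  if asbool (b `<=` A) then b else set0.
have -> : A = \bigcup_p B p.
  apply/seteqP; split => [x Ax|x [p _]]; last first.
    by rewrite /B; case: asboolP => // bA /bA.
  move: oA; rewrite openE => /(_ _ Ax) /nbhs_ballP[e /= e0 xeA].
  (* Half of [e]: a ball of radius [1/(k+1)] that contains [x] then stays within distance [e] of
     [x]. *)
  have [k ke] : exists k : nat, k.+1%:R^-1 < e / 2.
    have [k _ /(_ _ (leqnn _))] := near_infty_natSinv_lt (PosNum (divr_gt0 e0 (ltr0n R 2))).
    by exists k.
  have k0 : 0 < k.+1%:R^-1 :> R by rewrite invr_gt0.
  have cq i : exists q : rat, `|x ord0 i - ratr q| < k.+1%:R^-1.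
    have hlt : x ord0 i - k.+1%:R^-1 < x ord0 i + k.+1%:R^-1.
      by rewrite ltrD2l (lt_trans _ k0)// oppr_lt0.
    have [q] := rat_in_itvoo hlt.
    rewrite in_itv/= => /andP[q1 q2]; exists q; rewrite ltr_norml.
    by move: q1 q2; move: (_^-1) => ik q1 q2; apply/andP; split; lra.
  pose q : 'rV[rat]_n := \row_i projT1 (cid (cq i)).
  have qx : ball (map_mx ratr q : 'rV[R]_n) (k.+1%:R^-1) x.
    rewrite -ball_normE/=; apply/rV_norm_ltP => // i; rewrite !mxE distrC.
    by case: cid.
  exists (q, k) => //; rewrite /B/=; case: asboolP => // nqA; exfalso; apply: nqA.
  move=> y; rewrite -ball_normE/= => qy; apply: xeA; rewrite -ball_normE/=.
  move: qx; rewrite -ball_normE/= => qx.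
  rewrite distrC in qx.
  apply: le_lt_trans (ler_distD (map_mx ratr q) x y) _.
  by rewrite (splitr e) ltrD// (lt_trans _ ke).
apply: countable_bigcupT_measurable => // p; rewrite /B.
by case: asboolP => // _; exact: measurable_rV_ball.
Qed.

Lemma rV_closed_measurable n (A : set 'rV[R]_n) : closed A -> measurable A.
Proof. by move/closed_openC/rV_open_measurable/measurableC; rewrite setCK. Qed.

Lemma rV_continuous_measurable n (f : 'rV[R]_n -> R) :
  continuous f -> measurable_fun setT f.
Proof.
move=> /continuousP cf; apply: (measurability _ (RGenOpens.measurableE R)).
move=> _ [_ [a [b ->] <-]]; rewrite setTI; apply: rV_open_measurable.
exact/cf/interval_open.
Qed.

Lemma measurable_rV_norm n : measurable_fun setT (fun x : 'rV[R]_n => `|x|).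
Proof. by apply: rV_continuous_measurable => x; exact: norm_continuous. Qed.

Lemma measurable_enorm n : measurable_fun setT (@enorm R n).
Proof.
apply: (measurableT_comp (f := @Num.sqrt R)).
  by apply: continuous_measurable_fun; exact: sqrt_continuous.
apply: measurable_sum => i; apply: measurable_funX; exact: measurable_coor.
Qed.

Lemma measurable_rV_addr d (T : measurableType d) n (f g : T -> 'rV[R]_n) :
  measurable_fun setT f -> measurable_fun setT g ->
  measurable_fun setT (fun x => f x + g x).
Proof.
move=> mf mg; apply: measurable_rVP => i; under eq_fun do rewrite mxE.
apply: measurable_funD; exact: (measurableT_comp (measurable_coor i)).
Qed.

Lemma measurable_rV_opp d (T : measurableType d) n (f : T -> 'rV[R]_n) :
  measurable_fun setT f -> measurable_fun setT (fun x => - f x).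
Proof.
move=> mf; apply: measurable_rVP => i; under eq_fun do rewrite mxE.
by apply: measurableT_comp => //; exact: (measurableT_comp (measurable_coor i)).
Qed.

Lemma enorm_ge_norm n (x : 'rV[R]_n) : `|x| <= enorm x.
Proof.
have [->|x0] := eqVneq x 0; first by rewrite normr0 sqrtr_ge0.
have : mx_norm x != 0.
  by apply: contra_neq x0; exact: mx_norm_eq0.
move=> /mx_norm_neq0[[i j]]/= xE; rewrite (_ : `|x| = `|x i j|)// ord1.
rewrite -[leLHS]sqrtr_sqr ler_sqrt ?sqr_ge0//; last by apply: sumr_ge0 => k _; rewrite sqr_ge0.
by rewrite (bigD1 j)//= lerDl sumr_ge0// => k _; rewrite sqr_ge0.
Qed.

Lemma enorm_le_norm n (x : 'rV[R]_n) : enorm x <= n%:R * `|x|.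
Proof.
have -> : n%:R * `|x| = Num.sqrt ((n%:R * `|x|) ^+ 2).
  by rewrite sqrtr_sqr ger0_norm// mulr_ge0.
rewrite ler_sqrt ?sqr_ge0//.
apply: (@le_trans _ _ (\sum_(i < n) `|x| ^+ 2)).
  apply: ler_sum => i _; rewrite -(real_normK (num_real (x _ _))).
  by rewrite ler_sqr ?nnegrE//; exact: rV_norm_coor.
rewrite sumr_const card_ord -[leLHS]mulr_natl exprMn.
case: n x => [|n] x; first by rewrite mul0r expr0n mul0r.
apply: ler_wpM2r; first exact: sqr_ge0.
by rewrite -natrX ler_nat leq_pmulr.
Qed.

Lemma enorm_ge0 n (x : 'rV[R]_n) : 0 <= enorm x.
Proof. exact: sqrtr_ge0. Qed.

Lemma enormN n (x : 'rV[R]_n) : enorm (- x) = enorm x.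
Proof.
by rewrite /enorm; congr Num.sqrt; apply: eq_bigr => i _; rewrite mxE sqrrN.
Qed.

End euclidean_space.

(** * Translation invariance of Lebesgue measure; the volume of cubes *)

Section lebesgue_translation.
Context {R : realType}.
Local Open Scope ereal_scope.

Lemma lebesgue_measureD (c : R) (A : set R) : measurable A ->
  pushforward lebesgue_measure (fun x : measurableTypeR R => (x + c)%R : measurableTypeR R) A
  = lebesgue_measure A.
Proof.
move=> mA.
have mD : measurable_fun [set: measurableTypeR R] (fun x : measurableTypeR R => (x + c)%R : measurableTypeR R).
  exact: measurable_funD.
apply/esym/lebesgue_measure_unique => //= _ [[a b]] _ <-.
rewrite /pushforward.
rewrite (_ : _ @^-1` _ = `](a - c)%R, (b - c)%R]%classic).
  rewrite !lebesgue_measure_itv/= !lte_fin ltrD2r.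
  by case: ifP => // _; rewrite -!EFinD; congr (_%:E); ring.
by apply/seteqP; split => x /=; rewrite !in_itv/= => /andP[? ?]; apply/andP; split; lra.
Qed.

Lemma ge0_integral_shift1 (c : R) (f : R -> \bar R) :
  measurable_fun [set: R] f -> (forall x, 0 <= f x) ->
  \int[lebesgue_measure]_x f (x + c)%R = \int[lebesgue_measure]_x f x.
Proof.
move=> mf f0.
have mD : measurable_fun [set: measurableTypeR R] (fun x : measurableTypeR R => (x + c)%R : measurableTypeR R).
  exact: measurable_funD.
rewrite -[LHS](@ge0_integral_pushforward _ _ _ _ R _ mD lebesgue_measure setT f)//.
by apply: eq_measure_integral => //= A mA _; exact: lebesgue_measureD.
Qed.

(** The measure in dimension [n.+1] is the image of a product measure, so Tonelli splits off the
    first coordinate. This is the induction step for translation invariance. *)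
Lemma integral_lebesgue_rVS n (f : 'rV[R]_n.+1 -> \bar R) :
  measurable_fun setT f -> (forall x, 0 <= f x) ->
  \int[@lebesgue_rV R n.+1]_x f x =
  \int[lebesgue_measure]_a \int[@lebesgue_rV R n]_y f (rV_cons (a, y)).
Proof.
move=> mf f0.
rewrite (@ge0_integral_pushforward _ _ _ _ R _ (@measurable_rV_cons R n) _ setT f)//.
rewrite preimage_setT (fubini_tonelli1 (f \o (@rV_cons R n)))//.
  exact: (measurableT_comp mf (@measurable_rV_cons R n)).
by move=> x; exact: f0.
Qed.

Lemma ge0_integral_rV_shift n (v : 'rV[R]_n) (f : 'rV[R]_n -> \bar R) :
  measurable_fun setT f -> (forall x, 0 <= f x) ->
  \int[@lebesgue_rV R n]_x f (x + v)%R = \int[@lebesgue_rV R n]_x f x.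
Proof.
elim: n v f => [|n IH] v f mf f0.
  by apply: eq_integral => x _; congr f; apply/rowP; case.
have mfv : measurable_fun setT (fun x : 'rV[R]_n.+1 => f (x + v)%R).
  by apply: (measurableT_comp mf); apply: measurable_rV_addr.
rewrite (integral_lebesgue_rVS mfv (fun x => f0 _)) (integral_lebesgue_rVS mf f0).
have mc : measurable_fun setT (f \o (@rV_cons R n)).
  exact: (measurableT_comp mf (@measurable_rV_cons R n)).
pose v0 := v ord0 ord0; pose v' : 'rV[R]_n := \row_j v ord0 (lift ord0 j).
rewrite -[RHS](ge0_integral_shift1 v0).
- apply: eq_integral => a _; rewrite -[RHS](IH v').
  + apply: eq_integral => y _; congr f; apply/rowP => i.
    rewrite /rV_cons !mxE/=; case: unliftP => [j ->|->] /=; rewrite ?mxE//.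
  + exact: (measurableT_comp mc (pair1_measurable _)).
  + by move=> y; exact: f0.
- exact: (@measurable_fun_fubini_tonelli_F _ _ (measurableTypeR R) _ R _
    (f \o (@rV_cons R n)) mc (fun x => f0 _)).
- by move=> a; apply: integral_ge0 => y _; exact: f0.
Qed.

(** Balls of the library norm are cubes of side [2 * r], so the volume is exact. In dimension 0 the
    Dirac mass gives 1, the empty product. *)
Lemma lebesgue_rV_ball n (x : 'rV[R]_n) (r : R) : (0 < r)%R ->
  @lebesgue_rV R n (ball x r) = ((2 * r) ^+ n)%:E.
Proof.
elim: n x => [|n IH] x r0.
  rewrite /=/dirac/= indicE mem_set ?expr0//.
  by rewrite -ball_normE/=; apply/rV_norm_ltP => //; case.
rewrite /= /rV_step /pushforward.
rewrite (_ : _ @^-1` _ = ball (x ord0 ord0) r `*` ball (\row_j x ord0 (lift ord0 j)) r).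
  rewrite product_measure1E//; last exact: measurable_rV_ball.
    rewrite IH// [X in X * _](_ : _ = (r *+ 2)%:E); last first.
      by apply: lebesgue_measure_ball; exact: ltW.
    by rewrite -EFinM exprS mulr_natl.
  exact: measurable_ball.
apply/seteqP; split => -[a y].
  rewrite /= -ball_normE/= => /rV_norm_ltP-/(_ r0) h; split => /=.
    by rewrite -ball_normE/=; have := h ord0; rewrite !mxE unlift_none.
  rewrite -ball_normE/=; apply/rV_norm_ltP => // i.
  by have := h (lift ord0 i); rewrite !mxE liftK.
move=> [/=]; rewrite -!ball_normE/= => h0 /rV_norm_ltP-/(_ r0) h.
apply/rV_norm_ltP => // i; rewrite !mxE.
by case: unliftP => [j ->|->] //=; have := h j; rewrite !mxE.
Qed.

(** [f] is first set to zero outside [B]; the translate of the result dominates the left integrand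
    on [A], and its integral over the whole space is invariant. *)
Lemma le_integral_rV_shift n (v : 'rV[R]_n) (A B : set 'rV[R]_n)
    (f : 'rV[R]_n -> \bar R) :
  measurable B -> measurable_fun setT f -> (forall x, 0 <= f x) ->
  (forall x, A x -> B (x + v)%R) ->
  \int[@lebesgue_rV R n]_(x in A) f (x + v)%R <=
  \int[@lebesgue_rV R n]_(x in B) f x.
Proof.
move=> mB mf f0 AB; rewrite [leRHS]integral_mkcond.
rewrite -[leRHS](ge0_integral_rV_shift v); last 2 first.
- by apply/(measurable_restrictT _ _).1 => //; exact: measurable_funTS.
- by move=> x; apply: erestrict_ge0 => y _; exact: f0.
apply: le_integral_ge0 => // x Ax.
- by apply: erestrict_ge0 => y _; exact: f0.
- by rewrite patchE mem_set//; exact: AB.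
Qed.

End lebesgue_translation.

(** * Tonelli's theorem on rectangles *)

Section tonelli.
Context d1 d2 (T1 : measurableType d1) (T2 : measurableType d2) (R : realType).
Variables (m1 : {sigma_finite_measure set T1 -> \bar R})
          (m2 : {sigma_finite_measure set T2 -> \bar R}).
Variables (A : set T1) (B : set T2) (f : T1 -> T2 -> \bar R).
Hypotheses (mA : measurable A) (mB : measurable B).
Hypothesis mf : measurable_fun [set: T1 * T2] (fun z : T1 * T2 => f z.1 z.2).
Local Open Scope ereal_scope.
Hypothesis f0 : forall x y, 0 <= f x y.

(** Extension by zero reduces integrals over rectangles to integrals over the whole product. *)
Let g := (fun z : T1 * T2 => f z.1 z.2) \_ (A `*` B).

Let mg : measurable_fun setT g.
Proof.
by apply/(measurable_restrictT _ _).1; [exact: measurableX|exact: measurable_funTS].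
Qed.

Let g0 z : 0 <= g z.
Proof. by apply: erestrict_ge0. Qed.

Let gE1 x : \int[m2]_y g (x, y) = ((fun x => \int[m2]_(y in B) f x y) \_ A) x.
Proof.
rewrite patchE; case: ifPn => [/set_mem Ax|/negP xA].
  rewrite [RHS]integral_mkcond; apply: eq_integral => y _.
  rewrite /g !patchE; case: (pselect (B y)) => By.
    by rewrite !mem_set.
  by rewrite !memNset// => -[].
rewrite integral0_eq// => y _; rewrite /g patchE memNset// => -[/= Ax _].
by apply: xA; exact/mem_set.
Qed.

Let gE2 y : \int[m1]_x g (x, y) = ((fun y => \int[m1]_(x in A) f x y) \_ B) y.
Proof.
rewrite patchE; case: ifPn => [/set_mem By|/negP yB].
  rewrite [RHS]integral_mkcond; apply: eq_integral => x _.
  rewrite /g !patchE; case: (pselect (A x)) => Ax.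
    by rewrite !mem_set.
  by rewrite !memNset// => -[].
rewrite integral0_eq// => x _; rewrite /g patchE memNset// => -[/= _ By].
by apply: yB; exact/mem_set.
Qed.

Lemma tonelli_in : \int[m1]_(x in A) \int[m2]_(y in B) f x y =
  \int[m2]_(y in B) \int[m1]_(x in A) f x y.
Proof.
rewrite [LHS]integral_mkcond [RHS]integral_mkcond.
under eq_integral do rewrite -gE1.
under [RHS]eq_integral do rewrite -gE2.
exact: fubini_tonelli.
Qed.

Lemma product_tonelli_in : \int[m1 \x m2]_(z in A `*` B) f z.1 z.2 =
  \int[m1]_(x in A) \int[m2]_(y in B) f x y.
Proof.
rewrite [LHS]integral_mkcond [RHS]integral_mkcond.
under [RHS]eq_integral do rewrite -gE1.
exact: fubini_tonelli1.
Qed.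

End tonelli.

Section tonelli_measurable.
Context d1 d2 (T1 : measurableType d1) (T2 : measurableType d2) (R : realType).
Variable m2 : {sigma_finite_measure set T2 -> \bar R}.
Local Open Scope ereal_scope.

Lemma measurable_integral_in (B : set T2) (f : T1 -> T2 -> \bar R) :
  measurable B -> measurable_fun [set: T1 * T2] (fun z : T1 * T2 => f z.1 z.2) ->
  (forall x y, 0 <= f x y) ->
  measurable_fun setT (fun x => \int[m2]_(y in B) f x y).
Proof.
move=> mB mf f0.
pose g := (fun z : T1 * T2 => f z.1 z.2) \_ (setT `*` B).
have mg : measurable_fun setT g.
  by apply/(measurable_restrictT _ _).1; [exact: measurableX|exact: measurable_funTS].
have g0 z : 0 <= g z by apply: erestrict_ge0.
rewrite (_ : (fun x => _) = (fun x => \int[m2]_y g (x, y))).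
  exact: (measurable_fun_fubini_tonelli_F g).
apply/funext => x; rewrite integral_mkcond; apply: eq_integral => y _.
rewrite /g !patchE; case: (pselect (B y)) => By; first by rewrite !mem_set.
by rewrite !memNset// => -[].
Qed.

End tonelli_measurable.

(** * Integrals of powers of the norm by dyadic shells *)

Section dyadic_integrals.
Context {R : realType} {n : nat}.
Notation leb := (@lebesgue_rV R n).

Lemma nneseries_ge_term (a : nat -> \bar R) i : (forall k, (0 <= a k)%E) ->
  (a i <= \sum_(k <oo) a k)%E.
Proof.
move=> a0; apply: le_trans (nneseries_lim_ge (P := xpredT) i.+1 _) => //.
by rewrite big_nat_recr//= leeDr// sume_ge0.
Qed.

Lemma nneseries_geometric_le (A q : R) (a : nat -> R) : 0 <= A -> 0 < q < 1 ->
  (forall i, 0 <= a i <= A * q ^+ i) ->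
  (\sum_(i <oo) (a i)%:E <= (A / (1 - q))%:E)%E.
Proof.
move=> A0 /andP[q0 q1] aq; apply: lime_le.
  by apply: is_cvg_nneseries => i _ _; rewrite lee_fin; have /andP[] := aq i.
apply: nearW => N; rewrite sumEFin lee_fin.
apply: le_trans (geometric_le_lim N A0 q0 _); last by rewrite ger0_norm// ltW.
by rewrite /series/= ; apply: ler_sum => i _; have /andP[] := aq i.
Qed.

(** Only an upper bound is wanted, so each shell is enlarged to a full ball: [f] lies below the sum
    of the functions [a i] times the indicator of [ball 0 (rho i)], whose integrals are dominated by
    a geometric series. *)
Lemma integral_shells_le (D : set 'rV[R]_n) (f : 'rV[R]_n -> R)
    (a rho : nat -> R) (A q : R) :
  0 <= A -> 0 < q < 1 -> (forall i, 0 <= a i) -> (forall i, 0 < rho i) ->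
  (forall e, D e -> 0 <= f e) ->
  (forall e, D e -> exists i, `|e| < rho i /\ f e <= a i) ->
  (forall i, a i * (2 * rho i) ^+ n <= A * q ^+ i) ->
  (\int[leb]_(e in D) (f e)%:E <= (A / (1 - q))%:E)%E.
Proof.
move=> A0 q01 a0 r0 f0 fa aA.
pose F i (e : 'rV[R]_n) : \bar R := ((a i)%:E * (\1_(ball (0%R : 'rV[R]_n) (rho i)) e)%:E)%E.
have F0 i e : (0 <= F i e)%E by rewrite mule_ge0// lee_fin.
apply: (@le_trans _ _ (\int[leb]_e \sum_(i <oo) F i e)%E).
  apply: le_integral_ge0 => [//|e De|e _|e De].
  - by rewrite lee_fin f0.
  - exact: nneseries_ge0.
  - have [i [ei fi]] := fa _ De.
    apply: (@le_trans _ _ (F i e)); last exact: nneseries_ge_term.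
    rewrite /F indicE mem_set ?mule1 ?lee_fin//.
    by rewrite -ball_normE/= sub0r normrN.
rewrite integral_nneseries//; last first.
  move=> i; apply: measurable_funeM; apply/measurable_EFinP.
  by apply: measurable_indic; exact: measurable_rV_ball.
rewrite (eq_eseriesr (g := fun i => (a i * (2 * rho i) ^+ n)%:E)); last first.
  move=> i _; rewrite /F ge0_integralZl_EFin//; last first.
    by apply/measurable_EFinP; apply: measurable_indic; exact: measurable_rV_ball.
  rewrite integral_indic//; last exact: measurable_rV_ball.
  rewrite setIT [X in (_ * X)%E](_ : _ = ((2 * rho i) ^+ n)%:E) ?EFinM//.
  exact: lebesgue_rV_ball.
apply: nneseries_geometric_le => // i; rewrite aA andbT mulr_ge0// exprn_ge0//.
by rewrite mulr_ge0// ltW.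
Qed.

Lemma dyadic_above (r x : R) : 0 < r -> r <= x ->
  exists i, r * 2 ^+ i <= x < r * 2 ^+ i.+1.
Proof.
move=> r0 rx.
have ex : exists i, x < r * 2 ^+ i.+1.
  exists (Num.bound (x / r)); rewrite -ltr_pdivrMl// mulrC.
  by apply: upper_nthrootP; exact: leqnSn.
case: (ex_minnP ex) => i xi imin; exists i; rewrite xi andbT leNgt.
apply/negP; case: i xi imin => [|i] xi imin xr.
  by move: xr; rewrite expr0 mulr1 ltNge rx.
by have := imin _ xr; rewrite ltnn.
Qed.

Lemma dyadic_below (r x : R) : 0 < x -> x < r ->
  exists i, r / 2 ^+ i.+1 <= x < r / 2 ^+ i.
Proof.
move=> x0 xr.
have ex : exists i, r / 2 ^+ i.+1 <= x.
  exists (Num.bound (r / x)); rewrite ler_pdivrMr ?exprn_gt0// -ler_pdivrMl// mulrC ltW//.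
  by apply: upper_nthrootP; exact: leqnSn.
case: (ex_minnP ex) => i xi imin; exists i; rewrite xi/= ltNge.
apply/negP; case: i xi imin => [|i] xi imin rx.
  by move: rx; rewrite expr0 divr1 leNgt xr.
by have := imin _ rx; rewrite ltnn.
Qed.

Lemma powR_exprn (a p : R) i : 0 <= a -> (a ^+ i) `^ p = (a `^ p) ^+ i.
Proof.
move=> a0; elim: i => [|i IH]; first by rewrite !expr0 powR1.
by rewrite !exprS powRM ?exprn_ge0// IH.
Qed.

Lemma powR2_lt1 (t : R) : 0 < t -> 0 < (2 : R) `^ (- t) < 1.
Proof.
move=> t0; rewrite powR_gt0//= powRN invf_lt1 ?powR_gt0//.
rewrite /powR pnatr_eq0/= -[ltLHS]expR0 ltr_expR mulr_gt0// ln_gt0//.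
by rewrite (ltr_nat R 1 2).
Qed.

(** On the shell of index [i] the denominator is at least [(r * 2^i)^n], while the ball that
    contains the shell is a cube of side [4 * (r * 2^i)]: hence the factor [4^n]. The powers
    [(r * 2^i)^(-t)] form the geometric series. *)
Lemma integral_far_le (t r : R) : 0 < t -> 0 < r ->
  (\int[leb]_(e in [set e : 'rV[R]_n | (r <= `|e|)%R]) (`|e| `^ (- t) / `|e| ^+ n)%:E
   <= (4 ^+ n / (1 - 2 `^ (- t)) * r `^ (- t))%:E)%E.
Proof.
move=> t0 r0.
rewrite -mulrAC; apply: (@integral_shells_le _ _
  (fun i => (r * 2 ^+ i) `^ (- t) / (r * 2 ^+ i) ^+ n) (fun i => r * 2 ^+ i.+1)).
- by rewrite mulr_ge0// powR_ge0.
- exact: powR2_lt1.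
- by move=> i; rewrite divr_ge0 ?powR_ge0// exprn_ge0// mulr_ge0 ?ltW.
- by move=> i; rewrite mulr_gt0.
- by move=> e _; rewrite divr_ge0 ?powR_ge0// exprn_ge0.
- move=> e /= re; have [i /andP[ie ei]] := dyadic_above r0 re; exists i; split => //.
  have i0 : 0 < r * 2 ^+ i by rewrite mulr_gt0.
  have e0 : 0 < `|e| by exact: lt_le_trans re.
  rewrite ler_pM ?invr_ge0 ?powR_ge0 ?exprn_ge0//.
    rewrite !powRN lef_pV2 ?posrE ?powR_gt0//; apply: ge0_ler_powR => //; rewrite ?nnegrE ltW//.
  by rewrite lef_pV2 ?posrE ?exprn_gt0// lerXn2r// nnegrE ltW.
- move=> i; have i0 : 0 < r * 2 ^+ i by rewrite mulr_gt0.
  rewrite (_ : 2 * _ = 4 * (r * 2 ^+ i)); last by rewrite exprS; ring.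
  rewrite [(4 * _) ^+ n]exprMn powRM//; last exact: ltW.
  have -> : (2 ^+ i : R) `^ (- t) = (2 `^ (- t)) ^+ i.
    exact: powR_exprn.
  have : (r * 2 ^+ i) ^+ n != 0 by rewrite expf_neq0// gt_eqF.
  by move: ((r * _) ^+ n) (2 `^ _) (r `^ _) => z y x z0; rewrite le_eqVlt; apply/orP; left; apply/eqP; field.
Qed.

Lemma integral_near_le (t r : R) : 0 < t -> 0 < r ->
  (\int[leb]_(e in ball (0%R : 'rV[R]_n) r) (`|e| `^ t / `|e| ^+ n)%:E
   <= (4 ^+ n / (1 - 2 `^ (- t)) * r `^ t)%:E)%E.
Proof.
move=> t0 r0.
rewrite -mulrAC.
(* The shells miss the origin; there the integrand is 0 because a positive power of 0 is 0. *)
have -> : (\int[leb]_(e in ball (0%R : 'rV[R]_n) r) (`|e| `^ t / `|e| ^+ n)%:E =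
   \int[leb]_(e in [set e : 'rV[R]_n | (0 < `|e| < r)%R]) (`|e| `^ t / `|e| ^+ n)%:E)%E.
  rewrite [LHS]integral_mkcond [RHS]integral_mkcond; apply: eq_integral => e _.
  rewrite !patchE.
  have [->|e0] := eqVneq e 0.
    rewrite normr0 powR0 ?gt_eqF// mul0r; by do 2 case: ifP.
  have [re|re] := ltP `|e| r.
    by rewrite !mem_set//= ?normr_gt0 ?e0// -ball_normE/= sub0r normrN.
  rewrite !memNset//=; first by rewrite normr_gt0 e0/= ltNge re.
  by rewrite -ball_normE/= sub0r normrN ltNge re.
apply: (@integral_shells_le _ _
  (fun i => (r / 2 ^+ i) `^ t / (r / 2 ^+ i.+1) ^+ n) (fun i => r / 2 ^+ i)).
- by rewrite mulr_ge0// powR_ge0.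
- exact: powR2_lt1.
- by move=> i; rewrite divr_ge0 ?powR_ge0// exprn_ge0// divr_ge0 ?ltW.
- by move=> i; rewrite divr_gt0.
- by move=> e _; rewrite divr_ge0 ?powR_ge0// exprn_ge0.
- move=> e /= /andP[e0 re]; have [i /andP[ie ei]] := dyadic_below e0 re; exists i; split => //.
  have i0 k : 0 < r / 2 ^+ k by rewrite divr_gt0.
  rewrite ler_pM ?invr_ge0 ?powR_ge0 ?exprn_ge0//.
    by apply: ge0_ler_powR; rewrite ?nnegrE ltW.
  by rewrite lef_pV2 ?posrE ?exprn_gt0// lerXn2r// nnegrE ltW.
- move=> i; have i0 : 0 < r / 2 ^+ i by rewrite divr_gt0.
  rewrite (_ : 2 * _ = 4 * (r / 2 ^+ i.+1)); last first.
    by rewrite exprS; field; rewrite expf_neq0//.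
  rewrite [(4 * _) ^+ n]exprMn powRM ?invr_ge0//; last exact: ltW.
  have -> : ((2 ^+ i)^-1 : R) `^ t = (2 `^ (- t)) ^+ i.
    by rewrite -exprVn powR_exprn ?invr_ge0// -powR_inv1// -powRrM mulN1r.
  have : (r / 2 ^+ i.+1) ^+ n != 0 by rewrite expf_neq0// gt_eqF// divr_gt0.
  by move: ((r / _) ^+ n) (2 `^ _) (r `^ _) => z y x z0; rewrite le_eqVlt; apply/orP; left; apply/eqP; field.
Qed.

End dyadic_integrals.

(** * Functions that are flat at the origin *)

Section flat_functions.
Context {R : realType}.
Implicit Types (p : {poly R}) (t : R).

(** The function [p(1/t) exp(-1/t)] extended by 0. Taking all polynomials [p] gives a family closed
    under differentiation, with [flat_deriv] acting on [p], so that one differentiability statement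
    yields derivatives of every order. *)
Definition flat p t : R := if 0 < t then p.[t^-1] * expR (- t^-1) else 0.

Definition flat_deriv p : {poly R} := 'X^2 * (p - p^`()).

(** With [x = 1/t], the bound [exp x >= x^(i+1) / (i+1)!] gives [x^i exp(-x) <= (i+1)! * t] for each
    monomial. *)
Lemma flat_le p : exists C, forall t, `|flat p t| <= C * `|t|.
Proof.
exists (\sum_(i < size p) `|p`_i| * i.+1`!%:R) => t.
rewrite /flat; case: ifPn => t0; last first.
  by rewrite normr0 mulr_ge0// sumr_ge0// => i _; rewrite mulr_ge0.
rewrite horner_coef normrM (gtr0_norm (expR_gt0 _)) (gtr0_norm t0).
rewrite mulr_suml; apply: le_trans (ler_wpM2r (expR_ge0 _) (ler_norm_sum _ _ _)) _.
rewrite mulr_suml; apply: ler_sum => i _; rewrite normrM -!mulrA ler_wpM2l//.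
have x0 : 0 < t^-1 by rewrite invr_gt0.
rewrite (ger0_norm (exprn_ge0 _ (ltW x0))) expRN ler_pdivrMr ?expR_gt0//.
have := expR_ge1Dxn i (ltW x0).
rewrite -[X in X <= _]addrC => h.
have {}h : t^-1 ^+ i.+1 / (i.+1)`!%:R <= expR t^-1.
  by apply: le_trans h; rewrite lerDl.
move: h; rewrite ler_pdivrMr ?ltr0n ?fact_gt0// exprS => h.
rewrite -mulrA mulrCA -ler_pdivrMl//.
by rewrite [leLHS]mulrC [leRHS]mulrC [leLHS]mulrC.
Qed.

Lemma is_derive_flat p t : is_derive t 1 (flat p) (flat (flat_deriv p) t).
Proof.
have [t0|t0|t0] := ltgtP t 0.
- rewrite /(flat _ t) ltNge (ltW t0)/=.
  have H : \forall y \near t, (cst 0 : R -> R) y = flat p y.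
    near=> y; have y0 : y < 0 by near: y; exact: lt_nbhsl.
    by rewrite /flat ltNge (ltW y0).
  by apply: (near_eq_is_derive H); exact: is_derive_cst.
- have H : \forall y \near t, ((fun y => p.[y^-1] * expR (- y^-1)) : R -> R) y = flat p y.
    near=> y; have y0 : 0 < y by near: y; exact: lt_nbhsr.
    by rewrite /flat y0.
  apply: (near_eq_is_derive H).
  rewrite /flat t0 /flat_deriv.
  have dV : is_derive t 1 (fun y : R => y^-1) (- t ^- 2).
    have t0' : t != 0 by rewrite gt_eqF.
    have := @is_deriveV R id t 1 1 t0' (is_derive_id _ _).
    by rewrite /GRing.scale/= mulr1.
  have d1 : is_derive t 1 (fun y => p.[y^-1]) (p^`().[t^-1] * - t ^- 2).
    exact: (is_derive1_comp (is_derive_poly p t^-1) dV).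
  have d2 : is_derive t 1 (fun y => expR (- y^-1)) (expR (- t^-1) * t ^- 2).
    apply: (@is_derive1_comp R expR (fun y => - y^-1)).
    by rewrite -[t ^- 2]opprK; exact: is_deriveN.
  apply: (@is_derive_eq _ _ _ _ _ _ _ _ (is_deriveM d1 d2)).
  rewrite !hornerE /= /GRing.scale/=; field; by rewrite gt_eqF.
- subst t; rewrite {2}/flat ltxx.
  (* At the origin the difference quotient of [flat p] is [flat ('X * p)], which the linear bound
     sends to 0. *)
  have [C HC] := flat_le ('X * p).
  have cv : h^-1 *: ((flat p \o shift 0) (h *: 1) - flat p 0) @[h --> 0^'] --> (0 : R).
    apply/cvgrPdist_le => e e0.
    near=> h.
    have h0 : h != 0 by near: h; exact: nbhs_dnbhs_neq.
    rewrite sub0r normrN /= /shift/= addr0 /GRing.scale/= mulr1.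
    rewrite {2}/flat ltxx subr0.
    have -> : h^-1 * flat p h = flat ('X * p) h.
      rewrite /flat; case: ifP; rewrite ?mulr0// => _.
      by rewrite hornerM hornerX mulrA.
    apply: le_trans (HC h) _.
    have C0 : 0 < `|C| + 1 by rewrite ltr_wpDl.
    apply: (@le_trans _ _ ((`|C| + 1) * `|h|)).
      by rewrite ler_wpM2r// (le_trans (ler_norm _))// lerDl.
    rewrite -ler_pdivlMl//.
    near: h; apply: dnbhs0_le; rewrite mulr_gt0// invr_gt0//.
  apply: DeriveDef; first by apply/cvg_ex; exists 0.
  by apply: (cvg_lim _ cv).
Unshelve. all: by end_near. Qed.

End flat_functions.

(** * Iterated partial derivatives and a smooth bump *)

Section directional.
Context {R : realType} {n : nat}.
Notation Rn := 'rV[R]_n.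

Lemma is_derive_line (f : Rn -> R) (x v : Rn) (df : R) :
  is_derive (0 : R) 1 (fun t : R => f (t *: v + x)) df <-> is_derive x v f df.
Proof.
have E : (fun h : R => h^-1 *: (((fun t : R => f (t *: v + x)) \o shift 0) (h *: 1)
    - f (0 *: v + x))) = (fun h : R => h^-1 *: ((f \o shift x) (h *: v) - f x)).
  by apply/funext => h /=; rewrite /shift/= addr0 scale0r add0r [h *: 1]mulr1.
by split => -[d1 d2]; apply: DeriveDef; move: d1 d2; rewrite /derivable /derive E.
Qed.

(** A form of [smooth] by recursion on the order, which lets sums, products and convolutions be
    treated by induction with the function generalised. *)
Fixpoint Ck k (f : Rn -> R) : Prop := continuous f /\
  if k is k'.+1 then forall i : 'I_n, (forall x, derivable f x (ei i)) /\
    Ck k' (fun x => 'D_(ei i) f x) else True.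

Lemma Ck_continuous k f : Ck k f -> continuous f.
Proof. by case: k => [|k] []. Qed.

Lemma CkS k f : Ck k.+1 f -> Ck k f.
Proof.
elim: k f => [|k IH] f [cf df]; first by split.
by split => // i; have [d1 d2] := df i; split => //; exact: IH.
Qed.

Lemma Ck_is_derive k f (g : 'I_n -> Rn -> R) : continuous f ->
  (forall i x, is_derive x (ei i) f (g i x)) -> (forall i, Ck k (g i)) ->
  Ck k.+1 f.
Proof.
move=> cf dg cg; split=> // i; split.
  by move=> x; case: (dg i x).
rewrite (_ : (fun x => _) = g i)//; apply/funext => x.
by case: (dg i x).
Qed.

Lemma Ck_cst k (c : R) : Ck k (cst c).
Proof.
elim: k c => [|k IH] c; first by split=> //; exact: cst_continuous.
by apply: (@Ck_is_derive _ _ (fun _ => cst 0)) => // x; exact: cst_continuous.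
Qed.

Lemma Ck_add k (f g : Rn -> R) : Ck k f -> Ck k g -> Ck k (f + g).
Proof.
elim: k f g => [|k IH] f g [cf df] [cg dg].
  by split => // x; apply: continuousD; [exact: cf|exact: cg].
apply: (@Ck_is_derive _ _ (fun i => (fun x => 'D_(ei i) f x) + (fun x => 'D_(ei i) g x))).
- by move=> x; apply: continuousD; [exact: cf|exact: cg].
- by move=> i x; apply: is_deriveD; apply/derivableP; [exact: (df i).1|exact: (dg i).1].
- by move=> i; apply: IH; [exact: (df i).2|exact: (dg i).2].
Qed.

Lemma Ck_mul k (f g : Rn -> R) : Ck k f -> Ck k g -> Ck k (f * g).
Proof.
elim: k f g => [|k IH] f g.
  by move=> [cf _] [cg _]; split => // x; apply: continuousM; [exact: cf|exact: cg].
move=> Cf Cg; have [cf df] := Cf; have [cg dg] := Cg.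
apply: (@Ck_is_derive _ _ (fun i => f * (fun x => 'D_(ei i) g x) + g * (fun x => 'D_(ei i) f x))).
- by move=> x; apply: continuousM; [exact: cf|exact: cg].
- by move=> i x; apply: is_deriveM; apply/derivableP; [exact: (df i).1|exact: (dg i).1].
- by move=> i; apply: Ck_add; apply: IH => //; try exact: CkS; [exact: (dg i).2|exact: (df i).2].
Qed.

Lemma Ck_prod k (I : Type) (l : seq I) (f : I -> Rn -> R) :
  (forall i, Ck k (f i)) -> Ck k (fun x => \prod_(i <- l) f i x).
Proof.
move=> Cf; elim: l => [|i l IH].
  by rewrite (_ : (fun x => _) = cst 1); [exact: Ck_cst|apply/funext => x; rewrite big_nil].
rewrite (_ : (fun x => _) = f i * (fun x => \prod_(i <- l) f i x)); first exact: Ck_mul.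
by apply/funext => x; rewrite big_cons.
Qed.

Lemma Ck_flat k (p : {poly R}) (a c : R) (i : 'I_n) :
  Ck k (fun x => flat p (c + a * x ord0 i)).
Proof.
have cont q : continuous (fun x : Rn => flat q (c + a * x ord0 i)).
  move=> x; apply: (@continuous_comp _ _ _ (fun x : Rn => c + a * x ord0 i) (flat q)).
    apply: continuousD; first exact: cst_continuous.
    by apply: continuousM; [exact: cst_continuous|exact: coord_continuous].
  apply: differentiable_continuous; apply/derivable1_diffP.
  by case: (is_derive_flat q (c + a * x ord0 i)).
elim: k p => [|k IH] p; first by split.
apply: (@Ck_is_derive _ _ (fun j => cst (a *+ (i == j)) * (fun x => flat (flat_deriv p) (c + a * x ord0 i)))).
- exact: cont.
- move=> j x; apply/is_derive_line.
  have -> : (fun t : R => flat p (c + a * (t *: ei j + x) ord0 i)) =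
      flat p \o (fun t : R => (a *+ (i == j)) * t + (c + a * x ord0 i)).
    apply/funext => t /=; congr flat; rewrite !mxE eqxx/=.
    by case: eqP => _; rewrite ?mulr1n ?mulr0n; ring.
  have d1 : is_derive (0 : R) 1 (fun t : R => (a *+ (i == j)) * t + (c + a * x ord0 i)) (a *+ (i == j)).
    apply: is_derive_eq.
    by rewrite addr0 /GRing.scale/= mulr1.
  apply: is_derive_eq.
    apply: is_derive1_comp d1; rewrite mulr0 add0r.
    exact: is_derive_flat.
  by rewrite /= mulrC.
- by move=> j; apply: Ck_mul; [exact: Ck_cst|exact: IH].
Qed.

(** [iter_partial] applies the last element of the list first, and [Ck] peels off the innermost
    derivative: hence the induction from the end of the list. *)
Lemma iter_partial_Ck l k (f : Rn -> R) : Ck (size l + k) f -> Ck k (iter_partial l f).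
Proof.
elim/last_ind: l f => [//|l i IH] f.
rewrite size_rcons addSn => -[_ /(_ i)[_ Cf]].
by rewrite /iter_partial foldr_rcons; exact: IH.
Qed.

Lemma Ck_smooth (f : Rn -> R) : (forall k, Ck k f) -> smooth f.
Proof.
move=> Cf l; have [c d] : Ck 1 (iter_partial l f) by apply: iter_partial_Ck.
by split => // i x; have [] := d i.
Qed.

(* [a] is the inverse of the radius of the support. *)
Definition mbump (a : R) (x : Rn) : R :=
  \prod_(i <- enum 'I_n) (flat 1 (1 + a * x ord0 i) * flat 1 (1 + (- a) * x ord0 i)).

Lemma Ck_bump k a : Ck k (mbump a).
Proof.
apply: (@Ck_prod _ _ _ (fun i => (fun x => flat 1 (1 + a * x ord0 i)) * (fun x => flat 1 (1 + (- a) * x ord0 i)))).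
by move=> i; apply: Ck_mul; exact: Ck_flat.
Qed.

Lemma flat1_ge0 (t : R) : 0 <= flat 1 t.
Proof. by rewrite /flat; case: ifP => // _; rewrite hornerE mul1r expR_ge0. Qed.

Lemma bump_ge0 a x : 0 <= mbump a x.
Proof. by apply: prodr_ge0 => i _; rewrite mulr_ge0// flat1_ge0. Qed.

Lemma bump_supp a x : 0 < a -> a^-1 <= `|x| -> mbump a x = 0.
Proof.
move=> a0 ax; have [i hi] : exists i, a^-1 <= `|x ord0 i|.
  apply: contrapT => /forallNP h; move: ax; rewrite leNgt => /negP; apply.
  apply/rV_norm_ltP; first by rewrite invr_gt0.
  by move=> i; rewrite ltNge; apply/negP.
rewrite /mbump (big_rem i) ?mem_enum//= [X in X * _](_ : _ = 0) ?mul0r//.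
have h1 : 1 <= a * `|x ord0 i| by rewrite -ler_pdivrMl// mulr1.
have [xi|xi] := leP 0 (x ord0 i).
  rewrite ger0_norm// in h1.
  by rewrite [X in _ * X]/flat ifF ?mulr0//; apply/negbTE; rewrite -leNgt; lra.
rewrite ltr0_norm// in h1.
by rewrite /flat ifF ?mul0r//; apply/negbTE; rewrite -leNgt; lra.
Qed.

Lemma bump_gt0 a x : 0 < a -> `|x| < a^-1 -> 0 < mbump a x.
Proof.
move=> a0 /rV_norm_ltP; rewrite invr_gt0 => /(_ a0) h.
apply: prodr_gt0 => i _; have hi := h i.
have {hi} : a * `|x ord0 i| < 1 by rewrite -ltr_pdivlMl// mulr1.
rewrite -{1}(gtr0_norm a0) -normrM ltr_norml => /andP[h1 h2].
by rewrite mulr_gt0// /flat ifT ?hornerE ?mul1r ?expR_gt0//; lra.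
Qed.

End directional.

(** * Differentiation of convolutions *)

Section convolution.
Context {R : realType} {n : nat}.
Notation Rn := 'rV[R]_n.
Notation leb := (@lebesgue_rV R n).

Lemma rV_shift_measurable (f : Rn -> R) (v : Rn) : measurable_fun setT f ->
  measurable_fun setT (fun x : Rn => f (x + v)).
Proof. by move=> mf; apply: (measurableT_comp mf); exact: measurable_rV_addr. Qed.

Lemma bounded_integrable (D : set Rn) (f : Rn -> R) (M : R) : measurable D ->
  (leb D < +oo)%E -> measurable_fun D f -> (forall x, D x -> `|f x| <= M) ->
  leb.-integrable D (EFin \o f).
Proof.
move=> mD D0 mf fM; apply: measurable_bounded_integrable => //.
exists M; split; first exact: num_real.
by move=> y My x Dx; apply: le_trans (fM x Dx) _; exact: ltW.
Qed.

Variables (psi : Rn -> R) (S M : R).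
Hypothesis mpsi : measurable_fun setT psi.
Hypothesis psiM : forall x, `|psi x| <= M.
Hypothesis S0 : 0 < S.
Let B : set Rn := ball 0 S.

Let mB : measurable B. Proof. exact: measurable_rV_ball. Qed.
Let Bfin : (leb B < +oo)%E. Proof. by rewrite lebesgue_rV_ball// ltry. Qed.
Let M0 : 0 <= M. Proof. exact: le_trans (normr_ge0 _) (psiM 0). Qed.

(** The integral runs over a fixed ball, where constants are integrable majorants; it is the full
    convolution as soon as [psi] vanishes outside that ball. *)
Definition conv (rho : Rn -> R) (x : Rn) : R := \int[leb]_(y in B) (rho (x - y) * psi y).

Implicit Types (rho : Rn -> R) (x : Rn).

Lemma conv_integrable rho (K : R) x : continuous rho -> (forall z, `|rho z| <= K) ->
  leb.-integrable B (EFin \o (fun y => rho (x - y) * psi y)).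
Proof.
move=> crho rhoK; apply: (@bounded_integrable _ _ (K * M)) => //.
  apply: measurable_funTS; apply: measurable_funM => //.
  apply: (measurableT_comp (rV_continuous_measurable crho)).
  by apply: measurable_rV_addr => //; exact: measurable_rV_opp.
by move=> y _; rewrite normrM ler_pM.
Qed.

Lemma supp_bounded (rho : Rn -> R) (S' : R) : continuous rho ->
  (forall x, S' < `|x| -> rho x = 0) -> exists K : R, forall z : Rn, `|rho z| <= K.
Proof.
move=> crho rho0.
pose A : set Rn := [set x | `|x| <= `|S'|].
have cA : compact A.
  apply: bounded_closed_compact.
    exists `|S'|; split; first exact: num_real.
    by move=> y Sy x /= /le_trans; apply; exact: ltW.
  rewrite (_ : A = (fun x : Rn => `|x|) @^-1` [set t | t <= `|S'|]).
    apply: closed_comp; last exact: closed_le.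
    by move=> x _; exact: norm_continuous.
  by [].
have A0 : A !=set0 by exists 0; rewrite /A/= normr0.
have cn : {within A, continuous (fun x => `|rho x|)}.
  apply: continuous_subspaceT => x; apply: (@continuous_comp _ _ _ rho normr).
    exact: crho.
  exact: norm_continuous.
have [c _ hc] := compact_EVT_max A0 cA cn.
exists `|rho c| => z; have [zS|zS] := leP `|z| `|S'|.
  by apply: hc; apply/mem_set.
by rewrite rho0 ?normr0// (le_lt_trans (ler_norm S')).
Qed.

(** The strict inequality [S' < |x|] defines an open set, so [rho] vanishes near each of its points
    and the condition is inherited by derivatives. *)
Lemma deriv_supp (rho : Rn -> R) (S' : R) i : (forall x, S' < `|x| -> rho x = 0) ->
  forall x, S' < `|x| -> 'D_(ei i) rho x = 0.
Proof.
move=> rho0 x xS.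
have H : \forall y \near x, (cst 0 : Rn -> R) y = rho y.
  have : \forall y \near x, S' < `|y|.
    have := @norm_continuous _ _ x; move/(_ [set t | S' < t]); apply.
    exact: lt_nbhsr.
  by apply: filterS => y yS; rewrite rho0.
by have [_ ->] := near_eq_is_derive H (is_derive_cst 0 x (ei i)).
Qed.

(* Only continuity along sequences is available through dominated convergence. *)
Lemma continuous_seq (f : Rn -> R) (x : Rn) :
  (forall a : nat -> Rn, a k @[k --> \oo] --> x -> f (a k) @[k --> \oo] --> f x) ->
  {for x, continuous f}.
Proof.
move=> H; suff : f y @[y --> x] --> f x by [].
apply/(@cvgrPdist_lt R R^o Rn (nbhs x) (nbhs_filter x) f (f x)) => e e0.
apply: contrapT => nH.
have ex (k : nat) : exists y : Rn, `|x - y| < k.+1%:R^-1 /\ e <= `|f x - f y|.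
  apply: contrapT => /forallNP Hk; apply: nH.
  apply/nbhs_ballP; exists k.+1%:R^-1; first by rewrite /= invr_gt0.
  move=> y; rewrite -ball_normE/= => xy.
  by rewrite ltNge; apply/negP => he; apply: (Hk y).
pose a k := projT1 (cid (ex k)).
have aP k : `|x - a k| < k.+1%:R^-1 /\ e <= `|f x - f (a k)| := projT2 (cid (ex k)).
have ax : a k @[k --> \oo] --> x.
  apply/cvgrPdist_lt => d d0; near=> k.
  apply: lt_trans (aP k).1 _; near: k.
  exact: (near_infty_natSinv_lt (PosNum d0)).
have /cvgrPdist_lt/(_ _ e0)[N _ /(_ N (leqnn _))] := H _ ax.
by rewrite ltNge (aP N).2.
Unshelve. all: by end_near. Qed.

Lemma conv_continuous rho S' : continuous rho -> (forall x, S' < `|x| -> rho x = 0) ->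
  continuous (conv rho).
Proof.
move=> crho rho0; have [K rhoK] := supp_bounded crho rho0.
move=> x; apply: continuous_seq => a ax.
have mint y := conv_integrable y crho rhoK.
have fE y : (\int[leb]_(z in B) (rho (y - z) * psi z)%:E)%E = (conv rho y)%:E.
  by rewrite /conv /Rintegral fineK//; apply: integrable_fin_num => //; exact: mint.
have H1 k : measurable_fun B (fun y => (rho (a k - y) * psi y)%:E).
  exact: measurable_int (mint (a k)).
have H2 y : B y -> (rho (a k - y) * psi y)%:E @[k --> \oo] --> (rho (x - y) * psi y)%:E.
  move=> By; apply: cvg_EFin; first exact: nearW.
  apply: cvgM; last exact: cvg_cst.
  apply: (cvg_comp (fun k => a k - y) rho); last exact: crho.
  by apply: cvgB => //; exact: cvg_cst.
have H3 : leb.-integrable B (cst (K * M)%:E).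
  apply: (@bounded_integrable _ _ (K * M)) => // y _.
  by rewrite ger0_norm// mulr_ge0// (le_trans (normr_ge0 (rho 0))).
have H4 k y : B y -> (`|(rho (a k - y) * psi y)%:E| <= (K * M)%:E)%E.
  by move=> _; rewrite lee_fin normrM ler_pM.
have H0 y : B y -> (cst (K * M)%:E : Rn -> \bar R) y \is a fin_num by [].
have := dominated_cvg mB H1 H2 H0 H3 H4.
by rewrite fE => /fine_cvg.
Qed.

(** Differentiation under the integral along the line [t *: ei i + x], with the constant majorant
    [K' * M] obtained from the bound on the derivative of [rho]. *)
Lemma conv_is_derive rho S' i : Ck 1 rho -> (forall x, S' < `|x| -> rho x = 0) ->
  forall x, is_derive x (ei i) (conv rho) (conv (fun z => 'D_(ei i) rho z) x).
Proof.
move=> [crho /(_ i)[drho [cdrho _]]] rho0 x.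
have [K rhoK] := supp_bounded crho rho0.
have [K' drhoK] := supp_bounded cdrho (deriv_supp i rho0).
have K'0 : 0 <= K' by exact: le_trans (normr_ge0 _) (drhoK 0).
pose F (t : R) (y : Rn) := rho (t *: ei i + x - y) * psi y.
have dF (t : R) (y : Rn) : is_derive t 1 (F^~ y) ('D_(ei i) rho (t *: ei i + x - y) * psi y).
  have := (derivableP (drho (t *: ei i + x - y))) => /is_derive_line dr.
  have dr' : is_derive t 1 (fun t' : R => rho (t' *: ei i + x - y)) ('D_(ei i) rho (t *: ei i + x - y)).
    have -> : (fun t' : R => rho (t' *: ei i + x - y)) =
       (fun h : R => rho (h *: ei i + (t *: ei i + x - y))) \o (fun t' => t' - t).
      apply/funext => t' /=; congr rho; rewrite scalerBl !addrA; congr (_ - y).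
      by rewrite [_ - _ + _]subrK.
    have d1 : is_derive t 1 (fun t' : R => t' - t) (1 : R).
      by apply: is_derive_eq; rewrite subr0.
    have := @is_derive1_comp R _ _ t _ _ _ d1; rewrite subrr => /(_ _ _ dr).
    by rewrite mulr1.
  apply: (@is_derive_eq _ _ _ _ _ _ _ _ (is_deriveM dr' (is_derive_cst (psi y) t 1))).
  by rewrite /GRing.scale/=; ring.
apply/is_derive_line.
have H : derivable (fun t : R => \int[leb]_(y in B) F t y) 0 1 /\
   (fun t : R => \int[leb]_(y in B) F t y)^`()%classic 0 = \int[leb]_(y in B) partial1of2 F 0 y.
  have a01 : `]-1, 1[%classic (0 : R) by rewrite /= in_itv/=; apply/andP; split; lra.
  have i1 (t : R) : `]-1, 1[%classic t -> leb.-integrable B (EFin \o F t).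
    by move=> _; exact: conv_integrable (t *: ei i + x) crho rhoK.
  have i2 (t : R) (y : Rn) : `]-1, 1[%classic t -> B y -> derivable (F^~ y) t 1.
    by move=> _ _; case: (dF t y).
  have i3 : leb.-integrable B (EFin \o cst (K' * M)).
    apply: (@bounded_integrable _ _ (K' * M)) => // y _.
    by rewrite ger0_norm// mulr_ge0.
  have i4 (t : R) (y : Rn) : `]-1, 1[%classic t -> B y -> `|partial1of2 F t y| <= cst (K' * M) y.
    move=> _ _; rewrite partial1of2E.
    by case: (dF t y) => _ ->; rewrite normrM ler_pM.
  have i5 (y : Rn) : 0 <= cst (K' * M) y by rewrite mulr_ge0.
  split.
    exact: (derivable_under_integral mB a01 i1 i2 i5 i3 i4).
  exact: (differentiation_under_integral mB a01 i1 i2 i5 i3 i4).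
case: H => H1 H2; apply: DeriveDef => //.
rewrite -derive1E [LHS]H2; apply: eq_Rintegral => y _.
by rewrite partial1of2E; case: (dF 0 y) => _ ->; rewrite scale0r add0r.
Qed.

(** All derivatives fall on [rho]. The loss of one order is harmless for a mollifier, which is [Ck]
    for every [k]. *)
Lemma Ck_conv k rho S' : Ck k.+1 rho -> (forall x, S' < `|x| -> rho x = 0) ->
  Ck k (conv rho).
Proof.
elim: k rho => [|k IH] rho Cr r0.
  by split => //; apply: (@conv_continuous _ S') => //; case: Cr.
apply: (@Ck_is_derive _ _ _ _ (fun i => conv (fun z => 'D_(ei i) rho z))).
- by apply: (@conv_continuous _ S') => //; case: Cr.
- have C1 : Ck 1 rho by elim: (k) Cr => [/CkS//|k' IHk /CkS].
  by move=> i x; exact: conv_is_derive C1 r0 x.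
- by move=> i; apply: IH; [case: Cr => _ /(_ i)[]|exact: deriv_supp].
Qed.

End convolution.

(** * Measurability of composite expressions *)

Lemma mf_comp2 d d1 d2 d3 (T : measurableType d) (T1 : measurableType d1)
    (T2 : measurableType d2) (T3 : measurableType d3)
    (H : T1 -> T2 -> T3) (v : T -> T1) (w : T -> T2) :
  measurable_fun setT (fun z : T1 * T2 => H z.1 z.2) ->
  measurable_fun setT v -> measurable_fun setT w ->
  measurable_fun setT (fun z => H (v z) (w z)).
Proof.
move=> mH mv mw.
rewrite (_ : (fun z => _) = (fun z : T1 * T2 => H z.1 z.2) \o (fun z => (v z, w z)))//.
by apply: (measurableT_comp mH); exact/measurable_fun_pair.
Qed.

Section measurability_lemmas.
Context d (T : measurableType d) {R : realType} {n : nat}.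
Implicit Types (f g : T -> R) (v w : T -> 'rV[R]_n).

Lemma mf_norm v : measurable_fun setT v -> measurable_fun setT (fun z => `|v z|).
Proof. exact: (measurableT_comp (@measurable_rV_norm R n)). Qed.

Lemma mf_abs f : measurable_fun setT f -> measurable_fun setT (fun z => `|f z|).
Proof. exact: (measurableT_comp (@normr_measurable R setT)). Qed.

Lemma mf_powR f p : measurable_fun setT f -> measurable_fun setT (fun z => f z `^ p).
Proof. exact: (measurableT_comp (@measurable_powR R p)). Qed.

Lemma mf_add f g : measurable_fun setT f -> measurable_fun setT g ->
  measurable_fun setT (fun z => f z + g z).
Proof. exact: measurable_funD. Qed.

Lemma mf_opp f : measurable_fun setT f -> measurable_fun setT (fun z => - f z).
Proof. exact: (measurableT_comp (@oppr_measurable R setT)). Qed.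

Lemma mf_mul f g : measurable_fun setT f -> measurable_fun setT g ->
  measurable_fun setT (fun z => f z * g z).
Proof. exact: measurable_funM. Qed.

Lemma mf_exp f k : measurable_fun setT f -> measurable_fun setT (fun z => f z ^+ k).
Proof. exact: measurable_funX. Qed.

Lemma mf_b2r (b : T -> bool) : measurable_fun setT b ->
  measurable_fun setT (fun z => (b z)%:R : R).
Proof.
move=> mb; rewrite (_ : (fun z => _) = (fun z => if b z then 1 else 0)).
  exact: measurable_fun_ifT.
by apply/funext => z; case: (b z).
Qed.

Lemma mf_lt f g : measurable_fun setT f -> measurable_fun setT g ->
  measurable_fun setT (fun z => f z < g z).
Proof. exact: measurable_fun_ltr. Qed.

Lemma mf_le f g : measurable_fun setT f -> measurable_fun setT g ->
  measurable_fun setT (fun z => f z <= g z).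
Proof. exact: measurable_fun_ler. Qed.

Lemma mf_EFin f : measurable_fun setT f -> measurable_fun setT (fun z => (f z)%:E).
Proof. by move/measurable_EFinP. Qed.

End measurability_lemmas.

(* [constr_eq] rather than a non-linear pattern: the latter compares up to
   conversion and unfolds the integrands. *)
Ltac mfun := repeat (first
  [ lazymatch goal with
    | |- measurable_fun _ _ =>
        match goal with H : measurable_fun _ ?f |- measurable_fun _ ?g =>
          constr_eq f g; exact H end
    | |- _ => assumption
    end
  | lazymatch goal with
    | |- measurable_fun _ (fun z => (@?f z)%:E) => apply: mf_EFin
    | |- measurable_fun _ (fun z => (@?f z + @?g z)%R) =>
        first [apply: mf_add | apply: measurable_rV_addr]
    | |- measurable_fun _ (fun z => (- @?f z)%R) =>
        first [apply: mf_opp | apply: measurable_rV_opp]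
    | |- measurable_fun _ (fun z => (@?f z * @?g z)%R) => apply: mf_mul
    | |- measurable_fun _ (fun z => (@?f z ^+ _)%R) => apply: mf_exp
    | |- measurable_fun _ (fun z => (nat_of_bool (@?f z))%:R%R) => apply: mf_b2r
    | |- measurable_fun _ (fun z => (@?f z < @?g z)%R) => apply: mf_lt
    | |- measurable_fun _ (fun z => (@?f z <= @?g z)%R) => apply: mf_le
    | |- measurable_fun _ (fun z => `|@?f z|%R) => first [apply: mf_abs | apply: mf_norm]
    | |- measurable_fun _ (fun z => (@?f z `^ _)%R) => apply: mf_powR
    | |- measurable_fun _ fst => exact: measurable_fst
    | |- measurable_fun _ snd => exact: measurable_snd
    | |- measurable_fun _ (fun z => fst (@?f z)) => apply: (measurableT_comp measurable_fst)
    | |- measurable_fun _ (fun z => snd (@?f z)) => apply: (measurableT_comp measurable_snd)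
    end
  | match goal with H : measurable_fun _ ?w |- measurable_fun _ (fun z => ?f (@?g z)) =>
      constr_eq w f; apply: (measurableT_comp H) end
  | exact: measurable_id | exact: measurable_cst
  | match goal with H : measurable_fun _ ?w |- measurable_fun _ (fun z => ?w (@?g z)) =>
      apply: (measurableT_comp H) end
  | assumption
  | apply: measurable_rV_addr | apply: mf_add | apply: measurable_rV_opp | apply: mf_opp | apply: mf_norm | apply: mf_abs ]).

(** * From nearby pairs to a single shift *)

Section averaging.
Context {R : realType} {n : nat}.
Notation Rn := 'rV[R]_n.
Notation leb := (@lebesgue_rV R n).
Local Open Scope ereal_scope.

(* The quasi-triangle inequality for [H], averaged over the intermediate point. *)
Lemma shift_average (H : Rn -> Rn -> R) (c l : R) (k : Rn) (Y Z : set Rn) :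
  measurable_fun setT (fun z : Rn * Rn => H z.1 z.2) -> (forall x y, (0 <= H x y)%R) ->
  (forall x y, H x y = H y x) -> (0 <= c)%R ->
  (forall x y z, (H x z <= c * (H x y + H y z))%R) ->
  (0 < l)%R -> (`|k| <= l / 2)%R -> measurable Y -> measurable Z ->
  (forall x, Z x -> Y x /\ Y (x + k)%R) ->
  (l ^+ n)%:E * \int[leb]_(x in Z) (H x (x + k)%R)%:E <=
  (c *+ 2)%:E * \int[leb]_(x in Y) \int[leb]_y (((`|y - x| < l)%R)%:R * H x y)%:E.
Proof.
move=> mH H0 Hsym c0 Hc l0 kl mY mZ ZY.
pose F (x : Rn) := \int[leb]_y (((`|y - x| < l)%R)%:R * H x y)%:E.
have Hg0 (x y : Rn) : 0 <= (((`|y - x| < l)%R)%:R * H x y)%:E by rewrite lee_fin mulr_ge0.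
have F0 x : 0 <= F x by apply: integral_ge0.
have mF : measurable_fun setT F.
  apply: (@measurable_integral_in _ _ Rn Rn R leb setT
    (fun x y : Rn => (((`|y - x| < l)%R)%:R * H x y)%:E)) => //; mfun.
have mHx x : measurable_fun setT (fun y => (H x y)%:E).
  by apply: mf_EFin; exact: (measurableT_comp mH (pair1_measurable _)).
have mHy y : measurable_fun setT (fun x => (H x y)%:E).
  by apply: mf_EFin; exact: (measurableT_comp mH (pair2_measurable _)).
have l20 : (0 < l / 2)%R by rewrite divr_gt0.
(* The intermediate points are [e + x] with [|e| < l / 2]. Since [|k| <= l / 2] they lie at distance
   less than [l] from both [x] and [x + k], and the ball of these [e] has volume [l^n]. *)
have key x : Z x -> (l ^+ n)%:E * (H x (x + k)%R)%:E <= c%:E * (F x + F (x + k)%R).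
  move=> Zx.
  have mB : measurable (ball (0%R : Rn) (l / 2)) by exact: measurable_rV_ball.
  have lebB : leb (ball (0%R : Rn) (l / 2)) = (l ^+ n)%:E.
    by rewrite lebesgue_rV_ball// mulrC divfK.
  have B0 e : ball (0%R : Rn) (l / 2) e -> (`|e| < l / 2)%R.
    by rewrite -ball_normE/= sub0r normrN.
  rewrite -lebB muleC -integral_cst//.
  have m1 : measurable_fun setT (fun e : Rn => (H x (e + x)%R)%:E).
    by apply: (measurableT_comp (mHx x)); mfun.
  have m2 : measurable_fun setT (fun e : Rn => (H (x + k)%R (e + x)%R)%:E).
    by apply: (measurableT_comp (mHx (x + k)%R)); mfun.
  apply: (@le_trans _ _ (\int[leb]_(e in ball (0%R : Rn) (l / 2))
     (c%:E * ((H x (e + x)%R)%:E + (H (x + k)%R (e + x)%R)%:E)))).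
    apply: le_integral_ge0 => // e Be.
    - by rewrite /= lee_fin.
    - by rewrite -EFinD -EFinM lee_fin mulr_ge0// addr_ge0.
    - by rewrite /= -EFinD -EFinM lee_fin [H (x + k)%R _]Hsym; exact: Hc.
  rewrite ge0_integralZl_EFin//; last 2 first.
    by move=> e _; rewrite adde_ge0// lee_fin.
    by apply: emeasurable_funD; apply: measurable_funTS.
  apply: lee_wpmul2l; first by rewrite lee_fin.
  have H1 e : ball (0%R : Rn) (l / 2) e -> 0 <= (H x (e + x)%R)%:E by rewrite lee_fin.
  have H2 e : ball (0%R : Rn) (l / 2) e -> 0 <= (H (x + k)%R (e + x)%R)%:E by rewrite lee_fin.
  rewrite (ge0_integralD leb mB H1 (measurable_funTS m1) H2 (measurable_funTS m2)).
  have aux (z : Rn) : (`|z - x| <= l / 2)%R ->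
      \int[leb]_(e in ball (0%R : Rn) (l / 2)) (H z (e + x)%R)%:E <= F z.
    move=> zx.
    have mg : measurable_fun setT (fun y : Rn => (((`|y - z| < l)%R)%:R * H z y)%:E).
      apply: mf_EFin; apply: mf_mul; first by mfun.
      exact: (measurableT_comp mH (pair1_measurable _)).
    apply: le_trans (@le_integral_rV_shift R n x (ball (0%R : Rn) (l / 2)) setT _ measurableT mg _ _); last 2 first.
    - by move=> y; exact: Hg0.
    - by [].
    apply: le_integral_ge0 => // e Be; first by rewrite lee_fin.
    have -> : (`|e + x - z| < l)%R.
      rewrite -addrA (le_lt_trans (ler_normD _ _))// (splitr l) ltr_leD ?B0//.
      by rewrite distrC.
    by rewrite mul1r.
  apply: leeD.
    by apply: aux; rewrite subrr normr0 ltW.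
  by apply: aux; rewrite addrAC subrr add0r.
rewrite -ge0_integralZl_EFin//; last 3 first.
- by move=> x _; rewrite lee_fin.
- by apply: measurable_funTS; apply: mf_EFin; apply: (mf_comp2 mH); mfun.
- by rewrite exprn_ge0// ltW.
apply: (@le_trans _ _ (\int[leb]_(x in Z) (c%:E * (F x + F (x + k)%R)))).
  apply: le_integral_ge0 => [//|x Zx|x Zx|x Zx].
  - by rewrite -EFinM lee_fin mulr_ge0// exprn_ge0// ltW.
  - by rewrite mule_ge0 ?lee_fin// adde_ge0.
  - exact: key.
have mFk : measurable_fun setT (fun x : Rn => F (x + k)%R).
  by apply: (measurableT_comp mF); mfun.
rewrite ge0_integralZl_EFin//; last 2 first.
  by move=> x _; rewrite adde_ge0.
  by apply: emeasurable_funD; exact: measurable_funTS.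
rewrite (ge0_integralD leb mZ (fun x _ => F0 x) (measurable_funTS mF)
  (fun x _ => F0 (x + k)%R) (measurable_funTS mFk)).
have I0 : 0 <= \int[leb]_(x in Y) F x by apply: integral_ge0.
apply: (@le_trans _ _ (c%:E * (\int[leb]_(x in Y) F x + \int[leb]_(x in Y) F x))).
  apply: lee_wpmul2l; first by rewrite lee_fin.
  apply: leeD.
    by apply: le_integral_ge0 => // x Zx; have [] := ZY _ Zx.
  by apply: (le_integral_rV_shift mY mF) => // x Zx; have [] := ZY _ Zx.
by rewrite mulr2n EFinD ge0_muleDl ?lee_fin// ge0_muleDr.
Qed.

End averaging.

(** * Points at a given distance from the complement of a domain *)

Section inner_sets.
Context {R : realType} {n : nat}.
Notation Rn := 'rV[R]_n.
Implicit Types (Omega : set Rn) (d : R).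

(** A closed set from which all shifts shorter than [d] stay in [Omega]. Estimates spend part of the
    margin at each shift, which accounts for the multiples [2 * d], ..., [6 * d] below. *)
Definition inner Omega d : set Rn := [set x | ball x d `<=` Omega].

Lemma inner_in Omega d x y : inner Omega d x -> `|y - x| < d -> Omega y.
Proof. by move=> ix yx; apply: ix; rewrite -ball_normE/= distrC. Qed.

Lemma inner_sub Omega d : 0 < d -> inner Omega d `<=` Omega.
Proof. by move=> d0 x /inner_in; apply; rewrite subrr normr0. Qed.

Lemma inner_shift Omega a b x y : inner Omega a x -> `|y - x| + b <= a ->
  inner Omega b y.
Proof.
move=> ix yx z; rewrite -ball_normE/= => yz; apply: (inner_in ix).
rewrite -(subrKA y) (le_lt_trans (ler_normD _ _))//.
by rewrite distrC addrC (lt_le_trans _ yx)// ltrD2l.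
Qed.

Lemma inner_closed Omega d : closed (inner Omega d).
Proof.
rewrite -[X in closed X]setCK; apply: open_closedC; rewrite openE => x /=.
move/existsNP => [y /not_implyP[xy nO]].
move: xy; rewrite -ball_normE/= => xy.
apply/nbhs_ballP; exists (d - `|x - y|); first by rewrite /= subr_gt0.
move=> z; rewrite -ball_normE/= => xz /(_ y) H; apply: nO; apply: H.
rewrite -ball_normE/= -(subrKA x) (le_lt_trans (ler_normD _ _))//.
by rewrite distrC -ltrBrDr.
Qed.

Lemma inner_measurable Omega d : measurable (inner Omega d).
Proof. by apply: rV_closed_measurable; exact: inner_closed. Qed.

Lemma bounded_set_ball Omega : bounded_set Omega ->
  exists2 S : R, 0 < S & Omega `<=` ball 0 S.
Proof.
move=> [M [_ HM]]; exists (`|M| + 2); first by rewrite ltr_wpDl.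
move=> x Ox; rewrite -ball_normE/= sub0r normrN.
apply: (@le_lt_trans _ _ (`|M| + 1)); last by rewrite ltrD2l ltr1n.
by apply: HM => //; rewrite (le_lt_trans (ler_norm _))// ltrDl.
Qed.

Lemma bounded_set_lebesgue Omega : bounded_set Omega -> measurable Omega ->
  (@lebesgue_rV R n Omega < +oo)%E.
Proof.
move=> /bounded_set_ball[S S0 OS] mO.
apply: (@le_lt_trans _ _ (@lebesgue_rV R n (ball 0 S))).
  by apply: le_measure => //; rewrite inE//; exact: measurable_rV_ball.
by rewrite lebesgue_rV_ball// ltry.
Qed.

End inner_sets.

(** * The fractional kernel and the Gagliardo seminorm *)

Section kernel.
Context {R : realType} {n : nat}.
Notation Rn := 'rV[R]_n.
Notation leb := (@lebesgue_rV R n).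
Variable s : R.
Hypothesis s0 : 0 < s.

(** Being a nonzero power of 0, its value at the origin is 0, in agreement with the quotients of the
    energy form on the diagonal. *)
Definition kern (e : Rn) : R := enorm e `^ (- (n%:R + s * 2)).

Let ns0 : 0 < n%:R + s * 2. Proof. by rewrite ltr_wpDl// mulr_gt0. Qed.

Lemma kern_ge0 e : 0 <= kern e. Proof. exact: powR_ge0. Qed.

Lemma kernN e : kern (- e) = kern e. Proof. by rewrite /kern enormN. Qed.

Lemma measurable_kern : measurable_fun setT kern.
Proof. by apply: mf_powR; exact: measurable_enorm. Qed.

Lemma enorm0 : enorm (0 : Rn) = 0.
Proof. by apply/eqP; rewrite eq_le enorm_ge0 andbT (le_trans (enorm_le_norm _))// normr0 mulr0. Qed.

Lemma kern0 : kern 0 = 0.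
Proof. by rewrite /kern enorm0 powR0// oppr_eq0 gt_eqF. Qed.

Lemma kern_le e : kern e <= `|e| `^ (- (2 * s)) / `|e| ^+ n.
Proof.
have [->|e0] := eqVneq e 0.
  by rewrite kern0 mulr_ge0 ?powR_ge0// invr_ge0 exprn_ge0.
have ne0 : 0 < `|e| by rewrite normr_gt0.
rewrite /kern !powRN -invfM -powR_mulrn// -powRD; last by rewrite implybE (gt_eqF ne0) orbT.
rewrite lef_pV2 ?posrE ?powR_gt0//; last exact: lt_le_trans (enorm_ge_norm e).
rewrite addrC (mulrC 2); apply: ge0_ler_powR; rewrite ?nnegrE ?enorm_ge0 ?enorm_ge_norm//.
exact: ltW.
Qed.

Lemma kern_ge e l : e != 0 -> `|e| <= l -> 1 <= (n%:R * l) `^ (n%:R + s * 2) * kern e.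
Proof.
move=> e0 el; have ne0 : 0 < `|e| by rewrite normr_gt0.
have ee : 0 < enorm e by exact: lt_le_trans (enorm_ge_norm e).
rewrite /kern powRN ler_pdivlMr ?powR_gt0// mul1r.
apply: ge0_ler_powR; rewrite ?nnegrE ?enorm_ge0//; first exact: ltW.
- by rewrite mulr_ge0// (le_trans (ltW ne0)).
- by apply: le_trans (enorm_le_norm _) _; rewrite ler_wpM2l.
Qed.

Local Open Scope ereal_scope.

(** The squared Gagliardo seminorm in the variables [x] and [e = y - x]: the kernel depends on the
    outer variable only, and translations act on the inner one. *)
Definition gag (f : Rn -> R) : \bar R :=
  \int[leb]_e \int[leb]_x ((f (x + e) - f x) ^+ 2 * kern e)%:E.

Lemma double_integral_shift (F : Rn -> Rn -> R) : (forall x y, (0 <= F x y)%R) ->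
  measurable_fun setT (fun z : Rn * Rn => F z.1 z.2) ->
  \int[leb]_x \int[leb]_y (F x y)%:E = \int[leb]_e \int[leb]_x (F x (x + e)%R)%:E.
Proof.
move=> F0 mF.
have mFx (x : Rn) : measurable_fun setT (fun y => (F x y)%:E).
  by apply: mf_EFin; exact: (measurableT_comp mF (pair1_measurable _)).
transitivity (\int[leb]_x \int[leb]_e (F x (x + e)%R)%:E).
  apply: eq_integral => x _; rewrite -(ge0_integral_rV_shift x)//; last by move=> y; rewrite lee_fin.
  by apply: eq_integral => e _; rewrite addrC.
apply: (@tonelli_in _ _ Rn Rn R leb leb setT setT (fun x e : Rn => (F x (x + e)%R)%:E)) => //.
apply: mf_EFin.
  by apply: (mf_comp2 mF); mfun.
by move=> x y; rewrite lee_fin.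
Qed.

Lemma gagE (f : Rn -> R) : measurable_fun setT f ->
  gag f = \int[leb]_x \int[leb]_y ((f x - f y) ^+ 2 * kern (x - y))%:E.
Proof.
move=> mf; have mk := measurable_kern.
rewrite (@double_integral_shift (fun x y => ((f x - f y) ^+ 2 * kern (x - y))%R)).
- apply: eq_integral => e _; apply: eq_integral => x _; apply: congr1.
  by rewrite -(sqrrN (_ - _)) opprB -[in RHS](kernN) opprB addrAC subrr add0r.
- by move=> x y; rewrite mulr_ge0 ?sqr_ge0 ?kern_ge0.
- by mfun.
Qed.

Lemma gagliardo_gag (f : Rn -> R) : measurable_fun setT f ->
  gagliardo s 2 setT f = gag f.
Proof.
move=> mf; have mk := measurable_kern; rewrite gagE//.
rewrite -(@product_tonelli_in _ _ Rn Rn R leb leb setT setT (fun x y => ((f x - f y) ^+ 2 * kern (x - y))%:E)) //.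
- apply: eq_integral => z _; congr (_%:E).
  by rewrite (powR_mulrn 2)// (real_normK (num_real _)) /kern powRN.
- by mfun.
- by move=> x y; rewrite lee_fin mulr_ge0 ?sqr_ge0 ?kern_ge0.
Qed.

Lemma gag_ge0 f : 0 <= gag f.
Proof.
apply: integral_ge0 => e _; apply: integral_ge0 => x _.
by rewrite lee_fin mulr_ge0 ?sqr_ge0 ?kern_ge0.
Qed.

(** This is [shift_average] for [(f x - f y)^2] with [c = 2] and [l = 2 * |k|]. For [|x - y| < l]
    the kernel is at least [(n * l)^(-(n + 2s))], so the average is bounded by the seminorm, and
    division by [l^n] leaves [|k|^(2s)]. *)
Lemma L2_shift_le : exists2 C : R, (0 <= C)%R & forall (f : Rn -> R) (k : Rn),
  measurable_fun setT f ->
  \int[leb]_x ((f (x + k) - f x) ^+ 2)%:E <= (C * `|k| `^ (s * 2))%:E * gag f.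
Proof.
exists (4 * (n%:R * 2) `^ (n%:R + s * 2) / 2 ^+ n)%R.
  by rewrite mulr_ge0 ?mulr_ge0 ?powR_ge0// invr_ge0 exprn_ge0.
move=> f k mf; have mk := measurable_kern.
have [->|k0] := eqVneq k 0%R.
  rewrite normr0 powR0 ?gt_eqF ?mulr_gt0// mulr0 mul0e integral0_eq// => x _.
  by rewrite addr0 subrr expr0n.
have nk0 : (0 < `|k|)%R by rewrite normr_gt0.
pose l := (2 * `|k|)%R; have l0 : (0 < l)%R by rewrite mulr_gt0.
have kl : (`|k| <= l / 2)%R by rewrite /l mulrAC divff// mul1r.
have mH : measurable_fun setT (fun z : Rn * Rn => ((f z.1 - f z.2) ^+ 2)%R) by mfun.
have := @shift_average R n (fun x y => (f x - f y) ^+ 2)%R 2 l k setT setT mH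
  (fun _ _ => sqr_ge0 _) _ (ler0n _ 2) _ l0 kl measurableT measurableT _.
have E1 : \int[leb]_x ((f x - f (x + k)) ^+ 2)%:E = \int[leb]_x ((f (x + k) - f x) ^+ 2)%:E.
  by apply: eq_integral => x _; rewrite -sqrrN opprB.
rewrite E1 => H.
have {}H : (l ^+ n)%:E * \int[leb]_x ((f (x + k) - f x) ^+ 2)%:E <=
   (2 *+ 2)%:E * \int[leb]_x \int[leb]_y (((`|y - x| < l)%R)%:R * (f x - f y) ^+ 2)%:E.
  apply: H => //.
  - by move=> x y; rewrite -sqrrN opprB.
  - move=> x y z; rewrite -(subrKA (f y)).
    by have := sqr_ge0 (f x - f y - (f y - f z)); nra.
have H2 : \int[leb]_x \int[leb]_y (((`|y - x| < l)%R)%:R * (f x - f y) ^+ 2)%:E <=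
   ((n%:R * l) `^ (n%:R + s * 2))%:E * gag f.
  rewrite (gagE mf) -ge0_integralZl_EFin; [|exact: measurableT| | |exact: powR_ge0]; last 2 first.
  - by move=> x _; apply: integral_ge0 => y _; rewrite lee_fin mulr_ge0 ?sqr_ge0 ?kern_ge0.
  - apply: (@measurable_integral_in _ _ Rn Rn R leb setT (fun x y : Rn => ((f x - f y) ^+ 2 * kern (x - y))%:E)) => //.
      by mfun.
    by move=> x y; rewrite lee_fin mulr_ge0 ?sqr_ge0 ?kern_ge0.
  apply: le_integral_ge0 => // x _.
  - by apply: integral_ge0 => y _; rewrite lee_fin mulr_ge0 ?sqr_ge0.
  - rewrite mule_ge0 ?lee_fin ?powR_ge0//.
    by apply: integral_ge0 => y _; rewrite lee_fin mulr_ge0 ?sqr_ge0 ?kern_ge0.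
  rewrite -ge0_integralZl_EFin ?powR_ge0//; last 2 first.
  - by move=> y _; rewrite lee_fin mulr_ge0 ?sqr_ge0 ?kern_ge0.
  - by mfun.
  apply: le_integral_ge0 => // y _.
  - by rewrite lee_fin mulr_ge0 ?sqr_ge0.
  - by rewrite -EFinM lee_fin (mulr_ge0 (powR_ge0 _ _))// mulr_ge0 ?sqr_ge0 ?kern_ge0.
  rewrite -EFinM lee_fin.
  have [->|xy] := eqVneq x y; first by rewrite !subrr expr0n/= mulr0 mul0r mulr0.
  have [yx|_] := ltP `|y - x|%R l; last first.
    by rewrite mul0r (mulr_ge0 (powR_ge0 _ _))// mulr_ge0 ?sqr_ge0 ?kern_ge0.
  rewrite mul1r mulrCA ler_peMr ?sqr_ge0// kern_ge//.
    by rewrite subr_eq0.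
  by rewrite distrC ltW.
have ln0 : (0 < l ^+ n)%R by rewrite exprn_gt0.
have {H H2} H : (l ^+ n)%:E * \int[leb]_x ((f (x + k) - f x) ^+ 2)%:E <=
    (4 * (n%:R * l) `^ (n%:R + s * 2))%:E * gag f.
  apply: le_trans H _; rewrite EFinM -muleA; apply: lee_pmul => //.
  - apply: integral_ge0 => x _; apply: integral_ge0 => y _.
    by rewrite lee_fin mulr_ge0 ?sqr_ge0.
  - by rewrite lee_fin -mulr_natr -natrM.
have -> : (4 * (n%:R * 2) `^ (n%:R + s * 2) / 2 ^+ n * `|k| `^ (s * 2))%R =
   ((l ^+ n)^-1 * (4 * (n%:R * l) `^ (n%:R + s * 2)))%R.
  have E : (`|k| `^ (n%:R + s * 2) = `|k| ^+ n * `|k| `^ (s * 2))%R.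
    by rewrite powRD ?powR_mulrn// implybE normr_eq0 k0 orbT.
  rewrite /l mulrA (powRM _ (mulr_ge0 (ler0n _ _) (ler0n _ _)) (normr_ge0 _)) exprMn E.
  by field; rewrite !expf_neq0// normr_eq0 k0.
by rewrite EFinM -muleA lee_pdivlMl.
Qed.

End kernel.

(** * A normalised mollifier *)

Section mollifier.
Context {R : realType} {n : nat}.
Notation Rn := 'rV[R]_n.
Notation leb := (@lebesgue_rV R n).

Lemma integral_rV_shift (v : Rn) (f : Rn -> \bar R) : measurable_fun setT f ->
  (\int[leb]_x f (x + v)%R = \int[leb]_x f x)%E.
Proof.
move=> mf; rewrite integralE [RHS]integralE; congr (_ - _)%E.
- rewrite -[RHS](ge0_integral_rV_shift v (measurable_funepos mf) (funepos_ge0 f)).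
  by apply: eq_integral => x _; rewrite !funeposE.
- rewrite -[RHS](ge0_integral_rV_shift v (measurable_funeneg mf) (funeneg_ge0 f)).
  by apply: eq_integral => x _; rewrite !funenegE.
Qed.

Variable a : R.
Hypothesis a0 : 0 < a.
Let B : set Rn := ball 0 a^-1.
Let mB : measurable B. Proof. exact: measurable_rV_ball. Qed.
Let ia0 : 0 < a^-1. Proof. by rewrite invr_gt0. Qed.
Let Bfin : (leb B < +oo)%E. Proof. by rewrite lebesgue_rV_ball// ltry. Qed.

Let bump_cont : continuous (@mbump R n a). Proof. exact: Ck_continuous (Ck_bump 0 a). Qed.

Let bump_bd : exists K : R, forall z : Rn, `|mbump a z| <= K.
Proof. by apply: (@supp_bounded R n _ a^-1) => // x ax; apply: bump_supp => //; exact: ltW. Qed.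

Definition bump_mass : R := \int[leb]_(z in B) mbump a z.

Let bump_int : leb.-integrable B (EFin \o mbump a).
Proof.
have [K HK] := bump_bd; apply: (@bounded_integrable _ _ _ _ K) => //.
by apply: measurable_funTS; exact: rV_continuous_measurable.
Qed.

(** A nonnegative function with zero integral vanishes almost everywhere, whereas the bump is
    positive on the whole ball, which has positive volume. *)
Lemma bump_mass_gt0 : 0 < bump_mass.
Proof.
rewrite lt_neqAle Rintegral_ge0 ?andbT; last by move=> x _; exact: bump_ge0.
apply/negP => /eqP mass0.
have : (\int[leb]_(z in B) (mbump a z)%:E = 0)%E.
  have := integrable_fin_num mB bump_int => /fineK <-.
  by congr (_%:E); exact/esym.
move=> I0.
have H : (\int[leb]_(z in B) `|(mbump a z)%:E| = 0)%E.
  by rewrite -[RHS]I0; apply: eq_integral => z _; rewrite /= ger0_norm// bump_ge0.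
have mb : measurable_fun B (EFin \o mbump a).
  exact: (measurable_int _ bump_int).
have /(ae_eq_integral_abs leb mB mb) := H.
move=> [N [mN N0 BN]].
have BsubN : B `<=` N.
  move=> z Bz; apply: BN => /= /(_ Bz) /eqP; rewrite eqe => /eqP bz.
  suff : 0 < mbump a z by rewrite bz ltxx.
  by apply: bump_gt0 => //; move: Bz; rewrite /B -ball_normE/= sub0r normrN.
have : (leb B <= leb N)%E by apply: le_measure => //; rewrite inE.
rewrite N0 lebesgue_rV_ball// lee_fin leNgt => /negP; apply.
by rewrite exprn_gt0// mulr_gt0.
Qed.

Definition moll (z : Rn) : R := bump_mass^-1 * mbump a z.

Lemma moll_ge0 z : 0 <= moll z.
Proof. by rewrite mulr_ge0 ?bump_ge0// invr_ge0 ltW// bump_mass_gt0. Qed.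

Lemma Ck_moll k : Ck k moll.
Proof. by apply: (@Ck_mul _ _ _ (cst _)); [exact: Ck_cst|exact: Ck_bump]. Qed.

Lemma moll_supp z : a^-1 <= `|z| -> moll z = 0.
Proof. by move=> az; rewrite /moll bump_supp// mulr0. Qed.

Lemma mollN z : moll (- z) = moll z.
Proof.
congr (_ * _); apply: eq_bigr => i _; rewrite mxE mulrC.
by congr (flat 1 _ * flat 1 _); ring.
Qed.

Lemma measurable_moll : measurable_fun setT moll.
Proof. by apply: rV_continuous_measurable; exact: Ck_continuous (Ck_moll 0). Qed.

Lemma moll_bd : exists K : R, forall z : Rn, `|moll z| <= K.
Proof.
have [K HK] := bump_bd; exists (`|bump_mass^-1| * K) => z.
by rewrite normrM ler_wpM2l.
Qed.

Lemma moll_mul_integrable (F : Rn -> R) (M : R) : measurable_fun setT F ->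
  (forall z, `|F z| <= M) -> leb.-integrable B (EFin \o (fun z => moll z * F z)).
Proof.
move=> mF FM; have [K HK] := moll_bd; apply: (@bounded_integrable _ _ _ _ (K * M)) => //.
  by apply: measurable_funTS; apply: mf_mul => //; exact: measurable_moll.
by move=> z _; rewrite normrM ler_pM.
Qed.

Lemma moll_mass : \int[leb]_(z in B) moll z = 1.
Proof.
rewrite [LHS](RintegralZl _ mB bump_int).
by rewrite -/bump_mass mulVf// gt_eqF// bump_mass_gt0.
Qed.

Lemma moll_cst c : \int[leb]_(z in B) (moll z * c) = c.
Proof.
rewrite RintegralZr//; first by rewrite moll_mass mul1r.
apply: eq_integrable (@moll_mul_integrable (cst 1) 1 _ _) => //.
  by move=> z _; rewrite /= mulr1.
by move=> z; rewrite normr1.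
Qed.

(** Integrate [F^2 >= 2 * m * F - m^2] against the mollifier, [m] being the weighted mean of [F]. *)
Lemma moll_jensen (F : Rn -> R) (M : R) : measurable_fun setT F ->
  (forall z, `|F z| <= M) ->
  (\int[leb]_(z in B) (moll z * F z)) ^+ 2 <= \int[leb]_(z in B) (moll z * F z ^+ 2).
Proof.
move=> mF FM; set m := \int[leb]_(z in B) (moll z * F z).
have I1 := moll_mul_integrable mF FM.
have I2 : leb.-integrable B (EFin \o (fun z => moll z * F z ^+ 2)).
  apply: (@moll_mul_integrable _ (M ^+ 2)); first exact: mf_exp.
  move=> z; rewrite normrX lerXn2r// nnegrE//.
  exact: le_trans (normr_ge0 _) (FM z).
have Ic c : leb.-integrable B (EFin \o (fun z => moll z * c)).
  by apply: (@moll_mul_integrable (cst c) `|c|).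
have I3 : leb.-integrable B (EFin \o (fun z => moll z * F z * (2 * m))).
  apply: eq_integrable (@integrableZr _ _ _ leb _ mB (2 * m) _ I1) => //.
have : \int[leb]_(z in B) (moll z * F z * (2 * m) - moll z * m ^+ 2) <=
    \int[leb]_(z in B) (moll z * F z ^+ 2).
  apply: le_Rintegral => //.
    exact: eq_integrable (integrableB mB I3 (Ic (m ^+ 2))).
  move=> z _; have := moll_ge0 z; have := sqr_ge0 (F z - m); nra.
rewrite RintegralB// RintegralZr// moll_cst -/m; nra.
Qed.

End mollifier.

(** * Mollification in L^2 and in the Gagliardo seminorm *)

Section mollification.
Context {R : realType} {n : nat}.
Notation Rn := 'rV[R]_n.
Notation leb := (@lebesgue_rV R n).
Variables (psi : Rn -> R) (K : R).
Hypothesis mpsi : measurable_fun setT psi.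
Hypothesis psiK : forall x, `|psi x| <= K.

Let mshift (x : Rn) : measurable_fun setT (fun z : Rn => psi (x + z)).
Proof. by mfun. Qed.

Definition mconv (a : R) (x : Rn) : R := \int[leb]_(z in ball 0 a^-1) (moll a z * psi (x + z)).

(** Two forms of one mollification, equal because the mollifier is even. [mconv] translates [psi],
    which suits Jensen's inequality; [conv] translates the kernel, which suits differentiation. *)
Lemma mconv_conv a S x : 0 < a -> 0 < S -> (forall y, psi y != 0 -> ball 0 S y) ->
  mconv a x = @conv R n psi S (moll a) x.
Proof.
move=> a0 S0 psi0; congr fine; have mm := @measurable_moll R n a.
transitivity (\int[leb]_z (moll a z * psi (x + z))%:E)%E.
  rewrite integral_mkcond; apply: eq_integral => z _; rewrite patchE.
  case: ifPn => // /negP zB; rewrite moll_supp ?mul0r// leNgt; apply/negP => za.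
  by apply: zB; apply/mem_set; rewrite -ball_normE/= sub0r normrN.
rewrite [RHS]integral_mkcond -[RHS](integral_rV_shift x).
  apply: eq_integral => z _; rewrite patchE (addrC z x) opprD addrA subrr add0r mollN//.
  case: ifPn => // /negP zB; have [->|/psi0 h] := eqVneq (psi (x + z)) 0.
    by rewrite mulr0.
  by exfalso; apply: zB; exact/mem_set.
apply/(measurable_restrictT _ _).1; first exact: measurable_rV_ball.
by apply: measurable_funTS; mfun.
Qed.

Let K0 : 0 <= K. Proof. exact: le_trans (normr_ge0 _) (psiK 0). Qed.

Let diffK (x z : Rn) : `|psi (x + z) - psi x| <= 2 * K.
Proof. by rewrite (le_trans (ler_normB _ _))// mulr2n mulrDl mul1r lerD. Qed.

Lemma mconv_diff a x : 0 < a ->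
  mconv a x - psi x = \int[leb]_(z in ball 0 a^-1) (moll a z * (psi (x + z) - psi x)).
Proof.
move=> a0; rewrite -[X in _ - X](@moll_cst R n a a0 (psi x)) -RintegralB.
- by apply: eq_Rintegral => z _; rewrite mulrBr.
- exact: measurable_rV_ball.
- exact: (moll_mul_integrable a0 (mshift x)).
- by apply: (@moll_mul_integrable _ _ _ a0 (cst (psi x)) K) => // z; exact: psiK.
Qed.

Lemma mconv_jensen1 a x : 0 < a ->
  (((mconv a x - psi x) ^+ 2)%:E <=
   \int[leb]_(z in ball 0%R a^-1) (moll a z * (psi (x + z) - psi x) ^+ 2)%:E)%E.
Proof.
move=> a0; rewrite mconv_diff//.
have mF : measurable_fun setT (fun z : Rn => psi (x + z) - psi x) by mfun.
have := moll_jensen a0 mF (diffK x); rewrite -lee_fin => /le_trans; apply.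
rewrite fineK//; apply: integrable_fin_num; first exact: measurable_rV_ball.
apply: (@moll_mul_integrable _ _ _ a0 _ ((2 * K) ^+ 2)); first exact: mf_exp.
by move=> z; rewrite normrX lerXn2r// nnegrE// mulr_ge0.
Qed.

Lemma mconv_jensen2 a x y : 0 < a ->
  ((((mconv a y - psi y) - (mconv a x - psi x)) ^+ 2)%:E <=
   \int[leb]_(z in ball 0%R a^-1)
     (moll a z * ((psi (y + z) - psi y) - (psi (x + z) - psi x)) ^+ 2)%:E)%E.
Proof.
move=> a0; rewrite !mconv_diff// -RintegralB; last 3 first.
- exact: measurable_rV_ball.
- by apply: (moll_mul_integrable a0 _ (diffK y)); mfun.
- by apply: (moll_mul_integrable a0 _ (diffK x)); mfun.
have mF : measurable_fun setT (fun z : Rn => (psi (y + z) - psi y) - (psi (x + z) - psi x)) by mfun.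
have dK z : `|(psi (y + z) - psi y) - (psi (x + z) - psi x)| <= 4 * K.
  have := diffK y z; have := diffK x z.
  by rewrite !ler_norml => /andP[? ?] /andP[? ?]; apply/andP; split; lra.
rewrite [X in (X ^+ 2)%:E](_ : _ = \int[leb]_(z in ball 0 a^-1)
    (moll a z * ((psi (y + z) - psi y) - (psi (x + z) - psi x)))); last first.
  by apply: eq_Rintegral => z _ /=; rewrite -mulrBr.
have := moll_jensen a0 mF dK; rewrite -lee_fin => /le_trans; apply.
rewrite fineK//; apply: integrable_fin_num; first exact: measurable_rV_ball.
apply: (@moll_mul_integrable _ _ _ a0 _ ((4 * K) ^+ 2)); first exact: mf_exp.
by move=> z; rewrite normrX lerXn2r// nnegrE// mulr_ge0.
Qed.

Lemma moll_mass_e a (c : \bar R) : 0 < a -> (0 <= c)%E ->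
  (\int[leb]_(z in ball 0%R a^-1) ((moll a z)%:E * c) = c)%E.
Proof.
move=> a0 c0; have mm := @measurable_moll R n a.
have mB : measurable (ball (0%R : Rn) a^-1) by exact: measurable_rV_ball.
rewrite ge0_integralZr//; last 2 first.
- by apply: measurable_funTS; mfun.
- by move=> z _; rewrite lee_fin moll_ge0.
rewrite [X in (X * _)%E](_ : _ = 1%E) ?mul1e//.
have := @moll_mass R n a a0; rewrite /Rintegral => <-; rewrite fineK//.
apply: integrable_fin_num => //.
apply: eq_integrable (@moll_mul_integrable _ _ _ a0 (cst 1) 1 _ _) => //.
  by move=> z _; rewrite /= mulr1.
by move=> z; rewrite normr1.
Qed.

Local Open Scope ereal_scope.

(** Jensen's inequality is applied pointwise and the mollification variable is moved outside by
    Tonelli: the error is then an average over [|z| < 1/a] of the errors of the translates.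
    [mconv_gag] follows the same pattern. *)
Lemma mconv_L2 a (eps : \bar R) : (0 < a)%R ->
  (forall z : Rn, (`|z| < a^-1)%R -> \int[leb]_x ((psi (x + z) - psi x) ^+ 2)%:E <= eps) ->
  \int[leb]_x ((mconv a x - psi x) ^+ 2)%:E <= eps.
Proof.
move=> a0 He; have mm := @measurable_moll R n a.
have mB : measurable (ball (0%R : Rn) a^-1) by exact: measurable_rV_ball.
have e0 : 0 <= eps.
  apply: le_trans (He 0%R _); last by rewrite normr0 invr_gt0.
  by apply: integral_ge0 => x _; rewrite lee_fin sqr_ge0.
pose G (x z : Rn) := (moll a z * (psi (x + z) - psi x) ^+ 2)%:E.
have G0 x z : 0 <= G x z by rewrite lee_fin mulr_ge0 ?sqr_ge0 ?moll_ge0.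
apply: (@le_trans _ _ (\int[leb]_x \int[leb]_(z in ball 0%R a^-1) G x z)).
  apply: le_integral_ge0 => // x _.
  - by rewrite lee_fin sqr_ge0.
  - by apply: integral_ge0.
  - exact: mconv_jensen1.
rewrite (@tonelli_in _ _ Rn Rn R leb leb setT _ G)//; last by rewrite /G; mfun.
rewrite -[leRHS](moll_mass_e a0 e0); apply: le_integral_ge0 => // z Bz.
- by apply: integral_ge0.
- by rewrite mule_ge0// lee_fin moll_ge0.
rewrite /G; under eq_integral do rewrite EFinM.
rewrite ge0_integralZl_EFin ?moll_ge0//; last 2 first.
- by move=> x _; rewrite lee_fin sqr_ge0.
- by mfun.
apply: lee_wpmul2l; first by rewrite lee_fin moll_ge0.
by apply: He; move: Bz; rewrite -ball_normE/= sub0r normrN.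
Qed.

Lemma mconv_gag s a (eps : \bar R) : (0 < a)%R ->
  (forall z : Rn, (`|z| < a^-1)%R -> gag s (fun x => psi (x + z) - psi x)%R <= eps) ->
  gag s (fun x => mconv a x - psi x)%R <= eps.
Proof.
move=> a0 He; have mm := @measurable_moll R n a; have mk := @measurable_kern R n s.
have mB : measurable (ball (0%R : Rn) a^-1) by exact: measurable_rV_ball.
have e0 : 0 <= eps.
  by apply: le_trans (He 0%R _); [exact: gag_ge0|rewrite normr0 invr_gt0].
pose D (e x z : Rn) : R := (((psi ((x + e) + z) - psi (x + e)) - (psi (x + z) - psi x)) ^+ 2 * kern s e)%R.
have D0 e x z : (0 <= D e x z)%R by rewrite mulr_ge0 ?sqr_ge0 ?kern_ge0.
pose G e x z := (moll a z * D e x z)%:E.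
have G0 e x z : 0 <= G e x z by rewrite lee_fin mulr_ge0 ?moll_ge0.
apply: (@le_trans _ _ (\int[leb]_e \int[leb]_x \int[leb]_(z in ball 0%R a^-1) G e x z)).
  apply: le_integral_ge0 => // e _.
  - by apply: integral_ge0 => x _; rewrite lee_fin mulr_ge0 ?sqr_ge0 ?kern_ge0.
  - by apply: integral_ge0 => x _; apply: integral_ge0.
  apply: le_integral_ge0 => // x _.
  - by rewrite lee_fin mulr_ge0 ?sqr_ge0 ?kern_ge0.
  - by apply: integral_ge0.
  have := mconv_jensen2 x (x + e)%R a0.
  move=> /(lee_wpmul2r (_ : 0 <= (kern s e)%:E)) => /(_ _)/le_trans; rewrite -EFinM; apply.
    by rewrite lee_fin kern_ge0.
  rewrite -ge0_integralZr//; last 3 first.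
  - by apply: measurable_funTS; mfun.
  - by move=> z _; rewrite lee_fin mulr_ge0 ?sqr_ge0 ?moll_ge0.
  - by rewrite lee_fin kern_ge0.
  by rewrite le_eqVlt; apply/orP; left; apply/eqP; apply: eq_integral => z _; rewrite -EFinM -mulrA.
have mDe e : measurable_fun setT (fun w : Rn * Rn => G e w.1 w.2).
  by rewrite /G /D; mfun.
have mG : measurable_fun setT (fun w : (Rn * Rn) * Rn => G w.1.1 w.2 w.1.2).
  rewrite /G /D; mfun.
under eq_integral => e _ do rewrite (@tonelli_in _ _ Rn Rn R leb leb setT _ (G e)) //.
rewrite (@tonelli_in _ _ Rn Rn R leb leb setT (ball 0%R a^-1) (fun e z => \int[leb]_x G e x z))//; last 2 first.
- exact: (@measurable_integral_in _ _ _ Rn R leb setT (fun w x => G w.1 x w.2)).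
- by move=> e z; apply: integral_ge0.
rewrite -[leRHS](moll_mass_e a0 e0); apply: le_integral_ge0 => // z Bz.
- by apply: integral_ge0 => e _; apply: integral_ge0.
- by rewrite mule_ge0// lee_fin moll_ge0.
have Bz' : (`|z| < a^-1)%R by move: Bz; rewrite -ball_normE/= sub0r normrN.
apply: le_trans (lee_wpmul2l _ (He z Bz')); last by rewrite lee_fin moll_ge0.
rewrite /gag -ge0_integralZl_EFin ?moll_ge0//; last 2 first.
- move=> e _; apply: integral_ge0 => x _; exact: (D0 e x z).
- apply: (@measurable_integral_in _ _ Rn Rn R leb setT (fun e x => (D e x z)%:E)) => //.
    by rewrite /D; mfun.
  by move=> e x; rewrite lee_fin.
apply: le_integral_ge0 => // e _.
- by apply: integral_ge0.
- by rewrite mule_ge0 ?lee_fin ?moll_ge0//; apply: integral_ge0 => x _; exact: (D0 e x z).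
rewrite -ge0_integralZl_EFin ?moll_ge0//.
- by move=> x _; exact: (D0 e x z).
- by rewrite -/(D e); mfun.
Qed.

End mollification.

(** * Continuity of translations in the Gagliardo seminorm *)

Lemma measurable_norm_ge {R : realType} n (r : R) : measurable [set e : 'rV[R]_n | r <= `|e|].
Proof.
rewrite (_ : [set _ | _] = ~` ball (0 : 'rV[R]_n) r).
  by apply: measurableC; exact: measurable_rV_ball.
apply/seteqP; split => e /=; rewrite -ball_normE/= sub0r normrN leNgt => /negP //.
Qed.

Lemma measurable_norm_expV {R : realType} n k :
  measurable_fun setT (fun z : 'rV[R]_n => (`|z| ^+ k)^-1).
Proof.
rewrite (_ : (fun z => _) = (fun z : 'rV[R]_n => `|z| `^ (- k%:R))); first by mfun.
by apply/funext => y; rewrite powRN powR_mulrn.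
Qed.

Lemma lee_addl_small {R : realType} (a b : \bar R) (eps : R) :
  (0 <= a -> 0 <= b -> a + b < +oo -> a + b - eps%:E < b -> a <= eps%:E)%E.
Proof.
case: a b => [a| |] [b| |]//= _ _ _.
by rewrite -!EFinD lte_fin lee_fin; lra.
Qed.

Section shift_continuity.
Context {R : realType} {n : nat}.
Notation Rn := 'rV[R]_n.
Notation leb := (@lebesgue_rV R n).
Variable s : R.
Hypothesis s0 : 0 < s.
Local Open Scope ereal_scope.

Lemma L2_diff_le (a : Rn -> R) (e : Rn) : measurable_fun setT a ->
  \int[leb]_x ((a (x + e) - a x) ^+ 2)%:E <= 4%:E * \int[leb]_x (a x ^+ 2)%:E.
Proof.
move=> ma.
have E : \int[leb]_x (a (x + e)%R ^+ 2)%:E = \int[leb]_x (a x ^+ 2)%:E.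
  by apply: (@ge0_integral_rV_shift R n e (fun x => (a x ^+ 2)%:E)); [mfun|move=> x; rewrite lee_fin sqr_ge0].
apply: (@le_trans _ _ (\int[leb]_x (2%:E * ((a (x + e)%R ^+ 2)%:E + (a x ^+ 2)%:E)))).
  apply: le_integral_ge0 => // x _.
  - by rewrite lee_fin sqr_ge0.
  - by rewrite -EFinD -EFinM lee_fin mulr_ge0// addr_ge0 ?sqr_ge0.
  - by rewrite -EFinD -EFinM lee_fin; have := sqr_ge0 (a (x + e)%R + a x)%R; nra.
have I0 : 0 <= \int[leb]_x (a x ^+ 2)%:E by apply: integral_ge0 => x _; rewrite lee_fin sqr_ge0.
rewrite ge0_integralZl_EFin//; last 2 first.
- by move=> x _; rewrite -EFinD lee_fin addr_ge0 ?sqr_ge0.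
- by apply: emeasurable_funD; mfun.
rewrite ge0_integralD//; last 4 first.
- by move=> x _; rewrite lee_fin sqr_ge0.
- by mfun.
- by move=> x _; rewrite lee_fin sqr_ge0.
- by mfun.
rewrite E; move: (\int[leb]_x (a x ^+ 2)%:E) I0 => [r r0|_|//].
  by rewrite -EFinD -!EFinM lee_fin; lra.
by rewrite /= !gt0_muley ?lte_fin.
Qed.

Variable psi : Rn -> R.
Hypothesis mpsi : measurable_fun setT psi.
Hypothesis gpsi : gag s psi < +oo.

Let g e := \int[leb]_x ((psi (x + e) - psi x) ^+ 2 * kern s e)%:E.
Let g0 e : 0 <= g e.
Proof. by apply: integral_ge0 => x _; rewrite lee_fin mulr_ge0 ?sqr_ge0 ?kern_ge0. Qed.

Let mg : measurable_fun setT g.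
Proof.
have mk := @measurable_kern R n s.
apply: (@measurable_integral_in _ _ Rn Rn R leb setT (fun e x => ((psi (x + e) - psi x) ^+ 2 * kern s e)%:E)) => //.
  by mfun.
by move=> e x; rewrite lee_fin mulr_ge0 ?sqr_ge0 ?kern_ge0.
Qed.

(** The parts of the finite seminorm with [|e| >= 1/(k+1)] increase to the whole by monotone
    convergence. The origin belongs to none of these sets, but the kernel is 0 there. *)
Lemma gag_near0 (eps : R) : (0 < eps)%R ->
  exists2 sigma : R, (0 < sigma)%R & \int[leb]_(e in ball (0%R : Rn) sigma) g e <= eps%:E.
Proof.
move=> eps0.
pose F k : set Rn := ~` ball 0%R k.+1%:R^-1.
have mF k : measurable (F k) by apply: measurableC; exact: measurable_rV_ball.
have ndF : nondecreasing_seq F.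
  move=> i j ij; apply/subsetPset; apply: subsetC; apply: le_ball.
  by rewrite lef_pV2 ?posrE// ler_nat.
have cv := @ge0_nondecreasing_set_cvg_integral _ Rn R F g leb ndF mF (fun k => measurable_funTS mg) (fun k x _ => g0 x).
have E : \int[leb]_(x in \bigcup_i F i) g x = gag s psi.
  rewrite [RHS](_ : _ = \int[leb]_x g x)// integral_mkcond.
  apply: eq_integral => e _; rewrite patchE; case: ifPn => // /negP eF.
  suff -> : e = 0%R.
    by rewrite /g kern0//; apply/esym; apply: integral0_eq => x _; rewrite mulr0.
  apply: contrapT => /eqP e0; apply: eF; apply/mem_set.
  have [k _ /(_ k (leqnn k)) /= hk] : \forall k \near \oo, (k.+1%:R^-1 < `|e|)%R.
    have ne0 : (0 < `|e|)%R by rewrite normr_gt0.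
    exact: (near_infty_natSinv_lt (PosNum ne0)).
  by exists k => //; rewrite /F /= -ball_normE/= sub0r normrN; apply/negP; rewrite -leNgt ltW.
rewrite E in cv.
have gfin : gag s psi \is a fin_num by rewrite ge0_fin_numE// gag_ge0.
have {}cv : exists k, gag s psi - eps%:E < \int[leb]_(x in F k) g x.
  have : gag s psi - eps%:E < gag s psi by rewrite lteBlDr// lteDl// lte_fin.
  move=> h; have : \forall k \near \oo, gag s psi - eps%:E < \int[leb]_(x in F k) g x.
    have : nbhs (gag s psi) [set y | gag s psi - eps%:E < y].
      by apply: open_nbhs_nbhs; split => //; exact: open_ereal_gt_ereal.
    by move/cv.
  by case=> k _ /(_ k (leqnn k)) ?; exists k.
case: cv => k hk; exists (k.+1%:R^-1)%R; first by rewrite invr_gt0.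
have mB : measurable (ball (0%R : Rn) k.+1%:R^-1) by exact: measurable_rV_ball.
have : gag s psi = \int[leb]_(e in ball (0%R : Rn) k.+1%:R^-1) g e + \int[leb]_(e in F k) g e.
  rewrite -ge0_integral_setU//; first by rewrite setUv.
  - by rewrite setUv.
  - by apply/disj_set2P; rewrite setICr.
move=> gE.
apply: (@lee_addl_small _ _ (\int[leb]_(e in F k) g e)).
- exact: integral_ge0.
- exact: integral_ge0.
- by rewrite -gE.
- by rewrite -gE.
Qed.

(** Split at [|e| = sigma]. The near part for [psi (x + z) - psi x] is at most 4 times that of
    [psi], small by the choice of [sigma]. In the far part the kernel is integrable and the squared
    L^2 norm of the shift is [O(|z|^(2s))]. *)
Lemma gag_shift_small (eps : R) : (0 < eps)%R -> exists2 delta : R, (0 < delta)%R &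
  forall z : Rn, (`|z| < delta)%R -> gag s (fun x => psi (x + z) - psi x)%R <= eps%:E.
Proof.
move=> eps0; have mk := @measurable_kern R n s.
(* The final budget is [4 * (eps / 8) + eps / 2]. *)
have [sigma sig0 Hsig] := gag_near0 (divr_gt0 eps0 (ltr0n R 8)).
have [C C0 HC] := L2_shift_le (n := n) s0.
have gfin : gag s psi \is a fin_num by rewrite ge0_fin_numE// gag_ge0.
pose A := (4 ^+ n / (1 - 2 `^ (- (2 * s))) * sigma `^ (- (2 * s)))%R.
have A0 : (0 <= A)%R.
  have /andP[q0 q1] := powR2_lt1 (mulr_gt0 (ltr0n R 2) s0).
  by rewrite mulr_ge0 ?powR_ge0// divr_ge0// subr_ge0 ltW.
have gf0 : (0 <= fine (gag s psi))%R by rewrite fine_ge0// gag_ge0.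
pose L := (4 * A * (C * fine (gag s psi)) + 1)%R.
have L0 : (0 < L)%R.
  by rewrite ltr_wpDl// mulr_ge0// mulr_ge0.
exists ((eps / (2 * L)) `^ (s * 2)^-1)%R; first by rewrite powR_gt0// divr_gt0// mulr_gt0.
move=> z zd.
have Hz : (`|z| `^ (s * 2) <= eps / (2 * L))%R.
  have p0 : (0 <= eps / (2 * L))%R by rewrite divr_ge0 ?ltW// mulr_gt0.
  have -> : (eps / (2 * L) = ((eps / (2 * L)) `^ (s * 2)^-1) `^ (s * 2))%R.
    by rewrite -powRrM mulVf ?powRr1// gt_eqF// mulr_gt0.
  apply: ge0_ler_powR; rewrite ?nnegrE ?powR_ge0//; last exact: ltW.
  by rewrite mulr_ge0// ltW.
pose D x := (psi (x + z) - psi x)%R.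
have mD : measurable_fun setT D by rewrite /D; mfun.
pose h e := \int[leb]_x ((D (x + e)%R - D x) ^+ 2 * kern s e)%:E.
have h0 e : 0 <= h e by apply: integral_ge0 => x _; rewrite lee_fin mulr_ge0 ?sqr_ge0 ?kern_ge0.
have mh : measurable_fun setT h.
  apply: (@measurable_integral_in _ _ Rn Rn R leb setT (fun e x => ((D (x + e) - D x) ^+ 2 * kern s e)%:E)) => //.
    by mfun.
  by move=> e x; rewrite lee_fin mulr_ge0 ?sqr_ge0 ?kern_ge0.
have mB : measurable (ball (0%R : Rn) sigma) by exact: measurable_rV_ball.
have -> : gag s D = \int[leb]_(e in ball (0%R : Rn) sigma) h e + \int[leb]_(e in ~` ball (0%R : Rn) sigma) h e.
  rewrite -ge0_integral_setU//; first by rewrite setUv.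
  - exact: measurableC.
  - by rewrite setUv.
  - by apply/disj_set2P; rewrite setICr.
have hE (e : Rn) (b : Rn -> R) : measurable_fun setT b ->
    \int[leb]_x (b x ^+ 2 * kern s e)%:E = (\int[leb]_x (b x ^+ 2)%:E) * (kern s e)%:E.
  move=> mb; rewrite -ge0_integralZr//.
  - by mfun.
  - by move=> x _; rewrite lee_fin sqr_ge0.
  - by rewrite lee_fin kern_ge0.
have h1 e : h e <= 4%:E * g e.
  rewrite /h /g !hE; try by mfun.
  rewrite muleA; apply: lee_wpmul2r; first by rewrite lee_fin kern_ge0.
  have m3 : measurable_fun setT (fun x : Rn => psi (x + e) - psi x)%R by mfun.
  apply: le_trans (L2_diff_le z m3).
  rewrite le_eqVlt; apply/orP; left; apply/eqP; apply: eq_integral => x _; congr (_ ^+ 2)%:E.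
  by rewrite /D (addrAC x e z); ring.
have h2 e : h e <= (4 * (eps / (2 * L) * (C * fine (gag s psi))) * kern s e)%:E.
  rewrite /h hE; last by mfun.
  rewrite EFinM; apply: lee_wpmul2r; first by rewrite lee_fin kern_ge0.
  apply: (le_trans (L2_diff_le e mD)); rewrite EFinM; apply: lee_wpmul2l => //.
  apply: (le_trans (HC psi z mpsi)); rewrite -(fineK gfin) -EFinM lee_fin fineK//.
  by rewrite [leLHS](_ : _ = `|z| `^ (s * 2) * (C * fine (gag s psi)))%R ?ler_wpM2r// ?mulr_ge0//; ring.
have -> : eps = (4 * (eps / 8) + eps / 2)%R by field.
rewrite EFinD; apply: leeD.
  apply: (@le_trans _ _ (4%:E * \int[leb]_(e in ball (0%R : Rn) sigma) g e)).
    rewrite -ge0_integralZl_EFin//; last exact: measurable_funTS.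
    by apply: le_integral_ge0 => // e _; rewrite mule_ge0.
  by rewrite EFinM; apply: lee_wpmul2l.
set c := (4 * (eps / (2 * L) * (C * fine (gag s psi))))%R in h2.
have c0 : (0 <= c)%R.
  by rewrite mulr_ge0// mulr_ge0//; [rewrite ltW// divr_gt0// mulr_gt0|rewrite mulr_ge0].
apply: (@le_trans _ _ (c%:E * A%:E)).
  apply: (@le_trans _ _ (\int[leb]_(e in [set e : Rn | (sigma <= `|e|)%R])
      (c%:E * (`|e| `^ (- (2 * s)) / `|e| ^+ n)%:E))).
    apply: le_integral_ge0 => // e.
    - by rewrite /= -ball_normE/= sub0r normrN => /negP; rewrite -leNgt.
    - by rewrite -EFinM lee_fin mulr_ge0// mulr_ge0 ?powR_ge0// invr_ge0 exprn_ge0.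
    - move=> _; apply: (le_trans (h2 e)); rewrite -EFinM lee_fin ler_wpM2l//.
      exact: kern_le.
  rewrite ge0_integralZl_EFin//.
  - by apply: lee_wpmul2l; [rewrite lee_fin|exact: integral_far_le (mulr_gt0 _ _) _].
  - exact: measurable_norm_ge.
  - apply: measurable_funTS; apply: mf_EFin; apply: mf_mul; first by mfun.
    exact: measurable_norm_expV.
rewrite -EFinM lee_fin /c.
rewrite (_ : (_ * A)%R = (eps / (2 * L)) * (4 * A * (C * fine (gag s psi)))%R)%R; last by ring.
rewrite mulrAC ler_pdivrMr ?mulr_gt0// -mulrA [leRHS](_ : _ = (eps * L)%R); last by field.
by rewrite ler_wpM2l ?(ltW eps0)// /L -mulrA lerDl.
Qed.

End shift_continuity.

(** * The equation tested with functions of finite energy *)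

Lemma young_weight {R : realType} (eta a b : R) : 0 < eta -> 0 <= a -> 0 <= b ->
  a * b <= eta * a ^+ 2 + eta^-1 * b ^+ 2.
Proof.
move=> e0 a0 b0; have -> : b = eta * (eta^-1 * b) by rewrite mulVKf// gt_eqF.
have -> : eta^-1 * (eta * (eta^-1 * b)) ^+ 2 = eta * (eta^-1 * b) ^+ 2 by field; rewrite gt_eqF.
rewrite mulrCA -mulrDr; apply: (ler_wpM2l (ltW e0)).
have := mulr_ge0 (ltW (_ : 0 < eta^-1)) b0; rewrite invr_gt0 => /(_ e0) c0.
by move: (eta^-1 * b) c0 => c c0; have := mulr_ge0 a0 c0; have := sqr_ge0 (a - c); nra.
Qed.

Section energy.
Context {R : realType} {n : nat}.
Notation Rn := 'rV[R]_n.
Notation leb := (@lebesgue_rV R n).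
Variables (s Lambda : R) (Phi : R -> R).
Hypothesis s0 : 0 < s.
Hypothesis Lam1 : 1 <= Lambda.
Hypothesis HPhi : structure_assumption Lambda Phi.

(** The flux: the integrand of [energy_form] without the factor [psi z.1 - psi z.2], divisions being
    written as negative powers. *)
Definition pot (u : Rn -> R) (z : Rn * Rn) : R :=
  Phi ((u z.1 - u z.2) * enorm (z.1 - z.2) `^ (- s)) *
  (enorm (z.1 - z.2) `^ (- s) * enorm (z.1 - z.2) `^ (- n%:R)).

Lemma energy_integrandE (u psi : Rn -> R) (z : Rn * Rn) :
  Phi ((u z.1 - u z.2) / enorm (z.1 - z.2) `^ s) *
     ((psi z.1 - psi z.2) / enorm (z.1 - z.2) `^ s) / enorm (z.1 - z.2) ^+ n =
  pot u z * (psi z.1 - psi z.2).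
Proof.
rewrite /pot !powRN powR_mulrn ?enorm_ge0//; ring.
Qed.

Lemma kernE (e : Rn) : kern s e = enorm e `^ (- s) * (enorm e `^ (- s) * enorm e `^ (- n%:R)).
Proof.
have [->|e0] := eqVneq e 0.
  by rewrite kern0// enorm0 [0 `^ (- s)]powR0 ?mul0r// oppr_eq0 gt_eqF.
have ee : enorm e != 0.
  by rewrite gt_eqF// (lt_le_trans _ (enorm_ge_norm e))// normr_gt0.
rewrite -!powRD ?ee ?implybT//; congr powR; ring.
Qed.

Lemma Phi0 : Phi 0 = 0.
Proof. by case: HPhi => /(_ 0) + _ _; rewrite oppr0 => h; lra. Qed.

Lemma measurable_Phi : measurable_fun setT Phi.
Proof.
case: HPhi => _ Lip _; apply: continuous_measurable_fun => x.
apply/cvgrPdist_lt => e e0.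
have L0 : 0 < Lambda by exact: lt_le_trans Lam1.
apply/nbhs_ballP; exists (e / Lambda); first by rewrite /= divr_gt0.
move=> y xy; apply: le_lt_trans (Lip _ _) _.
by rewrite mulrC -ltr_pdivlMr.
Qed.

Lemma measurable_pot u : measurable_fun setT u -> measurable_fun setT (pot u).
Proof.
move=> mu; have mP := measurable_Phi; have me := @measurable_enorm R n.
by rewrite /pot; mfun.
Qed.

(** The power [-s] inside [Phi] and the powers outside combine to [kern], so the Lipschitz bound on
    [Phi] becomes a linear bound against the kernel. [pot_diff_mono] transfers monotonicity in the
    same way. *)
Lemma pot_diff_le (u v : Rn -> R) z :
  `|pot u z - pot v z| <= Lambda * `|(u z.1 - u z.2) - (v z.1 - v z.2)| * kern s (z.1 - z.2).
Proof.
case: HPhi => _ Lip _; rewrite /pot kernE.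
set m := enorm _ `^ (- s); set k := enorm _ `^ (- n%:R).
have m0 : 0 <= m by exact: powR_ge0.
have k0 : 0 <= k by exact: powR_ge0.
rewrite -mulrBl normrM (ger0_norm (mulr_ge0 m0 k0)) [leRHS]mulrA.
apply: ler_wpM2r; first exact: mulr_ge0.
by apply: le_trans (Lip _ _) _; rewrite -mulrBl normrM (ger0_norm m0) mulrA.
Qed.

Lemma pot_le u z : `|pot u z| <= Lambda * `|u z.1 - u z.2| * kern s (z.1 - z.2).
Proof.
have := pot_diff_le u (cst 0) z; rewrite /= !subrr subr0.
by rewrite /pot !subrr mul0r Phi0 mul0r subr0.
Qed.

Lemma pot_diff_mono (u v : Rn -> R) z :
  Lambda^-1 * ((u z.1 - u z.2) - (v z.1 - v z.2)) ^+ 2 * kern s (z.1 - z.2) <=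
  (pot u z - pot v z) * ((u z.1 - u z.2) - (v z.1 - v z.2)).
Proof.
case: HPhi => _ _ Mon; rewrite /pot kernE.
set m := enorm _ `^ (- s); set k := enorm _ `^ (- n%:R).
have m0 : 0 <= m by exact: powR_ge0.
have k0 : 0 <= k by exact: powR_ge0.
set x := u z.1 - u z.2; set y := v z.1 - v z.2.
have := Mon (x * m) (y * m); rewrite (real_normK (num_real _)) -mulrBl => h.
rewrite [leLHS](_ : _ = (Lambda^-1 * ((x - y) * m) ^+ 2) * k); last by ring.
rewrite [leRHS](_ : _ = ((Phi (x * m) - Phi (y * m)) * ((x - y) * m)) * k); last by ring.
by rewrite ler_wpM2r.
Qed.

Local Open Scope ereal_scope.

Lemma gag_prod (f : Rn -> R) : measurable_fun setT f ->
  gag s f = \int[leb \x leb]_z ((f z.1 - f z.2) ^+ 2 * kern s (z.1 - z.2))%:E.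
Proof.
move=> mf; have mk := @measurable_kern R n s; rewrite gagE//.
rewrite -(@product_tonelli_in _ _ Rn Rn R leb leb setT setT (fun x y => ((f x - f y) ^+ 2 * kern s (x - y))%:E)) //.
- by rewrite setXTT.
- by mfun.
- by move=> x y; rewrite lee_fin mulr_ge0 ?sqr_ge0 ?kern_ge0.
Qed.

(* Young's inequality, with the weight [eta] left free. *)
Lemma form_le (b : Rn * Rn -> R) (u psi : Rn -> R) (eta : R) : (0 < eta)%R ->
  measurable_fun setT u -> measurable_fun setT psi ->
  (forall z, (`|b z| <= Lambda * `|u z.1 - u z.2| * kern s (z.1 - z.2))%R) ->
  \int[leb \x leb]_z `|(b z * (psi z.1 - psi z.2))%:E| <=
  Lambda%:E * (eta%:E * gag s u + eta^-1%:E * gag s psi).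
Proof.
move=> eta0 mu mpsi Hb; have mk := @measurable_kern R n s.
have L0 : (0 <= Lambda)%R by exact: le_trans Lam1.
have nn (f : Rn -> R) (z : Rn * Rn) : (0 <= (f z.1 - f z.2) ^+ 2 * kern s (z.1 - z.2))%R.
  by rewrite mulr_ge0 ?sqr_ge0 ?kern_ge0.
rewrite !gag_prod// -!ge0_integralZl_EFin ?invr_ge0 ?(ltW eta0)//; last 4 first.
- by move=> z _; exact: nn.
- by mfun.
- by move=> z _; exact: nn.
- by mfun.
rewrite -ge0_integralD//; last 4 first.
- by move=> z _; rewrite -EFinM lee_fin mulr_ge0 ?nn// ltW.
- by apply: measurable_funeM; mfun.
- by move=> z _; rewrite -EFinM lee_fin mulr_ge0 ?nn// invr_ge0 ltW.
- by apply: measurable_funeM; mfun.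
rewrite -ge0_integralZl_EFin//; last 2 first.
- move=> z _; rewrite -!EFinM -EFinD lee_fin addr_ge0// mulr_ge0 ?nn// ?invr_ge0 ltW//.
- by apply: emeasurable_funD; apply: measurable_funeM; mfun.
apply: le_integral_ge0 => // z _.
- by rewrite mule_ge0 ?adde_ge0 ?mule_ge0 ?lee_fin ?nn ?invr_ge0 ?(ltW eta0).
rewrite [leRHS](_ : _ = (Lambda * (eta * ((u z.1 - u z.2) ^+ 2 * kern s (z.1 - z.2)) +
  eta^-1 * ((psi z.1 - psi z.2) ^+ 2 * kern s (z.1 - z.2))))%:E)// lee_fin normrM.
apply: le_trans (ler_wpM2r (normr_ge0 _) (Hb z)) _.
set A := (u z.1 - u z.2)%R; set B := (psi z.1 - psi z.2)%R.
have k0 := kern_ge0 s (z.1 - z.2); move: (kern s _) k0 => k k0.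
have a0 := normr_ge0 A; have b0 := normr_ge0 B.
rewrite [leLHS](_ : _ = Lambda * (`|A| * `|B| * k))%R; last by ring.
rewrite [leRHS](_ : _ = Lambda * ((eta * `|A| ^+ 2 + eta^-1 * `|B| ^+ 2) * k))%R; last first.
  by rewrite !(real_normK (num_real _)); ring.
apply: ler_wpM2l => //.
by apply: ler_wpM2r => //; exact: young_weight.
Qed.

Lemma form_integrable (b : Rn * Rn -> R) (u psi : Rn -> R) :
  measurable_fun setT b ->
  measurable_fun setT u -> measurable_fun setT psi ->
  (forall z, (`|b z| <= Lambda * `|u z.1 - u z.2| * kern s (z.1 - z.2))%R) ->
  gag s u < +oo -> gag s psi < +oo ->
  (leb \x leb).-integrable setT (fun z => (b z * (psi z.1 - psi z.2))%:E).
Proof.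
move=> mb mu mpsi Hb gu gpsi; apply/integrableP; split; first by mfun.
apply: le_lt_trans (form_le ltr01 mu mpsi Hb) _.
rewrite invr1 !mul1e; apply: lte_mul_pinfty; [by rewrite lee_fin (le_trans ler01 Lam1)|exact: isT|].
exact: (lte_add_pinfty gu gpsi).
Qed.

Lemma ge_forall_small (x c : R) : (0 <= c)%R -> (forall e, (0 < e)%R -> (`|x| <= c * e)%R) -> x = 0%R.
Proof.
move=> c0 H; apply/eqP; rewrite -normr_le0 leNgt; apply/negP => x0.
have := H (`|x| / (2 * (c + 1)))%R; rewrite divr_gt0 ?mulr_gt0 ?ltr_wpDl// => /(_ isT).
rewrite leNgt => /negP; apply; rewrite mulrA ltr_pdivrMr ?mulr_gt0 ?ltr_wpDl//; nra.
Qed.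

Variable Omega : set Rn.
Hypothesis oO : open Omega.
Hypothesis bO : bounded_set Omega.
Variables (f u : Rn -> R) (Fb : R).
Hypothesis cf : continuous f.
Hypothesis fFb : forall x, (`|f x| <= Fb)%R.
Hypothesis mu : measurable_fun setT u.
Hypothesis gu : gag s u < +oo.
Hypothesis weak : weak_formulation s Phi Omega u (density_integral Omega f).

Let mO : measurable Omega. Proof. exact: rV_open_measurable. Qed.
Let Ofin : leb Omega < +oo. Proof. exact: bounded_set_lebesgue. Qed.
Let Fb0 : (0 <= Fb)%R. Proof. exact: le_trans (normr_ge0 _) (fFb 0%R). Qed.

(** Mollification at radius [1/a < d] moves the support by at most [1/a], into
    [inner Omega (d - 1/a)]. This set is closed, so it also contains the closure that defines the
    support. *)
Lemma Ccoo_mconv (psi : Rn -> R) (K d a : R) : measurable_fun setT psi ->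
  (forall x, (`|psi x| <= K)%R) -> (0 < a)%R -> (a^-1 < d)%R ->
  (forall x, psi x != 0%R -> inner Omega d x) -> Ccoo Omega (mconv psi a).
Proof.
move=> mpsi psiK a0 ad psi0.
have d0 : (0 < d)%R by apply: lt_trans ad; rewrite invr_gt0.
have [S S0 OS] := bounded_set_ball bO.
have psiS y : psi y != 0%R -> ball (0%R : Rn) S y by move/psi0/(inner_sub d0)/OS.
have -> : mconv psi a = conv psi S (moll a).
  by apply/funext => x; exact: (mconv_conv mpsi x a0 S0 psiS).
have Csub : supp (conv psi S (moll a)) `<=` inner Omega (d - a^-1).
  have /closure_id -> := @inner_closed _ _ Omega (d - a^-1)%R.
  apply: closure_subset => x /= /negP nz.
  have [y [/psi0 iy yx]] : exists y, psi y != 0%R /\ (`|x - y| < a^-1)%R.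
    apply: contrapT => /forallNP H; apply: nz; apply/eqP.
    rewrite /conv /Rintegral integral0_eq// => y _.
    have [->|py] := eqVneq (psi y) 0%R; first by rewrite mulr0.
    by rewrite moll_supp ?mul0r// leNgt; apply/negP => xy; apply: (H y).
  by apply: (inner_shift iy); lra.
split.
- apply: Ck_smooth => k; apply: (@Ck_conv R n psi S K mpsi psiK S0 k (moll a) a^-1%R).
    exact: Ck_moll.
  by move=> x ax; apply: moll_supp => //; exact: ltW.
- apply: bounded_closed_compact; last exact: closed_closure.
  case: bO => M [Mr HM]; exists M; split => // y My x Sx; apply: (HM y My).
  by apply: (@inner_sub R n Omega (d - a^-1)); [rewrite subr_gt0|exact: Csub].
- by apply: subset_trans Csub _; apply: inner_sub; rewrite subr_gt0.
Qed.

(* By mollification; the continuity of translations in L^2 that this requires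
   follows from the finiteness of the Gagliardo seminorm ([L2_shift_le]). *)
Lemma weak_extension (psi : Rn -> R) (K d : R) : (0 < d)%R -> measurable_fun setT psi ->
  (forall x, (`|psi x| <= K)%R) -> (forall x, psi x != 0%R -> inner Omega d x) ->
  gag s psi < +oo ->
  energy_form s Phi u psi = density_integral Omega f psi.
Proof.
move=> d0 mpsi psiK psi0 gpsi.
have mk := @measurable_kern R n s; have mp := measurable_pot mu.
have mf : measurable_fun setT f by exact: rV_continuous_measurable.
have eE phi : energy_form s Phi u phi =
    (1 - s)%:E * \int[leb \x leb]_z (pot u z * (phi z.1 - phi z.2))%:E.
  by congr (_ * _); apply: eq_integral => z _; rewrite energy_integrandE.
have [C C0 HC] := L2_shift_le (n := n) s0.
have gufin : gag s u \is a fin_num by rewrite (ge0_fin_numE (gag_ge0 _ _)); exact: gu.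
have gpfin : gag s psi \is a fin_num by rewrite (ge0_fin_numE (gag_ge0 _ _)); exact: gpsi.
have gu0 : (0 <= fine (gag s u))%R by rewrite fine_ge0// gag_ge0.
have gp0 : (0 <= fine (gag s psi))%R by rewrite fine_ge0// gag_ge0.
have Of0 : (0 <= fine (leb Omega))%R by rewrite fine_ge0.
have I1 := form_integrable mp mu mpsi (pot_le u) gu gpsi.
have intO (g : Rn -> R) (M : R) : measurable_fun setT g -> (forall x, (`|g x| <= M)%R) ->
    leb.-integrable Omega (fun x => (g x * f x)%:E).
  move=> mg gM; apply: (@bounded_integrable _ _ Omega (fun x => g x * f x)%R (M * Fb)) => //.
    by apply: measurable_funTS; mfun.
  by move=> x _; rewrite normrM ler_pM.
have I2 := intO psi K mpsi psiK.
have F1 := integrable_fin_num measurableT I1.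
have F2 := integrable_fin_num mO I2.
rewrite eE /density_integral -(fineK F1) -(fineK F2) -EFinM; congr (_%:E).
apply/eqP; rewrite -subr_eq0; apply/eqP.
apply: (@ge_forall_small _ (`|1 - s| * Lambda * (fine (gag s u) + 1) + Fb * (fine (leb Omega) + 1))%R).
  have L0 : (0 <= Lambda)%R by exact: le_trans Lam1.
  exact: (addr_ge0 (mulr_ge0 (mulr_ge0 (normr_ge0 _) L0) (addr_ge0 gu0 ler01)) (mulr_ge0 Fb0 (addr_ge0 Of0 ler01))).
move=> e e0.
(* The squared errors are asked to be at most [e * e]: Young's inequality with weight [e] then
   bounds both sides of the equation for [phi - psi] by a multiple of [e]. *)
have [del del0 Hdel] := gag_shift_small s0 mpsi gpsi (mulr_gt0 e0 e0).
pose L := (C * fine (gag s psi) + 1)%R.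
have L0 : (0 < L)%R by rewrite ltr_wpDl// mulr_ge0.
pose del2 := ((e * e / L) `^ (s * 2)^-1)%R.
have del20 : (0 < del2)%R by rewrite powR_gt0// divr_gt0// mulr_gt0.
(* The mollification radius: [d / 2] keeps the support inside [Omega], [del] controls the seminorm
   and [del2] the L^2 norm. *)
pose t := (Num.min (d / 2) (Num.min del del2))%R.
have t0 : (0 < t)%R by rewrite !lt_min del0 del20 divr_gt0.
pose a := (t^-1)%R; have a0 : (0 < a)%R by rewrite invr_gt0.
have ta : (a^-1 = t)%R by rewrite invrK.
have ad : (a^-1 < d)%R.
  by rewrite ta (@le_lt_trans _ _ (d / 2)%R) ?ge_min ?lexx// ltr_pdivrMr// ltr_pMr// (ltr_nat R 1 2).
pose phi := mconv psi a.
have Cphi : Ccoo Omega phi by exact: Ccoo_mconv mpsi psiK a0 ad psi0.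
have cphi : continuous phi by case: Cphi => /(_ [::])[].
have mphi : measurable_fun setT phi by exact: rV_continuous_measurable.
have [K' phiK] : exists K' : R, forall x, (`|phi x| <= K')%R.
  have [S S0 OS] := bounded_set_ball bO.
  apply: (@supp_bounded R n phi S) => // x Sx; apply: contrapT => /eqP nz.
  have : ball (0%R : Rn) S x by apply: OS; case: Cphi => _ _; apply; exact: subset_closure.
  by rewrite -ball_normE/= sub0r normrN ltNge (ltW Sx).
have gD : gag s (fun x => phi x - psi x)%R <= (e * e)%:E.
  apply: (mconv_gag mpsi psiK a0) => z; rewrite ta => zt; apply: Hdel.
  by rewrite (lt_le_trans zt)// !ge_min lexx orbT.
have lD : \int[leb]_x ((phi x - psi x) ^+ 2)%:E <= (e * e)%:E.
  apply: (mconv_L2 mpsi psiK a0) => z; rewrite ta => zt.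
  apply: (le_trans (HC psi z mpsi)); rewrite -(fineK gpfin) -EFinM lee_fin.
  have zd : (`|z| <= del2)%R by rewrite (ltW (lt_le_trans zt _))// !ge_min lexx !orbT.
  have Hz : (`|z| `^ (s * 2) <= e * e / L)%R.
    have -> : (e * e / L = ((e * e / L) `^ (s * 2)^-1) `^ (s * 2))%R.
      by rewrite -powRrM mulVf ?powRr1 ?divr_ge0 ?mulr_ge0 ?ltW// gt_eqF// mulr_gt0.
    by apply: ge0_ler_powR; rewrite ?nnegrE ?powR_ge0// mulr_ge0// ltW.
  rewrite mulrAC mulrC; apply: (@le_trans _ _ ((e * e / L) * (C * fine (gag s psi))))%R.
    by apply: ler_wpM2r => //; exact: mulr_ge0.
  by rewrite mulrAC ler_pdivrMr// ler_wpM2l ?mulr_ge0 ?ltW// ltrDl.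
have mD : measurable_fun setT (fun x => phi x - psi x)%R by mfun.
have gDfin : gag s (fun x => phi x - psi x)%R < +oo by apply: le_lt_trans gD _; rewrite ltry.
have I3 := form_integrable mp mu mD (pot_le u) gu gDfin.
have I4 := intO phi K' mphi phiK.
have DK x : (`|phi x - psi x| <= K' + K)%R.
  by rewrite (le_trans (ler_normB _ _))// lerD.
have I5 := intO _ (K' + K)%R mD DK.
have F3 := integrable_fin_num measurableT I3.
have F5 := integrable_fin_num mO I5.
have := weak Cphi; rewrite eE /density_integral.
have -> : \int[leb \x leb]_z (pot u z * (phi z.1 - phi z.2))%:E =
   \int[leb \x leb]_z (pot u z * (psi z.1 - psi z.2))%:E +
   \int[leb \x leb]_z (pot u z * ((phi z.1 - psi z.1) - (phi z.2 - psi z.2)))%:E.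
  rewrite -integralD//; apply: eq_integral => z _; rewrite -EFinD; congr (_%:E); ring.
have -> : \int[leb]_(x in Omega) (phi x * f x)%:E = \int[leb]_(x in Omega) (psi x * f x)%:E +
   \int[leb]_(x in Omega) ((phi x - psi x) * f x)%:E.
  rewrite -integralD//; apply: eq_integral => x _; rewrite -EFinD; congr (_%:E); ring.
have HA : (`|fine (\int[leb \x leb]_z (pot u z * ((phi z.1 - psi z.1) - (phi z.2 - psi z.2)))%:E)|
    <= Lambda * (e * (fine (gag s u) + 1)))%R.
  rewrite -lee_fin -abse_EFin (fineK F3).
  apply: (le_trans (le_abse_integral _ measurableT (measurable_int _ I3))).
  apply: (le_trans (form_le e0 mu mD (pot_le u))).
  rewrite EFinM; apply: lee_wpmul2l; first by rewrite lee_fin (le_trans _ Lam1).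
  rewrite mulrDr EFinD mulr1 EFinM (fineK gufin); apply: leeD; first exact: lexx.
  by rewrite lee_pdivrMl// -EFinM.
have HB : (`|fine (\int[leb]_(x in Omega) ((phi x - psi x) * f x)%:E)|
    <= Fb * (e * (fine (leb Omega) + 1)))%R.
  rewrite -lee_fin -abse_EFin (fineK F5).
  apply: (le_trans (le_abse_integral _ mO (measurable_int _ I5))).
  apply: (@le_trans _ _ (\int[leb]_(x in Omega) (Fb%:E * (e%:E + e^-1%:E * ((phi x - psi x) ^+ 2)%:E)))).
    apply: le_integral_ge0 => // x _.
    - by rewrite mule_ge0 ?adde_ge0 ?mule_ge0 ?lee_fin ?sqr_ge0 ?invr_ge0 ?(ltW e0).
    - rewrite [leRHS](_ : _ = (Fb * (e + e^-1 * (phi x - psi x) ^+ 2))%:E)//.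
      rewrite lee_fin normrM mulrC ler_pM//.
      have := @young_weight R e 1 `|phi x - psi x|%R e0 ler01 (normr_ge0 _).
      by rewrite mul1r expr1n mulr1 (real_normK (num_real _)).
  have mD2 : measurable_fun setT (fun x => ((phi x - psi x) ^+ 2)%:E) by mfun.
  have P2 x : 0 <= ((phi x - psi x) ^+ 2)%:E by rewrite lee_fin sqr_ge0.
  have ie0 : (0 <= e^-1)%R by rewrite invr_ge0 ltW.
  rewrite ge0_integralZl_EFin//; last 2 first.
  - by move=> x _; rewrite adde_ge0 ?mule_ge0// lee_fin ltW.
  - by apply: measurable_funTS; apply: emeasurable_funD => //; exact: measurable_funeM.
  rewrite EFinM; apply: lee_wpmul2l; first by rewrite lee_fin.
  rewrite ge0_integralD//; last 3 first.
  - by move=> x _; rewrite lee_fin ltW.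
  - by move=> x _; rewrite mule_ge0.
  - by apply: measurable_funTS; exact: measurable_funeM.
  rewrite integral_cst// mulrDr EFinD mulr1 EFinM fineK ?ge0_fin_numE//; apply: leeD; first exact: lexx.
  rewrite ge0_integralZl_EFin//; last exact: measurable_funTS.
  rewrite lee_pdivrMl// -EFinM; apply: le_trans lD.
  exact: le_integral_ge0.
rewrite -(fineK F1) -(fineK F2) -(fineK F3) -(fineK F5) -!EFinD -EFinM => /eqP; rewrite eqe => /eqP /=.
move: HA HB; set A' := fine (integral _ _ _); set B' := fine (integral _ _ _) => HA HB.
set A := fine (integral _ _ _); set B := fine (integral _ _ _) => Heq.
have -> : ((1 - s) * A - B = B' - (1 - s) * A')%R by move: Heq; rewrite mulrDr; clear; lra.
apply: le_trans (ler_normB _ _) _; rewrite normrM.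
have h := ler_wpM2l (normr_ge0 (1 - s)%R) HA.
apply: le_trans (lerD HB h) _.
rewrite le_eqVlt; apply/orP; left; apply/eqP; ring.
Qed.

End energy.

(** * The truncation [Psi] and the cut-off [zeta] *)

Section truncation.
Context {R : realType}.
Variables kap del : R.
Hypothesis kap0 : 0 < kap.
Hypothesis del0 : 0 < del.

(* The primitive of [(kap + t)^(-1-del)] vanishing at 0: increasing and bounded. *)
Definition psi_half (t : R) : R := (kap `^ (- del) - (kap + t) `^ (- del)) / del.

(** The mean value theorem, the derivative [(kap + t)^(-1-del)] being decreasing: its values at [a]
    and at 0 bound it from below and from above. *)
Lemma psi_half_incr (b a : R) : 0 <= b -> b <= a ->
  (a - b) * (kap + a) `^ (- (1 + del)) <= psi_half a - psi_half b <= (a - b) * kap `^ (- (1 + del)).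
Proof.
move=> b0 ba; have [<-|ab] := eqVneq b a; first by rewrite !subrr !mul0r lexx.
have {}ba : b < a by rewrite lt_neqAle ab.
pose df (t : R) : R := (kap + t) `^ (- (1 + del)).
have D (t : R) : 0 <= t -> is_derive t 1 psi_half (df t).
  move=> t0; have kt : 0 < kap + t by rewrite ltr_wpDr.
  have d1 : is_derive t 1 (fun t : R => kap + t) (1 : R).
    have := is_deriveD (is_derive_cst kap t 1) (is_derive_id t (1 : R)).
    by rewrite add0r.
  have d2 := is_derive1_comp (is_derive1_powR (- del) kt) d1.
  have d3 := is_deriveM (is_deriveB (is_derive_cst (kap `^ (- del)) t 1) d2) (is_derive_cst (del^-1) t 1).
  apply: (@is_derive_eq _ _ _ _ _ _ _ _ d3).
  rewrite /df /GRing.scale/= opprD (addrC (-1)) mulr0 add0r sub0r mulr1 mulNr opprK.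
  by rewrite mulKf// gt_eqF.
have [c /[!in_itv]/= /andP[bc ca] ->] : exists2 c, c \in `]b, a[ & psi_half a - psi_half b = df c * (a - b).
  apply: MVT => //.
    by move=> x /[!in_itv]/= /andP[bx _]; apply: D; rewrite ltW// (le_lt_trans b0).
  apply: derivable_within_continuous => x /[!in_itv]/= /andP[bx _].
  by case: (D x (le_trans b0 bx)).
have c0 : 0 <= c by rewrite ltW// (le_lt_trans b0).
have ab0 : 0 <= a - b by rewrite subr_ge0 ltW.
have d10 : 0 <= 1 + del by rewrite addr_ge0// ltW.
have a0 : 0 <= a by exact: le_trans b0 (ltW ba).
have P (x y : R) : 0 <= x -> x <= y -> (kap + y) `^ (- (1 + del)) <= (kap + x) `^ (- (1 + del)).
  move=> x0 xy; have y0 := le_trans x0 xy.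
  rewrite !powRN lef_pV2 ?posrE ?powR_gt0 ?ltr_wpDr//.
  by apply: ge0_ler_powR => //; rewrite ?nnegrE ?lerD2l// addr_ge0// ltW.
rewrite [df c * _]mulrC /df; apply/andP; split; apply: ler_wpM2l => //; first exact: P (ltW ca).
by rewrite -[X in _ <= X `^ _]addr0; exact: P.
Qed.

Lemma psi_half0 : psi_half 0 = 0.
Proof. by rewrite /psi_half addr0 subrr mul0r. Qed.

Lemma psi_half_le t : psi_half t <= kap `^ (- del) / del.
Proof.
by rewrite ler_wpM2r ?invr_ge0 ?(ltW del0)// lerBlDr lerDl powR_ge0.
Qed.

Lemma psi_half_ge0 t : 0 <= t -> 0 <= psi_half t.
Proof.
move=> t0; have /andP[h _] := psi_half_incr (lexx 0) t0.
by rewrite psi_half0 !subr0 in h; apply: le_trans h; rewrite mulr_ge0// powR_ge0.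
Qed.

Definition Psi (t : R) : R := if 0 <= t then psi_half t else - psi_half (- t).

Definition psi_sup : R := kap `^ (- del) / del.

Lemma Psi_sup t : `|Psi t| <= psi_sup.
Proof.
rewrite /Psi; case: ifPn => t0; first by rewrite ger0_norm ?psi_half_ge0// psi_half_le.
rewrite normrN ger0_norm ?psi_half_le// psi_half_ge0// oppr_ge0 ltW// ltNge//.
Qed.

Lemma psi_sup_gt0 : 0 < psi_sup. Proof. by rewrite divr_gt0// powR_gt0. Qed.

(** For arguments of opposite sign the increment splits at 0 into two one-sided ones. The weight at
    [kap + |a| + |b|] is below both of theirs, so one formula serves every sign pattern. *)
Lemma Psi_incr b a : b <= a ->
  (a - b) * (kap + `|a| + `|b|) `^ (- (1 + del)) <= Psi a - Psi b <= (a - b) * kap `^ (- (1 + del)).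
Proof.
move=> ba.
have W (x y z : R) : 0 <= x -> 0 <= y -> x <= y -> 0 <= z ->
    z * (kap + y) `^ (- (1 + del)) <= z * (kap + x) `^ (- (1 + del)).
  move=> x0 y0 xy z0; apply: ler_wpM2l => //.
  rewrite !powRN lef_pV2 ?posrE ?powR_gt0 ?ltr_wpDr//.
  by apply: ge0_ler_powR; rewrite ?nnegrE ?addr_ge0 ?(ltW kap0) ?(ltW del0)// lerD2l.
have ab0 : 0 <= a - b by rewrite subr_ge0.
have n1 := normr_ge0 a; have n2 := normr_ge0 b.
rewrite -addrA /Psi; case: (leP 0 a) => a0; case: (leP 0 b) => b0.
- have /andP[h1 h2] := psi_half_incr b0 ba; rewrite h2 andbT (le_trans _ h1)//.
  by apply: W => //; rewrite ?addr_ge0// ger0_norm// lerDl.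
- have /andP[h1 h2] := psi_half_incr (lexx 0) a0.
  have nb : 0 <= - b by rewrite oppr_ge0 ltW.
  have /andP[h3 h4] := psi_half_incr (lexx 0) nb.
  rewrite psi_half0 !subr0 in h1 h2 h3 h4.
  rewrite opprK; apply/andP; split; last by rewrite mulrBl -mulNr lerD.
  rewrite mulrBl -mulNr lerD// ?(le_trans _ h1)// ?(le_trans _ h3)//; apply: W; rewrite ?addr_ge0//.
    by rewrite ger0_norm// lerDl.
  by rewrite (ltr0_norm b0) lerDr.
- by have := lt_le_trans a0 (le_trans b0 ba); rewrite ltxx.
- have na : 0 <= - a by rewrite oppr_ge0 ltW.
  have nba : - a <= - b by rewrite lerN2.
  have /andP[h1 h2] := psi_half_incr na nba.
  have E : - psi_half (- a) - - psi_half (- b) = psi_half (- b) - psi_half (- a) by ring.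
  have E2 : - b - - a = a - b by ring.
  rewrite E; rewrite E2 in h1 h2; rewrite h2 andbT (le_trans _ h1)//.
  apply: W => //; first by rewrite oppr_ge0 ltW.
  by rewrite (ltr0_norm b0) lerDr.
Qed.

Lemma Psi_mono a b :
  (kap + `|a| + `|b|) `^ (- (1 + del)) * (a - b) ^+ 2 <= (Psi a - Psi b) * (a - b).
Proof.
have [ba|ab] := leP b a.
  have /andP[h _] := Psi_incr ba.
  have ab0 : 0 <= a - b by rewrite subr_ge0.
  by rewrite expr2 mulrA; apply: ler_wpM2r => //; rewrite mulrC.
have /andP[h _] := Psi_incr (ltW ab).
have ab0 : 0 <= b - a by rewrite subr_ge0 ltW.
have := ler_wpM2r ab0 h; rewrite -(addrA _ `|a|) (addrC `|a|) addrA.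
by move: (_ `^ _) => W; nra.
Qed.

Lemma Psi_lip a b : `|Psi a - Psi b| <= kap `^ (- (1 + del)) * `|a - b|.
Proof.
wlog ba : a b / b <= a.
  by move=> H; have [/H//|/ltW/H] := leP b a; rewrite distrC (distrC b).
have /andP[h1 h2] := Psi_incr ba.
have ab0 : 0 <= a - b by rewrite subr_ge0.
by rewrite (ger0_norm ab0) mulrC ger0_norm// (le_trans _ h1)// mulr_ge0// powR_ge0.
Qed.

Lemma measurable_Psi : measurable_fun setT Psi.
Proof.
apply: continuous_measurable_fun => x; apply/cvgrPdist_lt => e e0.
have L0 : 0 < kap `^ (- (1 + del)) by rewrite powR_gt0.
apply/nbhs_ballP; exists (e / kap `^ (- (1 + del))); first by rewrite /= divr_gt0.
move=> y xy; apply: le_lt_trans (Psi_lip _ _) _.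
by rewrite mulrC -ltr_pdivlMr.
Qed.

End truncation.

Section cutoff.
Context {R : realType} {n : nat}.
Notation Rn := 'rV[R]_n.
Variables (x0 : Rn) (r : R).
Hypothesis r0 : 0 < r.

Definition zeta (x : Rn) : R := Num.max 0 (Num.min 1 (2 - `|x - x0| / r)).

Lemma zeta_ge0 x : 0 <= zeta x. Proof. by rewrite /zeta le_max lexx. Qed.

Lemma zeta_le1 x : zeta x <= 1.
Proof. by rewrite /zeta ge_max ler01 ge_min lexx. Qed.

Lemma zeta_eq1 x : `|x - x0| <= r -> zeta x = 1.
Proof.
move=> xr; have h : `|x - x0| / r <= 1 by rewrite ler_pdivrMr// mul1r.
by rewrite /zeta min_l ?max_r//; lra.
Qed.

Lemma zeta_eq0 x : 2 * r <= `|x - x0| -> zeta x = 0.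
Proof.
move=> xr; have h : 2 <= `|x - x0| / r by rewrite ler_pdivlMr.
by rewrite /zeta max_l// ge_min; apply/orP; right; lra.
Qed.

Lemma zeta_lip x y : `|zeta x - zeta y| <= `|x - y| / r.
Proof.
have mm (a b : R) : `|Num.max 0 (Num.min 1 a) - Num.max 0 (Num.min 1 b)| <= `|a - b|.
  by rewrite /Num.max /Num.min; repeat case: ifPn; rewrite ?ltNge ?negbK => *;
    rewrite ler_norml; apply/andP; split; have := ler_norm (a - b);
    have := ler_norm (- (a - b)); rewrite normrN; lra.
apply: le_trans (mm _ _) _.
rewrite (_ : _ - _ = (`|y - x0| - `|x - x0|) / r); last by field; rewrite gt_eqF.
rewrite normrM (gtr0_norm (_ : 0 < r^-1)) ?invr_gt0// ler_wpM2r ?invr_ge0 ?(ltW r0)//.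
by apply: le_trans (ler_dist_dist _ _) _; rewrite opprB addrA subrK distrC.
Qed.

Lemma measurable_zeta : measurable_fun setT zeta.
Proof.
apply: measurable_maxr; first exact: measurable_cst.
by apply: measurable_minr; [exact: measurable_cst|mfun].
Qed.

End cutoff.

(** * The pointwise Caccioppoli inequality *)

Section pointwise.
Context {R : realType}.

(* [A] plays the role of the difference of the fluxes, [p], [q] of the cutoff
   at the two points, [om] of the inverse weight. *)
Lemma caccioppoli_pointwise (Lam A wd k p q Pa Pb om K : R) :
  1 <= Lam -> 0 <= k -> 0 <= p -> 0 <= q -> 0 < om -> 0 <= K ->
  `|A| <= Lam * `|wd| * k -> Lam^-1 * wd ^+ 2 * k <= A * wd ->
  om * wd ^+ 2 <= (Pa - Pb) * wd -> `|Pa| <= K -> `|Pb| <= K ->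
  (4 * Lam)^-1 * ((p ^+ 2 + q ^+ 2) * (om * wd ^+ 2 * k)) <=
  A * (p ^+ 2 * Pa - q ^+ 2 * Pb) + 2 * Lam ^+ 3 * K ^+ 2 * ((p - q) ^+ 2 * om^-1 * k).
Proof.
move=> L1 k0 p0 q0 om0 K0 Ale Amono Pmono PaK PbK.
have L0 : 0 < Lam by exact: lt_le_trans L1.
(* Both monotonicity hypotheses carry a factor [wd]: they are multiplied together and divided by
   [wd^2]. If [wd = 0], the growth bound forces [A = 0]. *)
have H1 : Lam^-1 * (om * wd ^+ 2 * k) <= A * (Pa - Pb).
  have [w0|w0] := eqVneq wd 0.
    have -> : A = 0 by apply/eqP; rewrite -normr_le0 (le_trans Ale)// w0 normr0 mulr0 mul0r.
    by rewrite w0 expr0n/= mulr0 mul0r mulr0 mul0r.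
  have wd2 : 0 < wd ^+ 2 by rewrite exprn_even_gt0.
  rewrite -(ler_pM2r wd2).
  rewrite [leLHS](_ : _ = (Lam^-1 * wd ^+ 2 * k) * (om * wd ^+ 2)); last by ring.
  rewrite [leRHS](_ : _ = (A * wd) * ((Pa - Pb) * wd)); last by ring.
  apply: ler_pM => //; last by rewrite mulr_ge0 ?sqr_ge0// ltW.
  by apply: mulr_ge0 => //; apply: mulr_ge0; rewrite ?sqr_ge0// invr_ge0 ltW.
have H2 : `|(p - q) * (p + q) * (A * (Pa + Pb) / 2)| <=
    (4 * Lam)^-1 * ((p ^+ 2 + q ^+ 2) * (om * wd ^+ 2 * k)) +
    2 * Lam ^+ 3 * K ^+ 2 * ((p - q) ^+ 2 * om^-1 * k).
  apply: (@le_trans _ _ ((p + q) * `|wd| * (Lam * K * `|p - q|) * k)).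
    have pq0 : 0 <= p + q by rewrite addr_ge0.
    rewrite !normrM (ger0_norm pq0) (ger0_norm (_ : 0 <= 2^-1)) ?invr_ge0//.
    have h : `|A| * `|Pa + Pb| / 2 <= Lam * `|wd| * k * K.
      rewrite -mulrA ler_pM// ?mulr_ge0 ?invr_ge0//.
      have := ler_normD Pa Pb; lra.
    rewrite [leRHS](_ : _ = `|p - q| * (p + q) * (Lam * `|wd| * k * K)); last by ring.
    by apply: ler_wpM2l => //; rewrite mulr_ge0.
  (* The Young weight for which, using [(p + q)^2 <= 2 * (p^2 + q^2)], the cross term consumes
     exactly half of the coercive term. *)
  have t0 : 0 < om / (8 * Lam) by rewrite divr_gt0// mulr_gt0.
  set X := (p + q) * `|wd|; set Y := Lam * K * `|p - q|.
  have XY : X * Y <= om / (8 * Lam) * X ^+ 2 + (4 * (om / (8 * Lam)))^-1 * Y ^+ 2.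
    set t := om / (8 * Lam) in t0 *.
    have t4 : 0 < 4 * t by rewrite mulr_gt0.
    rewrite -(ler_pM2l t4) mulrDr (mulVKf (lt0r_neq0 t4)).
    have := sqr_ge0 (2 * t * X - Y); nra.
  apply: le_trans (ler_wpM2r k0 XY) _; rewrite mulrDl lerD//.
    rewrite [leRHS](_ : _ = om / (8 * Lam) * (2 * (p ^+ 2 + q ^+ 2) * wd ^+ 2) * k); last first.
      by field; rewrite gt_eqF.
    apply: ler_wpM2r => //; apply: ler_wpM2l; first exact: ltW.
    rewrite /X exprMn (real_normK (num_real _)); apply: ler_wpM2r; first exact: sqr_ge0.
    by have := sqr_ge0 (p - q); nra.
  rewrite le_eqVlt; apply/orP; left; apply/eqP.
  rewrite /Y exprMn (real_normK (num_real _)); field.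
  by rewrite !gt_eqF.
have := ler_wpM2l (_ : 0 <= (p ^+ 2 + q ^+ 2) / 2) H1.
rewrite divr_ge0 ?addr_ge0 ?sqr_ge0// => /(_ isT) H3.
(* Discrete product rule: a symmetric part, coercive by [H1], and a part with the increment [p - q]
   of the cut-off, bounded by [H2]. *)
have E : A * (p ^+ 2 * Pa - q ^+ 2 * Pb) = (p ^+ 2 + q ^+ 2) / 2 * (A * (Pa - Pb)) +
   (p - q) * (p + q) * (A * (Pa + Pb) / 2) by field.
have E2 : (p ^+ 2 + q ^+ 2) / 2 * (Lam^-1 * (om * wd ^+ 2 * k)) =
  2 * ((4 * Lam)^-1 * ((p ^+ 2 + q ^+ 2) * (om * wd ^+ 2 * k))) by field; rewrite gt_eqF.
move: H2; rewrite ler_norml => /andP[H2 _]; rewrite E; rewrite E2 in H3.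
by move: H2 H3; move: (_ * om^-1 * k) ((p ^+ 2 + q ^+ 2) * (_ * k)) => Z1 Z2; lra.
Qed.

End pointwise.

(** * Double integrals: shifts, symmetric kernels, the energy of the cut-off *)

Section double_integrals.
Context {R : realType} {n : nat}.
Notation Rn := 'rV[R]_n.
Notation leb := (@lebesgue_rV R n).
Local Open Scope ereal_scope.

Lemma product_integralE (F : Rn -> Rn -> R) : (forall x y, (0 <= F x y)%R) ->
  measurable_fun setT (fun z : Rn * Rn => F z.1 z.2) ->
  \int[leb \x leb]_z (F z.1 z.2)%:E = \int[leb]_x \int[leb]_y (F x y)%:E.
Proof.
move=> F0 mF.
rewrite -(@product_tonelli_in _ _ Rn Rn R leb leb setT setT (fun x y => (F x y)%:E)) ?setXTT//.
by mfun.
Qed.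

Lemma ge0_product_integral_shift (h : Rn) (F : Rn * Rn -> \bar R) : (forall z, 0 <= F z) ->
  measurable_fun setT F ->
  \int[leb \x leb]_z F (z.1 + h, z.2 + h)%R = \int[leb \x leb]_z F z.
Proof.
move=> F0 mF.
have mS : measurable_fun setT (fun z : Rn * Rn => (z.1 + h, z.2 + h)%R).
  by apply/measurable_fun_pair => /=; mfun.
have mF' : measurable_fun setT (fun z : Rn * Rn => F (z.1, z.2)).
  by rewrite (_ : (fun z => _) = F)//; apply/funext => -[].
have -> : \int[leb \x leb]_z F z = \int[leb \x leb]_z F (z.1, z.2).
  by apply: eq_integral => -[].
rewrite -setXTT (@product_tonelli_in _ _ Rn Rn R leb leb setT setT (fun x y => F (x, y)))//.
rewrite (@product_tonelli_in _ _ Rn Rn R leb leb setT setT (fun x y => F (x + h, y + h)%R) measurableT measurableT (measurableT_comp mF mS)); last first.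
  by move=> x y; exact: F0.
have mg : measurable_fun setT (fun x : Rn => \int[leb]_y F (x, y)).
  exact: (@measurable_integral_in _ _ Rn Rn R leb setT (fun x y => F (x, y))).
rewrite -[RHS](@ge0_integral_rV_shift R n h _ mg); last by move=> x; exact: integral_ge0.
apply: eq_integral => x _.
rewrite -[RHS](@ge0_integral_rV_shift R n h)//.
exact: (measurableT_comp mF (pair1_measurable _)).
Qed.

Lemma product_integral_shift (h : Rn) (F : Rn * Rn -> R) : measurable_fun setT F ->
  \int[leb \x leb]_z (F (z.1 + h, z.2 + h)%R)%:E = \int[leb \x leb]_z (F z)%:E.
Proof.
move=> mF; have mE : measurable_fun setT (fun z => (F z)%:E) by mfun.
rewrite integralE [RHS]integralE; congr (_ - _)%E.
- rewrite -[RHS](ge0_product_integral_shift h (funepos_ge0 _) (measurable_funepos mE)).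
  by apply: eq_integral => x _; rewrite !funeposE.
- rewrite -[RHS](ge0_product_integral_shift h (funeneg_ge0 _) (measurable_funeneg mE)).
  by apply: eq_integral => x _; rewrite !funenegE.
Qed.

(** [B] may change sign, so its integral cannot be bounded by pointwise domination; it is
    integrable, and the inequality [L <= B + Q] is integrated by linearity. When [Q] has infinite
    integral there is nothing to prove. *)
Lemma integral_le_signed d (T : measurableType d) (m : {measure set T -> \bar R})
    (L B Q : T -> R) (b : \bar R) : (forall z, (0 <= L z)%R) -> (forall z, (0 <= Q z)%R) ->
  measurable_fun setT L -> measurable_fun setT Q ->
  m.-integrable setT (fun z => (B z)%:E) ->
  (forall z, (L z <= B z + Q z)%R) -> \int[m]_z (B z)%:E <= b ->
  \int[m]_z (L z)%:E <= b + \int[m]_z (Q z)%:E.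
Proof.
move=> L0 Q0 mL mQ iB LBQ Bb.
have bN : b != -oo.
  by move: Bb; rewrite -(fineK (integrable_fin_num measurableT iB)); case: b.
have [Qoo|Qoo] := eqVneq (\int[m]_z (Q z)%:E) +oo.
  by rewrite Qoo addey ?leey.
have iQ : m.-integrable setT (fun z => (Q z)%:E).
  apply/integrableP; split; first by mfun.
  under eq_integral do rewrite /= ger0_norm//.
  by rewrite lt_neqAle Qoo leey.
apply: (@le_trans _ _ (\int[m]_z ((B z)%:E + (Q z)%:E))).
  apply: le_integral_ge0 => [//|z _|z _|z _]; rewrite ?lee_fin//.
  exact: le_trans (L0 z) (LBQ z).
by rewrite integralD//; exact: leeD.
Qed.

Lemma integral_split (A : set Rn) (f : Rn -> \bar R) : measurable A ->
  measurable_fun setT f -> (forall x, 0 <= f x) ->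
  \int[leb]_x f x = \int[leb]_(x in A) f x + \int[leb]_(x in ~` A) f x.
Proof.
move=> mA mf f0; rewrite -(setUv A) ge0_integral_setU//.
- exact: measurableC.
- by rewrite setUv.
- exact/disj_setPCl.
Qed.

Lemma symmetric_product (F : Rn -> Rn -> R) (g : Rn -> R) : (forall x y, (0 <= F x y)%R) ->
  (forall x y, F x y = F y x) -> (forall x, (0 <= g x)%R) ->
  measurable_fun setT (fun z : Rn * Rn => F z.1 z.2) -> measurable_fun setT g ->
  \int[leb \x leb]_z (F z.1 z.2 * (g z.1 + g z.2))%:E =
  2%:E * \int[leb]_x ((g x)%:E * \int[leb]_e (F x (x + e)%R)%:E).
Proof.
move=> F0 FC g0 mF mg.
have mFx (x : Rn) : measurable_fun setT (fun y => (F x y)%:E).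
  by apply: mf_EFin; exact: (measurableT_comp mF (pair1_measurable _)).
have m1 : measurable_fun setT (fun z : Rn * Rn => F z.1 z.2 * g z.1)%R by mfun.
have m2 : measurable_fun setT (fun z : Rn * Rn => F z.1 z.2 * g z.2)%R by mfun.
have p1 (x y : Rn) : (0 <= F x y * g x)%R by rewrite mulr_ge0.
have p2 (x y : Rn) : (0 <= F x y * g y)%R by rewrite mulr_ge0.
have H : \int[leb]_x \int[leb]_y (F x y * g x)%:E = \int[leb]_x ((g x)%:E * \int[leb]_e (F x (x + e)%R)%:E).
  apply: eq_integral => x _.
  under eq_integral do rewrite mulrC EFinM.
  rewrite ge0_integralZl_EFin; [|exact: measurableT|by move=> y _; rewrite lee_fin|exact: mFx|exact: g0].
  congr (_ * _); rewrite -(ge0_integral_rV_shift x (mFx x)); last by move=> y; rewrite lee_fin.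
  by apply: eq_integral => y _; rewrite addrC.
under eq_integral do rewrite mulrDr EFinD.
rewrite ge0_integralD; [|exact: measurableT|by move=> z _; rewrite lee_fin|by mfun|by move=> z _; rewrite lee_fin|by mfun].
rewrite (@product_integralE (fun x y => F x y * g x)%R p1 m1).
rewrite (@product_integralE (fun x y => F x y * g y)%R p2 m2).
have -> : \int[leb]_x \int[leb]_y (F x y * g y)%:E = \int[leb]_x \int[leb]_y (F x y * g x)%:E.
  transitivity (\int[leb]_y \int[leb]_x (F x y * g y)%:E).
    apply: (@tonelli_in _ _ Rn Rn R leb leb setT setT (fun x y : Rn => (F x y * g y)%:E)).
    - exact: measurableT.
    - exact: measurableT.
    - exact: mf_EFin.
    - by move=> x y; rewrite lee_fin.
  by apply: eq_integral => x _; apply: eq_integral => y _; rewrite FC.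
by rewrite H -mule2n -mule_natl.
Qed.

Lemma convolution_mass (v g : Rn -> R) : (forall e, (0 <= v e)%R) -> (forall e, v (- e)%R = v e) ->
  (forall x, (0 <= g x)%R) -> measurable_fun setT v -> measurable_fun setT g ->
  \int[leb \x leb]_z (v (z.1 - z.2) * (g z.1 + g z.2))%:E =
  2%:E * (\int[leb]_e (v e)%:E * \int[leb]_x (g x)%:E).
Proof.
move=> v0 vN g0 mv mg.
rewrite (@symmetric_product (fun x y => v (x - y)%R)); [|by []|by move=> x y; rewrite -vN opprB|by []|by mfun|by []].
congr (_ * _); rewrite muleC -ge0_integralZr; last 4 first.
- exact: measurableT.
- by mfun.
- by move=> x _; rewrite lee_fin.
- by apply: integral_ge0 => x _; rewrite lee_fin.
apply: eq_integral => x _; congr (_ * _); apply: eq_integral => e _; congr (_%:E).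
by rewrite opprD addrA subrr add0r vN.
Qed.

Lemma mem_ballE (x0 x : Rn) (rho : R) : (x \in (ball x0 rho : set Rn)) = (`|x - x0| < rho)%R.
Proof. by apply/idP/idP; rewrite inE -ball_normE/= distrC. Qed.

Variable s : R.
Hypothesis s01 : (0 < s < 1)%R.
Let s0 : (0 < s)%R. Proof. by case/andP: s01. Qed.

Lemma gag_shift (h : Rn) (u : Rn -> R) : measurable_fun setT u ->
  gag s (fun x => u (x + h)%R) = gag s u.
Proof.
move=> mu; apply: eq_integral => e _.
rewrite -[RHS](@ge0_integral_rV_shift R n h).
- by apply: eq_integral => x _; rewrite addrAC.
- by mfun.
- by move=> x; rewrite lee_fin mulr_ge0 ?sqr_ge0 ?kern_ge0.
Qed.

Lemma gag_le_lin (a b : R) (f g1 g2 : Rn -> R) : (0 <= a)%R -> (0 <= b)%R ->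
  measurable_fun setT f -> measurable_fun setT g1 -> measurable_fun setT g2 ->
  (forall x y, ((f x - f y) ^+ 2 <= a * (g1 x - g1 y) ^+ 2 + b * (g2 x - g2 y) ^+ 2)%R) ->
  gag s g1 < +oo -> gag s g2 < +oo -> gag s f < +oo.
Proof.
move=> a0 b0 mf m1 m2 H G1 G2; have mk := @measurable_kern R n s.
have nn (k : Rn -> R) (z : Rn * Rn) : 0 <= ((k z.1 - k z.2) ^+ 2 * kern s (z.1 - z.2))%:E.
  by rewrite lee_fin mulr_ge0 ?sqr_ge0 ?kern_ge0.
apply: (@le_lt_trans _ _ (a%:E * gag s g1 + b%:E * gag s g2)); last first.
  by apply: lte_add_pinfty; apply: lte_mul_pinfty;
    [rewrite lee_fin|exact: isT|exact: G1|rewrite lee_fin|exact: isT|exact: G2].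
rewrite !gag_prod//.
rewrite -!ge0_integralZl_EFin//; [|by mfun|by mfun].
rewrite -ge0_integralD//; last 4 first.
- by move=> z _; rewrite mule_ge0.
- by apply: measurable_funeM; mfun.
- by move=> z _; rewrite mule_ge0.
- by apply: measurable_funeM; mfun.
apply: le_integral_ge0 => [//|z _|z _|z _].
- exact: nn.
- by rewrite adde_ge0// mule_ge0.
rewrite [leRHS](_ : _ = ((a * (g1 z.1 - g1 z.2) ^+ 2 + b * (g2 z.1 - g2 z.2) ^+ 2) * kern s (z.1 - z.2))%:E).
  by rewrite lee_fin ler_wpM2r// kern_ge0.
by rewrite mulrDl EFinD -!EFinM !mulrA.
Qed.

Lemma integral_ball_ind (x0 : Rn) (rho : R) (g : Rn -> R) :
  \int[leb]_x (((`|x - x0| < rho)%R)%:R * g x)%:E = \int[leb]_(x in ball x0 rho) (g x)%:E.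
Proof.
rewrite [RHS]integral_mkcond; apply: eq_integral => x _; rewrite patchE mem_ballE.
by case: ifPn; rewrite ?mul1r ?mul0r.
Qed.

Lemma integral_ball_ind1 (x0 : Rn) (rho : R) : (0 < rho)%R ->
  \int[leb]_x (((`|x - x0| < rho)%R)%:R)%:E = ((2 * rho) ^+ n)%:E.
Proof.
move=> r0; rewrite -(lebesgue_rV_ball x0 r0) -[RHS]mul1e.
rewrite -integral_cst; last exact: measurable_rV_ball.
rewrite -(integral_ball_ind _ _ (cst 1%R)).
by apply: eq_integral => x _; rewrite mulr1.
Qed.

(** The increment is at most [|e| / r] and at most 1, and vanishes unless [x] or [x + e] is in the
    ball of radius [2 * r], which accounts for the volume [2 * (4 * r)^n]. The first bound is
    integrated for [|e| < r], where [s < 1] is needed, the second beyond, where [s > 0] is. *)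
Lemma gag_zeta (x0 : Rn) (r : R) : (0 < r)%R -> gag s (zeta x0 r) < +oo.
Proof.
move=> r0; have mk := @measurable_kern R n s; have mz := @measurable_zeta R n x0 r.
pose c (x : Rn) : R := ((`|x - x0| < 2 * r)%R)%:R.
have mc : measurable_fun setT c by rewrite /c; mfun.
have c0 x : (0 <= c x)%R by rewrite /c.
have Ic : \int[leb]_x (c x)%:E = ((4 * r) ^+ n)%:E.
  by rewrite integral_ball_ind1 ?mulr_gt0// mulrA -natrM.
have key (m : R) (e : Rn) : (0 <= m)%R -> (forall x, ((zeta x0 r (x + e) - zeta x0 r x) ^+ 2 <= m)%R) ->
    \int[leb]_x ((zeta x0 r (x + e) - zeta x0 r x) ^+ 2 * kern s e)%:E <= (2 * (4 * r) ^+ n * (m * kern s e))%:E.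
  move=> m0 Hm.
  have mk0 : (0 <= m * kern s e)%R by rewrite mulr_ge0 ?kern_ge0.
  apply: (@le_trans _ _ (\int[leb]_x ((m * kern s e)%:E * ((c (x + e)%R)%:E + (c x)%:E)))).
    apply: le_integral_ge0 => [//|x _|x _|x _].
    - by rewrite lee_fin mulr_ge0 ?sqr_ge0 ?kern_ge0.
    - by rewrite mule_ge0 ?adde_ge0 ?lee_fin.
    rewrite [leRHS](_ : _ = (m * (c (x + e) + c x) * kern s e)%:E)%R; last by rewrite mulrAC.
    rewrite lee_fin; apply: ler_wpM2r; first exact: kern_ge0.
    have [h1|h1] := ltP `|x + e - x0|%R (2 * r)%R.
      by apply: le_trans (Hm x) _; rewrite ler_peMr// /c h1 lerDl.
    have [h2|h2] := ltP `|x - x0|%R (2 * r)%R.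
      by apply: le_trans (Hm x) _; rewrite ler_peMr// /c h2 lerDr.
    by rewrite !zeta_eq0// subrr expr0n/= mulr_ge0// addr_ge0.
  rewrite ge0_integralZl_EFin//; last 2 first.
  - by move=> x _; rewrite adde_ge0 ?lee_fin.
  - by apply: emeasurable_funD; mfun.
  rewrite ge0_integralD//; last 4 first.
  - by move=> x _; rewrite lee_fin.
  - by mfun.
  - by move=> x _; rewrite lee_fin.
  - by mfun.
  rewrite (@ge0_integral_rV_shift R n e (fun x => (c x)%:E)); [|by mfun|by move=> x; rewrite lee_fin].
  by rewrite Ic -EFinD -EFinM lee_fin le_eqVlt; apply/orP; left; apply/eqP; ring.
have mF : measurable_fun setT (fun e : Rn => \int[leb]_x ((zeta x0 r (x + e) - zeta x0 r x) ^+ 2 * kern s e)%:E).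
  apply: (@measurable_integral_in _ _ Rn Rn R leb setT
    (fun e x : Rn => ((zeta x0 r (x + e) - zeta x0 r x) ^+ 2 * kern s e)%:E)) => //; first by mfun.
  by move=> e x; rewrite lee_fin mulr_ge0 ?sqr_ge0 ?kern_ge0.
have mB : measurable (ball (0%R : Rn) r) by exact: measurable_rV_ball.
have F0 (e : Rn) : 0 <= \int[leb]_x ((zeta x0 r (x + e) - zeta x0 r x) ^+ 2 * kern s e)%:E.
  by apply: integral_ge0 => x _; rewrite lee_fin mulr_ge0 ?sqr_ge0 ?kern_ge0.
pose V : R := (2 * (4 * r) ^+ n)%R.
have V0 : (0 <= V)%R by rewrite mulr_ge0// exprn_ge0// mulr_ge0// ltW.
have P0 (t : R) (e : Rn) : (0 <= `|e| `^ t / `|e| ^+ n)%R by rewrite divr_ge0 ?powR_ge0 ?exprn_ge0.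
have mP (t : R) (A : set Rn) : measurable_fun A (fun e : Rn => (`|e| `^ t / `|e| ^+ n)%:E).
  apply: measurable_funTS; apply: mf_EFin; apply: mf_mul; first by mfun.
  exact: measurable_norm_expV.
rewrite /gag (integral_split mB mF F0); apply: lte_add_pinfty.
- apply: (@le_lt_trans _ _ (\int[leb]_(e in ball (0%R : Rn) r) ((V / r ^+ 2)%:E * (`|e| `^ (2 - 2 * s) / `|e| ^+ n)%:E))).
    apply: le_integral_ge0 => [//|e _|e _|e _]; [exact: F0|by rewrite -EFinM lee_fin mulr_ge0// divr_ge0// sqr_ge0|].
    apply: (le_trans (@key (`|e| ^+ 2 / r ^+ 2)%R e _ _)).
    - by rewrite divr_ge0 ?sqr_ge0.
    - move=> x; have := zeta_lip x0 r0 (x + e) x; rewrite addrAC subrr add0r => h.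
      rewrite -(real_normK (num_real (_ - _))) -expr_div_n.
      by rewrite lerXn2r ?nnegrE ?divr_ge0 ?(ltW r0).
    rewrite -EFinM lee_fin -/V; have := kern_le s0 e.
    have [->|e0] := eqVneq e 0%R.
      by move=> _; rewrite kern0// !mulr0 mulr_ge0// ?divr_ge0 ?sqr_ge0.
    have ne0 : (0 < `|e|)%R by rewrite normr_gt0.
    have -> : (`|e| `^ (2 - 2 * s) = `|e| ^+ 2 * `|e| `^ (- (2 * s)))%R.
      rewrite powRD; first by rewrite (powR_mulrn 2).
      by rewrite (gt_eqF ne0) implybT.
    set X := (`|e| `^ _)%R; set Y := kern s e => XY.
    rewrite [leRHS](_ : _ = V * ((`|e| ^+ 2 / r ^+ 2) * (X / `|e| ^+ n)))%R; last by ring.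
    by apply: (ler_wpM2l V0); apply: ler_wpM2l => //; rewrite divr_ge0 ?sqr_ge0.
  rewrite ge0_integralZl_EFin//; last by rewrite divr_ge0// sqr_ge0.
  apply: lte_mul_pinfty; [by rewrite lee_fin divr_ge0// sqr_ge0|by []|].
  apply: le_lt_trans (@integral_near_le R n (2 - 2 * s)%R r _ r0) _; last by rewrite ltry.
  by case/andP: s01 => _; lra.
- have E : ~` ball (0%R : Rn) r = [set e : Rn | (r <= `|e|)%R].
    by apply/seteqP; split => e /=; rewrite -ball_normE/= sub0r normrN leNgt => /negP.
  rewrite E; apply: (@le_lt_trans _ _ (\int[leb]_(e in [set e : Rn | (r <= `|e|)%R]) (V%:E * (`|e| `^ (- (2 * s)) / `|e| ^+ n)%:E))).
    apply: le_integral_ge0 => [//|e _|e _|e _]; [exact: F0|by rewrite -EFinM lee_fin mulr_ge0|].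
    apply: (le_trans (@key 1%R e ler01 _)).
      move=> x; rewrite -(real_normK (num_real (_ - _))) expr_le1// ler_norml.
      by have := zeta_ge0 x0 r x; have := zeta_ge0 x0 r (x + e); have := zeta_le1 x0 r x;
        have := zeta_le1 x0 r (x + e); lra.
    by rewrite -EFinM lee_fin mul1r -/V; apply: ler_wpM2l => //; exact: kern_le.
  rewrite ge0_integralZl_EFin//; last by rewrite -E; exact: measurableC.
  apply: lte_mul_pinfty; [by rewrite lee_fin|by []|].
  by apply: le_lt_trans (@integral_far_le R n (2 * s)%R r _ r0) _; rewrite ?mulr_gt0// ltry.
Qed.

End double_integrals.

(** * The energy estimate for differences of a weak solution *)

(** The largest of [kap], [a], [b] plays the role of [m], and [3^(1 + del) <= 9]. The result is a
    sum of a function of [a] and the same function of [b], as required by [convolution_mass]. *)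
Lemma powR_weight_le {R : realType} (kap del a b : R) : 0 < kap <= 1 -> 0 < del <= 1 -> 0 <= a -> 0 <= b ->
  (kap + a + b) `^ (1 + del) <= 9 / 2 * ((kap + 2 * a `^ (1 + del)) + (kap + 2 * b `^ (1 + del))).
Proof.
move=> /andP[kap0 kap1] /andP[del0 del1] a0 b0.
have p0 : 0 <= 1 + del by rewrite addr_ge0// ltW.
have A0 := powR_ge0 a (1 + del); have B0 := powR_ge0 b (1 + del).
have H (m : R) : 0 <= m -> kap + a + b <= 3 * m -> m `^ (1 + del) <= kap + a `^ (1 + del) + b `^ (1 + del) ->
   (kap + a + b) `^ (1 + del) <= 9 / 2 * ((kap + 2 * a `^ (1 + del)) + (kap + 2 * b `^ (1 + del))).
  move=> m0 h1 h2; apply: (@le_trans _ _ ((3 * m) `^ (1 + del))).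
    by apply: ge0_ler_powR => //; rewrite nnegrE ?addr_ge0 ?mulr_ge0// ltW.
  rewrite powRM//.
  have h3 : (3 : R) `^ (1 + del) <= 9.
    apply: (@le_trans _ _ ((3 : R) `^ 2%:R)).
      by apply: ler_powR; [rewrite ler1n|rewrite -natr1 addrC lerD2r].
    by rewrite powR_mulrn// expr2 -natrM.
  apply: le_trans (ler_pM (powR_ge0 _ _) (powR_ge0 _ _) h3 h2) _; lra.
have kk : kap `^ (1 + del) <= kap.
  by rewrite -[leRHS](powRr1 (ltW kap0)); apply: ger_powR; [rewrite kap0|rewrite lerDl ltW].
have [ab|ab] := leP a b.
  by have [bk|bk] := leP b kap; [apply: (H kap)|apply: (H b)] => //; lra.
by have [ak|ak] := leP a kap; [apply: (H kap)|apply: (H a)] => //; lra.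
Qed.

(** The four summands belong to the datum, to the cut-off error near the diagonal, to the Young term
    that converts weighted energy into L^1 differences, and to the far interactions. [3^n] and [2^n]
    are the ratios of [(6r)^n] and [(4r)^n] to [(2r)^n]; the leading 2 comes from [shift_average]
    with [c = 1]. *)
Definition energy_const {R : realType} (n : nat) (s Lambda : R) : R :=
  2 * (3 ^+ n * (8 * Lambda / (1 - s)) + 3 ^+ n * (72 * Lambda ^+ 4 * (4 ^+ n / (1 - 2 `^ (- (2 - 2 * s))))) +
    3 ^+ n * (9 * n%:R `^ (n%:R + s * 2) * 2 ^+ n * 4) + 2 ^+ n * (8 * Lambda ^+ 2)).

Section energy_estimate.
Context {R : realType} {n : nat}.
Notation Rn := 'rV[R]_n.
Notation leb := (@lebesgue_rV R n).
Variables (s Lambda : R) (Phi : R -> R).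
Hypothesis s01 : 0 < s < 1.
Hypothesis Lam1 : 1 <= Lambda.
Hypothesis HPhi : structure_assumption Lambda Phi.
Variable Omega : set Rn.
Hypothesis oO : open Omega.
Hypothesis bO : bounded_set Omega.
Variables (f u : Rn -> R) (Fb : R).
Hypothesis cf : continuous f.
Hypothesis fFb : forall x, (`|f x| <= Fb)%R.
Hypothesis mu : measurable_fun setT u.
Hypothesis gu : (gag s u < +oo)%E.
Hypothesis weak : weak_formulation s Phi Omega u (density_integral Omega f).
Variables (d r kap del : R) (h : Rn).
Hypothesis d0 : 0 < d.
Hypothesis r0 : 0 < r.
Hypothesis rd : r <= d.
Hypothesis hr : `|h| <= r.
Hypothesis kap01 : 0 < kap <= 1.
Hypothesis del01 : 0 < del <= 1.

Let s0 : 0 < s. Proof. by case/andP: s01. Qed.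
Let s1 : 0 < 1 - s. Proof. by case/andP: s01 => _; rewrite subr_gt0. Qed.
Let kap0 : 0 < kap. Proof. by case/andP: kap01. Qed.
Let del0 : 0 < del. Proof. by case/andP: del01. Qed.
Let L0 : 0 < Lambda. Proof. exact: lt_le_trans Lam1. Qed.
Let mO : measurable Omega. Proof. exact: rV_open_measurable. Qed.
Let Ofin : (leb Omega < +oo)%E. Proof. exact: bounded_set_lebesgue. Qed.
Let Kp := psi_sup kap del.
Let Kp0 : 0 <= Kp. Proof. by rewrite ltW// psi_sup_gt0. Qed.
Let uh (x : Rn) : R := u (x + h).
Let muh : measurable_fun setT uh. Proof. exact: rV_shift_measurable. Qed.
Let w (x : Rn) : R := u (x + h) - u x.
Let mw : measurable_fun setT w. Proof. by rewrite /w; mfun. Qed.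
(** The test function. Subtracting the constant [w x0] does not affect differences of [w], but makes
    the moments in the error terms those of [w x - w x0], which are second differences of [u]. *)
Let ps (x0 x : Rn) : R := zeta x0 r x ^+ 2 * Psi kap del (w x - w x0).

Let mps x0 : measurable_fun setT (ps x0).
Proof.
have mz := @measurable_zeta R n x0 r; have mP := measurable_Psi kap0 del0.
by rewrite /ps; mfun.
Qed.

Let psK x0 x : `|ps x0 x| <= Kp.
Proof.
have z0 := zeta_ge0 x0 r x; have z1 := zeta_le1 x0 r x.
rewrite normrM (ger0_norm (sqr_ge0 _)) -[leRHS]mul1r ler_pM ?sqr_ge0 ?Psi_sup//.
by rewrite expr_le1.
Qed.

Let ps_supp x0 x : ps x0 x != 0 -> `|x - x0| < 2 * r.
Proof.
apply: contra_neqT; rewrite -leNgt => H.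
by rewrite /ps zeta_eq0// expr0n/= mul0r.
Qed.

Local Open Scope ereal_scope.

Let gw : gag s w < +oo.
Proof.
apply: (@gag_le_lin _ _ s 2 2 w uh u (ler0n _ _) (ler0n _ _) mw muh mu); [|by rewrite gag_shift|exact: gu].
by move=> x y; rewrite /w /uh; have := sqr_ge0 ((u (x + h) - u (y + h)) + (u x - u y))%R; lra.
Qed.

(** By the product rule the increments of [ps x0] are controlled by those of the cut-off, times the
    bound of [Psi], and by those of [w], times its Lipschitz constant. *)
Let gps x0 : gag s (ps x0) < +oo.
Proof.
pose kk := (kap `^ (- (1 + del)))%R.
apply: (@gag_le_lin _ _ s (8 * Kp ^+ 2)%R (2 * kk ^+ 2)%R (ps x0) (zeta x0 r) w
  (mulr_ge0 (ler0n _ _) (sqr_ge0 _)) (mulr_ge0 (ler0n _ _) (sqr_ge0 _)) (mps x0) (measurable_zeta _ _) mw);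
  [|exact: gag_zeta|exact: gw].
- move=> x y; rewrite /ps.
  have z0 := zeta_ge0 x0 r x; have z1 := zeta_le1 x0 r x.
  have y0 := zeta_ge0 x0 r y; have y1 := zeta_le1 x0 r y.
  have Pl := @Psi_lip R kap del kap0 del0 (w x - w x0) (w y - w x0).
  have Pa := @Psi_sup R kap del kap0 del0 (w x - w x0).
  have E : (w x - w x0 - (w y - w x0) = w x - w y)%R by ring.
  rewrite E -/kk in Pl.
  move: (Psi _ _ _) (Psi _ _ _) (zeta x0 r x) (zeta x0 r y) (w x - w y)%R z0 z1 y0 y1 Pl Pa => b a p q t p0 p1 q0 q1 Pl Pa.
  rewrite (_ : (_ - _)%R = ((p - q) * (p + q) * a + q ^+ 2 * (a - b))%R); last by ring.
  have H1 : (((p - q) * (p + q) * a) ^+ 2 <= 4 * Kp ^+ 2 * (p - q) ^+ 2)%R.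
    rewrite 2!exprMn [leRHS](_ : _ = (p - q) ^+ 2 * 2 ^+ 2 * Kp ^+ 2)%R; last by ring.
    apply: ler_pM; rewrite ?sqr_ge0//.
    + by rewrite mulr_ge0 ?sqr_ge0.
    + by apply: ler_wpM2l; rewrite ?sqr_ge0// lerXn2r ?nnegrE//; lra.
    + by rewrite -(real_normK (num_real a)) lerXn2r ?nnegrE.
  have H2 : ((q ^+ 2 * (a - b)) ^+ 2 <= kk ^+ 2 * t ^+ 2)%R.
    rewrite -exprMn -[leRHS](real_normK (num_real _)) -[leLHS](real_normK (num_real _)).
    rewrite lerXn2r ?nnegrE// normrM [leRHS]normrM (ger0_norm (sqr_ge0 q)) (ger0_norm (powR_ge0 _ _)).
    by rewrite -[leRHS]mul1r ler_pM ?sqr_ge0// expr_le1.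
  have LR (X Y Z T : R) : (X ^+ 2 <= 4 * Kp ^+ 2 * Z -> Y ^+ 2 <= T -> (X + Y) ^+ 2 <= 8 * Kp ^+ 2 * Z + 2 * T)%R.
    by have := sqr_ge0 (X - Y)%R; nra.
  by rewrite -(mulrA 2%R); exact: LR.
Qed.

Let fluxB x0 (z : Rn * Rn) : R :=
  (pot s Phi uh z - pot s Phi u z) * (ps x0 z.1 - ps x0 z.2).

Let mf : measurable_fun setT f. Proof. exact: rV_continuous_measurable. Qed.

(** By translation invariance of the form ([Sh]), testing the equation of [u] with [psh x0] amounts
    to testing that of its translate [uh] with [ps x0]. *)
Let psh x0 (x : Rn) : R := ps x0 (x - h).

Let mpsh x0 : measurable_fun setT (psh x0).
Proof. exact: rV_shift_measurable. Qed.

Let psK' x0 x : (`|psh x0 x| <= Kp)%R. Proof. exact: psK. Qed.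

Let tri (x x0 : Rn) : (`|x - x0| <= `|x - h - x0| + `|h|)%R.
Proof. by rewrite (le_trans _ (ler_normD _ _))// addrAC subrK. Qed.

Let ps_in x0 x : inner Omega (4 * d) x0 -> ps x0 x != 0%R -> inner Omega d x.
Proof.
move=> ix0 /ps_supp h1; apply: (inner_shift ix0).
by have LR (t : R) : (t < 2 * r -> t + d <= 4 * d)%R; [move: (rd) (d0) => *; lra|exact: LR].
Qed.

(** The margin [4 * d] consists of [2 * r] for the support, [r] for the shift by [h], and the [d]
    that [weak_extension] asks for. *)
Let psh_in x0 x : inner Omega (4 * d) x0 -> psh x0 x != 0%R -> inner Omega d x.
Proof.
move=> ix0 /ps_supp h1; apply: (inner_shift ix0).
have LR (t t2 t3 : R) : (t <= t2 + t3 -> t2 < 2 * r -> t3 <= r -> t + d <= 4 * d)%R.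
  by move: (rd) (r0) (d0) => *; lra.
exact: LR (tri x x0) h1 hr.
Qed.

Let eE phi : energy_form s Phi u phi =
  (1 - s)%:E * \int[leb \x leb]_z (pot s Phi u z * (phi z.1 - phi z.2))%:E.
Proof.
rewrite /energy_form; congr (_ * _); apply: eq_integral => z _; congr (_%:E).
exact: energy_integrandE.
Qed.

Let Sh x0 : \int[leb \x leb]_z (pot s Phi u z * (psh x0 z.1 - psh x0 z.2))%:E =
  \int[leb \x leb]_z (pot s Phi uh z * (ps x0 z.1 - ps x0 z.2))%:E.
Proof.
have mp := measurable_pot s Lam1 HPhi mu; have mpx := mpsh x0.
rewrite -(@product_integral_shift _ _ h (fun z => pot s Phi u z * (psh x0 z.1 - psh x0 z.2))%R); last by mfun.
apply: eq_integral => z _; rewrite /psh /= !addrK /pot /=.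
by have -> : (z.1 + h - (z.2 + h) = z.1 - z.2)%R by rewrite opprD addrACA subrr addr0.
Qed.

Let intO (g : Rn -> R) : measurable_fun setT g -> (forall x, (`|g x| <= Kp)%R) ->
  leb.-integrable Omega (fun x => (g x * f x)%:E).
Proof.
move=> mg gM; apply: (@bounded_integrable _ _ Omega (fun x => g x * f x)%R (Kp * Fb) mO Ofin).
  by apply: measurable_funTS; mfun.
by move=> x _; rewrite normrM ler_pM.
Qed.

Let fluxBE x0 z : (fluxB x0 z)%:E = (pot s Phi uh z * (ps x0 z.1 - ps x0 z.2))%:E -
  (pot s Phi u z * (ps x0 z.1 - ps x0 z.2))%:E.
Proof. by rewrite -EFinB /fluxB mulrBl. Qed.

Let I1 x0 : (leb \x leb).-integrable setT (fun z => (pot s Phi u z * (ps x0 z.1 - ps x0 z.2))%:E).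
Proof.
exact: (form_integrable Lam1 (measurable_pot s Lam1 HPhi mu) mu (mps x0) (pot_le s0 HPhi u) gu (gps x0)).
Qed.

Let I2 x0 : (leb \x leb).-integrable setT (fun z => (pot s Phi uh z * (ps x0 z.1 - ps x0 z.2))%:E).
Proof.
have guh : gag s uh < +oo by rewrite gag_shift; [exact: gu|exact: mu].
exact: (form_integrable Lam1 (measurable_pot s Lam1 HPhi muh) muh (mps x0) (pot_le s0 HPhi uh) guh (gps x0)).
Qed.

Lemma flux_integrable x0 : (leb \x leb).-integrable setT (fun z => (fluxB x0 z)%:E).
Proof.
have := integrableB measurableT (I2 x0) (I1 x0); congr (_.-integrable _ _).
by apply/funext => z; rewrite fluxBE.
Qed.

Let flux_eq x0 : inner Omega (4 * d) x0 -> (1 - s)%:E * \int[leb \x leb]_z (fluxB x0 z)%:E =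
   \int[leb]_(x in Omega) ((psh x0 x - ps x0 x) * f x)%:E.
Proof.
move=> ix0.
have E1 := weak_extension s0 Lam1 HPhi oO bO cf fFb mu gu weak d0 (mps x0) (psK x0) (fun x => @ps_in x0 x ix0) (gps x0).
have gpsh : gag s (psh x0) < +oo by rewrite gag_shift; [exact: gps|exact: mps].
have E2 := weak_extension s0 Lam1 HPhi oO bO cf fFb mu gu weak d0 (mpsh x0) (psK' x0) (fun x => @psh_in x0 x ix0) gpsh.
transitivity ((1 - s)%:E * (\int[leb \x leb]_z (pot s Phi uh z * (ps x0 z.1 - ps x0 z.2))%:E -
    \int[leb \x leb]_z (pot s Phi u z * (ps x0 z.1 - ps x0 z.2))%:E)).
  congr (_ * _); rewrite -(integralB measurableT (I2 x0) (I1 x0)).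
  by apply: eq_integral => z _; rewrite fluxBE.
rewrite muleBr; [|by []|by apply: fin_num_adde_defl; rewrite fin_numN; exact: (integrable_fin_num measurableT (I1 x0))].
transitivity (density_integral Omega f (psh x0) - density_integral Omega f (ps x0)).
  apply: f_equal2; last by apply: (f_equal oppe); exact: etrans (esym (eE _)) E1.
  apply: etrans E2; apply: etrans (esym (eE _)).
  by apply: f_equal; exact: esym (Sh x0).
rewrite /density_integral -(integralB mO (intO (mpsh x0) (psK' x0)) (intO (mps x0) (psK x0))).
by apply: eq_integral => x _; rewrite -EFinB mulrBl.
Qed.

(** The datum enters here only, and through its L^1 norm, because the test functions are bounded by
    [Kp]. Both vanish outside the ball of radius [3 * r]: [2 * r] for the cut-off and [r] for the
    shift. *)
Lemma flux_tested x0 : inner Omega (4 * d) x0 ->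
  \int[leb \x leb]_z (fluxB x0 z)%:E <=
  ((1 - s)^-1 * (2 * Kp))%:E * \int[leb]_(x in Omega) (((`|x - x0| < 3 * r)%R)%:R * `|f x|)%:E.
Proof.
move=> ix0; rewrite EFinM -muleA lee_pdivlMl// flux_eq//.
apply: (le_trans (lee_abs _)); have mpx := mpsh x0; have mqx := mps x0.
apply: (le_trans (le_abse_integral _ mO _)).
  by apply: measurable_funTS; mfun.
rewrite -ge0_integralZl_EFin; last 4 first.
- exact: mO.
- by move=> x _; rewrite lee_fin mulr_ge0.
- by apply: measurable_funTS; mfun.
- exact: mulr_ge0.
apply: le_integral_ge0 => [//|x _|x _|x _].
- exact: abse_ge0.
- by rewrite -EFinM lee_fin mulr_ge0// mulr_ge0.
rewrite -EFinM lee_fin mulrA normrM; apply: ler_wpM2r => //.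
have [h3|h3] := ltP `|x - x0|%R (3 * r)%R.
  rewrite mulr1 (le_trans (ler_normB _ _))// mulr_natl mulr2n lerD//.
have N1 : ps x0 x = 0%R.
  apply/eqP; apply: contraT => /ps_supp.
  by move/(le_lt_trans h3); rewrite ltr_pM2r// ltr_nat.
have N2 : psh x0 x = 0%R.
  apply/eqP; apply: contraT => /ps_supp h2.
  have LR (t t2 t3 : R) : (t <= t2 + t3 -> t2 < 2 * r -> t3 <= r -> 3 * r <= t -> False)%R.
    by move: (r0) => *; lra.
  by case: (LR _ _ _ (tri x x0) h2 hr h3).
by rewrite N1 N2 subrr normr0 mulr0.
Qed.

Variables (k : Rn) (th : R).
Hypothesis k0 : (0 < `|k|)%R.
Hypothesis kr : (`|k| <= r / 2)%R.
Hypothesis th0 : (0 < th)%R.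

Let l : R := (2 * `|k|)%R.
Let l0 : (0 < l)%R. Proof. by rewrite mulr_gt0. Qed.
(** The Young parameter. It contains the factor [l^n] by which the final inequality is divided, so
    that [th] is what remains. *)
Let eta : R := (l ^+ n * th)%R.
Let eta0 : (0 < eta)%R. Proof. by rewrite mulr_gt0// exprn_gt0. Qed.
Let lr : (l <= r)%R. Proof. by rewrite /l mulrC -ler_pdivlMr. Qed.

(** Notation for the pointwise inequality [LL <= 4 * Lambda * eta * fluxB + QQ]. [gg] bounds the
    inverse weight, [vv] collects the kernels of the cut-off error ([|e| < r]) and of the Young term
    ([|e| < l]), and [far] is the kernel beyond [r], where no sign is exploited. *)
Let gg x0 (x : Rn) : R := (((`|x - x0| < 3 * r)%R)%:R * (kap + 2 * `|w x - w x0| `^ (1 + del)))%R.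
Let cc x0 (x : Rn) : R := ((`|x - x0| < 2 * r)%R)%:R.
Let a1 : R := (36 * Lambda ^+ 4 * eta * Kp ^+ 2 / r ^+ 2)%R.
Let a3 : R := (eta^-1 * (n%:R * l) `^ (n%:R + s * 2) * (9 / 2))%R.
Let vv (e : Rn) : R := (a1 * (((`|e| < r)%R)%:R * (`|e| `^ (2 - 2 * s) / `|e| ^+ n)) + a3 * ((`|e| < l)%R)%:R)%R.
Let far (e : Rn) : R := (((r <= `|e|)%R)%:R * kern s e)%R.
Let c2 : R := (4 * Lambda ^+ 2 * eta * Kp)%R.
Let LL x0 (z : Rn * Rn) : R := (((`|z.1 - x0| < r)%R)%:R * (((`|z.2 - z.1| < l)%R)%:R * `|w z.1 - w z.2|))%R.
Let QQ x0 (z : Rn * Rn) : R := (vv (z.1 - z.2) * (gg x0 z.1 + gg x0 z.2) +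
  c2 * (far (z.1 - z.2) * `|w z.1 - w z.2| * (cc x0 z.1 + cc x0 z.2)))%R.

Let wt x0 (z : Rn * Rn) : R := (kap + `|w z.1 - w x0| + `|w z.2 - w x0|)%R.
Let wt0 x0 z : (0 < wt x0 z)%R. Proof. by rewrite /wt -addrA ltr_wpDr// addr_ge0. Qed.

Let weight_le (a b : R) : (0 <= a)%R -> (0 <= b)%R ->
  ((kap + a + b) `^ (1 + del) <= 9 / 2 * ((kap + 2 * a `^ (1 + del)) + (kap + 2 * b `^ (1 + del))))%R.
Proof. exact: powR_weight_le. Qed.

Let a1_0 : (0 <= a1)%R.
Proof.
rewrite /a1; apply: divr_ge0; last exact: sqr_ge0.
apply: mulr_ge0; last exact: sqr_ge0.
apply: mulr_ge0; last exact: ltW.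
by apply: mulr_ge0 => //; apply: exprn_ge0; exact: ltW.
Qed.

Let a3_0 : (0 <= a3)%R.
Proof. by rewrite /a3 !mulr_ge0 ?invr_ge0 ?(ltW eta0) ?powR_ge0. Qed.

Let c2_0 : (0 <= c2)%R.
Proof. exact: (mulr_ge0 (mulr_ge0 (mulr_ge0 (ler0n _ _) (sqr_ge0 _)) (ltW eta0)) Kp0). Qed.

Let vv_ge0 e : (0 <= vv e)%R.
Proof. 
exact: (addr_ge0 (mulr_ge0 a1_0 (mulr_ge0 (ler0n _ _) (divr_ge0 (powR_ge0 _ _) (exprn_ge0 n (normr_ge0 e)))))
  (mulr_ge0 a3_0 (ler0n _ _))).
 Qed.

Let gg_ge0 x0 x : (0 <= gg x0 x)%R.
Proof. by rewrite mulr_ge0// addr_ge0 ?(ltW kap0)// mulr_ge0 ?powR_ge0. Qed.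

Let far_ge0 e : (0 <= far e)%R. Proof. by rewrite mulr_ge0 ?kern_ge0. Qed.

Let QQ_ge0 x0 z : (0 <= QQ x0 z)%R.
Proof.
apply: addr_ge0; first by rewrite mulr_ge0// addr_ge0.
by rewrite mulr_ge0// mulr_ge0 ?addr_ge0// mulr_ge0.
Qed.

Let near_pointwise x0 z :
  ((4 * Lambda)^-1 * ((zeta x0 r z.1 ^+ 2 + zeta x0 r z.2 ^+ 2) *
     (wt x0 z `^ (- (1 + del)) * (w z.1 - w z.2) ^+ 2 * kern s (z.1 - z.2))) <=
  fluxB x0 z + 2 * Lambda ^+ 3 * Kp ^+ 2 *
    ((zeta x0 r z.1 - zeta x0 r z.2) ^+ 2 * wt x0 z `^ (1 + del) * kern s (z.1 - z.2)))%R.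
Proof.
have wdE : (uh z.1 - uh z.2 - (u z.1 - u z.2) = w z.1 - w z.2)%R by rewrite /uh /w; ring.
have := @caccioppoli_pointwise R Lambda (pot s Phi uh z - pot s Phi u z) (w z.1 - w z.2) (kern s (z.1 - z.2))
  (zeta x0 r z.1) (zeta x0 r z.2) (Psi kap del (w z.1 - w x0)) (Psi kap del (w z.2 - w x0))
  (wt x0 z `^ (- (1 + del))) Kp Lam1 (kern_ge0 _ _) (zeta_ge0 _ _ _) (zeta_ge0 _ _ _) (powR_gt0 _ (wt0 _ _)) Kp0.
have -> : ((wt x0 z `^ (- (1 + del)))^-1 = wt x0 z `^ (1 + del))%R by rewrite powRN invrK.
apply.
- by rewrite -wdE; exact: pot_diff_le.
- by rewrite -wdE; exact: pot_diff_mono.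
- have := @Psi_mono R kap del kap0 del0 (w z.1 - w x0)%R (w z.2 - w x0)%R.
  by have -> : (w z.1 - w x0 - (w z.2 - w x0) = w z.1 - w z.2)%R by ring.
- exact: Psi_sup.
- exact: Psi_sup.
Qed.

(** If the cut-off differs at two points less than [r] apart, one of them is within [2 * r] of [x0]
    and hence both are within [3 * r], where [gg] is not zero. The squared increment of the cut-off
    supplies the [|e|^2] that makes the kernel integrable at the diagonal. *)
Let zeta_diff x0 z : (`|z.1 - z.2| < r)%R ->
  ((zeta x0 r z.1 - zeta x0 r z.2) ^+ 2 * wt x0 z `^ (1 + del) * kern s (z.1 - z.2) <=
   9 / 2 / r ^+ 2 * (`|z.1 - z.2| `^ (2 - 2 * s) / `|z.1 - z.2| ^+ n) * (gg x0 z.1 + gg x0 z.2))%R.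
Proof.
move=> zr; set e := (z.1 - z.2)%R.
have G0 : (0 <= gg x0 z.1 + gg x0 z.2)%R by rewrite addr_ge0.
have P0 : (0 <= `|e| `^ (2 - 2 * s) / `|e| ^+ n)%R by rewrite divr_ge0 ?powR_ge0 ?exprn_ge0.
have R0 : (0 <= 9 / 2 / r ^+ 2)%R by rewrite divr_ge0 ?sqr_ge0.
have [e0|e0] := eqVneq e 0%R.
  by rewrite e0 kern0// mulr0 -e0 mulr_ge0// mulr_ge0.
have ne0 : (0 < `|e|)%R by rewrite normr_gt0.
have [zz|zz] := eqVneq (zeta x0 r z.1 - zeta x0 r z.2)%R 0%R.
  by rewrite zz expr0n/= !mul0r mulr_ge0// mulr_ge0.
have [b1 b2] : (`|z.1 - x0| < 3 * r)%R /\ (`|z.2 - x0| < 3 * r)%R.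
  have t1 : (`|z.1 - x0| <= `|e| + `|z.2 - x0|)%R by rewrite (le_trans _ (ler_normD _ _))// addrA subrK.
  have t2 : (`|z.2 - x0| <= `|e| + `|z.1 - x0|)%R.
    by rewrite -(normrN e) (le_trans _ (ler_normD _ _))// opprB addrA subrK.
  have LR (t t' t'' : R) : (t <= t'' + t' -> t'' < r -> t' < 2 * r -> t < 3 * r)%R.
    by move=> tt g1 g2; apply: le_lt_trans tt _; rewrite (_ : (3 * r = r + 2 * r)%R) ?ltrD//; ring.
  have LR' (t : R) : (t < 2 * r -> t < 3 * r)%R.
    by move=> /lt_trans; apply; rewrite ltr_pM2r ?r0// ltr_nat.
  have [h1|h1] := ltP `|z.1 - x0|%R (2 * r)%R.
    by split; [exact: LR'|exact: LR t2 zr h1].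
  have [h2|h2] := ltP `|z.2 - x0|%R (2 * r)%R.
    by split; [exact: LR t1 zr h2|exact: LR'].
  by move: zz; rewrite !zeta_eq0// subrr eqxx.
have Hw : (wt x0 z `^ (1 + del) <= 9 / 2 * (gg x0 z.1 + gg x0 z.2))%R.
  by rewrite /gg b1 b2 !mul1r; exact: weight_le.
have Hz : ((zeta x0 r z.1 - zeta x0 r z.2) ^+ 2 <= `|e| ^+ 2 / r ^+ 2)%R.
  rewrite -(real_normK (num_real (_ - _))) -expr_div_n lerXn2r ?nnegrE ?divr_ge0 ?(ltW r0)//.
  exact: zeta_lip.
have Hk : (`|e| ^+ 2 * kern s e <= `|e| `^ (2 - 2 * s) / `|e| ^+ n)%R.
  have -> : (`|e| `^ (2 - 2 * s) = `|e| ^+ 2 * `|e| `^ (- (2 * s)))%R.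
    rewrite powRD; first by rewrite (powR_mulrn 2).
    by rewrite (gt_eqF ne0) implybT.
  by rewrite -[leRHS]mulrA; apply: ler_wpM2l; [exact: sqr_ge0|exact: kern_le].
apply: (@le_trans _ _ (`|e| ^+ 2 / r ^+ 2 * (9 / 2 * (gg x0 z.1 + gg x0 z.2)) * kern s e)%R).
  apply: ler_wpM2r; first exact: kern_ge0.
  by apply: ler_pM => //; [exact: sqr_ge0|exact: powR_ge0].
rewrite [leLHS](_ : _ = 9 / 2 / r ^+ 2 * (`|e| ^+ 2 * kern s e) * (gg x0 z.1 + gg x0 z.2))%R; last by ring.
by apply: ler_wpM2r => //; exact: ler_wpM2l.
Qed.

(** For [|e| >= r] the left side vanishes, and it suffices to bound the flux from below by its
    absolute value. For [|e| < r] the Caccioppoli inequality controls the weighted squares [D], from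
    which Young's inequality extracts [|w z.1 - w z.2|]. *)
Let LL_le x0 z : (LL x0 z <= 4 * Lambda * eta * fluxB x0 z + QQ x0 z)%R.
Proof.
set e := (z.1 - z.2)%R; set wd := (w z.1 - w z.2)%R.
have L4 : (0 < 4 * Lambda)%R by rewrite mulr_gt0.
have L4e : (0 < 4 * Lambda * eta)%R by rewrite mulr_gt0.
have ne : (`|z.2 - z.1| = `|e|)%R by rewrite distrC.
have [er|er] := ltP `|e|%R r; last first.
  have -> : LL x0 z = 0%R.
    have el : (`|e| < l)%R = false by apply/negbTE; rewrite -leNgt (le_trans lr).
    by rewrite /LL ne el mul0r mulr0.
  rewrite /QQ -/e /far er mul1r.
  have V0 : (0 <= vv e * (gg x0 z.1 + gg x0 z.2))%R by rewrite mulr_ge0// addr_ge0.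
  have H : (- (Lambda * Kp * (kern s e * `|wd| * (cc x0 z.1 + cc x0 z.2))) <= fluxB x0 z)%R.
    rewrite lerNl; apply: le_trans (ler_norm _) _; rewrite normrN normrM.
    have h1 : (`|pot s Phi uh z - pot s Phi u z| <= Lambda * `|wd| * kern s e)%R.
      have -> : wd = (uh z.1 - uh z.2 - (u z.1 - u z.2))%R by rewrite /wd /uh /w; ring.
      exact: pot_diff_le.
    have h2 : (`|ps x0 z.1 - ps x0 z.2| <= Kp * (cc x0 z.1 + cc x0 z.2))%R.
      have h3 x : (`|ps x0 x| <= Kp * cc x0 x)%R.
        have [xx|xx] := eqVneq (ps x0 x) 0%R; first by rewrite xx normr0 mulr_ge0.
        by rewrite /cc (ps_supp xx) mulr1.
      by rewrite mulrDr (le_trans (ler_normB _ _))// lerD.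
    apply: le_trans (ler_pM (normr_ge0 _) (normr_ge0 _) h1 h2) _.
    by rewrite le_eqVlt; apply/orP; left; apply/eqP; ring.
  have := ler_wpM2l (ltW L4e) H; rewrite /c2 -/wd.
  have LR (X Y Z T : R) : (0 <= X -> Y <= Z -> T = - Y -> 0 <= Z + (X + T))%R.
    by move=> x0' yz ->; lra.
  by move=> h'; apply: (LR _ _ _ _ V0 h'); ring.
have far0 : (0 <= c2 * (far e * `|wd| * (cc x0 z.1 + cc x0 z.2)))%R.
  by rewrite mulr_ge0// mulr_ge0 ?addr_ge0// mulr_ge0.
have G0 : (0 <= gg x0 z.1 + gg x0 z.2)%R by rewrite addr_ge0.
have N1 := near_pointwise x0 z; have N2 := zeta_diff x0 er.
set D := ((zeta x0 r z.1 ^+ 2 + zeta x0 r z.2 ^+ 2) * _)%R in N1.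
set Z1 := ((zeta x0 r z.1 - _) ^+ 2 * _ * _)%R in N1 N2.
have D0 : (0 <= D)%R.
  rewrite mulr_ge0 ?addr_ge0 ?sqr_ge0//.
  by rewrite mulr_ge0 ?kern_ge0// mulr_ge0 ?powR_ge0 ?sqr_ge0.
have F1 : (eta * D <= 4 * Lambda * eta * fluxB x0 z +
    a1 * (`|e| `^ (2 - 2 * s) / `|e| ^+ n) * (gg x0 z.1 + gg x0 z.2))%R.
  have h1 := ler_wpM2l (ltW L4e) N1; rewrite mulrDr in h1.
  have -> : (eta * D = 4 * Lambda * eta * ((4 * Lambda)^-1 * D))%R.
    by have LR (X : R) : (eta * X = 4 * Lambda * eta * ((4 * Lambda)^-1 * X))%R by field; rewrite gt_eqF.
  apply: le_trans h1 _; apply: lerD => //.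
  set P := (4 * Lambda * eta * _)%R.
  have q0 : (0 <= 4 * Lambda * eta * (2 * Lambda ^+ 3 * Kp ^+ 2))%R.
    apply: mulr_ge0; first exact: ltW.
    apply: mulr_ge0; last exact: sqr_ge0.
    by apply: mulr_ge0 => //; apply: exprn_ge0; exact: ltW.
  rewrite /P mulrA; apply: le_trans (ler_wpM2l q0 N2) _.
  rewrite -/e /a1; set P' := (_ / `|e| ^+ n)%R; set G := (gg x0 _ + _)%R.
  have LR (X Y : R) : (4 * Lambda * eta * (2 * Lambda ^+ 3 * Kp ^+ 2) * (9 / 2 / r ^+ 2 * X * Y) =
      36 * Lambda ^+ 4 * eta * Kp ^+ 2 / r ^+ 2 * X * Y)%R by field; rewrite gt_eqF.
  by rewrite LR.
have F2 : (LL x0 z <= eta * D + a3 * ((`|e| < l)%R)%:R * (gg x0 z.1 + gg x0 z.2))%R.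
  have nn (b : bool) : (0 <= eta * D + a3 * b%:R * (gg x0 z.1 + gg x0 z.2))%R.
    exact: (addr_ge0 (mulr_ge0 (ltW eta0) D0) (mulr_ge0 (mulr_ge0 a3_0 (ler0n _ _)) G0)).
  rewrite /LL ne; have [h1|h1] := ltP `|z.1 - x0|%R r; last by rewrite mul0r; exact: nn.
  have [h2|h2] := ltP `|e|%R l; last by rewrite mul0r mulr0; exact: (nn false).
  rewrite !mul1r mulr1 -/wd.
  have [e0|e0] := eqVneq e 0%R.
    have -> : wd = 0%R by rewrite /wd (_ : z.1 = z.2) ?subrr//; apply/eqP; rewrite -subr_eq0; exact/eqP.
    by rewrite normr0; have := nn true; rewrite mulr1.
  have kk := kern_ge s0 e0 (ltW h2).
  set om := (wt x0 z `^ (- (1 + del)))%R.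
  have om0 : (0 < om)%R by exact: powR_gt0.
  have k1 : (0 < kern s e)%R.
    rewrite lt_neqAle kern_ge0 andbT; apply/negP => /eqP k0'.
    by move: kk; rewrite -k0' mulr0 ler10.
  have y0 : (0 < eta * om * kern s e)%R by exact: mulr_gt0 (mulr_gt0 eta0 om0) k1.
  (* With this weight the square is part of [eta * D]. In the other term [gg] bounds [om^-1], and
     the inverse kernel is at most [(n * l)^(n + 2s)] since [|e| < l]. *)
  have Y := @young_weight R (eta * om * kern s e) `|wd| 1 y0 (normr_ge0 _) ler01.
  rewrite mulr1 expr1n mulr1 (real_normK (num_real _)) in Y.
  apply: le_trans Y _; apply: lerD.
    rewrite /D (zeta_eq1 r0 (ltW h1)) expr1n -/om -/wd -/e.
    rewrite [leRHS](_ : _ = (1 + zeta x0 r z.2 ^+ 2) * (eta * om * kern s e * wd ^+ 2))%R; last by ring.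
    rewrite ler_peMl ?lerDl ?sqr_ge0// mulr_ge0 ?sqr_ge0// ltW//.
  have r1 : (`|z.1 - x0| < 3 * r)%R.
    by apply: lt_le_trans h1 _; rewrite ler_peMl ?(ltW r0)// ler1n.
  have r2 : (`|z.2 - x0| < 3 * r)%R.
    have t2 : (`|z.2 - x0| <= `|e| + `|z.1 - x0|)%R.
      by rewrite -(normrN e) (le_trans _ (ler_normD _ _))// opprB addrA subrK.
    apply: le_lt_trans t2 _; apply: lt_trans (ltrD er h1) _.
    by rewrite -mulr2n -[ltLHS]mulr_natl ltr_pM2r ?r0// ltr_nat.
  have Hw : (om^-1 <= 9 / 2 * (gg x0 z.1 + gg x0 z.2))%R.
    rewrite /om powRN invrK /gg r1 r2 !mul1r; exact: weight_le.
  rewrite invfM invfM /a3 -[leRHS]mulrA.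
  have Hk : ((kern s e)^-1 <= (n%:R * l) `^ (n%:R + s * 2))%R.
    by rewrite -[leLHS]mul1r ler_pdivrMr.
  rewrite -mulrA -[leRHS]mulrA; apply: ler_wpM2l; first by rewrite invr_ge0 ltW.
  rewrite mulrC; apply: ler_pM => //; rewrite invr_ge0 ltW//.
apply: le_trans F2 _; rewrite /QQ -/e /vv er mul1r [X in (_ <= _ + (X + _))%R]mulrDl.
by move: F1 far0; rewrite -/wd; move: (c2 * _)%R (_ * fluxB x0 z)%R => X Y; lra.
Qed.

Let mcc x0 : measurable_fun setT (cc x0). Proof. by rewrite /cc; mfun. Qed.
Let mgg x0 : measurable_fun setT (gg x0). Proof. by rewrite /gg; mfun. Qed.
Let mfar : measurable_fun setT far.
Proof. by have mk := @measurable_kern R n s; rewrite /far; mfun. Qed.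
Let mvv : measurable_fun setT vv.
Proof.
have := @measurable_norm_expV R n n; rewrite /vv => mn; apply: mf_add; last by mfun.
by apply: mf_mul; [mfun|apply: mf_mul; [mfun|apply: mf_mul; [mfun|exact: mn]]].
Qed.
Let vvN e : vv (- e) = vv e. Proof. by rewrite /vv normrN. Qed.

Let mLL x0 : measurable_fun setT (LL x0). Proof. by rewrite /LL; mfun. Qed.
Let mQQ x0 : measurable_fun setT (QQ x0).
Proof.
have m1 := mvv; have m2 := mgg x0; have m3 := mcc x0; have m4 := mfar.
by rewrite /QQ; mfun.
Qed.

Let Cn : R := (4 ^+ n / (1 - 2 `^ (- (2 - 2 * s))))%R.
Let Cn0 : (0 <= Cn)%R.
Proof.
rewrite divr_ge0 ?exprn_ge0// subr_ge0 ltW//.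
have H : (0 < 2 - 2 * s)%R by case/andP: s01 => _ ?; lra.
by have /andP[] := powR2_lt1 H.
Qed.

Let vv_mass : \int[leb]_e (vv e)%:E <= (a1 * (Cn * r `^ (2 - 2 * s)) + a3 * (2 * l) ^+ n)%:E.
Proof.
have mn := @measurable_norm_expV R n n.
have mP : measurable_fun setT (fun e : Rn => (((`|e| < r)%R)%:R * (`|e| `^ (2 - 2 * s) / `|e| ^+ n))%R).
  by apply: mf_mul; [mfun|apply: mf_mul; [mfun|exact: mn]].
have P0 (e : Rn) : (0 <= ((`|e| < r)%R)%:R * (`|e| `^ (2 - 2 * s) / `|e| ^+ n))%R.
  by rewrite mulr_ge0// divr_ge0 ?powR_ge0 ?exprn_ge0.
have mI : measurable_fun setT (fun e : Rn => ((`|e| < l)%R)%:R : R) by mfun.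
rewrite /vv; under eq_integral do rewrite EFinD.
rewrite ge0_integralD; [|exact: measurableT|by move=> e _; rewrite lee_fin mulr_ge0|by mfun|
  by move=> e _; rewrite lee_fin mulr_ge0|by mfun].
rewrite EFinD; apply: leeD.
  under eq_integral do rewrite EFinM.
  rewrite ge0_integralZl_EFin; [|exact: measurableT|by move=> e _; rewrite lee_fin|by mfun|exact: a1_0].
  rewrite [leRHS]EFinM; apply: lee_wpmul2l; first by rewrite lee_fin.
  have := @integral_near_le R n (2 - 2 * s)%R r _ r0; rewrite -/Cn => H.
  apply: le_trans (H _); last by case/andP: s01 => _; lra.
  rewrite -integral_ball_ind le_eqVlt; apply/orP; left; apply/eqP.
  by apply: eq_integral => e _; rewrite subr0.
under eq_integral do rewrite EFinM.
rewrite ge0_integralZl_EFin; [|exact: measurableT|by move=> e _; rewrite lee_fin|by mfun|exact: a3_0].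
rewrite [leRHS]EFinM; apply: lee_wpmul2l; first by rewrite lee_fin.
rewrite -(integral_ball_ind1 (0%R : Rn) l0) le_eqVlt; apply/orP; left; apply/eqP.
by apply: eq_integral => e _; rewrite subr0.
Qed.

Let HH (x : Rn) : \bar R := \int[leb]_e (((r <= `|e|)%R)%:R * kern s e * `|w (x + e) - w x|)%:E.
Let Fl (x0 : Rn) : \bar R := \int[leb]_(x in Omega) (((`|x - x0| < 3 * r)%R)%:R * `|f x|)%:E.
Let A1 : R := (4 * Lambda * eta * ((1 - s)^-1 * (2 * Kp)))%R.
Let A2 : R := (2 * (a1 * (Cn * r `^ (2 - 2 * s)) + a3 * (2 * l) ^+ n))%R.

Let L4e : (0 <= 4 * Lambda * eta)%R.
Proof. by rewrite mulr_ge0 ?(ltW eta0)// mulr_ge0// ltW. Qed.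

Let A1_0 : (0 <= A1)%R.
Proof. by rewrite mulr_ge0// mulr_ge0 ?invr_ge0 ?(ltW s1)// mulr_ge0. Qed.

Let A2_0 : (0 <= A2)%R.
Proof.
exact: (mulr_ge0 (ler0n _ _) (addr_ge0 (mulr_ge0 a1_0 (mulr_ge0 Cn0 (powR_ge0 _ _)))
  (mulr_ge0 a3_0 (exprn_ge0 n (mulr_ge0 (ler0n _ _) (ltW l0)))))).
Qed.

Let QQ_mass x0 : \int[leb \x leb]_z (QQ x0 z)%:E <=
  A2%:E * \int[leb]_x (gg x0 x)%:E + (2 * c2)%:E * \int[leb]_x ((cc x0 x)%:E * HH x).
Proof.
have m1 := mvv; have m2 := mgg x0; have m3 := mcc x0; have m4 := mfar.
have q1 (z : Rn * Rn) : (0 <= vv (z.1 - z.2) * (gg x0 z.1 + gg x0 z.2))%R.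
  by rewrite mulr_ge0// addr_ge0.
have q2 (z : Rn * Rn) : (0 <= far (z.1 - z.2) * `|w z.1 - w z.2| * (cc x0 z.1 + cc x0 z.2))%R.
  by rewrite mulr_ge0 ?addr_ge0// mulr_ge0.
rewrite /QQ; under eq_integral do rewrite EFinD.
rewrite ge0_integralD; [|exact: measurableT|by move=> z _; rewrite lee_fin|by mfun|
  by move=> z _; rewrite lee_fin mulr_ge0|by mfun].
apply: leeD.
  rewrite (convolution_mass vv_ge0 vvN (gg_ge0 x0) m1 m2) /A2 EFinM -muleA.
  apply: lee_wpmul2l; first by rewrite lee_fin.
  apply: lee_wpmul2r; last exact: vv_mass.
  by apply: integral_ge0 => x _; rewrite lee_fin.
under eq_integral do rewrite EFinM.
rewrite ge0_integralZl_EFin; [|exact: measurableT|by move=> z _; rewrite lee_fin|by mfun|exact: c2_0].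
rewrite (@symmetric_product _ _ (fun x y => far (x - y) * `|w x - w y|)%R).
- rewrite muleA -EFinM (mulrC c2); apply: lee_wpmul2l; first by rewrite lee_fin mulr_ge0.
  rewrite le_eqVlt; apply/orP; left; apply/eqP; apply: eq_integral => x _; congr (_ * _).
  apply: eq_integral => e _; congr (_%:E).
  by rewrite opprD addrA subrr add0r /far normrN kernN distrC.
- by move=> x y; rewrite mulr_ge0.
- by move=> x y; rewrite distrC /far -normrN -kernN opprB.
- by move=> x; rewrite /cc.
- by mfun.
- exact: m3.
Qed.

Let LL_mass x0 : inner Omega (4 * d) x0 -> \int[leb \x leb]_z (LL x0 z)%:E <=
  A1%:E * Fl x0 + (A2%:E * \int[leb]_x (gg x0 x)%:E + (2 * c2)%:E * \int[leb]_x ((cc x0 x)%:E * HH x)).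
Proof.
move=> ix0.
have L0' z : (0 <= LL x0 z)%R by rewrite /LL mulr_ge0// mulr_ge0.
have iB : (leb \x leb).-integrable setT (fun z => (4 * Lambda * eta * fluxB x0 z)%:E).
  have := integrableZl measurableT (4 * Lambda * eta)%R (flux_integrable x0); congr (_.-integrable _ _).
have bB : \int[leb \x leb]_z (4 * Lambda * eta * fluxB x0 z)%:E <= A1%:E * Fl x0.
  under eq_integral do rewrite EFinM.
  rewrite (integralZl measurableT (flux_integrable x0)) /A1 (EFinM (4 * Lambda * eta)) -muleA.
  by apply: lee_wpmul2l; [rewrite lee_fin|exact: flux_tested].
have H := integral_le_signed L0' (QQ_ge0 x0) (mLL x0) (mQQ x0) iB (LL_le x0) bB.
apply: (le_trans H).
by apply: leeD; [exact: lexx|exact: QQ_mass].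
Qed.

Variables M N T Lb : R.
Hypothesis HM : \int[leb]_(x in Omega) (`|f x|)%:E <= M%:E.
Hypothesis HL : leb Omega <= Lb%:E.
Hypothesis HN : forall p, (`|p| < 3 * r)%R ->
  \int[leb]_(x in inner Omega (4 * d)) (`|(u (x + p + h) - u (x + p)) - (u (x + h) - u x)| `^ (1 + del))%:E <= N%:E.
Hypothesis HT : \int[leb]_(x in inner Omega (2 * d)) \int[leb]_e
  (((r <= `|e|)%R)%:R * kern s e * `|(u (x + e + h) - u (x + e)) - (u (x + h) - u x)|)%:E <= T%:E.

Let X := inner Omega (4 * d).
Let mX : measurable X. Proof. exact: inner_measurable. Qed.

(** Integration over the centres: by Tonelli a point [x] is counted by those [x0] that lie in a cube
    of side [6 * r] about it. The same exchange is behind [int_gg], [int_cc] and [int_LL]. *)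
Let int_Fl : \int[leb]_(x0 in X) Fl x0 <= ((6 * r) ^+ n * M)%:E.
Proof.
rewrite (@tonelli_in _ _ Rn Rn R leb leb X Omega
  (fun x0 x : Rn => (((`|x - x0| < 3 * r)%R)%:R * `|f x|)%:E) mX mO); last 2 first.
- by mfun.
- by move=> x y; rewrite lee_fin mulr_ge0.
apply: (@le_trans _ _ (\int[leb]_(x in Omega) (((6 * r) ^+ n)%:E * `|f x|%:E))); last first.
  rewrite ge0_integralZl_EFin; [|exact: mO|by move=> x _; rewrite lee_fin|by apply: measurable_funTS; mfun|].
    by rewrite EFinM; apply: lee_wpmul2l; rewrite // lee_fin exprn_ge0// mulr_ge0// ltW.
  by rewrite exprn_ge0// mulr_ge0// ltW.
apply: le_integral_ge0 => [//|x _|x _|x Ox].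
- by apply: integral_ge0 => y _; rewrite lee_fin mulr_ge0.
- by rewrite -EFinM lee_fin mulr_ge0// exprn_ge0// mulr_ge0// ltW.
apply: (@le_trans _ _ (\int[leb]_x0 (((`|x0 - x| < 3 * r)%R)%:R%:E * `|f x|%:E))).
  apply: le_integral_ge0 => [//|y _|y _|y _].
  - by rewrite lee_fin mulr_ge0.
  - by rewrite -EFinM lee_fin mulr_ge0.
  - by rewrite distrC -EFinM.
rewrite ge0_integralZr; [|exact: measurableT|by mfun|by move=> y _; rewrite lee_fin|by rewrite lee_fin].
by rewrite integral_ball_ind1 ?mulr_gt0// mulrA -natrM.
Qed.

(** After the substitution [x = x0 + p] the moment is that of [w (x0 + p) - w x0], a second
    difference of [u] in [x0], so that [HN] applies for each [p]. *)
Let int_gg : \int[leb]_(x0 in X) \int[leb]_x (gg x0 x)%:E <= ((6 * r) ^+ n * (kap * Lb + 2 * N))%:E.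
Proof.
pose g2 (x0 p : Rn) : R := (((`|p| < 3 * r)%R)%:R * (kap + 2 * `|w (x0 + p) - w x0| `^ (1 + del)))%R.
have g20 (x0 p : Rn) : 0 <= (g2 x0 p)%:E.
  by rewrite lee_fin mulr_ge0// addr_ge0 ?(ltW kap0)// mulr_ge0 ?powR_ge0.
have -> : \int[leb]_(x0 in X) \int[leb]_x (gg x0 x)%:E = \int[leb]_(x0 in X) \int[leb]_p (g2 x0 p)%:E.
  apply: eq_integral => x0 _; have mg := mgg x0.
  rewrite -(@ge0_integral_rV_shift R n x0 (fun x => (gg x0 x)%:E)); [|by mfun|by move=> x; rewrite lee_fin].
  by apply: eq_integral => p _; rewrite /gg /g2 addrK (addrC p).
rewrite (@tonelli_in _ _ Rn Rn R leb leb X setT (fun x0 p => (g2 x0 p)%:E) mX measurableT); last 2 first.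
- by rewrite /g2; mfun.
- exact: g20.
have leX : leb X <= Lb%:E.
  apply: le_trans HL; apply: le_measure; rewrite ?inE; [exact: mX|exact: mO|].
  by apply: inner_sub; rewrite mulr_gt0.
have KN0 : (0 <= kap * Lb + 2 * N)%R.
  rewrite addr_ge0// mulr_ge0 ?(ltW kap0)//.
    by rewrite -lee_fin; apply: le_trans HL; exact: measure_ge0.
  have h0 : (`|0 : Rn| < 3 * r)%R by rewrite normr0 mulr_gt0.
  by rewrite -lee_fin; apply: le_trans (HN h0); apply: integral_ge0 => x _; rewrite lee_fin powR_ge0.
apply: (@le_trans _ _ (\int[leb]_p (((`|p - 0| < 3 * r)%R)%:R%:E * (kap * Lb + 2 * N)%:E))).
  apply: le_integral_ge0 => [//|p _|p _|p _].
  - exact: integral_ge0.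
  - by rewrite -EFinM lee_fin mulr_ge0.
  rewrite subr0 /g2; have [hp|hp] := ltP `|p|%R (3 * r)%R; last first.
    by rewrite mul0e integral0_eq// => x _; rewrite mul0r.
  rewrite mul1e; under eq_integral do rewrite mul1r EFinD EFinM.
  have mwx : measurable_fun setT (fun x : Rn => (`|w (x + p) - w x| `^ (1 + del))%R).
    by mfun.
  rewrite ge0_integralD; [|exact: mX|by move=> x _; rewrite lee_fin ltW|exact: measurable_cst|
    by move=> x _; rewrite -EFinM lee_fin mulr_ge0 ?powR_ge0|
    by apply: measurable_funTS; apply: measurable_funeM; mfun].
  rewrite [leRHS]EFinD; apply: leeD.
    by rewrite integral_cst// EFinM; apply: lee_wpmul2l; rewrite // lee_fin ltW.
  rewrite ge0_integralZl_EFin; [|exact: mX|by move=> x _; rewrite lee_fin powR_ge0|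
    by apply: measurable_funTS; mfun|by []].
  by rewrite EFinM; apply: lee_wpmul2l; [rewrite lee_fin|exact: HN].
rewrite ge0_integralZr; [|exact: measurableT|by mfun|by move=> y _; rewrite lee_fin|by rewrite lee_fin].
by rewrite integral_ball_ind1 ?mulr_gt0// mulrA -natrM.
Qed.

Let mHH : measurable_fun setT HH.
Proof.
have mk := @measurable_kern R n s.
apply: (@measurable_integral_in _ _ Rn Rn R leb setT
  (fun x e : Rn => (((r <= `|e|)%R)%:R * kern s e * `|w (x + e) - w x|)%:E)).
- exact: measurableT.
- by mfun.
- by move=> x y; rewrite lee_fin mulr_ge0// mulr_ge0 ?kern_ge0.
Qed.

Let HH0 x : 0 <= HH x.
Proof. by apply: integral_ge0 => e _; rewrite lee_fin mulr_ge0// mulr_ge0 ?kern_ge0. Qed.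

Let int_cc : \int[leb]_(x0 in X) \int[leb]_x ((cc x0 x)%:E * HH x) <= ((4 * r) ^+ n * T)%:E.
Proof.
have c0 x0 x : 0 <= (cc x0 x)%:E by rewrite lee_fin.
rewrite (@tonelli_in _ _ Rn Rn R leb leb X setT (fun x0 x => (cc x0 x)%:E * HH x) mX measurableT); last 2 first.
- apply: emeasurable_funM; first by rewrite /cc; mfun.
  exact: (measurableT_comp mHH measurable_snd).
- by move=> x y; rewrite mule_ge0.
pose D2 := inner Omega (2 * d); have mD2 : measurable D2 by exact: inner_measurable.
have r4 : (0 <= (4 * r) ^+ n)%R by rewrite exprn_ge0// mulr_ge0// ltW.
apply: (@le_trans _ _ (\int[leb]_(x in D2) (((4 * r) ^+ n)%:E * HH x))); last first.
  rewrite ge0_integralZl_EFin; [|exact: mD2|by move=> x _; exact: HH0|exact: measurable_funTS mHH|exact: r4].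
  by rewrite EFinM; apply: lee_wpmul2l; [rewrite lee_fin|exact: HT].
have Hin x : \int[leb]_(x0 in X) ((cc x0 x)%:E * HH x) <= ((4 * r) ^+ n)%:E * HH x.
  apply: (@le_trans _ _ (\int[leb]_x0 (((`|x0 - x| < 2 * r)%R)%:R%:E * HH x))).
    apply: le_integral_ge0 => [//|y _|y _|y _].
    - by rewrite mule_ge0.
    - by rewrite mule_ge0// lee_fin.
    - by rewrite /cc distrC.
  rewrite ge0_integralZr; [|exact: measurableT|by mfun|by move=> y _; rewrite lee_fin|exact: HH0].
  by rewrite integral_ball_ind1 ?mulr_gt0// mulrA -natrM.
rewrite [leRHS]integral_mkcond; apply: le_integral_ge0 => [//|x _|x _|x _].
- by apply: integral_ge0 => y _; rewrite mule_ge0.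
- by apply: erestrict_ge0 => y _; rewrite mule_ge0// lee_fin.
rewrite patchE; case: ifPn => [_|/negP xD]; first exact: Hin.
rewrite integral0_eq// => x0 X0; rewrite /cc; case: ltP => h1; last by rewrite mul0e.
case: xD; apply/mem_set; apply: (inner_shift X0).
by have LR (t : R) : (t < 2 * r -> t + 2 * d <= 4 * d)%R; [move: (rd) => *; lra|exact: LR].
Qed.

Let gl (x : Rn) : \bar R := \int[leb]_y (((`|y - x| < l)%R)%:R * `|w x - w y|)%:E.

(** For [x] in [inner Omega (5 * d)] every centre within distance [r] of [x] belongs to [X], so the
    integration over [x0] recovers the full volume [(2 * r)^n]. *)
Let int_LL : ((2 * r) ^+ n)%:E * \int[leb]_(x in inner Omega (5 * d)) gl x <=
  \int[leb]_(x0 in X) \int[leb \x leb]_z (LL x0 z)%:E.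
Proof.
have gl0 x : 0 <= gl x by apply: integral_ge0 => y _; rewrite lee_fin mulr_ge0.
have mgl : measurable_fun setT gl.
  apply: (@measurable_integral_in _ _ Rn Rn R leb setT
    (fun x y : Rn => (((`|y - x| < l)%R)%:R * `|w x - w y|)%:E)).
  - exact: measurableT.
  - by mfun.
  - by move=> x y; rewrite lee_fin mulr_ge0.
have E x0 : \int[leb \x leb]_z (LL x0 z)%:E = \int[leb]_x (((`|x - x0| < r)%R)%:R%:E * gl x).
  rewrite (@product_integralE _ _ (fun x y => LL x0 (x, y))); last 2 first.
  - by move=> x y; rewrite /LL mulr_ge0// mulr_ge0.
  - have := mLL x0; congr (measurable_fun _ _); by apply/funext => -[].
  apply: eq_integral => x _; rewrite /LL/=; under eq_integral do rewrite EFinM.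
  rewrite ge0_integralZl_EFin; [by []|exact: measurableT|by move=> y _; rewrite lee_fin mulr_ge0|by mfun|by []].
under [leRHS]eq_integral do rewrite E.
rewrite (@tonelli_in _ _ Rn Rn R leb leb X setT (fun x0 x => ((`|x - x0| < r)%R)%:R%:E * gl x) mX measurableT); last 2 first.
- apply: emeasurable_funM; first by mfun.
  exact: (measurableT_comp mgl measurable_snd).
- by move=> x y; rewrite mule_ge0// lee_fin.
rewrite -ge0_integralZl_EFin; [|exact: inner_measurable|by move=> x _; exact: gl0|exact: measurable_funTS mgl|
  by rewrite exprn_ge0// mulr_ge0// ltW].
apply: le_integral_ge0 => [//|x _|x _|x Yx].
- by rewrite mule_ge0// lee_fin exprn_ge0// mulr_ge0// ltW.
- by apply: integral_ge0 => y _; rewrite mule_ge0// lee_fin.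
rewrite -(integral_ball_ind1 x r0) -ge0_integralZr; [|exact: measurableT|by mfun|by move=> y _; rewrite lee_fin|exact: gl0].
rewrite [leRHS]integral_mkcond; apply: le_integral_ge0 => [//|y _|y _|y _].
- by rewrite mule_ge0// lee_fin.
- by apply: erestrict_ge0 => z _; rewrite mule_ge0// lee_fin.
rewrite patchE; case: ifPn => [_|/negP xD]; first by rewrite distrC.
case: ltP => h1; last by rewrite mul0e.
case: xD; apply/mem_set; apply: (inner_shift Yx).
by have LR (t : R) : (t < r -> t + 4 * d <= 5 * d)%R; [move: (rd) => *; lra|exact: LR].
Qed.

Let B1 : R := (A1 * ((6 * r) ^+ n * M) + (A2 * ((6 * r) ^+ n * (kap * Lb + 2 * N)) + 2 * c2 * ((4 * r) ^+ n * T)))%R.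

Let int_total : \int[leb]_(x0 in X) \int[leb \x leb]_z (LL x0 z)%:E <= B1%:E.
Proof.
have F0 x0 : 0 <= Fl x0 by apply: integral_ge0 => x _; rewrite lee_fin mulr_ge0.
have mFl : measurable_fun setT Fl.
  apply: (@measurable_integral_in _ _ Rn Rn R leb Omega
    (fun x0 x : Rn => (((`|x - x0| < 3 * r)%R)%:R * `|f x|)%:E)).
  - exact: mO.
  - by mfun.
  - by move=> x y; rewrite lee_fin mulr_ge0.
have G0 x0 : 0 <= \int[leb]_x (gg x0 x)%:E by apply: integral_ge0 => x _; rewrite lee_fin.
have mG : measurable_fun setT (fun x0 => \int[leb]_x (gg x0 x)%:E).
  apply: (@measurable_integral_in _ _ Rn Rn R leb setT (fun x0 x => (gg x0 x)%:E)).
  - exact: measurableT.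
  - by rewrite /gg; mfun.
  - by move=> x y; rewrite lee_fin.
have C0 x0 : 0 <= \int[leb]_x ((cc x0 x)%:E * HH x).
  by apply: integral_ge0 => x _; rewrite mule_ge0// lee_fin.
have mC : measurable_fun setT (fun x0 => \int[leb]_x ((cc x0 x)%:E * HH x)).
  apply: (@measurable_integral_in _ _ Rn Rn R leb setT (fun x0 x => (cc x0 x)%:E * HH x)).
  - exact: measurableT.
  - apply: emeasurable_funM; first by rewrite /cc; mfun.
    exact: (measurableT_comp mHH measurable_snd).
  - by move=> x y; rewrite mule_ge0// lee_fin.
have c20 : (0 <= 2 * c2)%R by rewrite mulr_ge0.
have g1 x0 : 0 <= A1%:E * Fl x0 by rewrite mule_ge0// lee_fin.
have g2 x0 : 0 <= A2%:E * \int[leb]_x (gg x0 x)%:E by rewrite mule_ge0// lee_fin.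
have g3 x0 : 0 <= (2 * c2)%:E * \int[leb]_x ((cc x0 x)%:E * HH x) by rewrite mule_ge0// lee_fin.
apply: (@le_trans _ _ (\int[leb]_(x0 in X) (A1%:E * Fl x0 + (A2%:E * \int[leb]_x (gg x0 x)%:E +
   (2 * c2)%:E * \int[leb]_x ((cc x0 x)%:E * HH x))))).
  apply: le_integral_ge0 => [//|x0 _|x0 _|x0 X0].
  - by apply: integral_ge0 => z _; rewrite lee_fin /LL mulr_ge0// mulr_ge0.
  - exact: adde_ge0 (g1 _) (adde_ge0 (g2 _) (g3 _)).
  - exact: LL_mass.
rewrite ge0_integralD; [|exact: mX|by move=> x0 _; exact: g1|
  by apply: measurable_funTS; exact: measurable_funeM|by move=> x0 _; exact: adde_ge0 (g2 _) (g3 _)|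
  by apply: measurable_funTS; apply: emeasurable_funD; exact: measurable_funeM].
rewrite ge0_integralD; [|exact: mX|by move=> x0 _; exact: g2|
  by apply: measurable_funTS; exact: measurable_funeM|by move=> x0 _; exact: g3|
  by apply: measurable_funTS; exact: measurable_funeM].
rewrite /B1 !EFinD; apply: leeD; [|apply: leeD].
- rewrite ge0_integralZl_EFin; [|exact: mX|by move=> x _; exact: F0|exact: measurable_funTS mFl|exact: A1_0].
  by rewrite [leRHS]EFinM; apply: lee_wpmul2l; [rewrite lee_fin|exact: int_Fl].
- rewrite ge0_integralZl_EFin; [|exact: mX|by move=> x _; exact: G0|exact: measurable_funTS mG|exact: A2_0].
  by rewrite [leRHS]EFinM; apply: lee_wpmul2l; [rewrite lee_fin|exact: int_gg].
- rewrite ge0_integralZl_EFin; [|exact: mX|by move=> x _; exact: C0|exact: measurable_funTS mC|exact: c20].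
  by rewrite [leRHS]EFinM; apply: lee_wpmul2l; [rewrite lee_fin|exact: int_cc].
Qed.

Lemma energy_bound :
  ((2 * r) ^+ n * l ^+ n)%:E * \int[leb]_(x in inner Omega (6 * d)) `|w (x + k) - w x|%:E <= (2 * B1)%:E.
Proof.
have r2 : (0 <= (2 * r) ^+ n)%R by rewrite exprn_ge0// mulr_ge0// ltW.
have SA := @shift_average R n (fun x y => `|w x - w y|)%R 1 l k (inner Omega (5 * d)) (inner Omega (6 * d)).
rewrite EFinM -muleA EFinM.
have {}SA : (l ^+ n)%:E * \int[leb]_(x in inner Omega (6 * d)) `|w (x + k) - w x|%:E <=
    2%:E * \int[leb]_(x in inner Omega (5 * d)) gl x.
  under eq_integral do rewrite distrC.
  apply: SA.
  - by mfun.
  - by [].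
  - by move=> x y; rewrite distrC.
  - by [].
  - by move=> x y z; rewrite mul1r ler_distD.
  - exact: l0.
  - by rewrite /l mulrC mulKf.
  - exact: inner_measurable.
  - exact: inner_measurable.
  - have LR (t : R) : (t <= r / 2 -> t + 5 * d <= 6 * d)%R by move: (rd) (r0) => *; lra.
    move=> x Zx; split.
      by apply: (inner_shift Zx); rewrite subrr; apply: LR; rewrite normr0 divr_ge0// ltW.
    by apply: (inner_shift Zx); rewrite addrAC subrr add0r; exact: LR.
apply: (le_trans (lee_wpmul2l _ SA)); first by rewrite lee_fin.
rewrite muleCA; apply: lee_wpmul2l; first by rewrite lee_fin.
exact: le_trans int_LL int_total.
Qed.

(** The consequence of the equation on which everything later rests. It sees the datum only through
    [M], and [th] is still free to balance the two groups of terms: one decreases with [th], the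
    other carries [|k|^(2s)]. *)
Lemma second_difference_estimate :
  \int[leb]_(x in inner Omega (6 * d)) `|(u (x + k + h) - u (x + k)) - (u (x + h) - u x)|%:E <=
  (energy_const n s Lambda *
    (th * (psi_sup kap del * M + psi_sup kap del ^+ 2 * r `^ (- (2 * s)) * (kap * Lb + 2 * N) + psi_sup kap del * T) +
     th^-1 * `|k| `^ (2 * s) * (kap * Lb + 2 * N)))%:E.
Proof.
have D0 : (0 < (2 * r) ^+ n * l ^+ n)%R by rewrite mulr_gt0// exprn_gt0// mulr_gt0.
have := energy_bound; rewrite -lee_pdivlMl// => H; apply: (le_trans H).
rewrite -EFinM lee_fin -ler_pdivlMl ?invr_gt0// invrK; set KN := (kap * Lb + 2 * N)%R.
rewrite -/Kp /B1 -/KN.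
have KN0 : (0 <= KN)%R.
  rewrite addr_ge0// mulr_ge0 ?(ltW kap0)//.
    by rewrite -lee_fin; apply: le_trans HL; exact: measure_ge0.
  have h0 : (`|0 : Rn| < 3 * r)%R by rewrite normr0 mulr_gt0.
  by rewrite -lee_fin; apply: le_trans (HN h0); apply: integral_ge0 => x _; rewrite lee_fin powR_ge0.
have M0 : (0 <= M)%R.
  by rewrite -lee_fin; apply: le_trans HM; apply: integral_ge0 => x _; rewrite lee_fin.
have T0 : (0 <= T)%R.
  rewrite -lee_fin; apply: le_trans HT; apply: integral_ge0 => x _; apply: integral_ge0 => e _.
  by rewrite lee_fin mulr_ge0// mulr_ge0 ?kern_ge0.
have E6 : ((6 * r) ^+ n = 3 ^+ n * (2 * r) ^+ n)%R by rewrite -exprMn mulrA -natrM.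
have E4 : ((4 * r) ^+ n = 2 ^+ n * (2 * r) ^+ n)%R by rewrite -exprMn mulrA -natrM.
have El : ((2 * l) ^+ n = 2 ^+ n * l ^+ n)%R by rewrite exprMn.
have Er : (r `^ (2 - 2 * s) = r ^+ 2 * r `^ (- (2 * s)))%R.
  rewrite powRD; first by rewrite (powR_mulrn 2)// ltW.
  by rewrite (gt_eqF r0) implybT.
have En : ((n%:R * l) `^ (n%:R + s * 2) = n%:R `^ (n%:R + s * 2) * (l ^+ n * l `^ (2 * s)))%R.
  rewrite powRM ?(ltW l0)//; congr (_ * _)%R.
  rewrite powRD; first by rewrite powR_mulrn ?(ltW l0)// (mulrC s).
  by rewrite (gt_eqF l0) implybT.
have Els : (l `^ (2 * s) <= 4 * `|k| `^ (2 * s))%R.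
  rewrite /l powRM//; apply: ler_wpM2r; first exact: powR_ge0.
  apply: (@le_trans _ _ ((2 : R) `^ 2%:R)%R).
    by apply: ler_powR; [rewrite ler1n|case/andP: s01 => _ s1'; rewrite ler_piMr// ltW].
  by rewrite powR_mulrn// expr2 -natrM.
rewrite /A1 /A2 /a1 /a3 /c2 /eta E6 E4 El Er En /energy_const -/Cn.
set P := ((2 * r) ^+ n)%R in D0 *; set Q := (l ^+ n)%R in D0 *; set t3 := (3 ^+ n)%R; set t2 := (2 ^+ n)%R.
set nn := (n%:R `^ _)%R; set rs := (r `^ _)%R; set ls := (l `^ (2 * s))%R; set ks := (`|k| `^ _)%R.
have Q0 : (0 < Q)%R by exact: exprn_gt0.
have t30 : (0 <= t3)%R by exact: exprn_ge0.
have t20 : (0 <= t2)%R by exact: exprn_ge0.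
have nn0 : (0 <= nn)%R by exact: powR_ge0.
apply: (@le_trans _ _ (P * Q * (2 * (t3 * (8 * Lambda / (1 - s)) * (th * (Kp * M)) +
   t3 * (72 * Lambda ^+ 4 * Cn) * (th * (Kp ^+ 2 * rs * KN)) +
   t3 * (9 * nn * t2) * (th^-1 * ls * KN) + t2 * (8 * Lambda ^+ 2) * (th * (Kp * T))))))%R.
  rewrite le_eqVlt; apply/orP; left; apply/eqP; field.
  by rewrite !gt_eqF.
apply: ler_wpM2l; first exact: ltW.
rewrite -[leRHS]mulrA; apply: ler_wpM2l => //.
have ith0 : (0 <= th^-1)%R by rewrite invr_ge0 ltW.
have ls0 : (0 <= ls)%R by exact: powR_ge0.
have ks0 : (0 <= ks)%R by exact: powR_ge0.
have rs0 : (0 <= rs)%R by exact: powR_ge0.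
set c1 := (t3 * (8 * Lambda / (1 - s)))%R; set b2 := (t3 * (72 * Lambda ^+ 4 * Cn))%R.
set b3 := (t3 * (9 * nn * t2))%R; set b4 := (t2 * (8 * Lambda ^+ 2))%R.
have c10 : (0 <= c1)%R by apply: mulr_ge0 => //; apply: divr_ge0; [apply: mulr_ge0 => //; exact: ltW|exact: ltW].
have b20 : (0 <= b2)%R.
  by apply: mulr_ge0 => //; apply: mulr_ge0 => //; apply: mulr_ge0 => //; apply: exprn_ge0; exact: ltW.
have b30 : (0 <= b3)%R by apply: mulr_ge0 => //; apply: mulr_ge0 => //; apply: mulr_ge0.
have b40 : (0 <= b4)%R by apply: mulr_ge0 => //; apply: mulr_ge0 => //; exact: sqr_ge0.
rewrite (_ : (t3 * (9 * nn * t2 * 4) = b3 * 4)%R); last by rewrite /b3; ring.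
set u1 := (th * (Kp * M))%R; set u2 := (th * (Kp ^+ 2 * rs * KN))%R; set u4 := (th * (Kp * T))%R.
have u10 : (0 <= u1)%R by apply: mulr_ge0; [exact: ltW|exact: mulr_ge0].
have u20 : (0 <= u2)%R by apply: mulr_ge0; [exact: ltW|apply: mulr_ge0 => //; apply: mulr_ge0 => //; exact: sqr_ge0].
have u40 : (0 <= u4)%R by apply: mulr_ge0; [exact: ltW|exact: mulr_ge0].
set u3 := (th^-1 * ks * KN)%R.
have u30 : (0 <= u3)%R by apply: mulr_ge0 => //; exact: mulr_ge0.
have u3' : (th^-1 * ls * KN <= 4 * u3)%R.
  rewrite (_ : (4 * u3 = th^-1 * (4 * ks) * KN)%R); last by rewrite /u3; ring.
  by apply: ler_wpM2r => //; exact: ler_wpM2l.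
have -> : (th * (Kp * M + Kp ^+ 2 * rs * KN + Kp * T) = u1 + u2 + u4)%R by rewrite /u1 /u2 /u4; ring.
have := ler_wpM2l b30 u3'; move: (b3 * (th^-1 * ls * KN))%R => y hy.
apply: (@le_trans _ _ (c1 * u1 + b2 * u2 + (b3 * (4 * u3)) + b4 * u4)%R); first by rewrite lerD2r lerD2l.
rewrite -subr_ge0.
have -> : ((c1 + b2 + b3 * 4 + b4) * (u1 + u2 + u4 + u3) - (c1 * u1 + b2 * u2 + b3 * (4 * u3) + b4 * u4) =
   c1 * (u2 + u4 + u3) + b2 * (u1 + u4 + u3) + b3 * (4 * (u1 + u2 + u4)) + b4 * (u1 + u2 + u3))%R by ring.
by rewrite !addr_ge0// mulr_ge0// ?addr_ge0// mulr_ge0// !addr_ge0.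
Qed.

End energy_estimate.

(** * Second differences and their integrals *)

Lemma ltr_add34 (R : realFieldType) (a b r d : R) :
  a < 3 * r -> b <= r -> r <= d -> a + b < 4 * d.
Proof. lra. Qed.

Lemma ltr_add_half6 (R : realFieldType) (a b r d : R) :
  0 < d -> a <= r / 2 -> b <= r -> r <= d -> a + b < 6 * d.
Proof. lra. Qed.

Section second_differences.
Context {R : realType} {n : nat}.
Notation Rn := 'rV[R]_n.
Notation leb := (@lebesgue_rV R n).
Variable Omega : set Rn.
Hypothesis mO : measurable Omega.
Implicit Types (v f : Rn -> R) (k h p x : Rn).

Definition diff2 v k h x : R := (v (x + k + h) - v (x + k)) - (v (x + h) - v x).

Lemma measurable_diff2 v k h : measurable_fun setT v -> measurable_fun setT (diff2 v k h).
Proof. by move=> mv; rewrite /diff2; mfun. Qed.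

Lemma diff2C v k h x : diff2 v k h x = diff2 v h k x.
Proof. by rewrite /diff2 (addrAC x k h); ring. Qed.

Lemma diff2B v f k h x : diff2 v k h x = diff2 f k h x + diff2 (fun y => v y - f y) k h x.
Proof. by rewrite /diff2; ring. Qed.

Lemma diff2_le v k h x : `|diff2 v k h x| <= `|v (x + k + h)| + `|v (x + k)| + `|v (x + h)| + `|v x|.
Proof.
rewrite /diff2; apply: le_trans (ler_normB _ _) _; rewrite -[leRHS]addrA.
by apply: lerD; exact: ler_normB.
Qed.

Lemma powR_add_le (p a b : R) : 0 <= p <= 2 -> 0 <= a -> 0 <= b ->
  (a + b) `^ p <= 4 * (a `^ p + b `^ p).
Proof.
move=> /andP[p0 p2] a0 b0; wlog ab : a b a0 b0 / a <= b.
  by move=> H; have [ab|/ltW ba] := leP a b; [exact: H|rewrite addrC (addrC (a `^ p)); exact: H].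
apply: (@le_trans _ _ ((2 * b) `^ p)).
  by apply: ge0_ler_powR => //; rewrite ?nnegrE ?addr_ge0 ?mulr_ge0//; lra.
rewrite powRM//; apply: ler_pM; rewrite ?powR_ge0// ?lerDr ?powR_ge0//.
apply: (@le_trans _ _ ((2 : R) `^ 2%:R)); first by apply: ler_powR; rewrite // ler1n.
by rewrite powR_mulrn// expr2 -natrM.
Qed.

Lemma diff2_powR_le (p : R) v k h x : 0 <= p <= 2 ->
  `|diff2 v k h x| `^ p <= 16 * (`|v (x + k + h)| `^ p + `|v (x + k)| `^ p + `|v (x + h)| `^ p + `|v x| `^ p).
Proof.
move=> p02; have /andP[p0 _] := p02.
apply: (@le_trans _ _ ((`|v (x + k + h)| + `|v (x + k)| + (`|v (x + h)| + `|v x|)) `^ p)).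
  apply: ge0_ler_powR => //; rewrite ?nnegrE ?addr_ge0//.
  by apply: le_trans (diff2_le _ _ _ _) _; rewrite !addrA.
have A0 := normr_ge0 (v (x + k + h)); have B0 := normr_ge0 (v (x + k)).
have C0 := normr_ge0 (v (x + h)); have D0 := normr_ge0 (v x).
apply: le_trans (powR_add_le p02 (addr_ge0 A0 B0) (addr_ge0 C0 D0)) _.
by have := powR_add_le p02 A0 B0; have := powR_add_le p02 C0 D0; lra.
Qed.

Local Open Scope ereal_scope.

Lemma integral_inner_shift f (a : R) k : measurable_fun setT f -> (forall x, (0 <= f x)%R) ->
  (`|k| < a)%R ->
  \int[leb]_(x in inner Omega a) (f (x + k)%R)%:E <= \int[leb]_(x in Omega) (f x)%:E.
Proof.
move=> mf f0 ka; apply: (@le_integral_rV_shift R n k (inner Omega a) Omega (fun x => (f x)%:E)) => //.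
- by mfun.
- by move=> x ix; apply: (inner_in ix); rewrite addrAC subrr add0r.
Qed.

(** [64 = 16 * 4]: the factor 16 comes from applying [powR_add_le] twice, and each of the four
    translates is integrated over a subset of [Omega]. *)
Lemma integral_diff2_powR (p a : R) v k h : (0 <= p <= 2)%R -> measurable_fun setT v ->
  (`|k| + `|h| < a)%R ->
  \int[leb]_(x in inner Omega a) (`|diff2 v k h x| `^ p)%:E <=
  64%:E * \int[leb]_(x in Omega) (`|v x| `^ p)%:E.
Proof.
move=> p02 mv kha.
have ka : (`|k| < a)%R by apply: le_lt_trans kha; rewrite lerDl.
have ha : (`|h| < a)%R by apply: le_lt_trans kha; rewrite lerDr.
have a0 : (0 < a)%R by apply: le_lt_trans ka.
pose f x : R := (`|v x| `^ p)%R.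
have mf : measurable_fun setT f by rewrite /f; mfun.
have f0 x : (0 <= f x)%R by exact: powR_ge0.
have mI : measurable (inner Omega a) by exact: inner_measurable.
have mfs (e : Rn) : measurable_fun (inner Omega a) (fun x => (f (x + e)%R)%:E).
  by apply: measurable_funTS; mfun.
have mf0 : measurable_fun (inner Omega a) (fun x => (f x)%:E).
  by apply: measurable_funTS; mfun.
apply: (@le_trans _ _ (\int[leb]_(x in inner Omega a) (16%:E * ((f (x + (k + h))%R)%:E + (f (x + k)%R)%:E + (f (x + h)%R)%:E + (f x)%:E)))).
  apply: le_integral_ge0 => [//|x _|x _|x _].
  - by rewrite lee_fin powR_ge0.
  - by rewrite mule_ge0 ?adde_ge0 ?lee_fin.
  - by rewrite -!EFinD -EFinM lee_fin addrA; exact: diff2_powR_le.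
rewrite ge0_integralZl_EFin; [|exact: mI|by move=> x _; rewrite !adde_ge0 ?lee_fin|
  by do 3?[apply: emeasurable_funD]|by []].
rewrite ge0_integralD; [|exact: mI|by move=> x _; rewrite !adde_ge0 ?lee_fin|
  by do 3?[apply: emeasurable_funD]|by move=> x _; rewrite lee_fin|by []].
rewrite ge0_integralD; [|exact: mI|by move=> x _; rewrite !adde_ge0 ?lee_fin|
  by do 3?[apply: emeasurable_funD]|by move=> x _; rewrite lee_fin|by []].
rewrite ge0_integralD; [|exact: mI|by move=> x _; rewrite lee_fin|by []|by move=> x _; rewrite lee_fin|by []].
set J := \int[leb]_(x in Omega) (f x)%:E.
have J0 : 0 <= J by apply: integral_ge0 => x _; rewrite lee_fin.
have h1 : \int[leb]_(x in inner Omega a) (f (x + (k + h))%R)%:E <= J.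
  by apply: integral_inner_shift => //; exact: le_lt_trans (ler_normD _ _) kha.
have h2 : \int[leb]_(x in inner Omega a) (f (x + k)%R)%:E <= J by exact: integral_inner_shift.
have h3 : \int[leb]_(x in inner Omega a) (f (x + h)%R)%:E <= J by exact: integral_inner_shift.
have h4 : \int[leb]_(x in inner Omega a) (f x)%:E <= J.
  by apply: le_integral_ge0 => [|x _|x _|//]; rewrite ?lee_fin//; exact: inner_sub.
apply: (@le_trans _ _ (16%:E * (J + J + J + J))).
  by apply: lee_wpmul2l; [rewrite lee_fin|exact: leeD (leeD (leeD h1 h2) h3) h4].
rewrite (_ : J + J + J + J = 4%:E * J); last first.
  rewrite (_ : 4%:E = 1 + 1 + 1 + 1); last by rewrite -!EFinD; congr (_%:E); ring.
  by rewrite !ge0_muleDl ?mul1e// ?adde_ge0.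
by rewrite muleA -EFinM -natrM.
Qed.

Lemma integral_diff2 (a : R) v k h : measurable_fun setT v -> (`|k| + `|h| < a)%R ->
  \int[leb]_(x in inner Omega a) (`|diff2 v k h x|)%:E <=
  64%:E * \int[leb]_(x in Omega) (`|v x|)%:E.
Proof.
move=> mv kha; have := @integral_diff2_powR 1%R a v k h; rewrite ler01 ler1n => /(_ isT mv kha).
under eq_integral do rewrite powRr1//.
by under [in X in _ <= X -> _]eq_integral do rewrite powRr1//.
Qed.

End second_differences.

(** * Tails of the kernel away from the diagonal *)

Section kernel_tails.
Context {R : realType} {n : nat}.
Notation Rn := 'rV[R]_n.
Notation leb := (@lebesgue_rV R n).
Variable s : R.
Hypothesis s0 : 0 < s.
Local Open Scope ereal_scope.

Definition far_mass (r : R) : R := (4 ^+ n / (1 - 2 `^ (- (2 * s))) * r `^ (- (2 * s)))%R.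

Lemma far_mass_ge0 r : (0 <= far_mass r)%R.
Proof.
rewrite mulr_ge0 ?powR_ge0// divr_ge0 ?exprn_ge0// subr_ge0 ltW//.
have H : (0 < 2 * s)%R by rewrite mulr_gt0.
by have /andP[] := powR2_lt1 H.
Qed.

Lemma kern_far_mass (r : R) : (0 < r)%R ->
  \int[leb]_e (((r <= `|e|)%R)%:R * kern s e)%:E <= (far_mass r)%:E.
Proof.
move=> r0; have H : (0 < 2 * s)%R by rewrite mulr_gt0.
apply: le_trans (@integral_far_le R n _ _ H r0).
rewrite [leRHS]integral_mkcond; apply: le_integral_ge0 => [//|e _|e _|e _].
- by rewrite lee_fin mulr_ge0 ?kern_ge0.
- by apply: erestrict_ge0 => z _; rewrite lee_fin divr_ge0 ?powR_ge0 ?exprn_ge0.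
rewrite patchE; case: ifPn => [|/negP er].
  by rewrite inE/= => ->; rewrite mul1r lee_fin; exact: kern_le.
by case: (leP r `|e|%R) => h; [case: er; rewrite inE|rewrite mul0r].
Qed.

Lemma kern_far_le (d : R) (e : Rn) : (0 < d)%R -> (d <= `|e|)%R ->
  (kern s e <= d `^ (- (2 * s)) / d ^+ n)%R.
Proof.
move=> d0 de; have e0 : (0 < `|e|)%R by exact: lt_le_trans de.
apply: le_trans (kern_le s0 e) _; rewrite !powRN; apply: ler_pM.
- by rewrite invr_ge0 powR_ge0.
- by rewrite invr_ge0 exprn_ge0.
- rewrite lef_pV2 ?posrE ?powR_gt0//; apply: ge0_ler_powR => //; rewrite ?nnegrE ?(ltW d0) ?(ltW e0)//.
  by rewrite mulr_ge0// ltW.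
- by rewrite lef_pV2 ?posrE ?exprn_gt0// lerXn2r ?nnegrE// ltW.
Qed.

Lemma kern_scale (lam : R) (e e' : Rn) : (0 < lam)%R -> e' != 0%R -> (enorm e' <= lam * enorm e)%R ->
  (kern s e <= lam `^ (n%:R + s * 2) * kern s e')%R.
Proof.
move=> lam0 e'0 ee.
have E' : (0 < enorm e')%R by apply: lt_le_trans (enorm_ge_norm e'); rewrite normr_gt0.
have E : (0 < enorm e)%R by rewrite -(pmulr_rgt0 _ lam0); exact: lt_le_trans ee.
have p0 : (0 <= n%:R + s * 2)%R by rewrite addr_ge0// mulr_ge0// ltW.
rewrite /kern !powRN ler_pdivlMr ?powR_gt0// mulrC ler_pdivrMr ?powR_gt0//.
rewrite -powRM ?enorm_ge0 ?(ltW lam0)//.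
by apply: ge0_ler_powR => //; rewrite nnegrE ?enorm_ge0// mulr_ge0 ?enorm_ge0// ltW.
Qed.

Variable Omega : set Rn.
Hypothesis mO : measurable Omega.
Variables (S d : R) (z : Rn).
Hypothesis S0 : (0 < S)%R.
Hypothesis d0 : (0 < d)%R.
Hypothesis OS : Omega `<=` ball (0%R : Rn) S.
Hypothesis Oz : Omega z.

(** The factor comparing distances from a moving and from a fixed point of [Omega]: if
    [|y - x - h| >= d >= |h|], then [|z - y| <= 2 * |y - x - h| + 2 * S], and [2 * S] is at most
    [2 * S / d] times [|y - x - h|]. The factor [n] passes to the Euclidean norm. *)
Definition tail_scale : R := (n%:R * (2 * S / d + 2))%R.

(** Inside [Omega] the kernel is bounded since [|e| >= d]. Outside, the kernel centred at [x + h] is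
    compared with the one centred at the fixed point [z], which makes the bound uniform in [x]. *)
Lemma tail_integral_le (u : Rn -> R) (h x : Rn) : measurable_fun setT u -> Omega x -> (`|h| <= d)%R -> (0 < n)%N ->
  \int[leb]_e (((d <= `|e|)%R)%:R * kern s e * `|u (x + e + h)|)%:E <=
  (d `^ (- (2 * s)) / d ^+ n)%:E * \int[leb]_(y in Omega) `|u y|%:E +
  (tail_scale `^ (n%:R + s * 2))%:E * \int[leb]_(y in ~` Omega) (`|u y| * kern s (z - y))%:E.
Proof.
move=> mu Ox hd n0; have mk := @measurable_kern R n s.
pose F (y : Rn) : R := (((d <= `|y - x - h|)%R)%:R * kern s (y - x - h) * `|u y|)%R.
have F0 y : (0 <= F y)%R by rewrite mulr_ge0// mulr_ge0 ?kern_ge0.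
have mF : measurable_fun setT F by rewrite /F; mfun.
have mFE : measurable_fun setT (fun y => (F y)%:E) by mfun.
have -> : \int[leb]_e (((d <= `|e|)%R)%:R * kern s e * `|u (x + e + h)|)%:E = \int[leb]_y (F y)%:E.
  rewrite -(@ge0_integral_rV_shift R n (x + h) (fun y => (F y)%:E)) //.
  apply: eq_integral => e _; rewrite /F.
  have -> : (e + (x + h) - x - h = e)%R by rewrite addrA (addrAC _ h) addrK addrK.
  by rewrite (addrC x e) addrA.
rewrite (integral_split mO mFE); last by move=> y; rewrite lee_fin.
have c0 : (0 <= d `^ (- (2 * s)) / d ^+ n)%R by rewrite divr_ge0 ?powR_ge0// exprn_ge0// ltW.
apply: leeD.
  rewrite -ge0_integralZl_EFin; [|exact: mO|by move=> y _; rewrite lee_fin|by apply: measurable_funTS; mfun|exact: c0].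
  apply: le_integral_ge0 => [//|y _|y _|y _].
  - by rewrite lee_fin.
  - by rewrite -EFinM lee_fin mulr_ge0.
  rewrite -EFinM lee_fin /F; apply: ler_wpM2r => //.
  by case: (leP d `|y - x - h|%R) => h1; [rewrite mul1r; exact: kern_far_le|rewrite mul0r].
have ts0 : (0 < tail_scale)%R.
  by rewrite mulr_gt0 ?ltr0n// addr_gt0// divr_gt0// mulr_gt0.
have mk2 : measurable_fun setT (fun y : Rn => `|u y| * kern s (z - y))%R by mfun.
rewrite -ge0_integralZl_EFin; [|exact: measurableC|by move=> y _; rewrite lee_fin mulr_ge0 ?kern_ge0|
  by apply: measurable_funTS; mfun|exact: powR_ge0].
apply: le_integral_ge0 => [//|y _|y _|y nOy].
- by rewrite lee_fin.
- by rewrite -EFinM lee_fin mulr_ge0 ?powR_ge0// mulr_ge0 ?kern_ge0.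
rewrite -EFinM lee_fin /F mulrCA mulrC; apply: ler_wpM2l; first exact: normr_ge0.
case: (leP d `|y - x - h|%R) => h1; last by rewrite mul0r mulr_ge0 ?powR_ge0 ?kern_ge0.
rewrite mul1r; apply: kern_scale => //.
  by apply/eqP => /subr0_eq zy; apply: nOy; rewrite -zy.
have nb a : Omega a -> (`|a| < S)%R by move/OS; rewrite -ball_normE/= sub0r normrN.
have t1 : (`|z - y| <= `|y - x - h| + `|h| + (`|z| + `|x|))%R.
  rewrite -(normrN (y - x - h)%R) (_ : (z - y = - (y - x - h) - h + (z - x))%R); last first.
    by apply/rowP => i; rewrite !mxE; ring.
  apply: le_trans (ler_normD _ _) _; apply: lerD; last exact: ler_normB.
  exact: ler_normB.
apply: le_trans (enorm_le_norm _) _; rewrite /tail_scale -mulrA; apply: ler_wpM2l => //.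
have LR (t b t2 t3 t4 E : R) : (t <= b + t2 + (t3 + t4) -> t2 <= d -> t3 < S -> t4 < S -> d <= b -> b <= E ->
    t <= (2 * S / d + 2) * E)%R.
  move=> a1 a2 a3 a4 a5 a6; have a7 : (2 * S <= 2 * S / d * E)%R.
    by rewrite mulrAC ler_pdivlMr// ler_wpM2l ?mulr_ge0 ?(ltW S0)// (le_trans a5).
  by rewrite mulrDl; lra.
exact: LR t1 hd (nb _ Oz) (nb _ Ox) h1 (enorm_ge_norm _).
Qed.

(** Of the four values in a second difference, the two that move with [e] are bounded by
    [tail_integral_le], and the two that do not are multiplied by the finite mass of the kernel
    beyond [d]. *)
Lemma tail_diff2_le (u : Rn -> R) (h : Rn) (A G Lb : R) : measurable_fun setT u -> (`|h| <= d)%R -> (0 < n)%N ->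
  \int[leb]_(y in Omega) `|u y|%:E <= A%:E -> leb Omega <= Lb%:E ->
  \int[leb]_(y in ~` Omega) (`|u y| * kern s (z - y))%:E <= G%:E ->
  \int[leb]_(x in inner Omega (2 * d)) \int[leb]_e (((d <= `|e|)%R)%:R * kern s e * `|diff2 u e h x|)%:E <=
  (2 * (d `^ (- (2 * s)) / d ^+ n * A + tail_scale `^ (n%:R + s * 2) * G) * Lb + far_mass d * (2 * A))%:E.
Proof.
move=> mu hd n0 HA HL HG; have mk := @measurable_kern R n s.
pose I := inner Omega (2 * d); have mI : measurable I by exact: inner_measurable.
have d20 : (0 < 2 * d)%R by rewrite mulr_gt0.
have IO : I `<=` Omega by exact: inner_sub.
pose B : R := (d `^ (- (2 * s)) / d ^+ n * A + tail_scale `^ (n%:R + s * 2) * G)%R.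
have c0 : (0 <= d `^ (- (2 * s)) / d ^+ n)%R by rewrite divr_ge0 ?powR_ge0// exprn_ge0// ltW.
have hB (h' x : Rn) : Omega x -> (`|h'| <= d)%R ->
    \int[leb]_e (((d <= `|e|)%R)%:R * kern s e * `|u (x + e + h')|)%:E <= B%:E.
  move=> Ox h'd; apply: le_trans (tail_integral_le mu Ox h'd n0) _.
  rewrite [leRHS]EFinD; apply: leeD; rewrite [leRHS]EFinM; apply: lee_wpmul2l => //; rewrite lee_fin//.
  exact: powR_ge0.
have A0 : (0 <= A)%R.
  by rewrite -lee_fin; apply: le_trans HA; apply: integral_ge0 => x _; rewrite lee_fin.
have B0 : (0 <= B)%R.
  rewrite -lee_fin; apply: le_trans (hB 0%R z Oz _); last by rewrite normr0 ltW.
  by apply: integral_ge0 => x _; rewrite lee_fin mulr_ge0// mulr_ge0 ?kern_ge0.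
have F0 := far_mass_ge0 d.
pose ke (e : Rn) : R := (((d <= `|e|)%R)%:R * kern s e)%R.
have ke0 e : (0 <= ke e)%R by rewrite mulr_ge0 ?kern_ge0.
have mke : measurable_fun setT ke by rewrite /ke; mfun.
apply: (@le_trans _ _ (\int[leb]_(x in I) ((2 * B)%:E + (far_mass d)%:E * (`|u (x + h)|%:E + `|u x|%:E)))).
  apply: le_integral_ge0 => [//|x _|x _|x Ix].
  - by apply: integral_ge0 => e _; rewrite lee_fin; exact: mulr_ge0 (ke0 e) (normr_ge0 _).
  - apply: adde_ge0; first by rewrite lee_fin; exact: mulr_ge0.
    by rewrite mule_ge0 ?adde_ge0 ?lee_fin.
  have Ox := IO _ Ix.
  have m1 (h' : Rn) : measurable_fun setT (fun e : Rn => (ke e * `|u (x + e + h')|)%:E) by mfun.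
  have m2 (a : R) : measurable_fun setT (fun e : Rn => (ke e * a)%:E) by mfun.
  apply: (@le_trans _ _ (\int[leb]_e ((ke e * `|u (x + e + h)|)%:E + (ke e * `|u (x + e + 0)|)%:E +
     (ke e * (`|u (x + h)| + `|u x|))%:E))).
    apply: le_integral_ge0 => [//|e _|e _|e _].
    - by rewrite lee_fin; exact: mulr_ge0 (ke0 e) (normr_ge0 _).
    - by rewrite -!EFinD lee_fin -!mulrDr; apply: (mulr_ge0 (ke0 e)); rewrite !addr_ge0.
    rewrite -!EFinD lee_fin addr0 -!mulrDr -/(ke e); apply: ler_wpM2l => //.
    by apply: le_trans (diff2_le _ _ _ _) _; rewrite !addrA.
  have p1 (h' e : Rn) : 0 <= (ke e * `|u (x + e + h')|)%:E by rewrite lee_fin; exact: mulr_ge0 (ke0 e) (normr_ge0 _).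
  have p2 (e : Rn) : 0 <= (ke e * (`|u (x + h)| + `|u x|))%:E.
    by rewrite lee_fin; exact: mulr_ge0 (ke0 e) (addr_ge0 (normr_ge0 _) (normr_ge0 _)).
  rewrite ge0_integralD; [|exact: measurableT|by move=> e _; exact: adde_ge0|exact: emeasurable_funD|by []|exact: m2].
  rewrite ge0_integralD; [|exact: measurableT|by []|exact: m1|by []|exact: m1].
  apply: leeD.
    rewrite mulr_natl mulr2n EFinD; apply: leeD; apply: hB => //.
    by rewrite normr0 ltW.
  under eq_integral do rewrite EFinM.
  rewrite ge0_integralZr; [|exact: measurableT|by mfun|by move=> e _; rewrite lee_fin|by rewrite lee_fin addr_ge0].
  rewrite EFinD; apply: lee_wpmul2r; first by rewrite adde_ge0 ?lee_fin.
  exact: kern_far_mass.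
have muh : measurable_fun I (fun x => `|u (x + h)|%:E) by apply: measurable_funTS; mfun.
have mu0 : measurable_fun I (fun x => `|u x|%:E) by apply: measurable_funTS; mfun.
rewrite ge0_integralD; [|exact: mI|by move=> x _; rewrite lee_fin mulr_ge0|exact: measurable_cst|
  by move=> x _; rewrite mule_ge0 ?adde_ge0 ?lee_fin|by apply: measurable_funeM; exact: emeasurable_funD].
rewrite [leRHS]EFinD; apply: leeD.
  rewrite integral_cst// [leRHS]EFinM; apply: lee_wpmul2l; first by rewrite lee_fin; exact: mulr_ge0.
  apply: le_trans HL; apply: le_measure; rewrite ?inE//.
rewrite ge0_integralZl_EFin; [|exact: mI|by move=> x _; rewrite adde_ge0 ?lee_fin|exact: emeasurable_funD|exact: F0].
rewrite [leRHS]EFinM; apply: lee_wpmul2l; first by rewrite lee_fin.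
rewrite ge0_integralD; [|exact: mI|by move=> x _; rewrite lee_fin|by []|by move=> x _; rewrite lee_fin|by []].
rewrite mulr_natl mulr2n EFinD; apply: leeD.
  apply: le_trans HA; apply: (@integral_inner_shift R n Omega mO (fun x => `|u x|)%R) => //; first by mfun.
  by apply: le_lt_trans hd _; rewrite ltr_pMl// ltr1n.
by apply: le_trans HA; apply: le_integral_ge0 => // x _; rewrite lee_fin.
Qed.

End kernel_tails.

(** * Passage to the limit in the estimate *)

Lemma energy_const_ge0 {R : realType} n (s Lambda : R) : 0 < s < 1 -> 1 <= Lambda ->
  0 <= energy_const n s Lambda.
Proof.
move=> /andP[s0 s1] L1; have L0 : 0 <= Lambda by exact: le_trans L1.
have H : 0 < 2 - 2 * s by lra.
have /andP[_ h] := powR2_lt1 H.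
have C0 : 0 <= 4 ^+ n / (1 - 2 `^ (- (2 - 2 * s))) :> R by rewrite divr_ge0 ?exprn_ge0// subr_ge0 ltW.
have e3 : 0 <= 3 ^+ n :> R by exact: exprn_ge0.
have e2 : 0 <= 2 ^+ n :> R by exact: exprn_ge0.
apply: mulr_ge0 => //; apply: addr_ge0; [apply: addr_ge0; [apply: addr_ge0|]|]; apply: mulr_ge0 => //.
- by apply: divr_ge0; [exact: mulr_ge0|rewrite subr_ge0 ltW].
- by apply: mulr_ge0 => //; apply: mulr_ge0 => //; exact: exprn_ge0.
- by apply: mulr_ge0 => //; apply: mulr_ge0 => //; apply: mulr_ge0 => //; exact: powR_ge0.
Qed.

(** [4 * N + kap], [T + 1 + Tc] and the last [th * Kp] are what remains when an approximation is
    replaced by its limit. They are absorbed in one constant because [N], [kap], [T] and 1 already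
    occur on the right. *)
Lemma estimate_algebra {R : realType} (Ec M Tc Lb kap N T Kp rs ks th : R) :
  0 <= Ec -> 0 <= M -> 0 <= Tc -> 0 <= Lb -> 0 <= kap -> 0 <= N -> 0 <= T -> 0 <= Kp -> 0 <= rs -> 0 <= ks -> 0 < th ->
  Ec * (th * (Kp * M + Kp ^+ 2 * rs * (kap * Lb + 2 * (4 * N + kap)) + Kp * (T + 1 + Tc)) +
        th^-1 * ks * (kap * Lb + 2 * (4 * N + kap))) + th * Kp <=
  (Ec * (M + Tc + Lb + 10) + 1) *
    (th * (Kp * (1 + T) + Kp ^+ 2 * rs * (kap + N)) + th^-1 * ks * (kap + N)).
Proof.
move=> Ec0 M0 Tc0 Lb0 kap0 N0 T0 Kp0 rs0 ks0 th0; set W := M + Tc + Lb + 10.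
have KN : kap * Lb + 2 * (4 * N + kap) <= W * (kap + N).
  have h1 : 0 <= (M + Tc + 8) * kap by apply: mulr_ge0 => //; lra.
  have h2 : 0 <= (M + Tc + Lb + 2) * N by apply: mulr_ge0 => //; lra.
  by rewrite -subr_ge0 (_ : _ - _ = (M + Tc + 8) * kap + (M + Tc + Lb + 2) * N) ?addr_ge0// /W; ring.
have KT : Kp * M + Kp * (T + 1 + Tc) <= W * (Kp * (1 + T)).
  rewrite -mulrDr mulrCA; apply: ler_wpM2l => //.
  have h1 : 0 <= (M + Tc + Lb + 9) * T by apply: mulr_ge0 => //; lra.
  by rewrite -subr_ge0 (_ : _ - _ = (M + Tc + Lb + 9) * T + (Lb + 9)) ?addr_ge0// /W; ring.
have t1 : th * (Kp * M + Kp ^+ 2 * rs * (kap * Lb + 2 * (4 * N + kap)) + Kp * (T + 1 + Tc)) <=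
   W * (th * (Kp * (1 + T) + Kp ^+ 2 * rs * (kap + N))).
  rewrite [leRHS]mulrCA; apply: ler_wpM2l; first exact: ltW.
  rewrite [leLHS]addrAC [leRHS]mulrDr; apply: lerD => //.
  rewrite [leRHS]mulrCA; apply: ler_wpM2l => //.
  by apply: mulr_ge0 => //; exact: sqr_ge0.
have t2 : th^-1 * ks * (kap * Lb + 2 * (4 * N + kap)) <= W * (th^-1 * ks * (kap + N)).
  by rewrite [leRHS]mulrCA; apply: ler_wpM2l => //; apply: mulr_ge0 => //; rewrite invr_ge0 ltW.
have t3 := ler_wpM2l Ec0 (lerD t1 t2).
set X := th * (Kp * (1 + T) + Kp ^+ 2 * rs * (kap + N)) in t1 t3 *.
set Y := th^-1 * ks * (kap + N) in t2 t3 *.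
rewrite -mulrDr mulrA in t3.
rewrite [leRHS]mulrDl mul1r; apply: lerD => //.
have Y0 : 0 <= Y by apply: mulr_ge0; [apply: mulr_ge0 => //; rewrite invr_ge0 ltW|exact: addr_ge0].
rewrite -[leLHS]addr0; apply: lerD => //; apply: ler_wpM2l; first exact: ltW.
rewrite mulrDr mulr1 -addrA lerDl addr_ge0 ?mulr_ge0 ?addr_ge0//.
Qed.

Section limit.
Context {R : realType} {n : nat}.
Notation Rn := 'rV[R]_n.
Notation leb := (@lebesgue_rV R n).
Variables (s Lambda : R) (Phi : R -> R).
Hypothesis n0 : (0 < n)%N.
Hypothesis s01 : 0 < s < 1.
Hypothesis Lam1 : 1 <= Lambda.
Hypothesis HPhi : structure_assumption Lambda Phi.
Variable Omega : set Rn.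
Hypothesis oO : open Omega.
Hypothesis bO : bounded_set Omega.
Variable z : Rn.
Hypothesis Oz : Omega z.
Variables (uj fj : nat -> Rn -> R) (v : Rn -> R) (qmax M G U : R).
Hypothesis cf : forall j, continuous (fj j).
Hypothesis fb : forall j, exists Fb : R, forall x, `|fj j x| <= Fb.
Hypothesis mu : forall j, measurable_fun setT (uj j).
Hypothesis gu : forall j, (gag s (uj j) < +oo)%E.
Hypothesis weak : forall j, weak_formulation s Phi Omega (uj j) (density_integral Omega (fj j)).
Hypothesis mv : measurable_fun setT v.
Local Open Scope ereal_scope.
Hypothesis Hconv : forall q e : R, (1 <= q < qmax)%R -> (0 < e)%R ->
  \forall j \near \oo, \int[leb]_(x in Omega) (`|uj j x - v x| `^ q)%:E <= e%:E.
Hypothesis HM : \forall j \near \oo, \int[leb]_(x in Omega) `|fj j x|%:E <= M%:E.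
Hypothesis HG : \forall j \near \oo, \int[leb]_(y in ~` Omega) (`|uj j y| * kern s (z - y))%:E <= G%:E.
Hypothesis HU : \int[leb]_(x in Omega) `|v x|%:E <= U%:E.

Let s0 : (0 < s)%R. Proof. by case/andP: s01. Qed.
Let mO : measurable Omega. Proof. exact: rV_open_measurable. Qed.

(** The part [r <= |e| < d] of the tail, which better bounds on second differences improve. The part
    beyond [d] is bounded once and for all through the exterior values. *)
Definition near_tail (r d : R) (h : Rn) : \bar R :=
  \int[leb]_(x in inner Omega (2 * d)) \int[leb]_e
    (((r <= `|e|)%R)%:R * ((`|e| < d)%R)%:R * kern s e * `|diff2 v e h x|)%:E.

Let kd (r d : R) (e : Rn) : R := (((r <= `|e|)%R)%:R * ((`|e| < d)%R)%:R * kern s e)%R.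
Let kd0 r d e : (0 <= kd r d e)%R. Proof. by rewrite mulr_ge0 ?kern_ge0// mulr_ge0. Qed.
Let mkd r d : measurable_fun setT (kd r d).
Proof. by have mk := @measurable_kern R n s; rewrite /kd; mfun. Qed.

(** For fixed [e] with [|e| < d] the second difference has L^1 norm at most 64 times that of [f],
    and the kernel beyond [r] has finite mass. *)
Let near_tail_small (f : Rn -> R) (r d : R) (h : Rn) (eps : R) : measurable_fun setT f -> (0 < r)%R -> (0 < d)%R -> (`|h| <= d)%R ->
  \int[leb]_(x in Omega) `|f x|%:E <= eps%:E ->
  \int[leb]_(x in inner Omega (2 * d)) \int[leb]_e (kd r d e * `|diff2 f e h x|)%:E <=
  (@far_mass R n s r * (64 * eps))%:E.
Proof.
move=> mf r0 d0 hd feps; have mk := mkd r d.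
have m2 : measurable_fun setT (fun y : Rn * Rn => kd r d y.2 * `|diff2 f y.2 h y.1|)%R.
  by rewrite /diff2; mfun.
rewrite (@tonelli_in _ _ Rn Rn R leb leb (inner Omega (2 * d)) setT
   (fun x e => (kd r d e * `|diff2 f e h x|)%:E) (inner_measurable _ _) measurableT); last 2 first.
- exact: mf_EFin.
- by move=> x y; rewrite lee_fin mulr_ge0.
have e0 : (0 <= 64 * eps)%R.
  by rewrite mulr_ge0// -lee_fin; apply: le_trans feps; apply: integral_ge0 => x _; rewrite lee_fin.
have mks := @measurable_kern R n s.
apply: (@le_trans _ _ (\int[leb]_e ((((r <= `|e|)%R)%:R * kern s e)%:E * (64 * eps)%:E))).
  apply: le_integral_ge0 => [//|e _|e _|e _].
  - by apply: integral_ge0 => x _; rewrite lee_fin mulr_ge0.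
  - by rewrite -EFinM lee_fin mulr_ge0// mulr_ge0 ?kern_ge0.
  have md := measurable_diff2 e h mf.
  under eq_integral do rewrite EFinM.
  rewrite ge0_integralZl_EFin; [|exact: inner_measurable|by move=> x _; rewrite lee_fin|
    by apply: measurable_funTS; mfun|exact: kd0].
  have [ed|ed] := ltP `|e|%R d; last first.
    have -> : kd r d e = 0%R by rewrite /kd ltNge ed /= mulr0 mul0r.
    by rewrite mul0e -EFinM lee_fin mulr_ge0// mulr_ge0 ?kern_ge0.
  have -> : kd r d e = (((r <= `|e|)%R)%:R * kern s e)%R by rewrite /kd ed mulr1.
  apply: lee_wpmul2l; first by rewrite lee_fin mulr_ge0 ?kern_ge0.
  apply: le_trans (@integral_diff2 R n Omega mO (2 * d)%R f e h mf _) _.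
    by rewrite mulr_natl mulr2n; exact: ltr_leD.
  by rewrite EFinM; apply: lee_wpmul2l; rewrite ?lee_fin.
rewrite ge0_integralZr; [|exact: measurableT|by mfun|by move=> e _; rewrite lee_fin mulr_ge0 ?kern_ge0|by rewrite lee_fin].
by rewrite [leRHS]EFinM; apply: lee_wpmul2r; [rewrite lee_fin|exact: kern_far_mass].
Qed.

Let tail_split (u : Rn -> R) (r d : R) (h : Rn) (T t1 t2 : R) : measurable_fun setT u -> (0 < r)%R -> (r <= d)%R ->
  near_tail r d h <= T%:E ->
  \int[leb]_(x in inner Omega (2 * d)) \int[leb]_e (kd r d e * `|diff2 (fun y => u y - v y)%R e h x|)%:E <= t1%:E ->
  \int[leb]_(x in inner Omega (2 * d)) \int[leb]_e (((d <= `|e|)%R)%:R * kern s e * `|diff2 u e h x|)%:E <= t2%:E ->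
  \int[leb]_(x in inner Omega (2 * d)) \int[leb]_e (((r <= `|e|)%R)%:R * kern s e * `|diff2 u e h x|)%:E <= (T + t1 + t2)%:E.
Proof.
move=> mut r0 rd HT H1 H2; have mk := mkd r d; have mks := @measurable_kern R n s.
have mI : measurable (inner Omega (2 * d)) by exact: inner_measurable.
have key (f : Rn -> R) (k : Rn -> R) : measurable_fun setT f -> measurable_fun setT k -> (forall e, (0 <= k e)%R) ->
    [/\ forall x, 0 <= \int[leb]_e (k e * `|diff2 f e h x|)%:E,
      measurable_fun setT (fun x => \int[leb]_e (k e * `|diff2 f e h x|)%:E),
      forall x, measurable_fun setT (fun e => (k e * `|diff2 f e h x|)%:E) &
      forall x e, 0 <= (k e * `|diff2 f e h x|)%:E].
  move=> mf mk' k0'; have p x e : 0 <= (k e * `|diff2 f e h x|)%:E by rewrite lee_fin mulr_ge0.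
  split; [by move=> x; apply: integral_ge0| | |exact: p].
    apply: (@measurable_integral_in _ _ Rn Rn R leb setT (fun x e => (k e * `|diff2 f e h x|)%:E)).
    - exact: measurableT.
    - by rewrite /diff2; mfun.
    - exact: p.
  by move=> x; rewrite /diff2; mfun.
pose k2 (e : Rn) : R := (((d <= `|e|)%R)%:R * kern s e)%R.
have mk2 : measurable_fun setT k2 by rewrite /k2; mfun.
have k20 e : (0 <= k2 e)%R by rewrite mulr_ge0 ?kern_ge0.
have muv : measurable_fun setT (fun y => u y - v y)%R by mfun.
have [a1 a2 a3 a4] := key v (kd r d) mv mk (kd0 r d).
have [b1 b2 b3 b4] := key _ (kd r d) muv mk (kd0 r d).
have [c1 c2 c3 c4] := key u k2 mut mk2 k20.
apply: (@le_trans _ _ (\int[leb]_(x in inner Omega (2 * d))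
   (\int[leb]_e (kd r d e * `|diff2 v e h x|)%:E +
    \int[leb]_e (kd r d e * `|diff2 (fun y => u y - v y)%R e h x|)%:E +
    \int[leb]_e (k2 e * `|diff2 u e h x|)%:E))).
  apply: le_integral_ge0 => [//|x _|x _|x _].
  - by apply: integral_ge0 => e _; rewrite lee_fin mulr_ge0// mulr_ge0 ?kern_ge0.
  - exact: adde_ge0 (adde_ge0 (a1 x) (b1 x)) (c1 x).
  rewrite -ge0_integralD; [|exact: measurableT|by []|exact: a3|by []|exact: b3].
  rewrite -ge0_integralD; [|exact: measurableT|by move=> e _; exact: adde_ge0|
     by apply: emeasurable_funD; [exact: a3|exact: b3]|by []|exact: c3].
  apply: le_integral_ge0 => [//|e _|e _|e _].
  - by rewrite lee_fin mulr_ge0// mulr_ge0 ?kern_ge0.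
  - exact: adde_ge0 (adde_ge0 (a4 x e) (b4 x e)) (c4 x e).
  rewrite -!EFinD lee_fin /kd /k2; have k0 := kern_ge0 s e.
  have [ed|ed] := ltP `|e|%R d.
    rewrite mulr1 !mul0r addr0 -mulrDr; apply: ler_wpM2l; first exact: mulr_ge0.
    by rewrite (diff2B u v) ler_normD.
  by rewrite (le_trans rd ed) mulr0 !mul0r !add0r.
rewrite ge0_integralD; [|exact: mI|by move=> x _; exact: adde_ge0|
  by apply: measurable_funTS; exact: emeasurable_funD|by move=> x _; exact: c1|exact: measurable_funTS].
rewrite ge0_integralD; [|exact: mI|by move=> x _; exact: a1|exact: measurable_funTS|by move=> x _; exact: b1|exact: measurable_funTS].
by rewrite !EFinD; exact: leeD (leeD HT H1) H2.
Qed.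

(** The constant is fixed before [r], [kap], [del], [th], [N], [T], [h] and [k], whereas [j] is
    chosen after them, so large that replacing [uj j] by [v] costs at most [kap] in the moments, 1
    in the near tail and [th * Kp] in the conclusion. *)
Lemma diff2_limit_estimate (d : R) : (0 < d)%R -> exists2 C : R, (0 <= C)%R &
  forall (r kap del th N T : R) (h k : Rn), (0 < r <= d)%R -> (`|h| <= r)%R -> (0 < `|k| <= r / 2)%R ->
  (0 < kap <= 1)%R -> (0 < del <= 1)%R -> (1 + del < qmax)%R -> (0 < th)%R ->
  (forall p : Rn, (`|p| < 3 * r)%R ->
    \int[leb]_(x in inner Omega (4 * d)) (`|diff2 v p h x| `^ (1 + del))%:E <= N%:E) ->
  near_tail r d h <= T%:E ->
  \int[leb]_(x in inner Omega (6 * d)) `|diff2 v k h x|%:E <=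
  (C * (th * (psi_sup kap del * (1 + T) + psi_sup kap del ^+ 2 * r `^ (- (2 * s)) * (kap + N)) +
     th^-1 * `|k| `^ (2 * s) * (kap + N)))%:E.
Proof.
move=> d0; have [S S0 OS] := bounded_set_ball bO.
have Ofin := bounded_set_lebesgue bO mO.
pose Lb : R := fine (leb Omega).
have HL : leb Omega <= Lb%:E by rewrite /Lb fineK// ge0_fin_numE.
have Lb0 : (0 <= Lb)%R by rewrite /Lb fine_ge0.
have U0 : (0 <= U)%R.
  by rewrite -lee_fin; apply: le_trans HU; apply: integral_ge0 => x _; rewrite lee_fin.
have [M0 G0] : (0 <= M)%R /\ (0 <= G)%R.
  near \oo => j; split; rewrite -lee_fin.
    have : \int[leb]_(x in Omega) `|fj j x|%:E <= M%:E by near: j.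
    by apply: le_trans; apply: integral_ge0 => x _; rewrite lee_fin.
  have : \int[leb]_(y in ~` Omega) (`|uj j y| * kern s (z - y))%:E <= G%:E by near: j.
  by apply: le_trans; apply: integral_ge0 => x _; rewrite lee_fin mulr_ge0 ?kern_ge0.
pose Tc : R := (2 * (d `^ (- (2 * s)) / d ^+ n * (U + 1) + @tail_scale R n S d `^ (n%:R + s * 2) * G) * Lb +
  @far_mass R n s d * (2 * (U + 1)))%R.
have Tc0 : (0 <= Tc)%R.
  have U1 : (0 <= U + 1)%R by rewrite addr_ge0.
  apply: addr_ge0; last by rewrite mulr_ge0 ?far_mass_ge0// mulr_ge0.
  apply: mulr_ge0 => //; apply: mulr_ge0 => //; apply: addr_ge0; apply: mulr_ge0 => //; last exact: powR_ge0.
  by apply: divr_ge0; [exact: powR_ge0|apply: exprn_ge0; exact: ltW].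
have Ec0 := @energy_const_ge0 _ n _ _ s01 Lam1.
exists (energy_const n s Lambda * (M + Tc + Lb + 10) + 1)%R.
  exact: (addr_ge0 (mulr_ge0 Ec0 (addr_ge0 (addr_ge0 (addr_ge0 M0 Tc0) Lb0) (ler0n _ _))) ler01).
move=> r kap del th N T h k /andP[r0 rd] hr /andP[k0 kr] kap01 del01 delq th0 HN HT.
have /andP[kap0 kap1] := kap01; have /andP[del0 del1] := del01.
set Kp := psi_sup kap del; have Kp0 : (0 < Kp)%R by exact: psi_sup_gt0.
have p02 : (0 <= 1 + del <= 2)%R by lra.
have hd : (`|h| <= d)%R by exact: le_trans rd.
have N0 : (0 <= N)%R.
  have h0 : (`|0 : Rn| < 3 * r)%R by rewrite normr0 mulr_gt0.
  by rewrite -lee_fin; apply: le_trans (HN _ h0); apply: integral_ge0 => x _; rewrite lee_fin powR_ge0.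
have T0 : (0 <= T)%R.
  rewrite -lee_fin; apply: le_trans HT; apply: integral_ge0 => x _; apply: integral_ge0 => e _.
  by rewrite lee_fin; exact: mulr_ge0 (kd0 r d e) (normr_ge0 _).
pose FM := @far_mass R n s r; have FM0 : (0 <= FM)%R by exact: far_mass_ge0.
(* L^1 accuracy of the approximation: the three bounds serve the L^1 norm, the near tail and the
   left-hand side. *)
pose e2 : R := Num.min 1%R (Num.min ((64 * FM + 1)^-1)%R (th * Kp / 64)%R).
have FM1 : (0 < 64 * FM + 1)%R by rewrite ltr_wpDl// mulr_ge0.
have e20 : (0 < e2)%R by rewrite !lt_min ltr01 invr_gt0 FM1 divr_gt0// mulr_gt0.
have e2a : (e2 <= 1)%R by rewrite ge_min lexx.
have e2b : (FM * (64 * e2) <= 1)%R.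
  have : (e2 <= (64 * FM + 1)^-1)%R by rewrite !ge_min lexx orbT.
  rewrite -[X in (_ <= X)%R -> _]mul1r ler_pdivlMr// => he.
  by apply: le_trans he; nra.
have e2c : (64 * e2 <= th * Kp)%R.
  have : (e2 <= th * Kp / 64)%R by rewrite !ge_min lexx !orbT.
  by rewrite ler_pdivlMr// mulrC.
have q1 : (1 <= 1 + del < qmax)%R by rewrite delq lerDl ltW.
have q2 : ((1 : R) <= 1 < qmax)%R by rewrite lexx (le_lt_trans _ delq)// lerDl ltW.
(* [256 = 4 * 64]: the moment of the error is multiplied by 64 in [integral_diff2_powR] and by 4 in
   [powR_add_le]. *)
have kap256 : (0 < kap / 256)%R by apply: divr_gt0 kap0 _; rewrite ltr0n.
have H1 := Hconv q1 kap256; have H2 := Hconv q2 e20.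
near \oo => j.
have Mj : \int[leb]_(x in Omega) `|fj j x|%:E <= M%:E by near: j.
have Gj : \int[leb]_(y in ~` Omega) (`|uj j y| * kern s (z - y))%:E <= G%:E by near: j.
have C1 : \int[leb]_(x in Omega) (`|uj j x - v x| `^ (1 + del))%:E <= (kap / 256)%:E.
  by near: j; exact: H1.
have C2 : \int[leb]_(x in Omega) (`|uj j x - v x|)%:E <= e2%:E.
  under eq_integral do rewrite -[X in X%:E]powRr1//.
  by near: j; exact: H2.
have mw : measurable_fun setT (fun y => uj j y - v y)%R by have := mu j => m; mfun.
have mO' := mO.
have dvw (p : Rn) : measurable_fun setT (diff2 (fun y => uj j y - v y)%R p h) by exact: measurable_diff2.
have dv (p : Rn) : measurable_fun setT (diff2 v p h) by exact: measurable_diff2.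
have HNj (p : Rn) : (`|p| < 3 * r)%R ->
    \int[leb]_(x in inner Omega (4 * d)) (`|diff2 (uj j) p h x| `^ (1 + del))%:E <= (4 * N + kap)%:E.
  move=> pr; pose f1 x := (`|diff2 v p h x| `^ (1 + del))%:E.
  pose f2 x := (`|diff2 (fun y => uj j y - v y)%R p h x| `^ (1 + del))%:E.
  have f10 x : 0 <= f1 x by rewrite lee_fin powR_ge0.
  have f20 x : 0 <= f2 x by rewrite lee_fin powR_ge0.
  have mf1 : measurable_fun setT f1 by have := dv p => m; rewrite /f1; mfun.
  have mf2 : measurable_fun setT f2 by have := dvw p => m; rewrite /f2; mfun.
  apply: (@le_trans _ _ (\int[leb]_(x in inner Omega (4 * d)) (4%:E * (f1 x + f2 x)))).
    apply: le_integral_ge0 => [//|x _|x _|x _].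
    - by rewrite lee_fin powR_ge0.
    - by rewrite mule_ge0 ?adde_ge0 ?lee_fin.
    rewrite -EFinD -EFinM lee_fin; apply: le_trans (powR_add_le p02 (normr_ge0 _) (normr_ge0 _)).
    apply: ge0_ler_powR; [by case/andP: p02|by rewrite nnegrE|by rewrite nnegrE addr_ge0|].
    by rewrite (diff2B (uj j) v) ler_normD.
  rewrite ge0_integralZl_EFin; [|exact: inner_measurable|by move=> x _; exact: adde_ge0|
    by apply: measurable_funTS; exact: emeasurable_funD|by []].
  rewrite ge0_integralD; [|exact: inner_measurable|by move=> x _; exact: f10|exact: measurable_funTS|
    by move=> x _; exact: f20|exact: measurable_funTS].
  have -> : (4 * N + kap = 4 * (N + kap / 4))%R by field.
  rewrite EFinM; apply: lee_wpmul2l; first by rewrite lee_fin.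
  rewrite EFinD; apply: leeD; first exact: HN.
  apply: le_trans (@integral_diff2_powR R n Omega mO' (1 + del) (4 * d) _ p h p02 mw _) _.
    exact: (ltr_add34 _ hr rd).
  have -> : (kap / 4 = 64 * (kap / 256))%R by field.
  by rewrite EFinM; apply: lee_wpmul2l; rewrite ?lee_fin.
have Uj : \int[leb]_(x in Omega) `|uj j x|%:E <= (U + 1)%:E.
  apply: (@le_trans _ _ (\int[leb]_(x in Omega) (`|v x|%:E + `|uj j x - v x|%:E))).
    apply: le_integral_ge0 => [//|x _|x _|x _]; rewrite -?EFinD ?lee_fin ?addr_ge0//.
    by rewrite -{1}(subrK (v x) (uj j x)) addrC ler_normD.
  rewrite ge0_integralD; [|exact: mO|by move=> x _; rewrite lee_fin|by apply: measurable_funTS; have := mv => m; mfun|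
    by move=> x _; rewrite lee_fin|by apply: measurable_funTS; mfun].
  by rewrite EFinD; apply: leeD => //; apply: le_trans C2 _; rewrite lee_fin.
have HTj : \int[leb]_(x in inner Omega (2 * d)) \int[leb]_e (((r <= `|e|)%R)%:R * kern s e * `|diff2 (uj j) e h x|)%:E <= (T + 1 + Tc)%:E.
  apply: (tail_split (mu j) r0 rd HT).
    apply: le_trans (near_tail_small mw r0 d0 hd C2) _.
    by rewrite lee_fin.
  exact: (tail_diff2_le s0 mO' S0 d0 OS Oz (mu j) hd n0 Uj HL Gj).
have [Fb HFb] := fb j; have cfj : continuous (fj j) := @cf j.
have E := second_difference_estimate s01 Lam1 HPhi oO bO cfj HFb (mu j) (gu j) (weak j) d0 r0 rd hr kap01 del01 k0 kr th0 Mj HL HNj HTj.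
apply: (@le_trans _ _ (\int[leb]_(x in inner Omega (6 * d)) (`|diff2 (uj j) k h x|%:E + `|diff2 (fun y => uj j y - v y)%R k h x|%:E))).
  apply: le_integral_ge0 => [//|x _|x _|x _]; rewrite -?EFinD ?lee_fin ?addr_ge0//.
  have -> : diff2 v k h x = (diff2 (uj j) k h x - diff2 (fun y => uj j y - v y)%R k h x)%R.
    by rewrite (diff2B (uj j) v) addrK.
  exact: ler_normB.
rewrite ge0_integralD; [|exact: inner_measurable|by move=> x _; rewrite lee_fin|
  by apply: measurable_funTS; have := measurable_diff2 k h (mu j) => m; mfun|
  by move=> x _; rewrite lee_fin|by apply: measurable_funTS; have := dvw k => m; mfun].
have E3 : \int[leb]_(x in inner Omega (6 * d)) `|diff2 (fun y => uj j y - v y)%R k h x|%:E <= (th * Kp)%:E.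
  apply: le_trans (@integral_diff2 R n Omega mO' (6 * d)%R _ k h mw _) _.
    exact: (ltr_add_half6 d0 kr hr rd).
  apply: (@le_trans _ _ (64%:E * e2%:E)); first by apply: lee_wpmul2l; rewrite ?lee_fin.
  by rewrite -EFinM lee_fin.
apply: le_trans (leeD E E3) _; rewrite -EFinD lee_fin -/Kp.
exact: (estimate_algebra Ec0 M0 Tc0 Lb0 (ltW kap0) N0 T0 (ltW Kp0) (powR_ge0 _ _) (powR_ge0 _ _) th0).
Unshelve. all: by end_near.
Qed.

End limit.

(** * The estimate for a SOLA *)

Section sola_consequences.
Context {R : realType} {n : nat}.
Notation Rn := 'rV[R]_n.
Notation leb := (@lebesgue_rV R n).
Local Open Scope ereal_scope.

Lemma cvg0_le (a : nat -> \bar R) (e : R) : a @ \oo --> 0 -> (0 < e)%R ->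
  \forall j \near \oo, a j <= e%:E.
Proof.
move=> acv e0.
have : \forall j \near \oo, a j < e%:E.
  apply: (acv [set y | y < e%:E]); apply: open_nbhs_nbhs; split; first exact: open_ereal_lt_ereal.
  by rewrite /= lte_fin.
by apply: filterS => j; exact: ltW.
Qed.

Lemma limn_esup_le_near (a : nat -> \bar R) (m M : R) : limn_esup a <= m%:E -> (m < M)%R ->
  \forall j \near \oo, a j <= M%:E.
Proof.
move=> am mM; have : limn_esup a < M%:E by apply: le_lt_trans am _; rewrite lte_fin.
move=> /ereal_inf_lt[_ [V FV <-] sM]; apply: filterS FV => j Vj.
by apply: le_trans (ltW sM); apply: ereal_sup_ubound; exists j.
Qed.

Lemma abs_charge_fin (mu : {charge set Rn -> \bar R}) A : measurable A -> abs_charge mu A \is a fin_num.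
Proof.
by move=> mA; rewrite /abs_charge /charge_variation/= fin_numD !fin_num_measure.
Qed.

Lemma Ccoo_continuous (Omega : set Rn) f : Ccoo Omega f -> continuous f.
Proof. by case=> /(_ [::])[]. Qed.

Lemma Ccoo_bounded (Omega : set Rn) f : Ccoo Omega f -> exists K : R, forall x, (`|f x| <= K)%R.
Proof.
move=> Cf; have cf := Ccoo_continuous Cf; case: Cf => _ /compact_bounded/bounded_set_ball[S S0 fS] _.
apply: (@supp_bounded R n f S) => // x Sx; apply: contrapT => /eqP nz.
have : ball (0%R : Rn) S x by apply: fS; exact: subset_closure.
by rewrite -ball_normE/= sub0r normrN ltNge (ltW Sx).
Qed.

Variables (s Lambda : R) (Phi : R -> R) (Omega : set Rn) (mu : {charge set Rn -> \bar R}) (g u : Rn -> R).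
Hypothesis n_ge2 : (2 <= n)%N.
Hypothesis s01 : (0 < s < 1)%R.
Hypothesis Lam1 : (1 <= Lambda)%R.
Hypothesis HPhi : structure_assumption Lambda Phi.
Hypothesis domO : bounded_domain Omega.
Hypothesis gL1 : L1_2s s g.
Hypothesis sola : SOLA s Phi Omega mu g u.

Let s0 : (0 < s)%R. Proof. by case/andP: s01. Qed.
Let oO : open Omega. Proof. by case: domO. Qed.
Let bO : bounded_set Omega. Proof. by case: domO. Qed.
Let mO : measurable Omega. Proof. exact: rV_open_measurable. Qed.
Let n0 : (0 < n)%N. Proof. exact: leq_trans n_ge2. Qed.

Definition qexp : R := (n%:R / (n%:R - s))%R.

Let ns0 : (0 < n%:R - s)%R.
Proof.
rewrite subr_gt0; case/andP: s01 => _ s1; apply: lt_le_trans s1 _.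
by rewrite ler1n.
Qed.

Lemma qexp_gt1 : (1 < qexp)%R.
Proof. by rewrite /qexp ltr_pdivlMr// mul1r gtrBl. Qed.

(* The definition of SOLA gives the measurability of [u] only inside [Omega]. *)
Definition ubar : Rn -> R := (u \_ Omega)%FUN.

Lemma ubarE x : Omega x -> ubar x = u x.
Proof. by move=> Ox; rewrite /ubar patchE mem_set. Qed.

Lemma measurable_ubar : measurable_fun setT ubar.
Proof.
apply/(measurable_restrictT _ mO); case: sola => /(_ (s / 2)%R 1%R) + _ _ _.
case.
- by rewrite divr_gt0//= ltr_pdivrMr// ltr_pMr// ltr1n.
- by rewrite /q_range lexx; exact: qexp_gt1.
- by [].
Qed.

Lemma ubar_Lq (q : R) : (1 <= q < qexp)%R -> \int[leb]_(x in Omega) (`|ubar x| `^ q)%:E < +oo.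
Proof.
move=> qr; case: sola => /(_ (s / 2)%R q) + _ _ _; case.
- by rewrite divr_gt0//= ltr_pdivrMr// ltr_pMr// ltr1n.
- exact: qr.
- move=> _ + _; apply: le_lt_trans; rewrite le_eqVlt; apply/orP; left; apply/eqP.
  by apply: eq_integral => x /set_mem Ox; rewrite ubarE.
Qed.

(** Outside [Omega] the approximation equals [g_ j], which is close to [g] in weighted L^1, and the
    weight centred at [z] is comparable there to [(1 + |y|)^(-n-2s)] because a ball about [z] lies
    in [Omega]. *)
Let exterior_mass (u_ g_ : nat -> Rn -> R) (z : Rn) (r0 : R) : (0 < r0)%R -> eball z r0 `<=` Omega ->
  (forall j, measurable_fun setT (u_ j)) -> (forall j, continuous (g_ j)) ->
  (forall j, ae_eq_outside Omega (u_ j) (g_ j)) ->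
  \int[leb]_(y in ~` eball z r0) (`|g_ j y - g y| / enorm (z - y) `^ (n%:R + 2 * s))%:E @[j --> \oo] --> 0 ->
  exists G : R, \forall j \near \oo, \int[leb]_(y in ~` Omega) (`|u_ j y| * kern s (z - y))%:E <= G%:E.
Proof.
move=> r00 zO mu_ cg aeg gcv; have mk := @measurable_kern R n s.
case: gL1 => -[mg _] gfin.
have g0 : 0 <= \int[leb]_y (`|g y| / (1 + enorm y) `^ (n%:R + 2 * s))%:E.
  by apply: integral_ge0 => y _; rewrite lee_fin divr_ge0 ?powR_ge0.
(* Chosen so that [1 + enorm y <= lam * enorm (z - y)] whenever [enorm (z - y) >= r0]. *)
pose lam : R := ((1 + n%:R * `|z|) / r0 + n%:R)%R.
have lam0 : (0 < lam)%R by rewrite ltr_wpDr// divr_gt0// ltr_wpDr// mulr_ge0.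
pose p : R := (n%:R + 2 * s)%R; have p0 : (0 <= p)%R by rewrite addr_ge0// mulr_ge0// ltW.
exists (1 + lam `^ p * fine (\int[leb]_y (`|g y| / (1 + enorm y) `^ p)%:E))%R.
have := cvg0_le gcv ltr01; apply: filterS => j Hj.
have mgj : measurable_fun setT (g_ j) by exact: rV_continuous_measurable.
have mC : measurable (~` Omega) by exact: measurableC.
have muj := mu_ j; have mg' : measurable_fun setT g := mg.
have E1 : \int[leb]_(y in ~` Omega) (`|u_ j y| * kern s (z - y))%:E = \int[leb]_(y in ~` Omega) (`|g_ j y| * kern s (z - y))%:E.
  apply: ge0_ae_eq_integral => //.
  - by apply: measurable_funTS; mfun.
  - by apply: measurable_funTS; mfun.
  - by move=> y _; rewrite lee_fin mulr_ge0 ?kern_ge0.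
  - by move=> y _; rewrite lee_fin mulr_ge0 ?kern_ge0.
  - by have := aeg j; apply: filterS => y Hy nOy; rewrite Hy.
have kE y : kern s (z - y) = ((enorm (z - y) `^ p)^-1)%R by rewrite /kern powRN /p (mulrC s).
have F1 : \int[leb]_(y in ~` Omega) (`|g_ j y - g y| * kern s (z - y))%:E <= 1.
  apply: le_trans Hj; apply: le_integral_ge0.
  - by move=> y; apply: contra_not; exact: zO.
  - by move=> y _; rewrite lee_fin mulr_ge0 ?kern_ge0.
  - by move=> y _; rewrite lee_fin divr_ge0 ?powR_ge0.
  - by move=> y _; rewrite kE.
have mG2 : measurable_fun setT (fun y => `|g y| * ((1 + enorm y) `^ p)^-1)%R.
  have me := @measurable_enorm R n; apply: mf_mul; first by mfun.
  rewrite (_ : (fun y => _) = (fun y : Rn => (1 + enorm y) `^ (- p)))%R; first by mfun.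
  by apply/funext => y; rewrite powRN.
have F2 : \int[leb]_(y in ~` Omega) (`|g y| * kern s (z - y))%:E <=
    (lam `^ p * fine (\int[leb]_y (`|g y| / (1 + enorm y) `^ p)%:E))%:E.
  rewrite EFinM fineK; last by rewrite ge0_fin_numE.
  rewrite -ge0_integralZl_EFin; [|exact: measurableT|by move=> y _; rewrite lee_fin divr_ge0 ?powR_ge0|exact: (mf_EFin mG2)|exact: powR_ge0].
  apply: le_integral_ge0 => [//|y _|y _|y nOy].
  - by rewrite lee_fin mulr_ge0 ?kern_ge0.
  - by rewrite -EFinM lee_fin mulr_ge0 ?powR_ge0// divr_ge0 ?powR_ge0.
  rewrite -EFinM lee_fin kE mulrCA; apply: ler_wpM2l => //.
  have Er : (r0 <= enorm (z - y))%R.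
    rewrite leNgt; apply/negP => h; apply: nOy; apply: zO.
    by rewrite /eball/= -enormN opprB.
  have E0 : (0 < enorm (z - y))%R by exact: lt_le_trans Er.
  have y1 : (0 < 1 + enorm y)%R by rewrite ltr_wpDr ?enorm_ge0.
  rewrite ler_pdivlMr ?powR_gt0// mulrC ler_pdivrMr ?powR_gt0//.
  rewrite -powRM ?(ltW lam0) ?(ltW E0)//.
  apply: ge0_ler_powR => //; rewrite ?nnegrE ?(ltW y1) ?mulr_ge0 ?(ltW lam0) ?(ltW E0)//.
  have h1 : (enorm y <= n%:R * (`|z| + enorm (z - y)))%R.
    apply: le_trans (enorm_le_norm _) _; apply: ler_wpM2l => //.
    have -> : `|y|%R = `|z - (z - y)|%R by rewrite opprB addrC subrK.
    by apply: le_trans (ler_normB _ _) _; apply: lerD => //; exact: enorm_ge_norm.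
  have h2 : (1 + n%:R * `|z| <= (1 + n%:R * `|z|) / r0 * enorm (z - y))%R.
    rewrite mulrAC ler_pdivlMr// ler_wpM2l// addr_ge0// mulr_ge0//.
  by rewrite /lam mulrDl; rewrite mulrDr in h1; lra.
rewrite E1 EFinD; apply: le_trans (leeD F1 F2).
rewrite -ge0_integralD; [|exact: mC|by move=> y _; rewrite lee_fin mulr_ge0 ?kern_ge0|by apply: measurable_funTS; mfun|
  by move=> y _; rewrite lee_fin mulr_ge0 ?kern_ge0|by apply: measurable_funTS; mfun].
apply: le_integral_ge0 => [//|y _|y _|y _].
- by rewrite lee_fin mulr_ge0 ?kern_ge0.
- by rewrite adde_ge0 ?lee_fin ?mulr_ge0 ?kern_ge0.
rewrite -EFinD lee_fin -mulrDl; apply: ler_wpM2r; first exact: kern_ge0.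
by rewrite -{1}(subrK (g y) (g_ j y)) ler_normD.
Qed.

Lemma sola_diff2_estimate (d : R) : (0 < d)%R -> exists2 C : R, (0 <= C)%R &
  forall (r kap del th N T : R) (h k : Rn), (0 < r <= d)%R -> (`|h| <= r)%R -> (0 < `|k| <= r / 2)%R ->
  (0 < kap <= 1)%R -> (0 < del <= 1)%R -> (1 + del < qexp)%R -> (0 < th)%R ->
  (forall p : Rn, (`|p| < 3 * r)%R ->
    \int[leb]_(x in inner Omega (4 * d)) (`|diff2 ubar p h x| `^ (1 + del))%:E <= N%:E) ->
  near_tail s Omega ubar r d h <= T%:E ->
  \int[leb]_(x in inner Omega (6 * d)) `|diff2 ubar k h x|%:E <=
  (C * (th * (psi_sup kap del * (1 + T) + psi_sup kap del ^+ 2 * r `^ (- (2 * s)) * (kap + N)) +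
     th^-1 * `|k| `^ (2 * s) * (kap + N)))%:E.
Proof.
move=> d0; case: sola => _ _ _ [u_ [mu_ [g_ [H1 [_ Hconv] [_ Hmu] Hg]]]].
case: domO => -[z Oz] _ _ _.
have mu_j j : measurable_fun setT (u_ j) by case: (H1 j) => -[].
have cont_mu j : continuous (mu_ j) by case: (H1 j) => _ /Ccoo_continuous.
have bd_mu j : exists K : R, forall x, (`|mu_ j x| <= K)%R by case: (H1 j) => _ /Ccoo_bounded.
have cont_g j : continuous (g_ j) by case: (H1 j) => _ _ /Ccoo_continuous.
have gagu j : gag s (u_ j) < +oo by rewrite -gagliardo_gag//; case: (H1 j) => -[].
have wk j : weak_formulation s Phi Omega (u_ j) (density_integral Omega (mu_ j)) by case: (H1 j) => _ _ _ [].
have aeg j : ae_eq_outside Omega (u_ j) (g_ j) by case: (H1 j).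
have [r0 r00 zO] : exists2 r0 : R, (0 < r0)%R & eball z r0 `<=` Omega.
  have : nbhs z Omega by exact: open_nbhs_nbhs.
  move=> /nbhs_ballP[e /= e0 He]; exists e => // y; rewrite /eball/= => yz; apply: He.
  by rewrite -ball_normE/= distrC (le_lt_trans (enorm_ge_norm _)).
have [_ _ gcv] := Hg z r0 r00.
have [G HG] := exterior_mass r00 zO mu_j cont_g aeg gcv.
have [S S0 OS] := bounded_set_ball bO.
(* The masses of the data are controlled on Euclidean balls only, so one that contains [Omega] is
   chosen. *)
pose rr : R := (n%:R * (`|z| + S) + 1)%R.
have rr0 : (0 < rr)%R by rewrite ltr_wpDl// mulr_ge0// addr_ge0// ltW.
have Oe : Omega `<=` eball z rr.
  move=> y Oy; rewrite /eball/=; apply: le_lt_trans (enorm_le_norm _) _.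
  rewrite /rr ltr_pwDr// ler_wpM2l//; apply: le_trans (ler_normB _ _) _; rewrite addrC lerD2l ltW//.
  by have := OS _ Oy; rewrite -ball_normE/= sub0r normrN.
have mcl : measurable (closure (eball z rr)) by apply: rV_closed_measurable; exact: closed_closure.
(* The added 1 is the strict gap that turns a bound on the limsup into one for all large [j]. *)
pose M : R := (fine (abs_charge mu (closure (eball z rr))) + 1)%R.
have HM : \forall j \near \oo, \int[leb]_(x in Omega) `|mu_ j x|%:E <= M%:E.
  have := Hmu z rr rr0; rewrite -[leRHS]fineK ?abs_charge_fin// => /limn_esup_le_near.
  move=> /(_ M); rewrite ltrDl ltr01 => /(_ isT); apply: filterS => j; apply: le_trans.
  by apply: le_integral_ge0 => // x _; rewrite lee_fin.
have HU1 : \int[leb]_(x in Omega) `|ubar x|%:E < +oo.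
  have := @ubar_Lq 1%R; rewrite lexx qexp_gt1 => /(_ isT); under eq_integral do rewrite powRr1//.
  by [].
pose U : R := fine (\int[leb]_(x in Omega) `|ubar x|%:E).
have HU : \int[leb]_(x in Omega) `|ubar x|%:E <= U%:E.
  by rewrite /U fineK// ge0_fin_numE//; apply: integral_ge0 => x _; rewrite lee_fin.
have Hc (q e : R) : (1 <= q < qexp)%R -> (0 < e)%R ->
    \forall j \near \oo, \int[leb]_(x in Omega) (`|u_ j x - ubar x| `^ q)%:E <= e%:E.
  move=> qr e0.
  have cK : compact (closure Omega).
    apply: bounded_closed_compact; last exact: closed_closure.
    exists S; split; first exact: num_real.
    move=> t St x /(closure_subset OS); rewrite -[closure _]/(closed_ball _ _) closed_ballE// /closed_ball_/=.
    by rewrite sub0r normrN => /le_trans; apply; exact: ltW.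
  have := cvg0_le (Hconv q qr _ cK) e0; apply: filterS => j; apply: le_trans.
  apply: le_integral_ge0 => [|x _|x _|x Ox].
  - exact: subset_closure.
  - by rewrite lee_fin powR_ge0.
  - by rewrite lee_fin powR_ge0.
  - by rewrite ubarE.
exact: (diff2_limit_estimate n0 s01 Lam1 HPhi oO bO Oz cont_mu bd_mu mu_j gagu wk measurable_ubar Hc HM HG HU d0).
Qed.

End sola_consequences.

(** * Dyadic recursions *)

Lemma powR2_lt {R : realType} (a b : R) : a < b -> (2 : R) `^ a < 2 `^ b.
Proof.
move=> ab; have H : 0 < b - a by rewrite subr_gt0.
have /andP[_ h] := powR2_lt1 H.
rewrite (_ : a = b + - (b - a)); last by ring.
rewrite powRD; first by rewrite gtr_pMr// powR_gt0.
by rewrite pnatr_eq0 implybT.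
Qed.

Section dyadic.
Context {R : realType} {n : nat}.
Notation Rn := 'rV[R]_n.
Variables (I : Rn -> \bar R) (E a C A : R).
Hypothesis E0 : 0 < E.
Hypothesis C0 : 0 <= C.
Hypothesis A0 : 0 <= A.
Hypothesis Ibase : forall h, E / 2 <= `|h| <= E -> (I h <= A%:E)%E.
Hypothesis Istep : forall h, 0 < `|h| <= E / 2 -> (2%:E * I h <= I (h + h) + (C * `|h| `^ a)%:E)%E.

(** A bound passes from [h + h] to [h], hence from the shell [E / 2 <= |h| <= E] to all smaller
    scales; [bd] is any function compatible with the recursion. *)
Lemma dyadic_induction (bd : R -> R) :
  (forall t, E / 2 <= t <= E -> A <= bd t) ->
  (forall t, 0 < t <= E / 2 -> bd (2 * t) + C * t `^ a <= 2 * bd t) ->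
  forall h, 0 < `|h| <= E -> (I h <= (bd `|h|)%:E)%E.
Proof.
move=> Hb Hs.
have H i : forall h : Rn, E / 2 ^+ i.+1 <= `|h| <= E -> (I h <= (bd `|h|)%:E)%E.
  elim: i => [|i IH] h; first by rewrite expr1 => hE; apply: le_trans (Ibase hE) _; rewrite lee_fin; exact: Hb.
  move=> /andP[h1 h2]; have [h3|h3] := leP (E / 2 ^+ i.+1) `|h|; first by apply: IH; rewrite h3.
  have hh : `|h + h| = 2 * `|h| by rewrite -mulr2n normrMn mulr_natl.
  have h0 : 0 < `|h| by apply: lt_le_trans h1; rewrite divr_gt0// exprn_gt0.
  have hE : 0 < `|h| <= E / 2.
    rewrite h0 ltW//; apply: lt_le_trans h3 _; rewrite ler_wpM2l ?(ltW E0)// lef_pV2 ?posrE ?exprn_gt0//.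
    by rewrite exprS ler_peMr// exprn_ege1// ler1n.
  have IH2 : (I (h + h) <= (bd (2 * `|h|))%:E)%E.
    rewrite -hh; apply: IH; rewrite hh; apply/andP; split.
      rewrite -ler_pdivrMl// mulrC; apply: le_trans h1.
      by rewrite -mulrA -invfM -exprSr.
    by move/andP: hE => [_]; rewrite ler_pdivlMr// mulrC.
  have := Istep hE; have S := Hs _ hE.
  have e2 : (0 < 2%:E :> \bar R)%E by rewrite lte_fin.
  move=> /le_trans /(_ (leeD IH2 (lexx _))); rewrite -EFinD => h4.
  by rewrite -(lee_pmul2l _ e2)// -EFinM; apply: le_trans h4 _; rewrite lee_fin.
move=> h /andP[h0 hE]; have [hE'|hE'] := ltP `|h| E; last first.
  by apply: (H 0%N); rewrite hE expr1 (le_trans _ hE')// ler_pdivrMr// ler_peMr ?(ltW E0)// ler1n.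
have [i /andP[h1 h2]] := dyadic_below h0 hE'.
by apply: (H i); rewrite h1.
Qed.

(** For [a > 1] the function [B * t - B' * t^a] satisfies the recursion with equality: the
    subtracted term absorbs the error at every scale, so the linear part does not grow with the
    number of scales. [B] is large enough for the function to exceed [A] on the first shell. *)
Lemma dyadic_linear : 1 < a -> forall h, 0 < `|h| <= E ->
  (I h <= ((2 * (A / E) + 2 * (C / (2 `^ a - 2)) * E `^ (a - 1)) * `|h|)%:E)%E.
Proof.
move=> a1 h hE; set B' := C / (2 `^ a - 2).
have p2 : 2 < (2 : R) `^ a.
  by rewrite -[ltLHS]powRr1//; exact: powR2_lt.
have B'0 : 0 <= B' by rewrite divr_ge0// subr_ge0 ltW.
set B := 2 * (A / E) + 2 * B' * E `^ (a - 1).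
have /andP[h0 hE1] := hE.
apply: (@le_trans _ _ (B * `|h| - B' * `|h| `^ a)%:E); last first.
  by rewrite lee_fin gerBl mulr_ge0// powR_ge0.
apply: (@dyadic_induction (fun t => B * t - B' * t `^ a)) => //.
- move=> t /andP[t1 t2]; have t0 : 0 < t by apply: lt_le_trans t1; rewrite divr_gt0.
  have h1 : t `^ a <= E * E `^ (a - 1).
    apply: (@le_trans _ _ (E `^ a)).
      by apply: ge0_ler_powR => //; rewrite ?nnegrE ?(ltW t0) ?(ltW E0)//; lra.
    by rewrite -{2}[E]powRr1 ?(ltW E0)// -powRD ?(gt_eqF E0) ?implybT// addrC subrK.
  have h2 : A <= 2 * (A / E) * t.
    rewrite [leRHS](_ : _ = A * (t * 2 / E)); last by ring.
    by rewrite ler_peMr// ler_pdivlMr// mul1r -ler_pdivrMr.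
  have h3 : E * E `^ (a - 1) <= 2 * E `^ (a - 1) * t.
    rewrite [leRHS]mulrAC; apply: ler_wpM2r; first exact: powR_ge0.
    by rewrite mulrC -ler_pdivrMr.
  have h4 := ler_wpM2l B'0 (le_trans h1 h3).
  rewrite /B mulrDl (_ : 2 * B' * E `^ (a - 1) * t = B' * (2 * E `^ (a - 1) * t)); last by ring.
  lra.
- move=> t /andP[t0 tE]; rewrite powRM ?(ltW t0)//.
  have -> : C = B' * (2 `^ a - 2) by rewrite divfK// subr_eq0 gt_eqF.
  by rewrite le_eqVlt; apply/orP; left; apply/eqP; ring.
Qed.

(** For [a < 1] a multiple of [t^a] suffices, since [2^a < 2] leaves room for the error
    [C * t^a]. *)
Lemma dyadic_sublinear : 0 <= a < 1 -> forall h, 0 < `|h| <= E ->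
  (I h <= ((A / (E / 2) `^ a + C / (2 - 2 `^ a)) * `|h| `^ a)%:E)%E.
Proof.
move=> /andP[a0 a1] h hE; set B' := C / (2 - 2 `^ a).
have p2 : (2 : R) `^ a < 2.
  by rewrite -[ltRHS]powRr1//; exact: powR2_lt.
have B'0 : 0 <= B' by rewrite divr_ge0// subr_ge0 ltW.
have E20 : 0 < (E / 2) `^ a by rewrite powR_gt0// divr_gt0.
apply: (@dyadic_induction (fun t => (A / (E / 2) `^ a + B') * t `^ a)) => //.
- move=> t /andP[t1 t2]; have t0 : 0 < t by apply: lt_le_trans t1; rewrite divr_gt0.
  rewrite mulrDl -[leLHS]addr0; apply: lerD; last by rewrite mulr_ge0// powR_ge0.
  rewrite mulrAC ler_pdivlMr//; apply: ler_wpM2l => //.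
  by apply: ge0_ler_powR => //; rewrite nnegrE ltW// divr_gt0.
- move=> t /andP[t0 tE]; rewrite (powRM _ (ler0n R 2) (ltW t0)).
  have ta : 0 <= t `^ a by exact: powR_ge0.
  have Q0 : 0 <= A / (E / 2) `^ a by rewrite divr_ge0// ltW.
  have Cle : C = B' * (2 - 2 `^ a) by rewrite divfK// subr_eq0 gt_eqF.
  set QA := A / _ in Q0 *; rewrite Cle [leLHS](_ : _ = (QA * 2 `^ a + B' * 2) * t `^ a); last by ring.
  rewrite [leRHS]mulrA; apply: ler_wpM2r => //.
  by have := ler_wpM2l Q0 (ltW p2); lra.
Qed.

End dyadic.

(** * Iterative improvement of the bounds on differences *)

Lemma core_algebra {R : realType} (C del K rL th T rs r4 nu V ks rk : R) :
  0 <= C -> 0 < del -> 1 <= K -> 1 <= rL -> 0 < th -> 0 <= T -> 0 <= rs -> 0 <= r4 -> 0 <= nu -> 0 <= V ->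
  0 <= ks -> ks <= rk ->
  C * (th * (K / del * (1 + T) + (K / del) ^+ 2 * rs * (r4 + (rL * nu + r4 * V))) +
       th^-1 * ks * (r4 + (rL * nu + r4 * V))) <=
  C * (del^-1 ^+ 2 + del^-1 + 1) * (V + 2) * (K ^+ 2 * rL) *
    (th * (1 + T + rs * (r4 + nu)) + th^-1 * rk * (r4 + nu)).
Proof.
move=> C0 del0 K1 rL1 th0 T0 rs0 r40 nu0 V0 ks0 ksr.
have K0 : 0 <= K by exact: le_trans K1.
have rL0 : 0 <= rL by exact: le_trans rL1.
have i0 : 0 <= del^-1 by rewrite invr_ge0 ltW.
have rk0 : 0 <= rk by exact: le_trans ksr.
set D := del^-1 ^+ 2 + del^-1 + 1.
have d20 : 0 <= del^-1 ^+ 2 by exact: exprn_ge0.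
have D1 : 1 <= D by rewrite /D; lra.
have D2 : del^-1 <= D by rewrite /D; lra.
have D3 : del^-1 ^+ 2 <= D by rewrite /D; lra.
have KK : K <= K ^+ 2 by rewrite expr2 ler_peMl.
have KN : r4 + (rL * nu + r4 * V) <= (V + 2) * rL * (r4 + nu).
  have h1 : r4 <= rL * r4 by rewrite ler_peMl.
  have h2 : r4 * V <= rL * r4 * V by apply: ler_wpM2r.
  have h3 : 0 <= rL * r4 by exact: mulr_ge0.
  have h4 : 0 <= rL * nu by exact: mulr_ge0.
  have h5 : 0 <= V * (rL * nu) by exact: mulr_ge0.
  rewrite [leRHS](_ : _ = rL * r4 * V + 2 * (rL * r4) + V * (rL * nu) + 2 * (rL * nu)); last by ring.
  lra.
have KN0 : 0 <= r4 + (rL * nu + r4 * V) by rewrite !addr_ge0 ?mulr_ge0.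
have W0 : 0 <= (V + 2) * rL by rewrite mulr_ge0 ?addr_ge0.
have W1 : 1 <= (V + 2) * rL by rewrite -[leLHS]mulr1 ler_pM//; lra.
set Z := th * (1 + T + _) + _.
rewrite [leRHS](_ : _ = C * (D * ((V + 2) * rL * K ^+ 2) * Z)); last by ring.
apply: ler_wpM2l => //; rewrite {}/Z.
set X := 1 + T; have X0 : 0 <= X by rewrite addr_ge0.
have t1 : K / del * X <= D * ((V + 2) * rL * K ^+ 2) * X.
  apply: ler_wpM2r => //; rewrite mulrC; apply: ler_pM => //.
  by apply: le_trans KK _; rewrite ler_peMl// exprn_ge0.
have t2 : (K / del) ^+ 2 * rs * (r4 + (rL * nu + r4 * V)) <= D * ((V + 2) * rL * K ^+ 2) * (rs * (r4 + nu)).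
  rewrite [leRHS](_ : _ = (D * K ^+ 2) * rs * ((V + 2) * rL * (r4 + nu))); last by ring.
  apply: ler_pM => //.
    by apply: mulr_ge0 => //; exact: sqr_ge0.
  apply: ler_wpM2r => //; rewrite expr_div_n mulrC -exprVn; apply: ler_wpM2r => //; exact: sqr_ge0.
have t3 : ks * (r4 + (rL * nu + r4 * V)) <= D * ((V + 2) * rL * K ^+ 2) * (rk * (r4 + nu)).
  rewrite [leRHS](_ : _ = (D * K ^+ 2) * rk * ((V + 2) * rL * (r4 + nu))); last by ring.
  apply: ler_pM => //; apply: le_trans ksr _; rewrite ler_peMl// -[leLHS]mulr1 ler_pM//.
  by apply: le_trans KK.
rewrite [leRHS](_ : _ = th * (D * ((V + 2) * rL * K ^+ 2) * X + D * ((V + 2) * rL * K ^+ 2) * (rs * (r4 + nu))) +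
   th^-1 * (D * ((V + 2) * rL * K ^+ 2) * (rk * (r4 + nu)))); last by ring.
apply: lerD; first by apply: ler_wpM2l; [exact: ltW|exact: lerD].
by rewrite -(mulrA th^-1); apply: ler_wpM2l => //; rewrite invr_ge0 ltW.
Qed.

Section bootstrap.
Context {R : realType} {n : nat}.
Notation Rn := 'rV[R]_n.
Notation leb := (@lebesgue_rV R n).
Variables (s : R) (Omega : set Rn) (v : Rn -> R) (q qmax V U : R).
Hypothesis s12 : 1 / 2 < s < 1.
Hypothesis mO : measurable Omega.
Hypothesis mv : measurable_fun setT v.
Hypothesis q12 : 1 < q <= 2.
Hypothesis qq : q < qmax.
Local Open Scope ereal_scope.
Hypothesis HV : \int[leb]_(x in Omega) (`|v x| `^ q)%:E <= V%:E.
Hypothesis HU : \int[leb]_(x in Omega) `|v x|%:E <= U%:E.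
Hypothesis star : forall d : R, (0 < d)%R -> exists2 C : R, (0 <= C)%R &
  forall (r kap del th N T : R) (h k : Rn), (0 < r <= d)%R -> (`|h| <= r)%R -> (0 < `|k| <= r / 2)%R ->
  (0 < kap <= 1)%R -> (0 < del <= 1)%R -> (1 + del < qmax)%R -> (0 < th)%R ->
  (forall p : Rn, (`|p| < 3 * r)%R ->
    \int[leb]_(x in inner Omega (4 * d)) (`|diff2 v p h x| `^ (1 + del))%:E <= N%:E) ->
  near_tail s Omega v r d h <= T%:E ->
  \int[leb]_(x in inner Omega (6 * d)) `|diff2 v k h x|%:E <=
  (C * (th * (psi_sup kap del * (1 + T) + psi_sup kap del ^+ 2 * r `^ (- (2 * s)) * (kap + N)) +
     th^-1 * `|k| `^ (2 * s) * (kap + N)))%:E.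

Let s0 : (0 < s)%R. Proof. by case/andP: s12; lra. Qed.

Definition int1 (d : R) (h : Rn) : \bar R := \int[leb]_(x in inner Omega d) `|v (x + h) - v x|%:E.
Definition int2 (d : R) (k h : Rn) : \bar R := \int[leb]_(x in inner Omega d) `|diff2 v k h x|%:E.

Lemma int2_ge0 d k h : 0 <= int2 d k h. Proof. by apply: integral_ge0 => x _; rewrite lee_fin. Qed.
Lemma int2C d k h : int2 d k h = int2 d h k.
Proof. by apply: eq_integral => x _; rewrite diff2C. Qed.

Let V0 : (0 <= V)%R.
Proof. by rewrite -lee_fin; apply: le_trans HV; apply: integral_ge0 => x _; rewrite lee_fin powR_ge0. Qed.
Let U0 : (0 <= U)%R.
Proof. by rewrite -lee_fin; apply: le_trans HU; apply: integral_ge0 => x _; rewrite lee_fin. Qed.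

(* Both terms of [|F (x + p) - F x|] are integrated over a larger inner set. *)
Lemma integral_diff_le (F : Rn -> R) (d d2 : R) (p : Rn) : measurable_fun setT F -> (`|p| + d2 <= d)%R ->
  \int[leb]_(x in inner Omega d) `|F (x + p) - F x|%:E <=
  2%:E * \int[leb]_(x in inner Omega d2) `|F x|%:E.
Proof.
move=> mF pd.
have mFp : measurable_fun (inner Omega d) (fun x => `|F (x + p)|%:E) by apply: measurable_funTS; mfun.
have mF0 : measurable_fun (inner Omega d) (fun x => `|F x|%:E) by apply: measurable_funTS; mfun.
have mFE : measurable_fun setT (fun x => `|F x|%:E) by mfun.
apply: (@le_trans _ _ (\int[leb]_(x in inner Omega d) (`|F (x + p)|%:E + `|F x|%:E))).
  apply: le_integral_ge0 => [//|x _|x _|x _]; rewrite -?EFinD ?lee_fin ?addr_ge0//.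
  exact: ler_normB.
rewrite ge0_integralD; [|exact: inner_measurable|by move=> x _; rewrite lee_fin|by []|by move=> x _; rewrite lee_fin|by []].
rewrite (_ : 2%:E = 1 + 1); last by rewrite -EFinD; congr (_%:E); ring.
rewrite ge0_muleDl// mul1e; apply: leeD.
  apply: (@le_integral_rV_shift R n p (inner Omega d) (inner Omega d2) (fun x => `|F x|%:E)).
  - exact: inner_measurable.
  - exact: mFE.
  - by move=> x; rewrite lee_fin.
  - by move=> x ix; apply: (inner_shift ix); rewrite addrAC subrr add0r.
apply: le_integral_ge0 => [x ix|x _|x _|//]; rewrite ?lee_fin//.
by apply: (inner_shift ix); rewrite subrr normr0 add0r (le_trans _ pd)// lerDr.
Qed.

Lemma int2_le_int1 d d2 p h : (`|p| + d2 <= d)%R -> int2 d p h <= 2%:E * int1 d2 h.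
Proof.
move=> pd; apply: (@integral_diff_le (fun x => v (x + h) - v x)%R d d2 p) => //.
by mfun.
Qed.

Lemma int1_le d h : (`|h| < d)%R -> int1 d h <= (2 * U)%:E.
Proof.
move=> hd; apply: (le_trans (@integral_diff_le v d (d - `|h|) h mv _)).
  by rewrite addrC subrK.
rewrite EFinM; apply: lee_wpmul2l; first by rewrite lee_fin.
apply: le_trans HU; apply: le_integral_ge0 => [|x _|x _|//]; rewrite ?lee_fin//.
by apply: inner_sub; rewrite subr_gt0.
Qed.

(** From the identity [2 * tau_h v = tau_(2h) v - tau_h tau_h v], which lets bounds on second
    differences be summed over dyadic scales into bounds on first differences. *)
Lemma int1_double d h : 2%:E * int1 d h <= int1 d (h + h) + int2 d h h.
Proof.
have m1 : measurable_fun (inner Omega d) (fun x => `|v (x + h) - v x|%:E) by apply: measurable_funTS; mfun.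
have m2 : measurable_fun (inner Omega d) (fun x => `|v (x + (h + h)) - v x|%:E) by apply: measurable_funTS; mfun.
have md := measurable_diff2 h h mv.
have m3 : measurable_fun (inner Omega d) (fun x => `|diff2 v h h x|%:E) by apply: measurable_funTS; mfun.
rewrite /int1 /int2 -ge0_integralZl_EFin; [|exact: inner_measurable|by move=> x _; rewrite lee_fin|by []|by []].
rewrite -ge0_integralD; [|exact: inner_measurable|by move=> x _; rewrite lee_fin|by []|by move=> x _; rewrite lee_fin|by []].
apply: le_integral_ge0 => [//|x _|x _|x _]; rewrite -?EFinD -?EFinM ?lee_fin ?addr_ge0 ?mulr_ge0//.
rewrite -{1}[2%R]ger0_norm// -normrM; apply: le_trans (ler_normB _ _).
rewrite /diff2 addrA le_eqVlt; apply/orP; left; apply/eqP; congr (`|_|)%R; ring.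
Qed.

(** The identity behind [int1_double] applied to [tau_e v]. Its error is [tau_e] of a second
    difference with both steps [h], at most twice the integral of the latter over a larger set. *)
Lemma int2_double d d2 e h : (`|e| + d2 <= d)%R ->
  2%:E * int2 d e h <= int2 d e (h + h) + 2%:E * int2 d2 h h.
Proof.
move=> ed.
have md1 := measurable_diff2 e h mv; have md2 := measurable_diff2 e (h + h) mv; have md := measurable_diff2 h h mv.
have m1 : measurable_fun (inner Omega d) (fun x => `|diff2 v e h x|%:E) by apply: measurable_funTS; mfun.
have m2 : measurable_fun (inner Omega d) (fun x => `|diff2 v e (h + h) x|%:E) by apply: measurable_funTS; mfun.
have m3 : measurable_fun (inner Omega d) (fun x => `|diff2 v h h (x + e) - diff2 v h h x|%:E) by apply: measurable_funTS; mfun.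
apply: (le_trans _ (leeD (lexx _) (@integral_diff_le (diff2 v h h) d d2 e md ed))).
rewrite /int2 -ge0_integralZl_EFin; [|exact: inner_measurable|by move=> x _; rewrite lee_fin|by []|by []].
rewrite -ge0_integralD; [|exact: inner_measurable|by move=> x _; rewrite lee_fin|by []|by move=> x _; rewrite lee_fin|by []].
apply: le_integral_ge0 => [//|x _|x _|x _]; rewrite -?EFinD -?EFinM ?lee_fin ?addr_ge0 ?mulr_ge0//.
rewrite -{1}[2%R]ger0_norm// -normrM; apply: le_trans (ler_normB _ _).
rewrite /diff2 !addrA le_eqVlt; apply/orP; left; apply/eqP; congr (`|_|)%R; ring.
Qed.

Lemma int2_dom d d2 k h : (d2 <= d)%R -> int2 d k h <= int2 d2 k h.
Proof.
move=> dd; apply: le_integral_ge0 => [x ix|x _|x _|//]; rewrite ?lee_fin//.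
by apply: (inner_shift ix); rewrite subrr normr0 add0r.
Qed.

(* The power of [rho^-del] lost in one step: 8 from [psi_sup ^+ 2] at
   [kap = rho ^+ 4], and [8 / (q - 1)] from truncating at [rho^(-8/(q-1))]. *)
Definition lam : R := (8 + 8 / (q - 1))%R.

Let q1 : (0 < q - 1)%R. Proof. by case/andP: q12; rewrite subr_gt0. Qed.

(** Below the level [Aa] the first term suffices, above it the second, whose exponent [1 + del - q]
    is not positive. *)
Lemma interpolation (del Aa a : R) : (0 < del)%R -> (1 + del <= q)%R -> (0 < Aa)%R -> (0 <= a)%R ->
  (a `^ (1 + del) <= Aa `^ del * a + Aa `^ (1 + del - q) * a `^ q)%R.
Proof.
move=> d0 dq A0 a0; have [->|an0] := eqVneq a 0%R.
  rewrite powR0; last by rewrite gt_eqF// ltr_wpDr// ltW.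
  by rewrite addr_ge0 ?mulr_ge0 ?powR_ge0.
have ap : (0 < a)%R by rewrite lt_neqAle eq_sym an0.
have imp (x y : R) : (x + y == 0)%R ==> (a != 0)%R by rewrite an0 implybT.
have [aA|aA] := leP a Aa.
  rewrite -[leLHS]addr0; apply: lerD; last by rewrite mulr_ge0 ?powR_ge0.
  rewrite addrC powRD ?imp// powRr1//; apply: ler_wpM2r => //.
  by apply: ge0_ler_powR => //; rewrite ?nnegrE ?(ltW d0) ?(ltW A0).
rewrite -[leLHS]add0r; apply: lerD; first by rewrite mulr_ge0 ?powR_ge0.
rewrite {1}(_ : (1 + del = (1 + del - q) + q)%R); last by rewrite subrK.
rewrite powRD ?imp//; apply: ler_wpM2r; first exact: powR_ge0.
rewrite -(opprB q) !powRN lef_pV2 ?posrE ?powR_gt0//.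
by apply: ge0_ler_powR; rewrite ?nnegrE ?subr_ge0 ?(ltW A0) ?(ltW ap)// ltW.
Qed.

(** The estimate with [kap = rho^4] and moments interpolated at the level [rho^(-L)], [L = 8/(q-1)].
    As [2 * del <= q - 1], the L^q part is then at most a multiple of [rho^4], which is negligible
    against the bounds on [nu] used later, none of them smaller than order [rho^2]. *)
Lemma core_estimate (d del : R) : (0 < d)%R -> (0 < del)%R -> (2 * del <= q - 1)%R ->
  exists2 C : R, (0 <= C)%R &
  forall (rho r th nu T : R) (h k : Rn), (0 < rho <= 1)%R -> (0 < r <= d)%R -> (rho <= r / 2)%R ->
  (`|h| <= rho)%R -> (0 < `|k| <= rho)%R -> (0 < th)%R ->
  (forall p : Rn, (`|p| < 3 * r)%R -> int2 (4 * d) p h <= nu%:E) ->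
  near_tail s Omega v r d h <= T%:E ->
  int2 (6 * d) k h <= (C * rho `^ (- (lam * del)) *
    (th * (1 + T + r `^ (- (2 * s)) * (rho ^+ 4 + nu)) + th^-1 * rho `^ (2 * s) * (rho ^+ 4 + nu)))%:E.
Proof.
move=> d0 del0 delq; have [C C0 HC] := star d0.
case/andP: q12 => qgt1 q2.
have del1 : (del <= 1)%R by move: qgt1 q2 delq del0; lra.
exists (C * (del^-1 ^+ 2 + del^-1 + 1) * (64 * V + 2))%R.
  by apply: mulr_ge0; [apply: mulr_ge0 => //|]; rewrite !addr_ge0 ?mulr_ge0 ?exprn_ge0 ?invr_ge0// ltW.
move=> rho r th nu T h k /andP[rho0 rho1] /andP[r0 rd] rhor hrho /andP[k0 krho] th0 Hnu HT.
have hr : (`|h| <= r)%R by apply: le_trans hrho _; move: rhor r0; lra.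
have kr : (0 < `|k| <= r / 2)%R by rewrite k0 (le_trans krho).
pose L : R := (8 / (q - 1))%R; have L0 : (0 < L)%R by rewrite divr_gt0.
pose Aa : R := (rho `^ (- L))%R; have Aa0 : (0 < Aa)%R by exact: powR_gt0.
pose rL : R := (rho `^ (- (L * del)))%R.
have rL1 : (1 <= rL)%R.
  rewrite /rL powRN -[leLHS]invr1 lef_pV2 ?posrE ?powR_gt0//.
  rewrite -(powRr0 rho) ger_powR ?rho0//; apply: mulr_ge0; exact: ltW.
have rL0 : (0 <= rL)%R by exact: le_trans rL1.
have nu0 : (0 <= nu)%R.
  rewrite -lee_fin; apply: le_trans (Hnu 0%R _); first exact: int2_ge0.
  by rewrite normr0 mulr_gt0.
pose r4 : R := (rho ^+ 4)%R; have r40 : (0 < r4)%R by exact: exprn_gt0.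
have A1 : (Aa `^ del = rL)%R by rewrite /Aa -powRrM mulNr.
have A2 : (Aa `^ (1 + del - q) <= r4)%R.
  rewrite /Aa -powRrM /r4 -(powR_mulrn _ (ltW rho0)); apply: ger_powR; first by rewrite rho0.
  rewrite (_ : (- L * (1 + del - q) = L * (q - 1 - del))%R); last by ring.
  rewrite (_ : (4%:R = L * ((q - 1) / 2))%R); last by rewrite /L; field; rewrite gt_eqF.
  by apply: ler_wpM2l; [exact: ltW|move: delq; lra].
have dq : (1 + del <= q)%R by move: delq del0; lra.
have HN (p : Rn) : (`|p| < 3 * r)%R ->
    \int[leb]_(x in inner Omega (4 * d)) (`|diff2 v p h x| `^ (1 + del))%:E <= (rL * nu + r4 * (64 * V))%:E.
  move=> pr; have md := measurable_diff2 p h mv.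
  have m1 : measurable_fun (inner Omega (4 * d)) (fun x => `|diff2 v p h x|%:E) by apply: measurable_funTS; mfun.
  have m2 : measurable_fun (inner Omega (4 * d)) (fun x => (`|diff2 v p h x| `^ q)%:E) by apply: measurable_funTS; mfun.
  apply: (@le_trans _ _ (\int[leb]_(x in inner Omega (4 * d)) (rL%:E * `|diff2 v p h x|%:E + r4%:E * (`|diff2 v p h x| `^ q)%:E))).
    apply: le_integral_ge0 => [//|x _|x _|x _].
    - by rewrite lee_fin powR_ge0.
    - by rewrite -!EFinM -EFinD lee_fin addr_ge0 ?mulr_ge0 ?powR_ge0// ltW.
    rewrite -!EFinM -EFinD lee_fin; apply: le_trans (interpolation del0 dq Aa0 (normr_ge0 _)) _.
    by rewrite A1; apply: lerD => //; apply: ler_wpM2r; [exact: powR_ge0|exact: A2].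
  rewrite ge0_integralD; [|exact: inner_measurable|by move=> x _; rewrite -EFinM lee_fin mulr_ge0|
    exact: measurable_funeM|by move=> x _; rewrite -EFinM lee_fin mulr_ge0 ?powR_ge0// ltW|exact: measurable_funeM].
  rewrite EFinD; apply: leeD.
    rewrite ge0_integralZl_EFin; [|exact: inner_measurable|by move=> x _; rewrite lee_fin|by []|by []].
    by rewrite EFinM; apply: lee_wpmul2l; [rewrite lee_fin|exact: Hnu].
  rewrite ge0_integralZl_EFin; [|exact: inner_measurable|by move=> x _; rewrite lee_fin powR_ge0|by []|exact: ltW].
  rewrite [leRHS]EFinM; apply: lee_wpmul2l; first by rewrite lee_fin ltW.
  apply: le_trans (@integral_diff2_powR R n Omega mO q (4 * d) v p h _ mv _) _.
  - by rewrite q2 andbT ltW// (lt_trans ltr01).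
  - exact: (ltr_add34 _ hr rd).
  - by rewrite EFinM; apply: lee_wpmul2l; rewrite ?lee_fin.
have kap01 : (0 < r4 <= 1)%R by rewrite r40 exprn_ile1// ltW.
have del01 : (0 < del <= 1)%R by rewrite del0.
apply: le_trans (HC r r4 del th (rL * nu + r4 * (64 * V))%R T h k _ hr kr kap01 del01 (le_lt_trans dq qq) th0 HN HT) _.
  by rewrite r0.
have T0 : (0 <= T)%R.
  rewrite -lee_fin; apply: le_trans HT; apply: integral_ge0 => x _; apply: integral_ge0 => e _.
  by rewrite lee_fin mulr_ge0// mulr_ge0 ?kern_ge0// mulr_ge0.
rewrite lee_fin /psi_sup.
have E4 : (r4 `^ (- del) = rho `^ (- (4 * del)))%R.
  by rewrite /r4 -(powR_mulrn 4 (ltW rho0)) -powRrM mulrN.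
rewrite E4; set K4 := (rho `^ (- (4 * del)))%R; set rs := (r `^ _)%R.
have El : (rho `^ (- (lam * del)) = K4 ^+ 2 * rL)%R.
  rewrite /K4 /rL -(powR_mulrn 2 (powR_ge0 _ _)) -powRrM -powRD ?(gt_eqF rho0) ?implybT//.
  by congr powR; rewrite /lam -/L; ring.
have K41 : (1 <= K4)%R.
  rewrite /K4 powRN -[leLHS]invr1 lef_pV2 ?posrE ?powR_gt0//.
  rewrite -[leRHS](powRr0 rho); apply: ger_powR; [by rewrite rho0|].
  by apply: mulr_ge0 => //; exact: ltW.
rewrite El; set ks := (`|k| `^ _)%R.
have ks0 : (0 <= ks)%R by exact: powR_ge0.
have ksr : (ks <= rho `^ (2 * s))%R.
  by apply: ge0_ler_powR; rewrite ?nnegrE ?mulr_ge0 ?(ltW s0) ?(ltW rho0).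
exact: (core_algebra C0 del0 K41 rL1 th0 T0 (powR_ge0 _ _) (ltW r40) nu0 (mulr_ge0 (ler0n _ 64) V0) ks0 ksr).
Qed.

(** The bound is asked for every margin [d], with constants depending on it, because each step of
    the iteration uses up part of the margin. *)
Definition first_bound (g : R) := forall d : R, (0 < d)%R -> exists C rho0 : R,
  [/\ (0 <= C)%R, (0 < rho0)%R & forall h : Rn, (0 < `|h| <= rho0)%R -> int1 d h <= (C * `|h| `^ g)%:E].

Definition second_bound (a : R) := forall d : R, (0 < d)%R -> exists C rho0 : R,
  [/\ (0 <= C)%R, (0 < rho0)%R & forall (rho : R) (h k : Rn), (0 < rho <= rho0)%R ->
     (`|h| <= rho)%R -> (`|k| <= rho)%R -> int2 d k h <= (C * rho `^ a)%:E].

Lemma int2_0 d h : int2 d 0 h = 0.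
Proof.
apply: integral0_eq => x _.
by rewrite /diff2 addr0 subrr normr0.
Qed.

Lemma second_bound_mono a b : (b <= a)%R -> second_bound a -> second_bound b.
Proof.
move=> ba H d d0; have [C [rho0 [C0 r0 HC]]] := H d d0.
exists C, (Num.min rho0 1%R); split => //; first by rewrite lt_min r0 ltr01.
move=> rho h k /andP[rho1]; rewrite le_min => /andP[rho2 rho3] hr kr.
apply: le_trans (HC rho h k _ hr kr) _; first by rewrite rho1.
by rewrite lee_fin ler_wpM2l//; apply: ger_powR; rewrite ?rho1.
Qed.

Lemma first_bound0 : first_bound 0.
Proof.
move=> d d0; exists (2 * U)%R, (d / 2)%R; split; [by rewrite mulr_ge0|by rewrite divr_gt0|].
move=> h /andP[h0 hd]; rewrite powRr0 mulr1; apply: int1_le; apply: le_lt_trans hd _.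
by rewrite ltr_pdivrMr// ltr_pMr// ltr1n.
Qed.

Lemma first_of_second_sub a : (0 <= a < 1)%R -> second_bound a -> first_bound a.
Proof.
move=> a01 H d d0; have [C [rho0 [C0 r0 HC]]] := H d d0.
pose E : R := Num.min rho0 (d / 2)%R; have E0 : (0 < E)%R by rewrite lt_min r0 divr_gt0.
have Er : (E <= rho0)%R by rewrite ge_min lexx.
have Ed : (E < d)%R.
  by rewrite (@le_lt_trans _ _ (d / 2)%R) ?ge_min ?lexx ?orbT// ltr_pdivrMr// ltr_pMr// ltr1n.
have U20 : (0 <= 2 * U)%R by rewrite mulr_ge0.
exists ((2 * U) / (E / 2) `^ a + C / (2 - 2 `^ a))%R, E; split => //.
  rewrite addr_ge0// divr_ge0 ?powR_ge0// subr_ge0 ltW// -[ltRHS]powRr1//.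
  by apply: powR2_lt; case/andP: a01.
apply: (@dyadic_sublinear R n (int1 d) E a C (2 * U)%R E0 C0 U20) => //.
  by move=> h /andP[_ hE]; apply: int1_le; exact: le_lt_trans Ed.
move=> h /andP[h0 hE]; apply: le_trans (int1_double d h) _; apply: leeD => //.
apply: HC => //; rewrite h0/= (le_trans hE)// (le_trans _ Er)// ler_pdivrMr// ler_peMr ?ler1n// ltW//.
Qed.

Lemma first_of_second a : (1 < a)%R -> second_bound a -> first_bound 1.
Proof.
move=> a1 H d d0; have [C [rho0 [C0 r0 HC]]] := H d d0.
pose E : R := Num.min rho0 (d / 2)%R; have E0 : (0 < E)%R by rewrite lt_min r0 divr_gt0.
have Er : (E <= rho0)%R by rewrite ge_min lexx.
have Ed : (E < d)%R.
  by rewrite (@le_lt_trans _ _ (d / 2)%R) ?ge_min ?lexx ?orbT// ltr_pdivrMr// ltr_pMr// ltr1n.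
have U20 : (0 <= 2 * U)%R by rewrite mulr_ge0.
have p2 : (0 <= 2 `^ a - 2 :> R)%R.
  by rewrite subr_ge0 ltW// -[ltLHS]powRr1//; exact: powR2_lt.
exists (2 * (2 * U / E) + 2 * (C / (2 `^ a - 2)) * E `^ (a - 1))%R, E; split => //.
  apply: addr_ge0; first by apply: mulr_ge0 => //; apply: divr_ge0 => //; exact: ltW.
  by apply: mulr_ge0; [apply: mulr_ge0 => //; exact: divr_ge0|exact: powR_ge0].
move=> h hE; rewrite powRr1//.
apply: (@dyadic_linear R n (int1 d) E a C (2 * U)%R E0 C0 U20) => //.
  by move=> k /andP[_ kE]; apply: int1_le; exact: le_lt_trans Ed.
move=> k /andP[k0 kE]; apply: le_trans (int1_double d k) _; apply: leeD => //.
apply: HC => //; rewrite k0/= (le_trans kE)// (le_trans _ Er)// ler_pdivrMr// ler_peMr ?ler1n// ltW//.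
Qed.

(** With [e] fixed, the dyadic recursion runs in [h] downwards from [|h| = |e|], where
    [second_bound] with [rho = |e|] starts it. The errors are [O(|h|^(1+g))] with [1 + g > 1], so
    the result is linear in [|h|] and keeps the factor [|e|^g]. *)
Lemma mixed_bound g : (0 < g)%R -> second_bound (1 + g) -> forall d : R, (0 < d)%R -> exists C rho0 : R,
  [/\ (0 <= C)%R, (0 < rho0)%R & forall e h : Rn, (0 < `|h|)%R -> (`|h| <= `|e|)%R -> (`|e| <= rho0)%R ->
     int2 d e h <= (C * `|e| `^ g * `|h|)%:E].
Proof.
move=> g0 H d d0; have d20 : (0 < d / 2)%R by rewrite divr_gt0.
have [C [rho1 [C0 r0 HC]]] := H _ d20.
have a1 : (1 < 1 + g)%R by rewrite ltrDl.
have p2 : (0 < 2 `^ (1 + g) - 2 :> R)%R.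
  by rewrite subr_gt0 -[ltLHS]powRr1//; exact: powR2_lt.
exists (2 * C + 2 * (2 * C / (2 `^ (1 + g) - 2)))%R, (Num.min rho1 (d / 2))%R; split.
- apply: addr_ge0; first by rewrite mulr_ge0.
  by rewrite mulr_ge0// divr_ge0 ?mulr_ge0// ltW.
- by rewrite lt_min r0.
move=> e h h0 he; rewrite le_min => /andP[er ed].
have e0 : (0 < `|e|)%R by exact: lt_le_trans he.
pose A : R := (C * `|e| `^ (1 + g))%R; have A0 : (0 <= A)%R by rewrite mulr_ge0// powR_ge0.
have ed2 : (`|e| + d / 2 <= d)%R by move: ed; move: `|e|%R => t ?; lra.
have C20 : (0 <= 2 * C)%R by rewrite mulr_ge0.
have := @dyadic_linear R n (int2 d e) `|e|%R (1 + g)%R (2 * C)%R A e0 C20 A0.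
have -> : (2 * (A / `|e|) + 2 * (2 * C / (2 `^ (1 + g) - 2)) * `|e| `^ (1 + g - 1) =
   (2 * C + 2 * (2 * C / (2 `^ (1 + g) - 2))) * `|e| `^ g)%R.
  rewrite /A (addrC 1%R g) addrK powRD ?(gt_eqF e0) ?implybT// powRr1//.
  have -> : (C * (`|e| `^ g * `|e|) / `|e| = C * `|e| `^ g)%R by rewrite mulrA mulfK ?gt_eqF.
  by ring.
apply => //; last by rewrite h0.
- move=> k /andP[_ ke]; apply: le_trans (int2_dom _ _ _) _; last first.
    apply: (HC `|e|%R k e _ ke) => //; by rewrite e0.
  by rewrite ler_pdivrMr// ler_peMr ?ler1n// ltW.
- move=> k /andP[k0 ke]; apply: le_trans (int2_double k ed2) _; apply: leeD => //.
  rewrite -mulrA EFinM; apply: lee_wpmul2l; first by rewrite lee_fin.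
  apply: HC => //; rewrite k0/= (le_trans ke)// (le_trans _ er)// ler_pdivrMr// ler_peMr ?ler1n//.
Qed.

Let lam0 : (0 < lam)%R. Proof. by rewrite ltr_wpDr// divr_ge0// ltW. Qed.

Let small_del (gap : R) : (0 < gap)%R -> exists del : R, [/\ (0 < del)%R, (2 * del <= q - 1)%R & (lam * del <= gap)%R].
Proof.
move=> g0; exists (Num.min ((q - 1) / 2) (gap / lam))%R; split.
- by rewrite lt_min !divr_gt0.
- by rewrite mulrC -ler_pdivlMr// ge_min lexx.
- by rewrite mulrC -ler_pdivlMr// ge_min lexx orbT.
Qed.

(* Here the cut-off radius is fixed; [th] is the only free parameter. *)
Lemma phase1_step g a : (0 <= g <= 1)%R -> (a < s + g / 2)%R -> first_bound g -> second_bound a.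
Proof.
move=> /andP[g0 g1] ag H d d0; pose d' : R := (d / 6)%R; have d'0 : (0 < d')%R by rewrite divr_gt0.
have [del [del0 delq dela]] : exists del : R, [/\ (0 < del)%R, (2 * del <= q - 1)%R & (lam * del <= s + g / 2 - a)%R].
  by apply: small_del; rewrite subr_gt0.
have [C1 C10 HC1] := core_estimate d'0 del0 delq.
have [C2 [rho2 [C20 r20 HC2]]] := H d' d'0.
pose W : R := (1 + d' `^ (- (2 * s)) * (1 + 2 * C2) + (1 + 2 * C2))%R.
have C220 : (0 <= 1 + 2 * C2)%R by rewrite addr_ge0// mulr_ge0.
exists (C1 * W)%R, (Num.min 1 (Num.min (d' / 2) rho2))%R; split.
- by apply: mulr_ge0 => //; rewrite !addr_ge0 ?mulr_ge0 ?powR_ge0.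
- by rewrite !lt_min ltr01 r20 divr_gt0.
move=> rho h k /andP[rho0]; rewrite !le_min => /and3P[rho1 rhod rhor] hrho krho.
have [k0|k0] := eqVneq k 0%R.
  rewrite k0 int2_0 lee_fin mulr_ge0 ?powR_ge0// mulr_ge0// !addr_ge0 ?mulr_ge0 ?powR_ge0//.
have [h0|h0] := eqVneq h 0%R.
  rewrite h0 int2C int2_0 lee_fin mulr_ge0 ?powR_ge0// mulr_ge0// !addr_ge0 ?mulr_ge0 ?powR_ge0//.
have hn : (0 < `|h|)%R by rewrite normr_gt0.
have -> : d = (6 * d')%R by rewrite mulrC divfK.
(* Balances [th] against [th^-1 * rho^(2s) * rho^g]. *)
pose th : R := (rho `^ (s + g / 2))%R; have th0 : (0 < th)%R by exact: powR_gt0.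
pose nu : R := (2 * (C2 * rho `^ g))%R.
have rg0 : (0 <= rho `^ g)%R by exact: powR_ge0.
have Hnu (p : Rn) : (`|p| < 3 * d')%R -> int2 (4 * d') p h <= nu%:E.
  move=> pd; apply: le_trans (@int2_le_int1 (4 * d')%R d' p h _) _.
    by have LR (t : R) : (t < 3 * d' -> t + d' <= 4 * d')%R; [move=> ?; lra|exact: LR].
  rewrite EFinM; apply: lee_wpmul2l; first by rewrite lee_fin.
  apply: le_trans (HC2 h _) _; first by rewrite hn (le_trans hrho).
  by rewrite lee_fin ler_wpM2l//; apply: ge0_ler_powR; rewrite ?nnegrE// ltW.
(* The range [d' <= |e| < d'] is empty. *)
have HT : near_tail s Omega v d' d' h <= 0%:E.
  rewrite /near_tail integral0_eq// => x _; rewrite integral0_eq// => e _.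
  by case: leP => _; rewrite /= ?mul0r ?mulr0 ?mul0r.
have kn : (0 < `|k| <= rho)%R by rewrite normr_gt0 k0.
apply: le_trans (HC1 rho d' th nu 0%R h k _ _ rhod hrho kn th0 Hnu HT) _.
- by rewrite rho0.
- by rewrite d'0 lexx.
rewrite lee_fin addr0 -!mulrA; apply: ler_wpM2l => //.
have X1 : (rho ^+ 4 + nu <= (1 + 2 * C2) * rho `^ g)%R.
  rewrite mulrDl mul1r /nu mulrA lerD2r -(powR_mulrn _ (ltW rho0)).
  by apply: ger_powR; [rewrite rho0|apply: le_trans g1 _; rewrite ler1n].
have nu0 : (0 <= rho ^+ 4 + nu)%R by rewrite addr_ge0 ?exprn_ge0 ?(ltW rho0)// mulr_ge0// mulr_ge0.
have Rn0 : rho != 0%R by rewrite gt_eqF.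
have imp (x y : R) : (x + y == 0)%R ==> (rho != 0)%R by rewrite Rn0 implybT.
have E1 : (th^-1 * (rho `^ (2 * s) * rho `^ g) = th)%R.
  rewrite /th -powRN -!powRD ?imp//; congr powR; by field.
have rg1 : (rho `^ g <= 1)%R by rewrite -[leRHS](powRr0 rho); apply: ger_powR; rewrite ?rho0.
have t1 : (th * (1 + d' `^ (- (2 * s)) * (rho ^+ 4 + nu)) <= th * (1 + d' `^ (- (2 * s)) * (1 + 2 * C2)))%R.
  apply: ler_wpM2l; first exact: ltW.
  rewrite lerD2l ler_wpM2l ?powR_ge0//; apply: le_trans X1 _.
  by rewrite -[leRHS]mulr1; exact: ler_wpM2l.
have t2 : (th^-1 * (rho `^ (2 * s) * (rho ^+ 4 + nu)) <= th * (1 + 2 * C2))%R.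
  rewrite -{2}E1 [leRHS](_ : _ = th^-1 * (rho `^ (2 * s) * ((1 + 2 * C2) * rho `^ g)))%R; last by ring.
  by apply: ler_wpM2l; [rewrite invr_ge0 ltW|apply: ler_wpM2l => //; exact: powR_ge0].
have W0 : (0 <= W)%R by rewrite !addr_ge0 ?mulr_ge0 ?powR_ge0.
apply: (@le_trans _ _ (rho `^ (- (lam * del)) * (th * W))%R).
  by apply: ler_wpM2l; [exact: powR_ge0|rewrite /W [leRHS]mulrDr; exact: lerD].
rewrite (mulrC th) mulrCA; apply: ler_wpM2l => //.
rewrite /th -powRD ?imp//; apply: ger_powR; first by rewrite rho0.
by rewrite addrC lerBrDr -lerBrDl.
Qed.

Let eta1 : R := ((s - 1 / 2) / 2)%R.
Let eta10 : (0 < eta1)%R. Proof. by rewrite divr_gt0// subr_gt0; case/andP: s12. Qed.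

Let eta1E : (s = 1 / 2 + 2 * eta1)%R. Proof. by rewrite /eta1; field. Qed.

(** With [s = 1/2 + 2 * eta1] the exponent [s + g/2] exceeds [g + eta1] for [g <= 1], so every round
    gains [eta1]. Below 1 the second-difference exponent passes unchanged to first differences. *)
Lemma phase1_iter i : (i%:R * eta1 < 1)%R -> first_bound (i%:R * eta1).
Proof.
elim: i => [|i IH] ie; first by rewrite mul0r; exact: first_bound0.
rewrite -natr1 mulrDl mul1r in ie *.
have i0 : (0 <= i%:R * eta1)%R by rewrite mulr_ge0// ltW.
have e0 := eta10; have sE := eta1E.
have ie' : (i%:R * eta1 < 1)%R by apply: lt_trans ie; rewrite ltrDl.
apply: first_of_second_sub; first by rewrite ie addr_ge0// ltW.
apply: (@phase1_step (i%:R * eta1)%R); [by rewrite i0 ltW| |exact: IH].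
by rewrite [X in (_ < X + _)%R]sE; move: (i%:R * eta1)%R ie i0 => t ie i0; lra.
Qed.

(** Take the last multiple [g] of [eta1] below 1. Then [g >= 1 - eta1], and one more round allows
    every exponent below [s + g/2 >= 1 + 3/2 * eta1], which crosses 1. *)
Lemma phase1 : second_bound (1 + eta1).
Proof.
have e0 := eta10; have sE := eta1E.
have [i i1 i2] : exists2 i, (i%:R * eta1 < 1)%R & (1 <= i.+1%:R * eta1)%R.
  have H : exists i, (1 <= i.+1%:R * eta1)%R.
    exists (Num.truncn eta1^-1); rewrite -ler_pdivrMr// mul1r ltW//.
    have e1 : (0 <= eta1^-1)%R by rewrite invr_ge0 ltW.
    by have /andP[] := truncn_itv e1.
  case: (ex_minnP H) => -[|i] Hi Hm.
    by exists 0%N => //; rewrite mul0r.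
  exists i.+1 => //; rewrite ltNge; apply/negP => /Hm.
  by rewrite ltnn.
have i0 : (0 <= i%:R * eta1)%R by rewrite mulr_ge0// ltW.
apply: (@phase1_step (i%:R * eta1)%R); [by rewrite i0 ltW| |exact: phase1_iter].
rewrite [X in (_ < X + _)%R]sE; rewrite -natr1 mulrDl mul1r in i2.
by move: (i%:R * eta1)%R i1 i2 => t i1 i2; lra.
Qed.

Lemma first_bound1 : first_bound 1.
Proof. by apply: first_of_second phase1; rewrite ltrDl. Qed.

Let mkd (r d : R) : measurable_fun setT (fun e : Rn => ((r <= `|e|)%R)%:R * ((`|e| < d)%R)%:R * kern s e)%R.
Proof. by have mk := @measurable_kern R n s; mfun. Qed.

Lemma near_tail_le (g B r d : R) (h : Rn) : (0 <= g < 2 * s)%R -> (0 <= B)%R -> (0 < r)%R ->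
  (forall e : Rn, (r <= `|e|)%R -> (`|e| < d)%R -> int2 (2 * d) e h <= (B * `|e| `^ g)%:E) ->
  near_tail s Omega v r d h <= (B * (4 ^+ n / (1 - 2 `^ (- (2 * s - g))) * r `^ (- (2 * s - g))))%:E.
Proof.
move=> /andP[g0 gs] B0 r0 Hd; have mk := mkd r d.
pose kd (e : Rn) : R := (((r <= `|e|)%R)%:R * ((`|e| < d)%R)%:R * kern s e)%R.
have kd0 e : (0 <= kd e)%R by rewrite mulr_ge0 ?kern_ge0// mulr_ge0.
have t0 : (0 < 2 * s - g)%R by rewrite subr_gt0.
rewrite /near_tail (@tonelli_in _ _ Rn Rn R leb leb (inner Omega (2 * d)) setT
   (fun x e => (kd e * `|diff2 v e h x|)%:E) (inner_measurable _ _) measurableT); last 2 first.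
- by have mkd' : measurable_fun setT kd := mk; rewrite /diff2; mfun.
- by move=> x y; rewrite lee_fin; exact: mulr_ge0 (kd0 _) (normr_ge0 _).
have P0 (e : Rn) : (0 <= `|e| `^ (- (2 * s - g)) / `|e| ^+ n)%R by rewrite divr_ge0 ?powR_ge0 ?exprn_ge0.
have mP (A : set Rn) : measurable_fun A (fun e : Rn => (`|e| `^ (- (2 * s - g)) / `|e| ^+ n)%:E).
  apply: measurable_funTS; apply: mf_EFin; apply: mf_mul; first by mfun.
  exact: measurable_norm_expV.
have mF : measurable [set e : Rn | (r <= `|e|)%R] by exact: measurable_norm_ge.
rewrite [leRHS]EFinM.
apply: le_trans (lee_wpmul2l _ (@integral_far_le R n _ _ t0 r0)); last by rewrite lee_fin.
rewrite -ge0_integralZl_EFin; [|exact: mF|by move=> e _; rewrite lee_fin|exact: mP|exact: B0].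
rewrite [leRHS]integral_mkcond; apply: le_integral_ge0 => [//|e _|e _|e _].
- by apply: integral_ge0 => x _; rewrite lee_fin; exact: mulr_ge0 (kd0 _) (normr_ge0 _).
- by apply: erestrict_ge0 => y _; rewrite -EFinM lee_fin; exact: mulr_ge0 (P0 _).
have md := measurable_diff2 e h mv.
under eq_integral do rewrite EFinM.
rewrite ge0_integralZl_EFin; [|exact: inner_measurable|by move=> x _; rewrite lee_fin|
  by apply: measurable_funTS; mfun|exact: kd0].
have [er|er] := leP r `|e|%R; last first.
  have -> : kd e = 0%R by rewrite /kd (leNgt r) er /= !mul0r.
  rewrite mul0e; apply: erestrict_ge0 => y _.
  by rewrite -EFinM lee_fin; exact: mulr_ge0 (P0 _).
rewrite patchE mem_set//.
have [ed|ed] := ltP `|e|%R d; last first.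
  by rewrite /kd er ltNge ed /= mulr0 mul0r mul0e -EFinM lee_fin; exact: mulr_ge0 (P0 _).
rewrite /kd er ed !mul1r; apply: le_trans (lee_wpmul2l _ (Hd e er ed)) _; first by rewrite lee_fin kern_ge0.
rewrite -!EFinM lee_fin mulrCA; apply: ler_wpM2l => //.
have e0 : (0 < `|e|)%R by exact: lt_le_trans er.
apply: le_trans (ler_wpM2r (powR_ge0 _ _) (kern_le s0 e)) _.
rewrite mulrAC -powRD ?(gt_eqF e0) ?implybT// opprB addrC; exact: lexx.
Qed.

(* [r = rho^(1/(2s-g))] makes [r^(-2s) * nu] and the kernel tail of order 1, like the
   contribution of the datum. *)
Lemma phase2_step g a : (0 < g < 2 * s - 1)%R -> (a < s + s / (2 * s - g))%R -> second_bound (1 + g) ->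
  second_bound a.
Proof.
move=> /andP[g0 gs] ag H d d0; pose d' : R := (d / 6)%R; have d'0 : (0 < d')%R by rewrite divr_gt0.
have /andP[s12' s1] := s12.
have g1 : (g <= 1)%R.
  by apply: ltW (lt_trans gs _); rewrite ltrBlDr -[ltRHS]/(2%:R) gtr_pMr.
pose t : R := (2 * s - g)%R; have t1 : (1 < t)%R by rewrite /t ltrBrDl -ltrBrDr.
have t0 : (0 < t)%R by exact: lt_trans t1.
pose theta : R := (t^-1)%R; have th1 : (theta < 1)%R by rewrite invf_lt1.
have theta0 : (0 < theta)%R by rewrite invr_gt0.
have [del [del0 delq dela]] : exists del : R, [/\ (0 < del)%R, (2 * del <= q - 1)%R & (lam * del <= s + s / t - a)%R].
  by apply: small_del; rewrite subr_gt0.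
have [C1 C10 HC1] := core_estimate d'0 del0 delq.
have [C2 [rho2 [C20 r20 HC2]]] := first_bound1 d'0.
have d20 : (0 < 2 * d')%R by rewrite mulr_gt0.
have [C3 [rho3 [C30 r30 HC3]]] := mixed_bound g0 H d20.
have d40 : (0 < 4 * d')%R by rewrite mulr_gt0.
have [C5 [rho5 [C50 r50 HC5]]] := H _ d40.
(* The mixed bound holds for [|e| <= rho3] only. For larger [e] the second difference is estimated
   by first differences, which are linear in [|h|], and the factor [|e|^g / rho3^g >= 1] is
   inserted. *)
pose C4 : R := (C3 + 2 * C2 / rho3 `^ g)%R.
have C40 : (0 <= C4)%R by rewrite addr_ge0// divr_ge0 ?powR_ge0// mulr_ge0.
pose Cf : R := (4 ^+ n / (1 - 2 `^ (- t)))%R.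
have Cf0 : (0 <= Cf)%R.
  rewrite divr_ge0 ?exprn_ge0// subr_ge0 ltW//.
  by have /andP[] := powR2_lt1 t0.
pose C6 : R := (1 + 3 * C4 + C5)%R; have C60 : (0 <= C6)%R by rewrite !addr_ge0// mulr_ge0.
pose W : R := (1 + C4 * Cf + C6 + C6)%R; have W0 : (0 <= W)%R by rewrite !addr_ge0// mulr_ge0.
(* [rho <= p1] ensures [rho <= r / 2], and [rho <= p2] ensures [r <= d' / 3]. *)
pose p1 : R := ((1 / 2) `^ (1 - theta)^-1)%R; have p10 : (0 < p1)%R by exact: powR_gt0.
pose p2 : R := ((d' / 3) `^ t)%R; have p20 : (0 < p2)%R by rewrite powR_gt0// divr_gt0.
exists (C1 * W)%R, (Num.min 1 (Num.min p1 (Num.min p2 (Num.min rho2 rho5))))%R; split.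
- exact: mulr_ge0.
- by rewrite !lt_min ltr01 p10 p20 r20.
move=> rho h k /andP[rho0]; rewrite !le_min => /and5P[rho1 rhop1 rhop2 rhor2 rhor5] hrho krho.
have [k0|k0] := eqVneq k 0%R.
  by rewrite k0 int2_0 lee_fin mulr_ge0 ?powR_ge0// mulr_ge0.
have [h0|h0] := eqVneq h 0%R.
  by rewrite h0 int2C int2_0 lee_fin mulr_ge0 ?powR_ge0// mulr_ge0.
have hn : (0 < `|h|)%R by rewrite normr_gt0.
have Rn0 : rho != 0%R by rewrite gt_eqF.
have imp (x y : R) : (x + y == 0)%R ==> (rho != 0)%R by rewrite Rn0 implybT.
pose r : R := (rho `^ theta)%R; have r0 : (0 < r)%R by exact: powR_gt0.
have rN0 : r != 0%R by rewrite gt_eqF.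
have impr (x y : R) : (x + y == 0)%R ==> (r != 0)%R by rewrite rN0 implybT.
have rhoE : (rho = r * rho `^ (1 - theta))%R.
  by rewrite /r -powRD ?imp// addrC subrK powRr1// ltW.
have rhor : (rho <= r / 2)%R.
  rewrite {1}rhoE; apply: ler_wpM2l; first exact: ltW.
  have -> : (2^-1 = p1 `^ (1 - theta))%R.
    by rewrite /p1 -powRrM mulVf ?powRr1 ?mul1r// ?invr_ge0// gt_eqF// subr_gt0.
  by apply: ge0_ler_powR; rewrite ?nnegrE ?subr_ge0 ?(ltW th1) ?(ltW rho0) ?(ltW p10).
have rd3 : (r <= d' / 3)%R.
  have -> : (d' / 3 = p2 `^ theta)%R.
    rewrite /p2 -powRrM mulfV ?gt_eqF// powRr1// divr_ge0// ltW//.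
  by apply: ge0_ler_powR; rewrite ?nnegrE ?(ltW theta0) ?(ltW rho0) ?(ltW p20).
have rd : (0 < r <= d')%R by rewrite r0 (le_trans rd3)// ler_pdivrMr// ler_peMr ?ler1n// ltW.
have rhor' : (rho <= r)%R by apply: le_trans rhor _; rewrite ler_pdivrMr// ler_peMr ?ler1n// ltW.
have rt : (r `^ (- t) = rho^-1)%R.
  by rewrite /r -powRrM mulrN mulVf ?gt_eqF// powR_inv1// ltW.
have C4le (e : Rn) : (`|h| <= `|e|)%R -> (`|e| < d')%R -> int2 (2 * d') e h <= (C4 * rho * `|e| `^ g)%:E.
  move=> he ed; have e0 : (0 < `|e|)%R by exact: lt_le_trans he.
  have eg0 : (0 <= `|e| `^ g)%R by exact: powR_ge0.
  have [er|er] := leP `|e|%R rho3.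
    apply: le_trans (HC3 e h hn he er) _; rewrite lee_fin mulrAC; apply: ler_wpM2r => //.
    by apply: ler_pM => //; rewrite /C4 lerDl divr_ge0 ?powR_ge0// mulr_ge0.
  apply: le_trans (@int2_le_int1 (2 * d')%R d' e h _) _.
    by rewrite mulr_natl mulr2n lerD2r ltW.
  apply: (@le_trans _ _ (2%:E * (C2 * `|h| `^ 1)%:E)).
    apply: lee_wpmul2l; first by rewrite lee_fin.
    by apply: HC2; rewrite hn (le_trans hrho).
  rewrite -EFinM lee_fin powRr1// mulrA.
  apply: (@le_trans _ _ (2 * C2 / rho3 `^ g * rho * `|e| `^ g)%R).
    rewrite [leRHS]mulrAC; apply: ler_pM => //; first by rewrite mulr_ge0.
    rewrite mulrAC ler_pdivlMr ?powR_gt0//; apply: ler_wpM2l; first by rewrite mulr_ge0.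
    by apply: ge0_ler_powR; rewrite ?nnegrE ?(ltW g0) ?(ltW r30)// ltW.
  by apply: ler_wpM2r => //; apply: ler_wpM2r; [exact: ltW|rewrite /C4 lerDr].
(* [3 * C4] serves the shifts with [|h| <= |p| < 3 * r], as [(3 * r)^g <= 3 * r^g]. For [|p| < |h|]
   the mixed bound does not apply and the hypothesis on second differences, with constant [C5], is
   used directly. *)
pose nu : R := ((3 * C4 + C5) * (rho * r `^ g))%R.
have rg0 : (0 <= r `^ g)%R by exact: powR_ge0.
have Hnu (p : Rn) : (`|p| < 3 * r)%R -> int2 (4 * d') p h <= nu%:E.
  move=> pr; have [hp|hp] := leP `|h|%R `|p|%R.
    apply: le_trans (@int2_dom (4 * d')%R (2 * d')%R p h _) _.
      by rewrite ler_wpM2r ?ler_nat// ltW.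
    apply: le_trans (C4le p hp _) _.
      by apply: lt_le_trans pr _; rewrite mulrC -ler_pdivlMr.
    rewrite lee_fin /nu [leRHS]mulrDl -[leLHS]addr0; apply: lerD; last by rewrite mulr_ge0// mulr_ge0// ltW.
    rewrite (_ : (3 * C4 * (rho * r `^ g) = C4 * rho * (3 * r `^ g))%R); last by ring.
    apply: ler_wpM2l; first by rewrite mulr_ge0// ltW.
    apply: (@le_trans _ _ ((3 * r) `^ g)%R).
      by apply: ge0_ler_powR; rewrite ?nnegrE ?mulr_ge0 ?(ltW g0) ?(ltW r0) ?(ltW pr).
    rewrite powRM// ?(ltW r0)//; apply: ler_wpM2r => //.
    rewrite -[leRHS]powRr1//; apply: ler_powR; rewrite ?ler1n//.
  apply: le_trans (HC5 rho h p _ hrho (le_trans (ltW hp) hrho)) _; first by rewrite rho0.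
  rewrite lee_fin /nu [leRHS]mulrDl -[leLHS]add0r; apply: lerD; first by rewrite mulr_ge0 ?mulr_ge0// ltW.
  apply: ler_wpM2l => //; rewrite powRD ?imp// powRr1 ?(ltW rho0)//; apply: ler_wpM2l; first exact: ltW.
  by apply: ge0_ler_powR; rewrite ?nnegrE ?(ltW g0) ?(ltW rho0) ?(ltW r0).
have HT : near_tail s Omega v r d' h <= (C4 * Cf)%:E.
  have gs2 : (0 <= g < 2 * s)%R by rewrite (ltW g0) -subr_gt0.
  apply: le_trans (@near_tail_le g (C4 * rho)%R r d' h gs2 _ r0 _) _.
  - by rewrite mulr_ge0// ltW.
  - by move=> e er ed; apply: C4le => //; apply: le_trans hrho _; exact: le_trans er.
  rewrite lee_fin -/t -/Cf rt le_eqVlt; apply/orP; left; apply/eqP; field.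
  by rewrite Rn0.
(* By the choice of [r] one has [rho * r^g = r^(2s)], so this value balances [th] against
   [th^-1 * rho^(2s) * r^(2s)]; it equals [rho^(s + s/(2s-g))]. *)
pose th : R := ((rho * r) `^ s)%R; have th0 : (0 < th)%R by rewrite powR_gt0// mulr_gt0.
have kn : (0 < `|k| <= rho)%R by rewrite normr_gt0 k0.
have -> : d = (6 * d')%R by rewrite mulrC divfK.
apply: le_trans (HC1 rho r th nu (C4 * Cf)%R h k _ rd rhor hrho kn th0 Hnu HT) _.
  by rewrite rho0.
rewrite lee_fin -!mulrA; apply: ler_wpM2l => //.
have X1 : (rho ^+ 4 + nu <= C6 * (rho * r `^ g))%R.
  rewrite /nu /C6 -addrA [leRHS]mulrDl mul1r lerD2r.
  rewrite (exprS _ 3); apply: ler_wpM2l; first exact: ltW.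
  apply: (@le_trans _ _ (rho `^ g)%R).
    rewrite -(powR_mulrn 3 (ltW rho0)); apply: ger_powR; first by rewrite rho0.
    by rewrite (le_trans g1)// ler1n.
  by apply: ge0_ler_powR; rewrite ?nnegrE ?(ltW g0) ?(ltW rho0) ?(ltW r0).
have E1 : (r `^ (- (2 * s)) * (rho * r `^ g) = 1)%R.
  rewrite mulrCA -powRD ?impr// (_ : (- (2 * s) + g = - t)%R); last by rewrite /t; ring.
  by rewrite rt mulfV.
have E2 : (rho * r `^ g = r `^ (2 * s))%R.
  have X0 : (r `^ (2 * s) != 0)%R by rewrite gt_eqF// powR_gt0.
  by rewrite -[LHS](mulVKf X0) -powRN E1 mulr1.
have E3 : (rho `^ (2 * s) * r `^ (2 * s) = th * th)%R.
  rewrite -powRM ?(ltW rho0) ?(ltW r0)// /th -powRD; last by rewrite (gt_eqF (mulr_gt0 rho0 r0)) implybT.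
  by congr powR; ring.
have nu0 : (0 <= rho ^+ 4 + nu)%R.
  apply: addr_ge0; first by apply: exprn_ge0; exact: ltW.
  by apply: mulr_ge0; [rewrite addr_ge0// mulr_ge0|rewrite mulr_ge0// ltW].
have b1 : (th * (1 + (C4 * Cf) + r `^ (- (2 * s)) * (rho ^+ 4 + nu)) <= th * (1 + C4 * Cf + C6))%R.
  apply: ler_wpM2l; first exact: ltW.
  rewrite lerD2l; apply: le_trans (ler_wpM2l (powR_ge0 _ _) X1) _.
  by rewrite mulrCA E1 mulr1.
have b2 : (th^-1 * (rho `^ (2 * s) * (rho ^+ 4 + nu)) <= th * C6)%R.
  apply: (@le_trans _ _ (th^-1 * (rho `^ (2 * s) * (C6 * (rho * r `^ g))))%R).
    by apply: ler_wpM2l; [rewrite invr_ge0 ltW|apply: ler_wpM2l => //; exact: powR_ge0].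
  rewrite E2 (mulrCA (rho `^ _)%R) E3 le_eqVlt; apply/orP; left; apply/eqP; field.
  by rewrite gt_eqF.
apply: (@le_trans _ _ (rho `^ (- (lam * del)) * (th * W))%R).
  by apply: ler_wpM2l; [exact: powR_ge0|rewrite /W [leRHS]mulrDr; exact: lerD].
rewrite (mulrC th) mulrCA; apply: ler_wpM2l => //.
have -> : th = (rho `^ (s + s / t))%R.
  rewrite /th powRM ?(ltW rho0) ?(ltW r0)// /r -powRrM -powRD ?imp//.
  by congr powR; rewrite /theta mulrC.
rewrite -powRD ?imp//; apply: ger_powR; first by rewrite rho0.
by rewrite addrC lerBrDr -lerBrDl.
Qed.

(* The gain [(s-g)(2s-1-g)/(2s-g)] of a step stays bounded away from 0 on
   compact subsets of [g < 2s-1]. *)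
Lemma second_bound_all g : (0 < g < 2 * s - 1)%R -> second_bound (1 + g).
Proof.
move=> /andP[g0 gs]; have /andP[s12' s1] := s12.
(* For [0 < y <= g] the gain is at least [(1-s)(2s-1-g)/(2s)], as [s - y >= 1 - s]. Half of it is
   kept, for strictness. *)
pose e2 : R := ((1 - s) * (2 * s - 1 - g) / (4 * s))%R.
have e20 : (0 < e2)%R by rewrite divr_gt0 ?mulr_gt0// ?subr_gt0//.
pose gi (i : nat) : R := Num.min g (eta1 + i%:R * e2)%R.
have H i : second_bound (1 + gi i).
  elim: i => [|i IH].
    apply: second_bound_mono phase1; rewrite lerD2l ge_min mul0r addr0 lexx orbT//.
  have gi0 : (0 < gi i)%R by rewrite lt_min g0 ltr_pwDl// mulr_ge0// ltW.
  have gig : (gi i <= g)%R by rewrite ge_min lexx.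
  apply: (@phase2_step (gi i)); [by rewrite gi0 (le_lt_trans gig)| |exact: IH].
  have h1 : (gi i.+1 <= gi i + e2)%R.
    rewrite /gi -natr1 mulrDl mul1r addrA; have [h|h] := leP g (eta1 + i%:R * e2)%R.
      by rewrite ge_min lerDl (ltW e20).
    by rewrite ge_min lexx orbT.
  apply: (@le_lt_trans _ _ (1 + (gi i + e2))%R); first by rewrite lerD2l.
  move: (gi i) gi0 gig => y y0 yg; rewrite -subr_gt0.
  have t0 : (0 < 2 * s - y)%R by lra.
  rewrite (_ : (_ - _ = (s - y) * (2 * s - 1 - y) / (2 * s - y) - e2)%R); last first.
    by field; rewrite gt_eqF.
  rewrite subr_gt0 /e2 ltr_pdivrMr ?mulr_gt0//.
  rewrite mulrAC ltr_pdivlMr//.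
  have q0 : (0 < s - y)%R by lra.
  have q3 : (0 < 2 * s - 1 - g)%R by lra.
  have q4 : ((1 - s) * (2 * s - 1 - g) <= (s - y) * (2 * s - 1 - y))%R by apply: ler_pM; lra.
  have q5 : (0 < (1 - s) * (2 * s - 1 - g))%R by apply: mulr_gt0; lra.
  apply: (@lt_le_trans _ _ ((1 - s) * (2 * s - 1 - g) * (4 * s))%R); first by rewrite ltr_pM2l//; lra.
  by apply: ler_wpM2r => //; rewrite mulr_ge0// ltW.
have [i Hi] : exists i, (g <= eta1 + i%:R * e2)%R.
  exists (Num.truncn (g / e2)).+1.
  have e1 : (0 <= g / e2)%R by rewrite divr_ge0// ltW.
  have /andP[_ h] := truncn_itv e1.
  rewrite ler_wpDl ?(ltW eta10)// ltW// -ltr_pdivrMr//.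
by have := H i; rewrite /gi min_l.
Qed.

Lemma mixed_bound_all g : (0 < g < 2 * s - 1)%R -> forall d : R, (0 < d)%R -> exists C rho0 : R,
  [/\ (0 <= C)%R, (0 < rho0)%R & forall e h : Rn, (0 < `|h|)%R -> (`|h| <= `|e|)%R -> (`|e| <= rho0)%R ->
     int2 d e h <= (C * `|e| `^ g * `|h|)%:E].
Proof. by move=> gs; apply: mixed_bound; [case/andP: gs|exact: second_bound_all]. Qed.

End bootstrap.

(** * Tools for the construction of the gradient *)

Section limsup_series.
Context {R : realType}.
Local Open Scope ereal_scope.

(* No convergence is needed: if the series on the right is finite then the
   sequence stays within that distance of [a k], hence so does its limsup. *)
Lemma limsup_series_le (a : nat -> R) k :
  `|a k - fine (limn_esup (fun j => (a j)%:E))|%:E <= \sum_(j <oo) `|a (k + j).+1 - a (k + j)%N|%:E.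
Proof.
set S := \sum_(j <oo) _.
have S0 : 0 <= S by apply: nneseries_ge0 => j _ _; rewrite lee_fin.
have [->|Soo] := eqVneq S +oo; first exact: leey.
have Sfin : S \is a fin_num by rewrite ge0_fin_numE// lt_neqAle Soo leey.
have H m : (`|a (k + m)%N - a k| <= fine S)%R.
  rewrite -lee_fin fineK//.
  apply: (@le_trans _ _ (\sum_(0 <= j < m) `|a (k + j).+1 - a (k + j)%N|%:E)); last first.
    by apply: nneseries_lim_ge => j _ _; rewrite lee_fin.
  elim: m => [|m IH]; first by rewrite addn0 subrr normr0 big_geq.
  rewrite big_nat_recr//= addnS; apply: le_trans (leeD IH (lexx _)); rewrite -EFinD lee_fin [leRHS]addrC.
  by rewrite -(subrKA (a (k + m)%N)) ler_normD.
have Hm m : (k <= m)%N -> (a k - fine S <= a m <= a k + fine S)%R.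
  move=> km; have := H (m - k)%N; rewrite subnKC// ler_norml; lra.
have up : limn_esup (fun j => (a j)%:E) <= (a k + fine S)%:E.
  apply: (@le_trans _ _ (ereal_sup [set (a j)%:E | j in [set m | (k <= m)%N]])).
    by apply: ereal_inf_lbound; exists [set m | (k <= m)%N] => //; exact: nbhs_infty_ge.
  apply: ge_ereal_sup => _ [m km <-]; rewrite lee_fin; by case/andP: (Hm m km).
have lo : (a k - fine S)%:E <= limn_esup (fun j => (a j)%:E).
  apply: le_ereal_inf_tmp => _ [V [N _ NV] <-].
  have Vm : V (maxn N k) by apply: NV; rewrite /= leq_maxl.
  apply: (@le_trans _ _ (a (maxn N k))%:E).
    by rewrite lee_fin; case/andP: (Hm (maxn N k) (leq_maxr _ _)).
  by apply: ereal_sup_ubound; exists (maxn N k).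
have lfin : limn_esup (fun j => (a j)%:E) \is a fin_num.
  by rewrite fin_numE gt_eqF ?(lt_le_trans _ lo) ?ltNyr// lt_eqF// (le_lt_trans up)// ltry.
rewrite -(fineK lfin) !lee_fin in up lo; rewrite -(fineK Sfin) lee_fin ler_norml; lra.
Qed.

End limsup_series.

Section compact_inner.
Context {R : realType} {n : nat}.
Notation Rn := 'rV[R]_n.

(** If [ball x e] lies in [Omega], every margin below [e / 2] works at all points of
    [ball x (e / 2)]; compactness makes the margin uniform. *)
Lemma compact_sub_inner (Omega K : set Rn) : open Omega -> compact K -> K `<=` Omega ->
  exists2 d : R, 0 < d & K `<=` inner Omega d.
Proof.
move=> oO /compact_near_coveringP cK KO.
have H : \forall d \near (0 : R)^'+, K `<=` inner Omega d.
  apply: (cK _ (0 : R)^'+ (fun d x => inner Omega d x)) => x Kx.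
  have : nbhs x Omega by apply: open_nbhs_nbhs; split => //; exact: KO.
  move=> /nbhs_ballP[e /= e0 He].
  exists (ball x (e / 2), [set d | d < e / 2]).
    split; first by apply: nbhsx_ballx; rewrite divr_gt0.
    by apply: nbhs_right_lt; rewrite divr_gt0.
  move=> [y d] /= [xy de] z yz; apply: He.
  rewrite -ball_normE/= in xy yz *; rewrite -(subrKA y) (le_lt_trans (ler_normD _ _))// (splitr e) ltrD//.
  exact: lt_trans de.
near (0 : R)^'+ => d; exists d; first by near: d; exact: nbhs_right_gt.
by near: d.
Unshelve. all: by end_near.
Qed.

Lemma norm_ei (i : 'I_n) : `|ei i : Rn| = 1.
Proof.
apply/eqP; rewrite eq_le; apply/andP; split; last first.
  by have := rV_norm_coor (ei i : Rn) i; rewrite /ei mxE !eqxx normr1.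
rewrite leNgt; apply/negP => h.
have := @rV_norm_ltP R n (ei i) `|ei i : Rn| (lt_trans ltr01 h).
rewrite ltxx => /elimF/(_ erefl); apply => j; rewrite /ei mxE/=; apply: le_lt_trans h.
by case: eqP => _; rewrite ?normr1 ?normr0.
Qed.

End compact_inner.

Section partial_taylor.
Context {R : realType} {n : nat}.
Notation Rn := 'rV[R]_n.
Implicit Types (f : Rn -> R) (i : 'I_n).

Lemma is_derive_along f i (x : Rn) (t : R) : (forall y, derivable f y (ei i)) ->
  is_derive t 1 (fun t : R => f (t *: ei i + x)) ('D_(ei i) f (t *: ei i + x)).
Proof.
move=> df; have := derivableP (df (t *: ei i + x)) => /is_derive_line dr.
have -> : (fun t' : R => f (t' *: ei i + x)) =
    (fun h : R => f (h *: ei i + (t *: ei i + x))) \o (fun t' => t' - t).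
  by apply/funext => t' /=; congr f; rewrite scalerBl addrA [_ - _ + _]subrK.
have d1 : is_derive t 1 (fun t' : R => t' - t) (1 : R).
  by apply: is_derive_eq; rewrite subr0.
have := @is_derive1_comp R _ _ t _ _ _ d1; rewrite subrr => /(_ _ _ dr).
by rewrite mulr1.
Qed.

Lemma partial_mvt f i (x : Rn) (t : R) : (forall y, derivable f y (ei i)) -> 0 < t ->
  exists2 c, 0 < c < t & f (t *: ei i + x) - f x = 'D_(ei i) f (c *: ei i + x) * t.
Proof.
move=> df t0; have D c := is_derive_along x c df.
have [c /[!in_itv]/= c0 E] : exists2 c, c \in `]0, t[ & f (t *: ei i + x) - f (0 *: ei i + x) =
    'D_(ei i) f (c *: ei i + x) * (t - 0).
  apply: (@MVT R (fun t : R => f (t *: ei i + x)) (fun c => 'D_(ei i) f (c *: ei i + x))) => //.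
  by apply: derivable_within_continuous => y _; case: (D y).
by exists c => //; rewrite scale0r add0r subr0 in E.
Qed.

(** Two applications of the mean value theorem along one coordinate line, so that only derivatives
    in that direction occur. *)
Lemma partial_taylor f i (K : R) (x : Rn) (t : R) : (forall y, derivable f y (ei i)) ->
  (forall y, derivable (fun z => 'D_(ei i) f z) y (ei i)) ->
  (forall y, `|'D_(ei i) (fun z => 'D_(ei i) f z) y| <= K) -> 0 < t ->
  `|t^-1 * (f (x - t *: ei i) - f x) + 'D_(ei i) f x| <= t * K.
Proof.
move=> df ddf HK t0; set y := x - t *: ei i.
have xE : x = t *: ei i + y by rewrite /y addrC subrK.
have [c /andP[c0 ct] E] := partial_mvt y df t0.
rewrite -xE in E.
have tc : 0 < t - c by rewrite subr_gt0.
have [c' /andP[_ _] E'] := partial_mvt (c *: ei i + y) ddf tc.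
have E2 : (t - c) *: ei i + (c *: ei i + y) = x by rewrite addrA -scalerDl subrK -xE.
rewrite E2 in E'.
have -> : t^-1 * (f y - f x) + 'D_(ei i) f x = 'D_(ei i) (fun z => 'D_(ei i) f z) (c' *: ei i + (c *: ei i + y)) * (t - c).
  rewrite -E' (_ : f y - f x = - (f x - f y)); last by rewrite opprB.
  rewrite E; move: ('D_(ei i) f x) ('D_(ei i) f _) => a b; field; by rewrite gt_eqF.
have K0 : 0 <= K by apply: le_trans (HK x).
rewrite normrM mulrC (gtr0_norm tc); apply: ler_pM => //; first exact: ltW.
by rewrite gerBl ltW.
Qed.

Lemma expr_small (q e : R) : 0 < q < 1 -> 0 < e -> exists k0, forall k, (k0 <= k)%N -> q ^+ k <= e.
Proof.
move=> /andP[q0 q1] e0; have h : `|q| < 1 by rewrite gtr0_norm.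
have [k0 _ H] := cvg_expr h (nbhsx_ballx (0 : R) e e0).
exists k0 => k kk; have := H k kk; rewrite /= -ball_normE/= sub0r normrN => /ltW.
exact: le_trans (ler_norm _).
Qed.

End partial_taylor.

Section integrable_products.
Context {R : realType} {n : nat}.
Notation Rn := 'rV[R]_n.
Notation leb := (@lebesgue_rV R n).

Lemma integrable_mul_bounded (f g : Rn -> R) (K : R) : leb.-integrable setT (EFin \o f) ->
  measurable_fun setT g -> (forall x, `|g x| <= K) ->
  leb.-integrable setT (EFin \o (fun x => f x * g x)).
Proof.
move=> fi mg gK; have mf : measurable_fun setT f.
  by apply/measurable_EFinP; exact: measurable_int fi.
apply: (@le_integrable _ _ _ leb setT measurableT _ (fun x => (K%:E * (f x)%:E)%E)) => [|x _|].
- exact: (mf_EFin (mf_mul mf mg)).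
- by rewrite /= lee_fin !normrM mulrC ler_wpM2r// (le_trans (gK x))// ler_norm.
- exact: (@integrableZl _ _ _ leb setT measurableT K (EFin \o f) fi).
Qed.

Lemma norm_Rintegral_le (f : Rn -> R) (c : R) : leb.-integrable setT (EFin \o f) ->
  (\int[leb]_x `|f x|%:E <= c%:E)%E -> `|\int[leb]_x f x| <= c.
Proof.
move=> fi fc; apply: le_trans (le_normr_Rintegral _ fi) _ => //.
rewrite -lee_fin fineK//; rewrite ge0_fin_numE; first by apply: le_lt_trans fc _; rewrite ltry.
by apply: integral_ge0 => x _; rewrite lee_fin.
Qed.

Lemma integrable_shift (f : Rn -> R) (h : Rn) : leb.-integrable setT (EFin \o f) ->
  leb.-integrable setT (EFin \o (fun x => f (x + h))).
Proof.
move=> fi; have mf : measurable_fun setT f.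
  by apply/measurable_EFinP; exact: measurable_int fi.
apply/integrableP; split; first by apply: mf_EFin; mfun.
rewrite (ge0_integral_rV_shift h (f := fun x => `|(f x)%:E|%E)) => [| |x//].
  by case/integrableP : fi.
by apply/measurable_EFinP; mfun.
Qed.

Lemma integrableB_fin (f g : Rn -> R) : leb.-integrable setT (EFin \o f) ->
  leb.-integrable setT (EFin \o g) -> leb.-integrable setT (EFin \o (fun x => f x - g x)).
Proof.
move=> fi gi; rewrite (_ : _ \o _ = ((EFin \o f) \- (EFin \o g))%E); first exact: integrableB.
by apply/funext => x /=; rewrite EFinB.
Qed.

Lemma integral_supported (D : set Rn) (F : Rn -> R) : (forall x, ~ D x -> F x = 0) ->
  (\int[leb]_(x in D) (F x)%:E = \int[leb]_x (F x)%:E)%E.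
Proof.
move=> F0; rewrite integral_mkcond; apply: eq_integral => x _; rewrite patchE.
by case: ifPn => // /negP nx; rewrite F0// => Dx; apply: nx; exact/mem_set.
Qed.

End integrable_products.

(** * The gradient as the limit of dyadic difference quotients *)

Section weak_gradient.
Context {R : realType} {n : nat}.
Notation Rn := 'rV[R]_n.
Notation leb := (@lebesgue_rV R n).
Variables (Omega : set Rn) (u v : Rn -> R) (U gm : R).
Hypothesis oO : open Omega.
Hypothesis bO : bounded_set Omega.
Hypothesis mv : measurable_fun setT v.
Hypothesis mu : measurable_fun Omega u.
Hypothesis vE : forall x, Omega x -> v x = u x.
Hypothesis v0 : forall x, ~ Omega x -> v x = 0.
Hypothesis gm0 : 0 < gm.
Local Open Scope ereal_scope.
Hypothesis HU : \int[leb]_(x in Omega) `|v x|%:E <= U%:E.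
Hypothesis Hmix : forall g, (0 < g < gm)%R -> forall d : R, (0 < d)%R -> exists C rho0 : R,
  [/\ (0 <= C)%R, (0 < rho0)%R & forall e h : Rn, (0 < `|h|)%R -> (`|h| <= `|e|)%R -> (`|e| <= rho0)%R ->
     int2 Omega v d e h <= (C * `|e| `^ g * `|h|)%:E].

Let mO : measurable Omega. Proof. exact: rV_open_measurable. Qed.
Let U0 : (0 <= U)%R.
Proof. by rewrite -lee_fin; apply: le_trans HU; apply: integral_ge0 => x _; rewrite lee_fin. Qed.

Let hk (i : 'I_n) (k : nat) : Rn := (2 ^- k *: ei i)%R.
Let hkn i k : `|hk i k|%R = (2 ^- k)%R.
Proof. by rewrite normrZ norm_ei mulr1 ger0_norm// invr_ge0 exprn_ge0. Qed.
Let hkS i k : (hk i k.+1 + hk i k.+1 = hk i k)%R.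
Proof. by rewrite /hk -scalerDl exprS invfM -mulrDl -[(2^-1)%R]div1r -splitr mul1r. Qed.

Definition dquot (i : 'I_n) (k : nat) (x : Rn) : R := (2 ^+ k * (v (x + (2 ^- k *: ei i)) - v x))%R.

(* The limsup of dyadic quotients needs no choice on a null set; [fine] sends an
   infinite limsup to 0. *)
Definition grad (x : Rn) : Rn := (\row_i fine (limn_esup (fun k => (dquot i k x)%:E)))%R.

Let gi (i : 'I_n) (x : Rn) : R := fine (limn_esup (fun k => (dquot i k x)%:E)).
Let gradE i x : grad x ord0 i = gi i x. Proof. by rewrite mxE. Qed.

Let mdq i k : measurable_fun setT (dquot i k). Proof. by rewrite /dquot; mfun. Qed.
Let mgi i : measurable_fun setT (gi i).
Proof.
apply: (measurableT_comp (f := @fine R)); first exact: fine_measurable.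
by apply: measurable_fun_limn_esup => k; apply: mf_EFin; exact: mdq.
Qed.

(** Doubling the step is again the identity [2 * tau_h = tau_(2h) - tau_h tau_h]: successive dyadic
    quotients differ by a rescaled second difference. *)
Let dq_step i k x : (`|dquot i k.+1 x - dquot i k x| = 2 ^+ k * `|diff2 v (hk i k.+1) (hk i k.+1) x|)%R.
Proof.
rewrite -(ger0_norm (exprn_ge0 k (ler0n R 2))) -normrM -normrN; congr (`|_|)%R.
rewrite /dquot -/(hk i k) -/(hk i k.+1) -(hkS i k) /diff2 addrA exprS; ring.
Qed.

(** With both steps equal to [2^-(m+1)], the mixed bound makes the increments [O(2^(-g*m))] in L^1.
    Summing them from [k] on bounds the distance of the quotient to its limsup. *)
Let dquot_grad_le (g d : R) : (0 < g < gm)%R -> (0 < d)%R -> exists C k0, (0 <= C)%R /\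
  forall i k, (k0 <= k)%N ->
  \int[leb]_(x in inner Omega d) `|dquot i k x - gi i x|%:E <= (C * (2 `^ (- g)) ^+ k)%:E.
Proof.
move=> g0 d0; have [C [rho0 [C0 r0 HC]]] := Hmix g0 d0; have /andP[gp _] := g0.
have q01 := powR2_lt1 gp; set q := (2 `^ (- g))%R in q01 *; have /andP[q0 q1] := q01.
have [k0 Hk0] : exists k0, forall k, (k0 <= k)%N -> (2 ^- k <= rho0)%R.
  exists (Num.truncn rho0^-1).+1 => k kk.
  have r1 : (0 <= rho0^-1)%R by rewrite invr_ge0 ltW.
  have /andP[_ h] := truncn_itv r1.
  rewrite -[leRHS]invrK lef_pV2 ?posrE ?exprn_gt0 ?invr_gt0//; apply: le_trans (ltW h) _.
  apply: (@le_trans _ _ k%:R); first by rewrite ler_nat.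
  by rewrite -natrX ler_nat ltnW// ltn_expl.
exists (C / (1 - q))%R, k0; split; first by rewrite divr_ge0// subr_ge0 ltW.
move=> i k kk.
have mI : measurable (inner Omega d) by exact: inner_measurable.
have mj j : measurable_fun (inner Omega d) (fun x => `|dquot i (k + j).+1 x - dquot i (k + j)%N x|%:E).
  by have m1 := mdq i (k + j).+1; have m2 := mdq i (k + j)%N; apply: measurable_funTS; mfun.
apply: (@le_trans _ _ (\int[leb]_(x in inner Omega d) \sum_(j <oo) `|dquot i (k + j).+1 x - dquot i (k + j)%N x|%:E)).
  apply: le_integral_ge0 => [//|x _|x _|x _].
  - by rewrite lee_fin.
  - by apply: nneseries_ge0 => j _ _; rewrite lee_fin.
  - exact: (limsup_series_le (fun k => dquot i k x) k).
rewrite integral_nneseries//.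
have B j : \int[leb]_(x in inner Omega d) `|dquot i (k + j).+1 x - dquot i (k + j)%N x|%:E <= (C * q ^+ k * q ^+ j)%:E.
  set m := (k + j)%N; under eq_integral do rewrite dq_step EFinM.
  have md := measurable_diff2 (hk i m.+1) (hk i m.+1) mv.
  rewrite ge0_integralZl_EFin; [|exact: mI|by move=> x _; rewrite lee_fin|by apply: measurable_funTS; mfun|exact: exprn_ge0].
  have hp : (0 < `|hk i m.+1|)%R by rewrite hkn invr_gt0 exprn_gt0.
  apply: le_trans (lee_wpmul2l _ (HC _ _ hp (lexx _) _)) _; first by rewrite lee_fin exprn_ge0.
    by rewrite hkn; apply: Hk0; rewrite leqW// (leq_trans kk)// leq_addr.
  rewrite -EFinM lee_fin hkn.
  have -> : (2 ^+ m * (C * (2 ^- m.+1) `^ g * 2 ^- m.+1) = C * (2 ^- m.+1) `^ g / 2)%R.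
    rewrite exprS invfM; set z := (2 ^- m)%R; rewrite (_ : (2 ^+ m = z^-1)%R); last by rewrite invrK.
    have z0 : z != 0%R by rewrite invr_eq0 expf_eq0 pnatr_eq0 andbF.
    set y := (_ `^ g)%R; field; by rewrite z0.
  have -> : ((2 ^- m.+1) `^ g = q ^+ m.+1)%R.
    by rewrite -exprVn powR_exprn ?invr_ge0// /q powRN -powR_inv1// -powRrM mulN1r powRN.
  rewrite -!mulrA -exprD -/m; apply: ler_wpM2l => //.
  rewrite ler_pdivrMr// exprS.
  have qm : (0 <= q ^+ m)%R by rewrite exprn_ge0// ltW.
  by nra.
apply: (@le_trans _ _ (\sum_(j <oo) (C * q ^+ k * q ^+ j)%:E)).
  by apply: lee_nneseries => [j _ _|j _]; [apply: integral_ge0 => x _; rewrite lee_fin|exact: B].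
have A0 : (0 <= C * q ^+ k)%R by rewrite mulr_ge0// exprn_ge0// ltW.
apply: (le_trans (@nneseries_geometric_le R (C * q ^+ k)%R q _ A0 q01 _)).
  by move=> j; rewrite lexx mulr_ge0// exprn_ge0// ltW.
by rewrite lee_fin mulrAC.
Qed.

Let half01 : (0 < (2^-1 : R) < 1)%R. Proof. by rewrite invr_gt0 ltr0n invf_lt1 ?ltr1n. Qed.

Let mabs i k : measurable_fun setT (fun x => `|dquot i k x - gi i x|%:E).
Proof. by have m1 := mdq i k; have m2 := mgi i; mfun. Qed.

Let gi_integrable i (d : R) : (0 < d)%R -> \int[leb]_(x in inner Omega d) `|gi i x|%:E < +oo.
Proof.
move=> d0; have g0 : (0 < gm / 2 < gm)%R by rewrite divr_gt0//= ltr_pdivrMr// ltr_pMr// ltr1n.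
have [C [k0 [C0 HC]]] := dquot_grad_le g0 d0.
have d20 : (0 < d / 2)%R by rewrite divr_gt0.
have [k1 Hk1] := expr_small half01 d20.
pose k := maxn k0 k1; have H1 := HC i k (leq_maxl _ _); have H2 := Hk1 k (leq_maxr _ _).
have hd : (`|hk i k| < d)%R.
  by rewrite hkn -exprVn (le_lt_trans H2)// ltr_pdivrMr// ltr_pMr// ltr1n.
have m1 := mdq i k; have m2 := mgi i.
have mI : measurable (inner Omega d) by exact: inner_measurable.
apply: (@le_lt_trans _ _ (\int[leb]_(x in inner Omega d) (`|dquot i k x|%:E + `|dquot i k x - gi i x|%:E))).
  apply: le_integral_ge0 => [//|x _|x _|x _]; rewrite -?EFinD ?lee_fin ?addr_ge0//.
  by rewrite -{1}(subKr (dquot i k x) (gi i x)) ler_normB.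
rewrite ge0_integralD; [|exact: mI|by move=> x _; rewrite lee_fin|by apply: measurable_funTS; mfun|
  by move=> x _; rewrite lee_fin|exact: measurable_funTS (mabs i k)].
apply: lte_add_pinfty; last by apply: le_lt_trans H1 _; rewrite ltry.
have mdd : measurable_fun setT (fun x : Rn => v (x + hk i k) - v x)%R by mfun.
rewrite (_ : (fun x : Rn => _) = (fun x : Rn => (2 ^+ k)%:E * `|v (x + hk i k) - v x|%:E)); last first.
  by apply/funext => x; rewrite /dquot normrM ger0_norm ?exprn_ge0.
rewrite ge0_integralZl_EFin; [|exact: mI|by move=> x _; rewrite lee_fin|by apply: measurable_funTS; mfun|exact: exprn_ge0].
apply: lte_mul_pinfty; rewrite ?lee_fin ?exprn_ge0//.
by apply: le_lt_trans (int1_le mv HU hd) _; rewrite ltry.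
Qed.

(** For given [e] the gradient is replaced by a quotient so fine that the error is at most [|e|^g].
    The shift of that quotient is [2^k] times a mixed second difference, and the factor [2^-k] in
    the mixed bound makes its size independent of [k]. *)
Let gi_shift (g d : R) : (0 < g < gm)%R -> (0 < d)%R -> exists C rho0 : R,
  [/\ (0 <= C)%R, (0 < rho0)%R & forall i (e : Rn), (0 < `|e| <= rho0)%R ->
    \int[leb]_(x in inner Omega d) `|gi i (x + e) - gi i x|%:E <= (C * `|e| `^ g)%:E].
Proof.
move=> g0 d0; have [C [rho1 [C0 r0 HC]]] := Hmix g0 d0.
have d20 : (0 < d / 2)%R by rewrite divr_gt0.
have [C2 [k2 [C20 HC2]]] := dquot_grad_le g0 d20.
have /andP[gp _] := g0; have q01 := powR2_lt1 gp.
exists (C + 1)%R, (Num.min rho1 (d / 2))%R; split; [by rewrite addr_ge0|by rewrite lt_min r0|].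
move=> i e /andP[e0]; rewrite le_min => /andP[er ed].
have eg : (0 < `|e| `^ g / (2 * C2 + 1))%R by rewrite divr_gt0 ?powR_gt0// ltr_wpDl// mulr_ge0.
have [k1 Hk1] := expr_small half01 e0; have [k3 Hk3] := expr_small q01 eg.
pose k := maxn k2 (maxn k1 k3).
have H2 := HC2 i k (leq_maxl _ _).
have H1 : (2 ^- k <= `|e|)%R by rewrite -exprVn; apply: Hk1; rewrite /k leq_max leq_max leqnn orbT.
have H3 : (2 * (C2 * (2 `^ (- g)) ^+ k) <= `|e| `^ g)%R.
  have := Hk3 k; rewrite /k !leq_max leqnn !orbT => /(_ isT).
  rewrite -/k ler_pdivlMr; last by rewrite ltr_wpDl// mulr_ge0.
  have : (0 <= (2 `^ (- g)) ^+ k :> R)%R by rewrite exprn_ge0// powR_ge0.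
  move: ((2 `^ (- g)) ^+ k)%R => y y0; nra.
have m1 := mdq i k; have m2 := mgi i.
have mI : measurable (inner Omega d) by exact: inner_measurable.
have mF : measurable_fun setT (fun x => dquot i k x - gi i x)%R by mfun.
apply: (@le_trans _ _ (\int[leb]_(x in inner Omega d) (`|dquot i k (x + e) - dquot i k x|%:E +
    `|(dquot i k (x + e) - gi i (x + e)) - (dquot i k x - gi i x)|%:E))).
  apply: le_integral_ge0 => [//|x _|x _|x _]; rewrite -?EFinD ?lee_fin ?addr_ge0//.
  apply: le_trans (ler_normB _ _); rewrite le_eqVlt; apply/orP; left; apply/eqP; congr (`|_|)%R; ring.
rewrite ge0_integralD; [|exact: mI|by move=> x _; rewrite lee_fin|by apply: measurable_funTS; mfun|
  by move=> x _; rewrite lee_fin|by apply: measurable_funTS; mfun].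
rewrite mulrDl mul1r EFinD; apply: leeD.
  have md := measurable_diff2 e (hk i k) mv.
  have -> : \int[leb]_(x in inner Omega d) `|dquot i k (x + e) - dquot i k x|%:E = (2 ^+ k)%:E * int2 Omega v d e (hk i k).
    rewrite -ge0_integralZl_EFin; [|exact: mI|by move=> x _; rewrite lee_fin|by apply: measurable_funTS; mfun|exact: exprn_ge0].
    apply: eq_integral => x _; rewrite -EFinM; congr (_%:E).
    by rewrite /dquot -mulrBr normrM ger0_norm ?exprn_ge0.
  have hp : (0 < `|hk i k|)%R by rewrite hkn invr_gt0 exprn_gt0.
  apply: le_trans (lee_wpmul2l _ (HC _ _ hp _ er)) _; [by rewrite lee_fin exprn_ge0|by rewrite hkn|].
  rewrite -EFinM lee_fin hkn mulrCA mulfV ?mulr1// expf_eq0 pnatr_eq0 andbF//.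
apply: le_trans (@integral_diff_le R n Omega _ d (d / 2)%R e mF _) _.
  by rewrite [leRHS]splitr lerD2r.
by apply: le_trans (lee_wpmul2l _ H2) _; rewrite ?lee_fin// -EFinM lee_fin.
Qed.

Lemma measurable_grad i : measurable_fun setT (fun x => grad x ord0 i).
Proof. by rewrite (_ : (fun x => _) = gi i)//; apply/funext => x; rewrite gradE. Qed.

Lemma grad_integrable i (d : R) : (0 < d)%R ->
  leb.-integrable (inner Omega d) (EFin \o (fun x => grad x ord0 i)).
Proof.
move=> d0; apply/integrableP; split; first by apply: measurable_funTS; apply: mf_EFin; exact: measurable_grad.
by under eq_integral do rewrite /= gradE; exact: gi_integrable.
Qed.

Lemma grad_shift (g d : R) : (0 < g < gm)%R -> (0 < d)%R -> exists C rho0 : R,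
  [/\ (0 <= C)%R, (0 < rho0)%R & forall i (e : Rn), (0 < `|e| <= rho0)%R ->
    \int[leb]_(x in inner Omega d) `|grad x ord0 i - grad (x + e) ord0 i|%:E <= (C * `|e| `^ g)%:E].
Proof.
move=> g0 d0; have [C [rho0 [C0 r0 H]]] := gi_shift g0 d0; exists C, rho0; split => // i e e0.
by apply: le_trans (H i e e0); under eq_integral do rewrite !gradE distrC.
Qed.

(** Discrete integration by parts moves the quotient from [v] to [psi]. The two errors are
    [O(2^-k)], by Taylor's formula for [psi], and [O(q^k)], by the L^1 convergence of the quotients.
    As [v] vanishes outside [Omega] and [psi] outside an inner set, all integrals can be taken over
    R^n. *)
Lemma grad_weak : weak_gradient Omega u grad.
Proof.
split.
  split => // K cK KO.
  apply: (@le_lt_trans _ _ (\int[leb]_(x in Omega) `|v x|%:E)); last by rewrite (le_lt_trans HU)// ltry.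
  apply: (@le_trans _ _ (\int[leb]_(x in K) `|v x|%:E)).
    by rewrite le_eqVlt; apply/orP; left; apply/eqP; apply: eq_integral => x /set_mem Kx; rewrite vE//; exact: KO.
  by apply: le_integral_ge0 => // x _; rewrite lee_fin.
move=> i; split.
  split; first by rewrite (_ : (fun x => _) = gi i); [exact: measurable_funTS|apply/funext => x; rewrite gradE].
  move=> K cK KO; have [d d0 Kd] := compact_sub_inner oO cK KO.
  under eq_integral do rewrite gradE.
  by apply: le_lt_trans (gi_integrable i d0); apply: le_integral_ge0 => // x _; rewrite lee_fin.
move=> psi Cpsi; have [sp cp pO] := Cpsi.
have [d d0 pd] := compact_sub_inner oO cp pO.
have [S S0 pS] := bounded_set_ball (compact_bounded cp).
have p0 x : (S < `|x|)%R -> psi x = 0%R.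
  move=> Sx; apply: contrapT => /eqP nz.
  have : ball (0%R : Rn) S x by apply: pS; exact: subset_closure.
  by rewrite -ball_normE/= sub0r normrN ltNge ltW.
have [c0 D0] := sp [::]; have [c1 D1] := sp [:: i]; have [c2 D2] := sp [:: i; i].
have [K1 HK1] := supp_bounded c0 p0.
have [K3 HK3] := supp_bounded c1 (deriv_supp i p0).
have [K2 HK2] := supp_bounded c2 (deriv_supp i (deriv_supp i p0)).
rewrite /iter_partial/= in c0 c1 c2 D0 D1 D2 HK1 HK2 HK3.
have mp := rV_continuous_measurable c0; have mDp := rV_continuous_measurable c1.
have K10 : (0 <= K1)%R by apply: le_trans (HK1 0%R).
have K20 : (0 <= K2)%R by apply: le_trans (HK2 0%R).
have pin x : ~ inner Omega d x -> psi x = 0%R.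
  by move=> nx; apply: contrapT => /eqP nz; apply: nx; apply: pd; exact: subset_closure.
have mI : measurable (inner Omega d) by exact: inner_measurable.
have IO := inner_sub (Omega := Omega) d0.
have vT : \int[leb]_x `|v x|%:E <= U%:E.
  by rewrite -(@integral_supported R n Omega)// => x nx; rewrite v0 ?normr0.
have vi : leb.-integrable setT (EFin \o v).
  apply/integrableP; split; first by apply: mf_EFin.
  by apply: le_lt_trans vT _; rewrite ltry.
have m2 := mgi i.
have bound_psi (F : Rn -> R) : measurable_fun setT F ->
    \int[leb]_x `|F x * psi x|%:E <= K1%:E * \int[leb]_(x in inner Omega d) `|F x|%:E.
  move=> mF; rewrite -(@integral_supported R n (inner Omega d)); last by move=> x nx; rewrite pin ?mulr0 ?normr0.
  rewrite -ge0_integralZl_EFin//; last by apply: measurable_funTS; mfun.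
  apply: le_integral_ge0 => // x _; rewrite -?EFinM lee_fin ?mulr_ge0//.
  by rewrite normrM mulrC ler_wpM2r.
have gpi : leb.-integrable setT (EFin \o (fun x => gi i x * psi x)%R).
  apply/integrableP; split; first by apply: mf_EFin; mfun.
  apply: le_lt_trans (bound_psi _ m2) _.
  by apply: lte_mul_pinfty; rewrite ?lee_fin//; exact: gi_integrable.
have vDi : leb.-integrable setT (EFin \o (fun x => v x * 'D_(ei i) psi x)%R).
  exact: integrable_mul_bounded HK3.
have [C [k0 [C0 HC]]] : exists C k0, (0 <= C)%R /\ forall i k, (k0 <= k)%N ->
    \int[leb]_(x in inner Omega d) `|dquot i k x - gi i x|%:E <= (C * (2 `^ (- (gm / 2))) ^+ k)%:E.
  by apply: dquot_grad_le => //; rewrite divr_gt0//= ltr_pdivrMr// ltr_pMr// ltr1n.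
have q01 : (0 < (2 : R) `^ (- (gm / 2)) < 1)%R by apply: powR2_lt1; rewrite divr_gt0.
set q := (_ `^ _)%R in HC q01.
set RA := (\int[leb]_x (v x * 'D_(ei i) psi x))%R.
set RB := (\int[leb]_x (gi i x * psi x))%R.
suff E : RA = (- RB)%R.
  have -> : \int[leb]_(x in Omega) (u x * 'D_(ei i) psi x)%:E = RA%:E.
    rewrite /RA /Rintegral fineK; last exact: integrable_fin_num vDi.
    rewrite -(@integral_supported R n Omega); last by move=> x nx; rewrite v0 ?mul0r.
    by apply: eq_integral => x /set_mem Ox; rewrite vE.
  have -> : \int[leb]_(x in Omega) (grad x ord0 i * psi x)%:E = RB%:E.
    rewrite /RB /Rintegral fineK; last exact: integrable_fin_num gpi.
    rewrite -(@integral_supported R n Omega); last by move=> x nx; rewrite pin ?mulr0// => /IO.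
    by apply: eq_integral => x _; rewrite gradE.
  by rewrite E EFinN.
have step k : (k0 <= k)%N -> (`|RA + RB| <= K2 * 2 ^- k * U + K1 * (C * q ^+ k))%R.
  move=> kk; have m1 := mdq i k.
  pose RBk := (\int[leb]_x (dquot i k x * psi x))%R.
  have psh : measurable_fun setT (fun x : Rn => psi (x - hk i k)%R) by mfun.
  have vsi := integrable_shift (hk i k) vi.
  have i1 : leb.-integrable setT (EFin \o (fun x => v (x + hk i k) * psi x)%R).
    exact: (integrable_mul_bounded vsi mp HK1).
  have i2 : leb.-integrable setT (EFin \o (fun x => v x * psi x)%R).
    exact: (integrable_mul_bounded vi mp HK1).
  have i3 : leb.-integrable setT (EFin \o (fun x => v x * psi (x - hk i k))%R).
    exact: (integrable_mul_bounded vi psh (fun x => HK1 _)).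
  have idq : leb.-integrable setT (EFin \o (fun x => dquot i k x * psi x)%R).
    rewrite (_ : _ \o _ = (fun x => (2 ^+ k)%:E * ((v (x + hk i k) * psi x)%:E - (v x * psi x)%:E))).
      by apply: integrableZl => //; exact: integrableB.
    by apply/funext => x /=; rewrite -EFinB -EFinM /dquot -mulrA mulrBl.
  (* The backward quotient of [psi], which tends to minus its derivative. *)
  pose pk (x : Rn) := (2 ^+ k * (psi (x - hk i k) - psi x))%R.
  have E1 : RBk = (\int[leb]_x (v x * pk x))%R.
    rewrite /RBk.
    transitivity (2 ^+ k * (\int[leb]_x (v (x + hk i k) * psi x) - \int[leb]_x (v x * psi x)))%R.
      rewrite -RintegralB// -RintegralZl//; last exact: integrableB_fin.
      by apply: eq_Rintegral => x _; rewrite /dquot -mulrA mulrBl.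
    rewrite (_ : \int[leb]_x (v (x + hk i k) * psi x) = \int[leb]_x (v x * psi (x - hk i k)))%R; last first.
      rewrite /Rintegral -[in RHS](integral_rV_shift (hk i k)); last by apply: mf_EFin; mfun.
      by congr fine; apply: eq_integral => x _; rewrite addrK.
    rewrite -RintegralB// -RintegralZl//; last exact: integrableB_fin.
    by apply: eq_Rintegral => x _; rewrite /pk mulrBr mulrA mulrCA; ring.
  have mpk : measurable_fun setT pk by rewrite /pk; mfun.
  have pkD x : (`|'D_(ei i) psi x + pk x| <= 2 ^- k * K2)%R.
    rewrite addrC; have := @partial_taylor R n psi i K2 x (2 ^- k)%R (D0 i) (D1 i) HK2.
    by rewrite invrK; apply; rewrite invr_gt0 exprn_gt0.
  have mpD : measurable_fun setT (fun x => 'D_(ei i) psi x + pk x)%R by mfun.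
  have ipk : leb.-integrable setT (EFin \o (fun x => v x * ('D_(ei i) psi x + pk x))%R).
    exact: (integrable_mul_bounded vi mpD pkD).
  have E2 : (RA + RBk = \int[leb]_x (v x * ('D_(ei i) psi x + pk x)))%R.
    rewrite E1 /RA -RintegralD//.
      by apply: eq_Rintegral => x _; rewrite mulrDr.
    rewrite (_ : _ \o _ = (fun x => (v x * ('D_(ei i) psi x + pk x))%:E - (v x * 'D_(ei i) psi x)%:E)); first exact: integrableB.
    by apply/funext => x /=; rewrite -EFinB mulrDr addrC addKr.
  have E3 : (RB - RBk = \int[leb]_x ((gi i x - dquot i k x) * psi x))%R.
    by rewrite /RB /RBk -RintegralB//; apply: eq_Rintegral => x _; rewrite mulrBl.
  have -> : (RA + RB = (RA + RBk) + (RB - RBk))%R by ring.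
  apply: le_trans (ler_normD _ _) _; apply: lerD.
    rewrite E2; apply: norm_Rintegral_le => //.
    rewrite (_ : K2 * _ * U = 2 ^- k * K2 * U)%R; last by ring.
    rewrite EFinM; apply: le_trans (lee_wpmul2l _ vT); last by rewrite lee_fin mulr_ge0// invr_ge0 exprn_ge0.
    rewrite -ge0_integralZl_EFin//; [|by mfun|by rewrite mulr_ge0// invr_ge0 exprn_ge0].
    by apply: le_integral_ge0 => // x _; rewrite -?EFinM lee_fin ?mulr_ge0 ?invr_ge0 ?exprn_ge0// normrM mulrC ler_wpM2r.
  rewrite E3; apply: norm_Rintegral_le.
    rewrite (_ : _ \o _ = (fun x => (gi i x * psi x)%:E - (dquot i k x * psi x)%:E)); first exact: integrableB.
    by apply/funext => x /=; rewrite -EFinB mulrBl.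
  have mgd : measurable_fun setT (fun x : Rn => gi i x - dquot i k x)%R by mfun.
  apply: le_trans (bound_psi _ mgd) _; rewrite EFinM; apply: lee_wpmul2l; first by rewrite lee_fin.
  by under eq_integral do rewrite distrC; exact: HC.
apply/eqP; rewrite -addr_eq0 -normr_le0; apply/ler_addgt0Pl => e e0; rewrite addr0.
pose M := (K2 * U + K1 * C + 1)%R.
have M0 : (0 < M)%R by rewrite ltr_wpDl// addr_ge0// mulr_ge0.
have eM : (0 < e / M)%R by rewrite divr_gt0.
have [k1 Hk1] := expr_small half01 eM; have [k2 Hk2] := expr_small q01 eM.
pose k := maxn k0 (maxn k1 k2).
have h1 : (2 ^- k <= e / M)%R by rewrite -exprVn; apply: Hk1; rewrite /k !leq_max leqnn orbT.
have h2 : (q ^+ k <= e / M)%R by apply: Hk2; rewrite /k !leq_max leqnn !orbT.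
apply: le_trans (step k (leq_maxl _ _)) _.
apply: (@le_trans _ _ (K2 * (e / M) * U + K1 * (C * (e / M))))%R.
  by apply: lerD; [rewrite ler_wpM2r// ler_wpM2l|rewrite ler_wpM2l// ler_wpM2l].
have -> : (K2 * (e / M) * U + K1 * (C * (e / M)) = (M - 1) * (e / M))%R by rewrite /M; ring.
by rewrite mulrA ler_pdivrMr// mulrC; apply: ler_wpM2l; [exact: ltW|rewrite gerBl].
Qed.

End weak_gradient.

(** * Hausdorff premeasures and null sets *)

Section hausdorff_nullsets.
Context {R : realType} {n : nat}.
Notation Rn := 'rV[R]_n.
Local Open Scope ereal_scope.
Implicit Types (A U : set Rn) (d delta : R).

Lemma diam_pow_ge0 d U : 0 <= diam_pow d U.
Proof. by rewrite /diam_pow; case: ifP => // _; exact: poweR_ge0. Qed.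

Lemma diam_pow_le d U (c : R) : (0 <= d)%R -> (0 <= c)%R -> diam U <= c%:E ->
  diam_pow d U <= (c `^ d)%:E.
Proof.
move=> d0 c0 Uc; rewrite /diam_pow; case: ifPn => [_|/set0P[x Ux]]; first by rewrite lee_fin powR_ge0.
have D0 : 0 <= diam U.
  by apply: ereal_sup_ubound; exists x => //; exists x => //; rewrite subrr enorm0.
have Df : diam U \is a fin_num by rewrite ge0_fin_numE// (le_lt_trans Uc)// ltry.
rewrite -(fineK Df) poweR_EFin lee_fin; apply: ge0_ler_powR => //; rewrite ?nnegrE//.
  by rewrite -lee_fin fineK.
by rewrite -lee_fin fineK.
Qed.

Lemma hausdorff_premeasure_ge0 d delta A : 0 <= hausdorff_premeasure d delta A.
Proof.
by apply: le_ereal_inf_tmp => _ [U _ <-]; apply: nneseries_ge0 => i _ _; exact: diam_pow_ge0.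
Qed.

Lemma hausdorff_premeasure_le d delta A (U : nat -> set Rn) : A `<=` \bigcup_i U i ->
  (forall i, diam (U i) <= delta%:E) ->
  hausdorff_premeasure d delta A <= \sum_(i <oo) diam_pow d (U i).
Proof. by move=> AU Ud; apply: ereal_inf_lbound; exists U. Qed.

(** The strict inequalities provide a cover of each piece with sum at most [b m]; a bijection
    between [nat] and pairs merges these covers into one sequence. *)
Lemma hausdorff_premeasure_bigcup d delta A (B : nat -> set Rn) (b : nat -> \bar R) :
  A `<=` \bigcup_m B m -> (forall m, hausdorff_premeasure d delta (B m) < b m) ->
  hausdorff_premeasure d delta A <= \sum_(m <oo) b m.
Proof.
move=> AB Hb.
have H m : exists V : nat -> set Rn, [/\ B m `<=` \bigcup_i V i,
    forall i, diam (V i) <= delta%:E & \sum_(i <oo) diam_pow d (V i) <= b m].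
  have [_ [V [BV Vd] <-] Vb] := ereal_inf_lt (Hb m).
  by exists V; split => //; exact: ltW.
have {H}[V HV] := choice H.
have /card_esym/card_set_bijP[f fb] := card_nat2.
have f2 (m i : nat) : exists k, f k = (m, i).
  by have [_ _ /(_ (m, i) I)[k _ <-]] := fb; exists k.
apply: (@le_trans _ _ (\sum_(k <oo) diam_pow d (V (f k).1 (f k).2))).
  apply: hausdorff_premeasure_le => [x Ax|k]; last by have [_ ->] := HV (f k).1.
  have [m _ Bx] := AB x Ax; have [/(_ x Bx)[i _ Vx] _ _] := HV m.
  by have [k fk] := f2 m i; exists k => //; rewrite fk.
rewrite nneseries_esumT; last by move=> k; exact: diam_pow_ge0.
rewrite -(@reindex_esum R nat (nat * nat)%type setT setT f (fun z => diam_pow d (V z.1 z.2)) fb).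
have -> : [set: nat * nat] = [set: nat] `*`` (fun=> [set: nat]) by apply/seteqP; split.
rewrite -(@esum_esum R nat nat setT (fun=> setT) (fun m i => diam_pow d (V m i))); last first.
  by move=> *; exact: diam_pow_ge0.
rewrite -nneseries_esumT; last by move=> m; apply: esum_ge0 => *; exact: diam_pow_ge0.
apply: lee_nneseries => [m _ _|m _]; first by apply: esum_ge0 => *; exact: diam_pow_ge0.
rewrite -nneseries_esumT; last by move=> i; exact: diam_pow_ge0.
by have [] := HV m.
Qed.

Lemma hausdorff_measure0 d A : (forall delta : R, (0 < delta)%R -> forall e : R, (0 < e)%R ->
    hausdorff_premeasure d delta A <= e%:E) -> hausdorff_measure d A = 0.
Proof.
move=> H; apply/eqP; rewrite eq_le; apply/andP; split; last first.
  apply: le_trans (hausdorff_premeasure_ge0 d 1 A) _.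
  by apply: ereal_sup_ubound; exists 1%R => //=.
apply: ge_ereal_sup => _ [delta delta0 <-]; apply/lee_addgt0Pr => e e0; rewrite add0e; exact: H.
Qed.

Lemma hausdorff_measure_bigcup0 d A (B : nat -> set Rn) : A `<=` \bigcup_m B m ->
  (forall m, hausdorff_measure d (B m) = 0) -> hausdorff_measure d A = 0.
Proof.
move=> AB B0; apply: hausdorff_measure0 => delta delta0 e e0.
have h01 : (0 < (2^-1 : R) < 1)%R by rewrite invr_gt0 ltr0n invf_lt1 ?ltr1n.
apply: le_trans (hausdorff_premeasure_bigcup (b := fun m => (e / 2 * 2^-1 ^+ m)%:E) AB _) _.
  move=> m; apply: (@le_lt_trans _ _ 0).
    by rewrite -(B0 m); apply: ereal_sup_ubound; exists delta.
  by rewrite lte_fin mulr_gt0 ?divr_gt0// exprn_gt0// invr_gt0.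
apply: le_trans (@nneseries_geometric_le R (e / 2)%R (2^-1)%R _ _ h01 _) _.
- by rewrite divr_ge0// ltW.
- by move=> i; rewrite lexx andbT mulr_ge0 ?divr_ge0 ?exprn_ge0 ?invr_ge0// ltW.
- rewrite lee_fin (_ : 1 - 2^-1 = 2^-1)%R; last by rewrite [X in (X - _)%R](splitr 1) div1r addrK.
  by rewrite invrK mulrAC -mulrA mulfV// mulr1.
Qed.

Lemma hausdorff_dim_le A (c : R) : (0 <= c)%R ->
  (forall d, (c < d)%R -> hausdorff_measure d A = 0) -> hausdorff_dim A <= c%:E.
Proof.
move=> c0 H; apply/lee_addgt0Pr => e e0; rewrite -EFinD; apply: ereal_inf_lbound.
exists (c + e)%R => //; split; first by rewrite addr_ge0// ltW.
by apply: H; rewrite ltrDl.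
Qed.

End hausdorff_nullsets.

(** * The grid of half-open cubes of mesh [rho] *)

Section grid.
Context {R : realType} {n : nat}.
Notation Rn := 'rV[R]_n.
Notation leb := (@lebesgue_rV R n).
Variable rho : R.
Hypothesis rho0 : 0 < rho.

Definition cell (x : Rn) : 'rV[int]_n := \row_j Num.floor (x ord0 j / rho).

(** Covers are sequences, so the cells are numbered through [pickle]; a number that codes no cell
    gives the empty set. *)
Definition cube (k : nat) : set Rn := [set x | pickle (cell x) = k].

Lemma trivIset_cube : trivIset setT cube.
Proof. by apply/trivIsetP => i j _ _ /eqP ij; apply/seteqP; split => // x [/= xi xj]; apply: ij; rewrite -xi -xj. Qed.

Lemma cubeP k x : cube k x -> cube k = [set y | forall j, Num.floor (y ord0 j / rho) = Num.floor (x ord0 j / rho)].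
Proof.
move=> kx; apply/seteqP; split => y.
  rewrite /cube/= -kx => /(pcan_inj pickleK) /rowP E j; by have := E j; rewrite !mxE.
by move=> E; rewrite /cube/= -kx; congr pickle; apply/rowP => j; rewrite !mxE E.
Qed.

Let floorP (a : R) (m : int) : (Num.floor (a / rho) = m) <-> (m%:~R * rho <= a < (m + 1)%:~R * rho).
Proof.
rewrite -ler_pdivlMr// -ltr_pdivrMr//; split => [<-|]; [exact: floor_itv|exact: floor_def].
Qed.

Lemma cube_dist k (x y : Rn) : cube k x -> cube k y -> `|x - y| < rho.
Proof.
move=> kx; rewrite (cubeP kx) => E; apply/rV_norm_ltP => // j; rewrite !mxE.
have /floorP/andP[a b] := E j; have /floorP/andP[c d] := erefl (Num.floor (x ord0 j / rho)).
rewrite intrD mulrDl mul1r in b d; rewrite ltr_norml; lra.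
Qed.

Lemma cube_measurable k : measurable (cube k).
Proof.
have [[x kx]|/set0P/negP/negPn/eqP->//] := pselect (cube k !=set0).
have -> : cube k = \bigcap_(j in [set: 'I_n]) ((fun y : Rn => y ord0 j) @^-1`
      `[(Num.floor (x ord0 j / rho))%:~R * rho, (Num.floor (x ord0 j / rho) + 1)%:~R * rho[%classic).
  rewrite (cubeP kx); apply/seteqP; split => y /= h j; first by move=> _; rewrite /= in_itv/=; exact/floorP.
  by have := h j I; rewrite /= in_itv/= => /floorP.
apply: fin_bigcap_measurable => // j _; rewrite -[X in measurable X]setTI.
by apply: (@measurable_coor R n j) => //; exact: measurable_itv.
Qed.

(** A nonempty cell contains the ball of radius [rho / 2] about its centre, which is an open cube of
    side [rho]. *)
Lemma cube_lebesgue k x : cube k x -> ((rho ^+ n)%:E <= leb (cube k))%E.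
Proof.
move=> kx; pose c : Rn := \row_j (((Num.floor (x ord0 j / rho))%:~R + 2^-1) * rho).
have r2 : 0 < rho / 2 by rewrite divr_gt0.
have -> : rho = 2 * (rho / 2) by rewrite mulrC divfK.
rewrite -(lebesgue_rV_ball c r2); apply: le_measure; rewrite ?inE.
- exact: measurable_rV_ball.
- exact: cube_measurable.
rewrite (cubeP kx) => y; rewrite -ball_normE/= => /rV_norm_ltP-/(_ r2) h j.
apply/floorP; have := h j; rewrite !mxE intrD ltr_norml; set z := _%:~R; move: (rho0); lra.
Qed.

End grid.

(** * Covering the points of large oscillation at one scale *)

Section bad_sets.
Context {R : realType} {n : nat}.
Notation Rn := 'rV[R]_n.
Notation leb := (@lebesgue_rV R n).
Variables (Omega : set Rn) (H : Rn -> Rn -> R) (gm : R).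
Hypothesis H0 : forall x y, 0 <= H x y.
Hypothesis Hxx : forall x, H x x = 0.
Hypothesis mH : measurable_fun setT (fun z : Rn * Rn => H z.1 z.2).
Local Open Scope ereal_scope.
Hypothesis Hsh : forall g, (0 < g < gm)%R -> forall d : R, (0 < d)%R -> exists C rho0 : R,
  [/\ (0 <= C)%R, (0 < rho0)%R & forall e : Rn, (0 < `|e| <= rho0)%R ->
    \int[leb]_(x in inner Omega d) (H x (x + e)%R)%:E <= (C * `|e| `^ g)%:E].

(** The double integral is not normalised: it is of order [r^(2n)] times the mean oscillation,
    whence the thresholds [rho^(2n + eps)]. *)
Definition osc (x : Rn) (r : R) : \bar R := \int[leb]_(a in ball x r) \int[leb]_(b in ball x r) (H a b)%:E.

(** The oscillation about [y] in translated coordinates: the domains are fixed, so it is measurable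
    in [y]. For [x] and [y] in one cell of mesh [rho], [osc x rho] is at most [osc0 y (2 * rho)]. *)
Let osc0 (y : Rn) (r : R) : \bar R :=
  \int[leb]_(p in ball (0%R : Rn) r) \int[leb]_(w in ball (0%R : Rn) r) (H (y + p) (y + w))%:E.

Let He0 x y : 0 <= (H x y)%:E. Proof. by rewrite lee_fin. Qed.

Let mb r : measurable (ball (0%R : Rn) r). Proof. exact: measurable_rV_ball. Qed.

Let mH2 d (T : measurableType d) (f g : T -> Rn) : measurable_fun setT f -> measurable_fun setT g ->
  measurable_fun setT (fun z => (H (f z) (g z))%:E).
Proof. by move=> mf mg; apply: mf_EFin; apply: (mf_comp2 mH). Qed.

Let osc_le (x y : Rn) (rho r : R) : (`|x - y| + rho <= r)%R -> osc x rho <= osc0 y r.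
Proof.
move=> xy; have B a : ball x rho a -> ball (0%R : Rn) r (a - y)%R.
  rewrite -!ball_normE/= sub0r normrN distrC => h; apply: lt_le_trans xy.
  by rewrite -(subrKA x) (le_lt_trans (ler_normD _ _))// addrC ltrD2l.
apply: (@le_trans _ _ (\int[leb]_(a in ball x rho) \int[leb]_(w in ball (0%R : Rn) r) (H (y + (a - y)) (y + w))%:E)).
  apply: le_integral_ge0 => [//|a _|a _|a _]; try by apply: integral_ge0.
  have -> : \int[leb]_(b in ball x rho) (H a b)%:E =
      \int[leb]_(b in ball x rho) ((fun w => (H (y + (a - y)) (y + w))%:E) (b - y)%R).
    by apply: eq_integral => b _ /=; rewrite ![(y + _)%R]addrC !subrK.
  apply: (le_integral_rV_shift (mb r)) => //; by apply: mH2; mfun.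
apply: (@le_integral_rV_shift R n (- y)%R _ _ (fun p => \int[leb]_(w in ball (0%R : Rn) r) (H (y + p) (y + w))%:E) (mb r)) => //.
- by apply: (@measurable_integral_in _ _ Rn Rn R leb _ (fun p w => (H (y + p) (y + w))%:E)) => //; apply: mH2; mfun.
- by move=> p; apply: integral_ge0.
Qed.

Let osc0_ge0 y r : 0 <= osc0 y r.
Proof. by apply: integral_ge0 => p _; apply: integral_ge0. Qed.

Let measurable_osc0_in r : measurable_fun setT (fun z : Rn * Rn => \int[leb]_(w in ball (0%R : Rn) r) (H (z.1 + z.2) (z.1 + w))%:E).
Proof.
apply: (@measurable_integral_in _ _ (Rn * Rn)%type Rn R leb _ (fun z w => (H (z.1 + z.2) (z.1 + w))%:E)) => //.
by apply: mH2; mfun.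
Qed.

Let measurable_osc0 r : measurable_fun setT (fun y => osc0 y r).
Proof.
apply: (@measurable_integral_in _ _ Rn Rn R leb _ (fun y p => \int[leb]_(w in ball (0%R : Rn) r) (H (y + p) (y + w))%:E)) => //.
by move=> x y; apply: integral_ge0.
Qed.

Let integral_ball_cst (c r : R) : (0 < r)%R -> \int[leb]_(w in ball (0%R : Rn) r) c%:E = (c * (2 * r) ^+ n)%:E.
Proof. by move=> r0; rewrite EFinM -(lebesgue_rV_ball (0%R : Rn) r0) integral_cst. Qed.

(** For fixed [p] and [w] the integral over [y] is one of the shift estimates, with shift [w - p] of
    length at most [2 * r]; integrating over [p] and [w] adds two volumes [(2r)^n]. The zero shift
    contributes nothing as [H x x = 0]. *)
Let integral_osc0_le (g C rho0 d d' r : R) : (0 < g)%R -> (0 <= C)%R -> (0 < r)%R -> (2 * r <= rho0)%R -> (r + d' <= d)%R ->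
  (forall e : Rn, (0 < `|e| <= rho0)%R ->
    \int[leb]_(x in inner Omega d') (H x (x + e)%R)%:E <= (C * `|e| `^ g)%:E) ->
  \int[leb]_(y in inner Omega d) osc0 y r <= (C * (2 * r) `^ g * ((2 * r) ^+ n * (2 * r) ^+ n))%:E.
Proof.
move=> g0 C0 r0 rr rd HC.
have mI : measurable (inner Omega d) by exact: inner_measurable.
rewrite (@tonelli_in _ _ Rn Rn R leb leb _ _ (fun y p => \int[leb]_(w in ball (0%R : Rn) r) (H (y + p) (y + w))%:E) mI (mb r)); last 2 first.
- exact: measurable_osc0_in.
- by move=> x y; apply: integral_ge0.
set K := (C * (2 * r) `^ g)%R.
have K0 : (0 <= K)%R by rewrite mulr_ge0// powR_ge0.
apply: (@le_trans _ _ (\int[leb]_(p in ball (0%R : Rn) r) (K * (2 * r) ^+ n)%:E)); last first.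
  by rewrite integral_ball_cst// mulrA.
apply: le_integral_ge0 => [//|p _|p _|p Bp]; first by do 2 apply: integral_ge0 => ? _.
  by rewrite lee_fin mulr_ge0// exprn_ge0// mulr_ge0// ltW.
rewrite (@tonelli_in _ _ Rn Rn R leb leb _ _ (fun y w => (H (y + p) (y + w))%:E) mI (mb r)) => //; last first.
  by apply: mH2; mfun.
apply: (@le_trans _ _ (\int[leb]_(w in ball (0%R : Rn) r) K%:E)); last first.
  by rewrite integral_ball_cst.
apply: le_integral_ge0 => [//|w _|w _|w Bw]; [by apply: integral_ge0|by rewrite lee_fin|].
rewrite -ball_normE/= sub0r normrN in Bp; rewrite -ball_normE/= sub0r normrN in Bw.
have m1 : measurable_fun setT (fun y : Rn => (H y (y + (w - p)))%:E) by apply: mH2; mfun.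
apply: (@le_trans _ _ (\int[leb]_(x in inner Omega d') (H x (x + (w - p)))%:E)).
  have -> : \int[leb]_(y in inner Omega d) (H (y + p) (y + w))%:E =
     \int[leb]_(y in inner Omega d) (H (y + p) (y + p + (w - p)))%:E.
    by apply: eq_integral => y _; rewrite -[(y + p + _)%R]addrA [(p + _)%R]addrC subrK.
  apply: (@le_integral_rV_shift R n p _ _ (fun y => (H y (y + (w - p)))%:E) (inner_measurable _ _) m1) => // x Ix.
  by apply: inner_shift Ix _; rewrite [(x + p)%R]addrC addrK (le_trans _ rd)// lerD2r ltW.
have [->|wp] := eqVneq w p.
  rewrite subrr; under eq_integral do rewrite addr0 Hxx.
  by rewrite integral0 lee_fin.
have nwp : (`|w - p| <= 2 * r)%R.
  by rewrite (le_trans (ler_normB _ _))// mulr_natl mulr2n lerD// ltW.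
apply: le_trans (HC _ _) _; first by rewrite normr_gt0 subr_eq0 wp/= (le_trans nwp).
rewrite lee_fin ler_wpM2l//; apply: ge0_ler_powR => //; rewrite ?nnegrE; [exact: ltW|exact: normr_ge0|].
by apply: mulr_ge0 => //; exact: ltW.
Qed.

(** Chebyshev's inequality on the grid: in a cell that contains a bad point [osc0 y (2 * rho)] is at
    least the threshold for all [y], so the number of such cells is at most
    [C (4 rho)^(g+2n) / (rho^(2n+eps) rho^n)]. Each contributes at most [(n rho)^t]. *)
Lemma bad_premeasure (t g eps d : R) : (0 <= t)%R -> (0 < g < gm)%R -> (0 < d)%R ->
  exists C rho1 : R, [/\ (0 <= C)%R, (0 < rho1)%R & forall rho delta : R, (0 < rho <= rho1)%R -> (n%:R * rho <= delta)%R ->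
    hausdorff_premeasure t delta [set x | inner Omega d x /\ (rho `^ (2 * n%:R + eps))%:E < osc x rho] <=
      (C * rho `^ (t - n%:R - eps + g))%:E].
Proof.
move=> t0 g0 d0; have d40 : (0 < d / 4)%R by rewrite divr_gt0.
have [C [rho0 [C0 r00 HC]]] := Hsh g0 d40; have /andP[gp _] := g0.
exists (n%:R `^ t * C * 4 `^ (2 * n%:R + g))%R, (Num.min (rho0 / 4) (d / 4))%R; split.
- by rewrite !mulr_ge0// powR_ge0.
- by rewrite lt_min d40 divr_gt0.
move=> rho delta /andP[r0]; rewrite le_min => /andP[rr rd] nd.
set th := (rho `^ _)%R; have th0 : (0 < th)%R by rewrite powR_gt0.
set Bad := [set x | _].
(* Only the cells that meet the bad set are kept; the others become empty and have weight 0. *)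
pose U (k : nat) : set Rn := if pselect (exists2 x, cube rho k x & Bad x) then cube rho k else set0.
have UP k y : U k y -> cube rho k y /\ exists2 x, cube rho k x & Bad x.
  by rewrite /U; case: pselect.
have Udist k x y : U k x -> U k y -> (`|x - y| < rho)%R.
  by move=> /UP[kx _] /UP[ky _]; exact: (cube_dist r0 kx ky).
have diamU k : diam (U k) <= (n%:R * rho)%:E.
  apply: ge_ereal_sup => _ [x Ux [y Uy <-]]; rewrite lee_fin.
  by apply: le_trans (enorm_le_norm _) _; rewrite ler_wpM2l// ltW// (Udist k).
apply: le_trans (hausdorff_premeasure_le t _ (U := U) (delta := delta) _) _.
- move=> x Bx; exists (pickle (cell rho x)) => //; rewrite /U; case: pselect => // -[].
  by exists x.
- by move=> k; apply: le_trans (diamU k) _; rewrite lee_fin.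
have mU k : measurable (U k) by rewrite /U; case: pselect => ? /=; [exact: cube_measurable|exact: measurable0].
have tU : trivIset setT U.
  apply/trivIsetP => i j _ _ ij; apply/seteqP; split => // x [/UP[xi _] /UP[xj _]].
  by move/trivIsetP: (@trivIset_cube R n rho) => /(_ i j I I ij) <-.
have r20 : (0 < 2 * rho)%R by rewrite mulr_gt0.
pose F y := osc0 y (2 * rho)%R.
have UF k y : U k y -> th%:E <= F y /\ inner Omega (3 * (d / 4)) y.
  move=> /UP[ky [x kx [Ix xo]]]; have xy := cube_dist r0 kx ky; split.
    by apply: le_trans (ltW xo) _; apply: osc_le; rewrite mulr_natl mulr2n lerD2r ltW.
  apply: inner_shift Ix _; rewrite distrC; move: (ltW xy) (rd); move: (`|_|)%R => z; lra.
(* The weight of one cell divided by [th * rho^n], the lower bound for the integral of [F] over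
   it. *)
pose c := ((n%:R * rho) `^ t / (th * rho ^+ n))%R.
have c0 : (0 <= c)%R by rewrite divr_ge0 ?powR_ge0// mulr_ge0 ?exprn_ge0// ltW.
have key k : diam_pow t (U k) <= c%:E * \int[leb]_(y in U k) F y.
  have [[y Uy]|/set0P/negP/negPn/eqP->] := pselect (U k !=set0); last first.
    by rewrite /diam_pow eqxx integral_set0 mule0.
  apply: le_trans (diam_pow_le t0 _ (diamU k)) _; first by rewrite mulr_ge0// ltW.
  apply: (@le_trans _ _ (c%:E * (th * rho ^+ n)%:E)).
    by rewrite -EFinM divfK// mulf_neq0// ?expf_neq0// gt_eqF.
  apply: lee_wpmul2l; first by rewrite lee_fin.
  apply: (@le_trans _ _ (\int[leb]_(y in U k) th%:E)).
    rewrite integral_cst// EFinM; apply: lee_wpmul2l; first by rewrite lee_fin ltW.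
    have [ky kx] := UP _ _ Uy; rewrite /U; case: pselect => ? //=; exact: (cube_lebesgue r0 ky).
  by apply: le_integral_ge0 => // z Uz; [rewrite lee_fin ltW|exact: osc0_ge0|have [] := UF k z Uz].
apply: (@le_trans _ _ (\sum_(k <oo) c%:E * \int[leb]_(y in U k) F y)).
  by apply: lee_nneseries => [k _ _|k _]; [exact: diam_pow_ge0|exact: key].
rewrite nneseriesZl; last by move=> k _; apply: integral_ge0 => y _; exact: osc0_ge0.
rewrite -(ge0_integral_bigcup leb mU); last 3 first.
- by apply: measurable_funTS; exact: measurable_osc0.
- by move=> y _; exact: osc0_ge0.
- exact: tU.
apply: (@le_trans _ _ (c%:E * \int[leb]_(y in inner Omega (3 * (d / 4))) F y)).
  apply: lee_wpmul2l; first by rewrite lee_fin.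
  by apply: le_integral_ge0 => [y [k _ /UF[]]//|y _|y _|//]; exact: osc0_ge0.
have L : \int[leb]_(y in inner Omega (3 * (d / 4))) F y <=
    (C * (2 * (2 * rho)) `^ g * ((2 * (2 * rho)) ^+ n * (2 * (2 * rho)) ^+ n))%:E.
  apply: (integral_osc0_le gp C0 r20 _ _ HC); move: (rr) (rd); lra.
apply: le_trans (lee_wpmul2l _ L) _; first by rewrite lee_fin.
rewrite -EFinM lee_fin le_eqVlt; apply/orP; left; apply/eqP.
rewrite /c /th (_ : 2 * (2 * rho) = 4 * rho)%R; last by ring.
rewrite !powRM// ?ltW// !exprMn -!powR_mulrn ?ltW//.
have -> : (t - n%:R - eps + g = t - (2 * n%:R + eps) - n%:R + g + n%:R + n%:R)%R by ring.
have -> : (2 * n%:R + g = g + n%:R + n%:R :> R)%R by ring.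
have P4 : (4 != 0 :> R)%R by rewrite pnatr_eq0.
have Pr : rho != 0%R by rewrite gt_eqF.
set w := (2 * n%:R + eps)%R.
rewrite !powRD ?Pr ?P4 ?implybT// !powRN /w powRD ?Pr ?implybT//.
have q1 : (rho `^ n%:R != 0)%R by rewrite gt_eqF// powR_gt0.
have q2 : (rho `^ (2 * n%:R) != 0)%R by rewrite gt_eqF// powR_gt0.
have q3 : (rho `^ eps != 0)%R by rewrite gt_eqF// powR_gt0.
by field; rewrite q1 q2 q3.
Qed.

End bad_sets.

(** * Points of large oscillation at infinitely many scales *)

Section bad_limsup.
Context {R : realType} {n : nat}.
Notation Rn := 'rV[R]_n.
Notation leb := (@lebesgue_rV R n).
Variables (Omega : set Rn) (H : Rn -> Rn -> R) (gm : R).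
Hypothesis H0 : forall x y, 0 <= H x y.
Hypothesis Hxx : forall x, H x x = 0.
Hypothesis mH : measurable_fun setT (fun z : Rn * Rn => H z.1 z.2).
Hypothesis gm0 : 0 < gm.
Local Open Scope ereal_scope.
Hypothesis Hsh : forall g, (0 < g < gm)%R -> forall d : R, (0 < d)%R -> exists C rho0 : R,
  [/\ (0 <= C)%R, (0 < rho0)%R & forall e : Rn, (0 < `|e| <= rho0)%R ->
    \int[leb]_(x in inner Omega d) (H x (x + e)%R)%:E <= (C * `|e| `^ g)%:E].

(** A Borel-Cantelli argument: for every [N] the set is covered by the bad sets at the scales [2^-i]
    with [i >= N], whose premeasures are dominated by a convergent geometric series. *)
Lemma bad_limsup_null (t : R) : (0 <= t)%R -> (n%:R - gm < t)%R -> exists2 eps : R, (0 < eps)%R &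
  forall d : R, (0 < d)%R -> hausdorff_measure t [set x | inner Omega d x /\
    forall N, exists2 i, (N <= i)%N & ((2 ^- i) `^ (2 * n%:R + eps))%:E < osc H x (2 ^- i)%R] = 0.
Proof.
(* [eta] is the room in [t > n - gm]. A quarter of it goes to [eps] and at most a quarter to
   [gm - g], so the exponent [b] is at least [eta / 2]. *)
move=> t0 tn; pose eta := (t - n%:R + gm)%R.
have eta0 : (0 < eta)%R by rewrite /eta; move: (tn); lra.
pose eps := (eta / 4)%R; pose m := (Num.min (eta / 4) (gm / 2))%R.
have eps0 : (0 < eps)%R by rewrite divr_gt0.
have m0 : (0 < m)%R by rewrite lt_min eps0 divr_gt0.
have m1 : (m <= eta / 4)%R by rewrite ge_min lexx.
have m2 : (m <= gm / 2)%R by rewrite ge_min lexx orbT.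
exists eps => // d d0; apply: hausdorff_measure0 => delta delta0 e e0.
pose g := (gm - m)%R; have g0 : (0 < g < gm)%R by rewrite /g; move: (m0) (m2) (gm0) => *; apply/andP; split; lra.
have [C [rho1 [C0 r10 HC]]] := bad_premeasure H0 Hxx mH Hsh eps t0 g0 d0.
pose b := (t - n%:R - eps + g)%R.
have b0 : (0 < b)%R by rewrite /b /g /eps; move: (m1) (eta0); rewrite /eta; lra.
have q01 := powR2_lt1 b0; set q := (2 `^ (- b))%R in q01; have /andP[q0 q1] := q01.
have qE i : ((2 ^- i) `^ b = q ^+ i)%R.
  by rewrite -exprVn powR_exprn ?invr_ge0// /q powRN -powR_inv1// -powRrM mulN1r powRN.
have h01 : (0 < (2^-1 : R) < 1)%R by rewrite invr_gt0 ltr0n invf_lt1 ?ltr1n.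
have de0 : (0 < delta / (n%:R + 1))%R by rewrite divr_gt0// ltr_wpDl.
have ee0 : (0 < e * (1 - q) / (C + 1))%R by rewrite divr_gt0 ?mulr_gt0 ?subr_gt0// ltr_wpDl.
have [k1 Hk1] := expr_small h01 r10; have [k2 Hk2] := expr_small h01 de0; have [k3 Hk3] := expr_small q01 ee0.
pose N := maxn k1 (maxn k2 k3).
pose B i := [set x | inner Omega d x /\ ((2 ^- (N + i)) `^ (2 * n%:R + eps))%:E < osc H x (2 ^- (N + i))%R].
apply: le_trans (@hausdorff_premeasure_bigcup R n t delta _ B (fun i => ((C + 1) * q ^+ (N + i))%:E) _ _) _.
- move=> x [Ix /(_ N)[i Ni xi]]; exists (i - N)%N; [exact: I|apply: conj; [exact: Ix|]].
  by rewrite (subnKC Ni).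
- move=> i; have r0 : (0 < 2 ^- (N + i) :> R)%R by rewrite invr_gt0 exprn_gt0.
  apply: le_lt_trans (HC (2 ^- (N + i))%R delta _ _) _.
  + rewrite r0 -exprVn/= Hk1// (leq_trans _ (leq_addr _ _))// leq_maxl//.
  + have := Hk2 (N + i)%N; rewrite (leq_trans _ (leq_addr _ _)); last by rewrite /N !leq_max leqnn orbT.
    move=> /(_ isT); rewrite exprVn ler_pdivlMr ?ltr_wpDl// => h; apply: le_trans h.
    by rewrite mulrC ler_wpM2l ?(ltW r0)// lerDl.
  + rewrite -/b qE lte_fin ltr_pM2r ?exprn_gt0// ltrDl//.
apply: le_trans (@nneseries_geometric_le R ((C + 1) * q ^+ N)%R q _ _ q01 _) _.
- by rewrite mulr_ge0 ?addr_ge0// exprn_ge0// ltW.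
- move=> i; rewrite exprD mulrA lexx andbT !mulr_ge0 ?addr_ge0// exprn_ge0// ltW//.
rewrite lee_fin ler_pdivrMr ?subr_gt0// mulrC -ler_pdivlMr ?ltr_wpDl//.
by apply: Hk3; rewrite /N !leq_max leqnn !orbT.
Qed.

End bad_limsup.

(** * Comparison of averages *)

Section averages.
Context {R : realType} {n : nat}.
Notation Rn := 'rV[R]_n.
Notation leb := (@lebesgue_rV R n).
Variables (f : Rn -> R) (A B : set Rn).
Hypothesis mf : measurable_fun setT f.
Hypotheses (mA : measurable A) (mB : measurable B).
Hypotheses (A0 : 0 < fine (leb A)) (B0 : 0 < fine (leb B)).
Hypotheses (fA : leb.-integrable A (EFin \o f)) (fB : leb.-integrable B (EFin \o f)).

Let avg (D : set Rn) : R := (fine (leb D))^-1 * \int[leb]_(x in D) f x.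

Let cst_integrable (D : set Rn) (c : R) : measurable D -> 0 < fine (leb D) ->
  leb.-integrable D (EFin \o cst c).
Proof.
move=> mD D0; apply/integrableP; split; first by apply/measurable_EFinP; exact: measurable_cst.
rewrite /= integral_cst// lte_mul_pinfty//.
have h (y : \bar R) : 0 < fine y -> (y < +oo)%E by case: y => [r| |] //=; rewrite ?ltry ?ltxx.
exact: h D0.
Qed.

(** [f a - avg B] is the mean over [b] in [B] of [f a - f b]. Averaging once more over [A] gives
    [average_diff_le], so a single double integral controls both mean oscillation and the change of
    averages. *)
Lemma integral_sub_average_le :
  (\int[leb]_(a in A) `|f a - avg B|%:E <=
   (fine (leb B))^-1%:E * \int[leb]_(a in A) \int[leb]_(b in B) `|f a - f b|%:E)%E.
Proof.
have m2 : measurable_fun setT (fun z : Rn * Rn => `|f z.1 - f z.2|%:E) by mfun.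
rewrite -ge0_integralZl_EFin//; last 3 first.
- by move=> a _; apply: integral_ge0.
- by apply: measurable_funTS; apply: (@measurable_integral_in _ _ Rn Rn R leb B (fun a b => `|f a - f b|%:E)).
- by rewrite invr_ge0 ltW.
apply: le_integral_ge0 => [//|a _|a _|a _]; first by rewrite lee_fin.
  by apply: mule_ge0; [rewrite lee_fin invr_ge0 ltW|apply: integral_ge0].
have fab : leb.-integrable B (EFin \o (fun b => f a - f b)).
  rewrite (_ : _ \o _ = ((EFin \o cst (f a)) \- (EFin \o f))%E); last by apply/funext => b /=; rewrite EFinB.
  by apply: integrableB => //; exact: cst_integrable.
have E : f a - avg B = (fine (leb B))^-1 * \int[leb]_(b in B) (f a - f b).
  rewrite RintegralB//; last exact: cst_integrable.
  by rewrite Rintegral_cst// mulrBr mulrCA mulVf ?mulr1 ?gt_eqF.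
rewrite E normrM ger0_norm; last by rewrite invr_ge0 ltW.
rewrite EFinM.
apply: lee_wpmul2l; first by rewrite lee_fin invr_ge0 ltW.
apply: (@le_trans _ _ (\int[leb]_(b in B) `|f a - f b|)%:E); first by rewrite lee_fin le_normr_Rintegral.
rewrite /Rintegral fineK//; apply: integrable_fin_num => //.
exact: (integrable_abse fab).
Qed.

Lemma average_diff_le :
  (`|avg A - avg B|%:E <=
   ((fine (leb A))^-1 * (fine (leb B))^-1)%:E * \int[leb]_(a in A) \int[leb]_(b in B) `|f a - f b|%:E)%E.
Proof.
have fab : leb.-integrable A (EFin \o (fun a => f a - avg B)).
  rewrite (_ : _ \o _ = ((EFin \o f) \- (EFin \o cst (avg B)))%E); last by apply/funext => b /=; rewrite EFinB.
  by apply: integrableB => //; exact: cst_integrable.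
have -> : avg A - avg B = (fine (leb A))^-1 * \int[leb]_(a in A) (f a - avg B).
  rewrite RintegralB//; last exact: cst_integrable.
  by rewrite Rintegral_cst// mulrBr mulrCA mulVf ?mulr1 ?gt_eqF.
rewrite normrM ger0_norm; last by rewrite invr_ge0 ltW.
rewrite EFinM [(_ * _)%:E]EFinM -muleA.
apply: lee_wpmul2l; first by rewrite lee_fin invr_ge0 ltW.
apply: le_trans integral_sub_average_le.
apply: (@le_trans _ _ (\int[leb]_(b in A) `|f b - avg B|)%:E); first by rewrite lee_fin le_normr_Rintegral.
rewrite /Rintegral fineK//; apply: integrable_fin_num => //.
exact: (integrable_abse fab).
Qed.

End averages.

(** * Points of small oscillation are regular *)

Section regular_points.
Context {R : realType} {n : nat}.
Notation Rn := 'rV[R]_n.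
Notation leb := (@lebesgue_rV R n).
Implicit Types (x : Rn) (r : R).

Lemma rV_norm_le_sum (x : Rn) : `|x| <= \sum_j `|x ord0 j|.
Proof.
rewrite leNgt; apply/negP => h.
have S0 : 0 <= \sum_j `|x ord0 j| by apply: sumr_ge0.
suff : `|x| < `|x| by rewrite ltxx.
apply/rV_norm_ltP => [|j]; first exact: le_lt_trans h.
by apply: le_lt_trans h; rewrite (bigD1 j)//= lerDl sumr_ge0.
Qed.

Lemma eball_sub_ball x r : eball x r `<=` ball x r.
Proof. by move=> y; rewrite /eball/= -ball_normE/= distrC; apply: le_lt_trans; exact: enorm_ge_norm. Qed.

Lemma measurable_eball x r : measurable (eball x r).
Proof.
have m : measurable_fun setT (fun y : Rn => enorm (y - x)).
  by apply: (measurableT_comp (@measurable_enorm R n)); mfun.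
rewrite (_ : eball x r = setT `&` (fun y : Rn => enorm (y - x)) @^-1` `]-oo, r[%classic).
  by apply: m => //; exact: measurable_itv.
by rewrite setTI; apply/seteqP; split => y /=; rewrite /eball/= in_itv.
Qed.

Lemma lebesgue_eball_ge x r : (0 < n)%N -> 0 < r -> ((2 * (r / n%:R)) ^+ n <= fine (leb (eball x r))).
Proof.
move=> n0 r0; have n0' : 0 < n%:R :> R by rewrite ltr0n.
have rn : 0 < r / n%:R by rewrite divr_gt0.
have lB : (leb (eball x r) <= ((2 * r) ^+ n)%:E)%E.
  rewrite -(lebesgue_rV_ball x r0); apply: le_measure; rewrite ?inE; [exact: measurable_eball|exact: measurable_rV_ball|exact: eball_sub_ball].
rewrite -lee_fin fineK; last by rewrite ge0_fin_numE// (le_lt_trans lB)// ltry.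
rewrite -(lebesgue_rV_ball x rn); apply: le_measure; rewrite ?inE; [exact: measurable_rV_ball|exact: measurable_eball|].
move=> y; rewrite -ball_normE/= distrC ltr_pdivlMr// mulrC => h.
by rewrite /eball/=; apply: le_lt_trans (enorm_le_norm _) h.
Qed.

Variables (G : Rn -> Rn) (x : Rn) (r0 eps : R) (N0 : nat).
Hypothesis n0 : (0 < n)%N.
Hypothesis mG : forall j, measurable_fun setT (fun x => G x ord0 j).
Hypothesis Gint : forall j, leb.-integrable (ball x r0) (EFin \o (fun x => G x ord0 j)).
Hypothesis eps0 : 0 < eps.
Hypothesis N0r : 2 ^- N0 <= r0.

Definition gradH (a b : Rn) : R := \sum_j `|G a ord0 j - G b ord0 j|.

Hypothesis osc_small : forall i, (N0 <= i)%N -> (osc gradH x (2 ^- i)%R <= ((2 ^- i) `^ (2 * n%:R + eps))%:E)%E.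

Let p i : R := 2 ^- i.
Let p0 i : 0 < p i. Proof. by rewrite invr_gt0 exprn_gt0. Qed.
Let pS i : p i.+1 = p i / 2. Proof. by rewrite /p exprS invfM mulrC. Qed.
Let p_le i j : (i <= j)%N -> p j <= p i.
Proof. by move=> ij; rewrite lef_pV2 ?posrE ?exprn_gt0// ler_weXn2l// ler1n. Qed.
Let q : R := 2 `^ (- eps).
Let q01 : 0 < q < 1. Proof. exact: powR2_lt1. Qed.
Let n0R : 0 < n%:R :> R. Proof. by rewrite ltr0n. Qed.

(** Subsets of the ball of radius [2^-i] of comparable volume. They include both cubes, for which
    the oscillation is known, and Euclidean balls, which the definition of a singular point uses. *)
Let good i (A : set Rn) := [/\ measurable A, A `<=` ball x (p i) & (p i / n%:R) ^+ n <= fine (leb A)].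

Let good_pos i A : good i A -> 0 < fine (leb A).
Proof. by case=> _ _; apply: lt_le_trans; rewrite exprn_gt0// divr_gt0. Qed.

Let good_int i A j : (N0 <= i)%N -> good i A -> leb.-integrable A (EFin \o (fun x => G x ord0 j)).
Proof.
move=> iN [mA AB _]; apply: (integrableS (measurable_rV_ball x r0) mA) (Gint j).
apply: subset_trans AB _; apply: le_ball; apply: le_trans N0r; exact: p_le.
Qed.

(** Bounds [(p i)^(2n) / (|A| * |B|)] for good sets [A] and [B] at scale [i]. *)
Let D : R := n%:R ^+ n * n%:R ^+ n.

Let osc_q i : (N0 <= i)%N -> (osc gradH x (p i) <= (p i ^+ n * p i ^+ n * q ^+ i)%:E)%E.
Proof.
move=> iN; apply: le_trans (osc_small iN) _; rewrite lee_fin le_eqVlt; apply/orP; left; apply/eqP.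
rewrite -/(p i) powRD; last by rewrite (gt_eqF (p0 i)) implybT.
rewrite mulr_natl mulr2n powRD; last by rewrite (gt_eqF (p0 i)) implybT.
rewrite !powR_mulrn ?(ltW (p0 _))//; congr (_ * _).
by rewrite /p -exprVn powR_exprn ?invr_ge0// /q powRN -powR_inv1// -powRrM mulN1r powRN.
Qed.

Let good_osc i A B j : good i A -> good i B -> (N0 <= i)%N ->
  (\int[leb]_(a in A) \int[leb]_(b in B) `|G a ord0 j - G b ord0 j|%:E <= (p i ^+ n * p i ^+ n * q ^+ i)%:E)%E.
Proof.
move=> [_ Ai _] [_ Bi _] iN; apply: le_trans (osc_q iN).
apply: le_integral_ge0 => [//|a _|a _|a _]; try by apply: integral_ge0 => b _; rewrite lee_fin ?sumr_ge0.
apply: le_integral_ge0 => [//|b _|b _|b _]; rewrite lee_fin ?sumr_ge0//.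
by rewrite /gradH (bigD1 j)//= lerDl sumr_ge0.
Qed.

Let good_inv i A : good i A -> (fine (leb A))^-1 <= n%:R ^+ n / p i ^+ n.
Proof.
move=> gA; have [_ _ h] := gA; have := good_pos gA => A0.
rewrite -[leRHS]invrK lef_pV2 ?posrE//; first by rewrite invf_div -expr_div_n.
by rewrite invr_gt0 divr_gt0 ?exprn_gt0.
Qed.

Let avg j (A : set Rn) : R := (fine (leb A))^-1 * \int[leb]_(x in A) G x ord0 j.

Let mul_inv i A B : good i A -> good i B ->
  (fine (leb A))^-1 * (fine (leb B))^-1 * (p i ^+ n * p i ^+ n * q ^+ i) <= D * q ^+ i.
Proof.
move=> gA gB; have qi : 0 <= q ^+ i by rewrite exprn_ge0// ltW//; case/andP: q01.
have pn : 0 < p i ^+ n by rewrite exprn_gt0.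
apply: (@le_trans _ _ ((n%:R ^+ n / p i ^+ n) * (n%:R ^+ n / p i ^+ n) * (p i ^+ n * p i ^+ n * q ^+ i))).
  apply: ler_wpM2r; first by rewrite !mulr_ge0// ltW.
  by apply: ler_pM; rewrite ?invr_ge0 ?(ltW (good_pos gA)) ?(ltW (good_pos gB))// good_inv.
rewrite le_eqVlt; apply/orP; left; apply/eqP; rewrite /D; field; by rewrite gt_eqF.
Qed.

Let avg_diff i A B j : (N0 <= i)%N -> good i A -> good i B -> `|avg j A - avg j B| <= D * q ^+ i.
Proof.
move=> iN gA gB; rewrite -lee_fin.
have [mA _ _] := gA; have [mB _ _] := gB.
apply: le_trans (average_diff_le (mG j) mA mB (good_pos gA) (good_pos gB) (good_int j iN gA) (good_int j iN gB)) _.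
apply: le_trans (lee_wpmul2l _ (good_osc j gA gB iN)) _.
  by rewrite lee_fin mulr_ge0// invr_ge0 ltW// ?(good_pos gA) ?(good_pos gB).
by rewrite -EFinM lee_fin; exact: mul_inv.
Qed.

Let good_ball i : good i (ball x (p i)).
Proof.
split; [exact: measurable_rV_ball|by []|].
rewrite (lebesgue_rV_ball x (p0 i)) lerXn2r ?nnegrE ?mulr_ge0 ?invr_ge0 ?(ltW (p0 _))//.
rewrite ler_pdivrMr//; have n1 : 1 <= n%:R :> R by rewrite ler1n.
have := p0 i; move: (p i) => y y0; nra.
Qed.

Let good_ballS i : good i (ball x (p i.+1)).
Proof.
split; [exact: measurable_rV_ball|by apply: le_ball; exact: p_le|].
rewrite (lebesgue_rV_ball x (p0 _)) pS mulrCA mulfV// mulr1 lerXn2r ?nnegrE ?mulr_ge0 ?invr_ge0 ?(ltW (p0 _))//.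
by rewrite ler_pdivrMr// ler_pMr// ler1n.
Qed.

Let good_eball i r : p i.+1 <= r <= p i -> good i (eball x r).
Proof.
move=> /andP[pr rp]; have r00 : 0 < r by apply: lt_le_trans pr.
split; [exact: measurable_eball|exact: subset_trans (@eball_sub_ball x r) (le_ball rp)|].
apply: le_trans (lebesgue_eball_ge x n0 r00); rewrite lerXn2r ?nnegrE ?mulr_ge0 ?invr_ge0 ?(ltW (p0 _)) ?(ltW r00)//.
rewrite mulrA ler_wpM2r ?invr_ge0//; move: pr; rewrite pS; lra.
Qed.

Let avg_ball_bound j m : `|avg j (ball x (p (N0 + m)))| <= `|avg j (ball x (p N0))| + D * ((1 - q ^+ m) / (1 - q)).
Proof.
have /andP[q0 q1] := q01; have D0 : 0 <= D by rewrite mulr_ge0// exprn_ge0.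
have q1' : 1 - q != 0 by rewrite subr_eq0 gt_eqF.
elim: m => [|m IH]; first by rewrite addn0 expr0 subrr mul0r mulr0 addr0.
have h := avg_diff j (leq_addr m N0) (good_ballS (N0 + m)) (good_ball (N0 + m)).
have h2 : D * q ^+ (N0 + m) <= D * q ^+ m.
  by apply: ler_wpM2l => //; rewrite exprD ler_piMl ?exprn_ge0 ?exprn_ile1 ?(ltW q0) ?(ltW q1).
have -> : D * ((1 - q ^+ m.+1) / (1 - q)) = D * ((1 - q ^+ m) / (1 - q)) + D * q ^+ m.
  by rewrite exprS; field.
rewrite addnS addrA [leRHS]addrC; apply: le_trans (lerD (le_trans h h2) IH); have := ler_normD (avg j (ball x (p (N0 + m).+1)) - avg j (ball x (p (N0 + m)))) (avg j (ball x (p (N0 + m)))).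
by rewrite subrK.
Qed.

Let right_nbhs_ex (V : set R) : (0 : R)^'+ V -> exists2 e : R, 0 < e & forall r, 0 < r < e -> V r.
Proof.
move=> /nbhs_ballP[e /= e0 He]; exists e => // r /andP[r00 re]; apply: He => //.
by rewrite -ball_normE/= sub0r normrN gtr0_norm.
Qed.

(** Averages over good sets at scale [i] differ by at most [D * q^i]. For the liminf of the mean
    oscillation it suffices to look at dyadic radii. For the limsup of the averages, each small
    Euclidean ball is compared with the dyadic ball around it, and the changes between dyadic balls
    are summed. *)
Lemma regular_point : ~ singular_point G x.
Proof.
have /andP[q0 q1] := q01.
have h01 : 0 < (2^-1 : R) < 1 by rewrite invr_gt0 ltr0n invf_lt1 ?ltr1n.
have D0 : 0 <= D by rewrite mulr_ge0// exprn_ge0.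
case.
  apply/negP; rewrite -leNgt limf_einfE; apply: ge_ereal_sup => _ [V /right_nbhs_ex[e e0 He] <-].
  apply/lee_addgt0Pr => c c0; rewrite add0e.
  have c1 : 0 < c / (n%:R * n%:R * D + 1) by rewrite divr_gt0// ltr_wpDl// !mulr_ge0.
  have e2 : 0 < e / 2 by rewrite divr_gt0.
  have [k1 Hk1] := expr_small h01 e2; have [k2 Hk2] := expr_small q01 c1.
  pose i := maxn N0 (maxn k1 k2).
  have pe : p i < e.
    apply: (@le_lt_trans _ _ (e / 2)); last by rewrite ltr_pdivrMr// ltr_pMr// ltr1n.
    by rewrite /p -exprVn Hk1// /i !leq_max leqnn orbT.
  have iN : (N0 <= i)%N by rewrite leq_maxl.
  apply: (@le_trans _ _ (Eloc G (eball x (p i)))).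
    by apply: ereal_inf_lbound; exists (p i) => //; apply: He; rewrite p0.
  have gE : good i (eball x (p i)) by apply: good_eball; rewrite p_le/=.
  set E := eball x (p i) in gE *; have [mE _ _] := gE.
  have Ep := good_pos gE.
  have b0 : 0 <= (fine (leb E))^-1 by rewrite invr_ge0 ltW.
  have mjj j : measurable_fun setT (fun a => `|G a ord0 j - avg j E|%:E) by have m1 := mG j; mfun.
  have avE a j : (G a - average G E) ord0 j = G a ord0 j - avg j E by rewrite !mxE.
  rewrite /Eloc.
  apply: (@le_trans _ _ ((fine (leb E))^-1%:E * (n%:R%:E * \sum_j \int[leb]_(a in E) `|G a ord0 j - avg j E|%:E))%E).
    apply: lee_wpmul2l; first by rewrite lee_fin.
    rewrite -ge0_integral_sum//; last by move=> j; exact: measurable_funTS.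
    rewrite -ge0_integralZl_EFin//; last 2 first.
    - by move=> a _; rewrite sumEFin lee_fin sumr_ge0.
    - by apply: measurable_funTS; apply: emeasurable_sum => j.
    apply: le_integral_ge0 => [//|a _|a _|a _].
    - by rewrite lee_fin enorm_ge0.
    - by rewrite sumEFin -EFinM lee_fin mulr_ge0// sumr_ge0.
    rewrite sumEFin -EFinM lee_fin; apply: le_trans (enorm_le_norm _) _; apply: ler_wpM2l => //.
    apply: le_trans (rV_norm_le_sum _) _; apply: ler_sum => j _; by rewrite avE.
  have S j : (\int[leb]_(a in E) `|G a ord0 j - avg j E|%:E <= ((fine (leb E))^-1 * (p i ^+ n * p i ^+ n * q ^+ i))%:E)%E.
    apply: le_trans (integral_sub_average_le (mG j) mE mE Ep (good_int j iN gE)) _.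
    rewrite EFinM; apply: lee_wpmul2l; first by rewrite lee_fin.
    exact: good_osc.
  apply: (@le_trans _ _ ((fine (leb E))^-1%:E * (n%:R%:E * \sum_(j < n) ((fine (leb E))^-1 * (p i ^+ n * p i ^+ n * q ^+ i))%:E))%E).
    apply: lee_wpmul2l; first by rewrite lee_fin.
    by apply: lee_wpmul2l; [rewrite lee_fin|apply: lee_sum => j _; exact: S].
  rewrite sumEFin sumr_const card_ord -!EFinM lee_fin -[X in _ * (_ * X)]mulr_natl.
  have M := mul_inv gE gE; have H2 : q ^+ i <= c / (n%:R * n%:R * D + 1) by apply: Hk2; rewrite /i !leq_max leqnn !orbT.
  apply: (@le_trans _ _ (n%:R * n%:R * (D * q ^+ i))).
    rewrite (_ : _ * (n%:R * (n%:R * _)) = n%:R * n%:R * ((fine (leb E))^-1 * (fine (leb E))^-1 * (p i ^+ n * p i ^+ n * q ^+ i))); last by ring.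
    by apply: ler_wpM2l => //; rewrite mulr_ge0.
  rewrite ler_pdivlMr in H2; last by rewrite ltr_wpDl// !mulr_ge0.
  by apply: le_trans H2; rewrite mulrA mulrDr mulr1 [q ^+ i * _]mulrC lerDl exprn_ge0// ltW.
(* The initial averages, the sum [D / (1 - q)] of the changes along dyadic balls, [D] for the
   passage to a Euclidean ball, and 1 to make the inequality strict. *)
move=> E; pose M := \sum_j `|avg j (ball x (p N0))| + D / (1 - q) + D + 1.
have D1 : 0 <= D / (1 - q) by rewrite divr_ge0// subr_ge0 ltW.
have M0 : 0 < M by rewrite ltr_wpDl// !addr_ge0// sumr_ge0.
suff : (limf_esup (fun r : R => (enorm (average G (eball x r)))%:E) 0^'+ <= (n%:R * M)%:E)%E.
  by rewrite E leye_eq.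
apply: (@le_trans _ _ (ereal_sup ((fun r : R => (enorm (average G (eball x r)))%:E) @` [set r | 0 < r < p N0]))).
  apply: ereal_inf_lbound; exists [set r | 0 < r < p N0] => //.
  near=> r; apply/andP; split; near: r; [exact: nbhs_right_gt|exact: nbhs_right_lt].
apply: ge_ereal_sup => _ [r /= /andP[r00 rN] <-]; rewrite lee_fin.
apply: le_trans (enorm_le_norm _) _; apply: ler_wpM2l => //; apply: ltW.
apply/rV_norm_ltP => // j; rewrite mxE -/(avg j (eball x r)).
have [m /andP[m1 m2]] := dyadic_below r00 rN.
have pE k : p N0 / 2 ^+ k = p (N0 + k) by rewrite /p exprD invfM.
rewrite !pE addnS in m1 m2.
have gE : good (N0 + m) (eball x r) by apply: good_eball; rewrite m1 ltW.
have h := avg_diff j (leq_addr m N0) gE (good_ball (N0 + m)).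
have h2 : D * q ^+ (N0 + m) <= D by rewrite ler_piMr ?exprn_ile1 ?(ltW q0) ?(ltW q1).
have h3 := avg_ball_bound j m.
have h4 : D * ((1 - q ^+ m) / (1 - q)) <= D / (1 - q).
  rewrite ler_wpM2l// ler_pdivrMr ?subr_gt0// mulVf ?subr_eq0 ?gt_eqF// gerBl exprn_ge0// ltW//.
have h5 : `|avg j (ball x (p N0))| <= \sum_j `|avg j (ball x (p N0))| by rewrite [leRHS](bigD1 j)//= lerDl sumr_ge0.
have := ler_normD (avg j (eball x r) - avg j (ball x (p (N0 + m)))) (avg j (ball x (p (N0 + m)))).
rewrite subrK => h6; apply: le_lt_trans h6 _; rewrite /M ltr_pwDr//.
by rewrite [leRHS]addrC; apply: lerD; [exact: le_trans h h2|exact: le_trans h3 (lerD h5 h4)].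
Unshelve. all: by end_near.
Qed.

End regular_points.

(** * The singular set *)

Section singular_set_null.
Context {R : realType} {n : nat}.
Notation Rn := 'rV[R]_n.
Notation leb := (@lebesgue_rV R n).
Variables (Omega : set Rn) (G : Rn -> Rn) (gm : R).
Hypothesis n0 : (0 < n)%N.
Hypothesis oO : open Omega.
Hypothesis gm0 : 0 < gm.
Hypothesis mG : forall j, measurable_fun setT (fun x => G x ord0 j).
Hypothesis Gint : forall j (d : R), 0 < d -> leb.-integrable (inner Omega d) (EFin \o (fun x => G x ord0 j)).
Hypothesis Gshift : forall g d : R, 0 < g < gm -> 0 < d -> exists C rho0 : R,
  [/\ 0 <= C, 0 < rho0 & forall j (e : Rn), 0 < `|e| <= rho0 ->
    (\int[leb]_(x in inner Omega d) `|G x ord0 j - G (x + e) ord0 j|%:E <= (C * `|e| `^ g)%:E)%E].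

(** If the oscillation exceeds its threshold at only finitely many dyadic scales, the point is
    regular. Hence the singular points lie in the null sets of [bad_limsup_null], taken with the
    margins [1/(m+1)], which exhaust [Omega]. *)
Lemma singular_points_null (t : R) : 0 <= t -> n%:R - gm < t ->
  hausdorff_measure t [set x | Omega x /\ singular_point G x] = 0%E.
Proof.
move=> t0 tn.
have H0 (a b : Rn) : 0 <= gradH G a b by apply: sumr_ge0.
have Hxx (a : Rn) : gradH G a a = 0 by rewrite /gradH big1// => j _; rewrite subrr normr0.
have mj j : measurable_fun setT (fun z : Rn * Rn => `|G z.1 ord0 j - G z.2 ord0 j|).
  by have m1 := mG j; apply: mf_abs; apply: mf_add; [|apply: mf_opp];
    [exact: (measurableT_comp m1 measurable_fst)|exact: (measurableT_comp m1 measurable_snd)].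
have mH : measurable_fun setT (fun z : Rn * Rn => gradH G z.1 z.2) by apply: measurable_sum.
have Hsh g : 0 < g < gm -> forall d : R, 0 < d -> exists C rho0 : R,
    [/\ 0 <= C, 0 < rho0 & forall e : Rn, 0 < `|e| <= rho0 ->
    (\int[leb]_(x in inner Omega d) (gradH G x (x + e))%:E <= (C * `|e| `^ g)%:E)%E].
  move=> g0 d d0; have [C [rho0 [C0 r0 HC]]] := Gshift g0 d0.
  exists (n%:R * C), rho0; split => //; first by rewrite mulr_ge0.
  move=> e e0; have mI := inner_measurable Omega d; rewrite /gradH; under eq_integral do rewrite -sumEFin.
  rewrite ge0_integral_sum//; last first.
    move=> j; have m1 := mG j; apply: measurable_funTS; apply: mf_EFin; apply: mf_abs.
    apply: mf_add => //; apply: mf_opp; apply: (measurableT_comp m1).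
    by mfun.
  apply: (@le_trans _ _ (\sum_(j < n) (C * `|e| `^ g)%:E)%E); first by apply: lee_sum => j _; exact: HC.
  by rewrite sumEFin sumr_const card_ord -[X in (X%:E <= _)%E]mulr_natl mulrA.
have [eps eps0 null] := bad_limsup_null H0 Hxx mH gm0 Hsh t0 tn.
pose B m := [set x | inner Omega m.+1%:R^-1 x /\
    forall N, exists2 i, (N <= i)%N & (((2 ^- i) `^ (2 * n%:R + eps))%:E < osc (gradH G) x (2 ^- i)%R)%E].
apply: (@hausdorff_measure_bigcup0 R n t _ B); last by move=> m; apply: null; rewrite invr_gt0.
move=> x [Ox sx]; have : nbhs x Omega by apply: open_nbhs_nbhs.
move=> /nbhs_ballP[e /= e0 He].
have e1 : 0 <= e^-1 by rewrite invr_ge0 ltW.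
have /andP[_ he] := truncn_itv e1.
exists (Num.truncn e^-1); first exact: I.
split.
  move=> y /le_ball-/(_ e) h; apply: He; apply: h.
  by rewrite -[leRHS]invrK lef_pV2 ?posrE ?invr_gt0//; exact: ltW.
move=> N; apply: contrapT => Hn.
have e2 : 0 < e / 2 by rewrite divr_gt0.
have h01 : 0 < (2^-1 : R) < 1 by rewrite invr_gt0 ltr0n invf_lt1 ?ltr1n.
have [k Hk] := expr_small h01 e2.
apply: (@regular_point R n G x (e / 2) eps (maxn N k) n0 mG _ eps0 _ _ sx).
- move=> j; apply: (integrableS (inner_measurable Omega (e / 2)) (measurable_rV_ball x _) _ (Gint j e2)).
  move=> y xy z yz; apply: He; rewrite -!ball_normE/= in xy yz *.
  by rewrite -(subrKA y) (le_lt_trans (ler_normD _ _))// (splitr e) ltrD.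
- by rewrite -exprVn Hk// leq_maxr.
- move=> i Ni; rewrite leNgt; apply/negP => h; apply: Hn; exists i => //.
  by apply: leq_trans Ni; rewrite leq_maxl.
Qed.

End singular_set_null.

Theorem corollary1p11 (R : realType) (n : nat) (s Lambda : R) (Phi : R -> R)
    (Omega : set 'rV[R]_n) (mu : {charge set 'rV[R]_n -> \bar R})
    (g u : 'rV[R]_n -> R)
    (n_ge2 : (2 <= n)%N) (s_range : 1 / 2 < s < 1) (Lambda_ge1 : 1 <= Lambda)
    (Phi_struct : structure_assumption Lambda Phi)
    (Omega_domain : bounded_domain Omega)
    (g_Wloc : Whq_loc s 2 [set: 'rV[R]_n] g) (g_L1 : L1_2s s g)
    (u_sola : SOLA s Phi Omega mu g u) :
  (hausdorff_dim (Sigma_set Omega u) <= (n%:R - 2 * s + 1)%:E)%E.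
Proof.
have n0 : (0 < n)%N by apply: leq_trans n_ge2.
have s01 : 0 < s < 1 by move: s_range => /andP[a b]; apply/andP; split; lra.
have [_ oO _ bO] := Omega_domain.
have mO : measurable Omega by exact: rV_open_measurable.
have star := sola_diff2_estimate n_ge2 s01 Lambda_ge1 Phi_struct Omega_domain g_L1 u_sola.
have mv := measurable_ubar n_ge2 s01 Omega_domain u_sola.
have Lq := ubar_Lq s01 u_sola.
have q1 := qexp_gt1 n_ge2 s01.
(* An exponent strictly between 1 and the limit of integrability, and at most 2 so that
   [powR_add_le] applies. *)
pose q := Num.min 2 ((1 + @qexp R n s) / 2).
have q12 : 1 < q <= 2 by rewrite lt_min ge_min lexx ltr1n/= andbT; move: q1; lra.
have qq : q < @qexp R n s by rewrite gt_min; apply/orP; right; move: q1; lra.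
have fin (f : 'rV[R]_n -> R) : (forall x, 0 <= f x) ->
    (\int[@lebesgue_rV R n]_(x in Omega) (f x)%:E < +oo)%E ->
    exists c : R, (\int[@lebesgue_rV R n]_(x in Omega) (f x)%:E <= c%:E)%E.
  move=> f0 foo; exists (fine (\int[@lebesgue_rV R n]_(x in Omega) (f x)%:E)).
  by rewrite fineK// ge0_fin_numE//; apply: integral_ge0 => x _; rewrite lee_fin.
have [V HV] := fin _ (fun x => powR_ge0 _ _) (Lq q (introT andP (conj (ltW (andP q12).1) qq))).
have [U HU] : exists U : R, (\int[@lebesgue_rV R n]_(x in Omega) `|ubar Omega u x|%:E <= U%:E)%E.
  apply: fin => //; have := Lq 1; rewrite lexx q1 => /(_ isT).
  by under eq_integral do rewrite powRr1//.
have mix := mixed_bound_all s_range mO mv q12 qq HV HU star.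
have gm0 : 0 < 2 * s - 1 by case/andP: s_range; lra.
have mu' : measurable_fun Omega u by exact: (measurable_restrictT _ mO).2 mv.
have vE := @ubarE R n Omega u.
have v0 x : ~ Omega x -> ubar Omega u x = 0 by move=> nx; rewrite /ubar patchE memNset.
have wg := grad_weak oO mv mu' vE v0 gm0 HU mix.
have mG := measurable_grad mv.
have Gint := grad_integrable mv gm0 HU mix.
have Gsh := grad_shift mv mix.
have n2 : 2 <= n%:R :> R by rewrite (ler_nat R 2).
apply: hausdorff_dim_le => [|d hd]; first by case/andP: s_range; lra.
(* A constant sequence turns countable subadditivity into monotonicity. A point of [Sigma_set] is
   singular for every weak gradient, in particular for [grad]. *)
apply: (@hausdorff_measure_bigcup0 R n d _ (fun=> [set x | Omega x /\ singular_point (grad (ubar Omega u)) x])).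
  by move=> x [Ox Sx]; exists 0%N => //; split => //; exact: Sx.
move=> _; apply: (singular_points_null n0 oO gm0 mG Gint Gsh).
  by move: hd n2; case/andP: s_range; lra.
by move: hd; lra.
Qed.
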